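(* Let $W=0$ and let $V\subseteq\mathbb{R}^d$ be an open set bounded away from the origin. Let $p$ be a transition kernel on $V\times V$ such that there exist $v_*\in\mathbb{R}^d$ and constants $r_0,\gamma>0$ with $B(v_*,r_0)\subseteq V$ and $$p(v,v')\ge\gamma\,\mathbf{1}_{v\in B(v_*,r_0)}\qquad\forall v,v'\in V.$$ Let $\sigma\in C^0(\mathbb{T}^d)$ be non-negative and satisfy the Geometric Control Condition: $T>0$ and $\kappa>0$ are such that $$\inf_{(x,v)\in\mathbb{T}^d\times V}\int_0^T\sigma(x-vt)\,\mathrm{d}t\ge\kappa.$$ Set $T_*=\frac{2\sqrt d}{r_0}$. Then there is a unique equilibrium state $\nu\in\mathscr{P}(\mathbb{T}^d\times V)$ of the linear Boltzmann equation, and every measure-valued solution $(\mu_t)_{t\ge0}$ with initial datum $\mu_0\in\mathscr{P}(\mathbb{T}^d\times V)$ satisfies $$\|\mu_t-\nu\|_{TV}\le e^{-\lambda(t-2T-T_* )}\|\mu_0-\nu\|_{TV},\qquad\forall t\ge T_*,$$ with $$\lambda=-\frac{1}{2T+\frac{2\sqrt d}{r_0}}\log\left(1-\frac{\gamma^2|B(v_*,r_0)|^2}{2^d}\,\kappa^2e^{-(2T+\frac{2\sqrt d}{r_0})\|\sigma\|_\infty}\right).$$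
   Context: $\mathbb{T}^d=\mathbb{R}^d/\mathbb{Z}^d$. $B(v_*,r_0)$ is the Euclidean ball in $\mathbb{R}^d$ and $|\cdot|$ of a set is Lebesgue measure. $\mathscr{P}(\cdot)$ denotes Borel probability measures. $\|\mu\|_{TV}=\sup\{\int\phi\,\mathrm{d}\mu:\phi\in C_b,\ \|\phi\|_\infty\le1\}$. A transition kernel $p\in C^1(V\times V)$ is non-negative with $\int_Vp(v,v')\,\mathrm{d}v=1$ for every $v'\in V$. Linear Boltzmann equation (with $W=0$): $\partial_tf+v\cdot\nabla_xf=\sigma(x)\int_V\big(p(v,v')f(v')-p(v',v)f(v)\big)\,\mathrm{d}v'$ on $\mathbb{T}^d\times V$. A measure-valued solution with initial datum $\mu_0\in\mathscr{P}(\mathbb{T}^d\times V)$ is a family $(\mu_t)_{t\ge0}$ of probability measures on $\mathbb{T}^d\times V$, continuous in $t$ for the weak topology (tested against $C_b$), such that for every $S>0$ and $\phi\in C^1_c([0,S)\times\mathbb{T}^d\times V)$, $$\int_0^S\iint\Big(\partial_t\phi+v\cdot\nabla_x\phi+\sigma(x)\Big(\int_Vp(v',v)\phi(t,x,v')\,\mathrm{d}v'-\phi\Big)\Big)\mu_t(\mathrm{d}x,\mathrm{d}v)\,\mathrm{d}t=-\iint\phi(0,x,v)\,\mu_0(\mathrm{d}x,\mathrm{d}v).$$ An equilibrium state is $\nu\in\mathscr{P}(\mathbb{T}^d\times V)$ such that $\mu_t\equiv\nu$ is a measure-valued solution. *)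

(* Defs.v *)
From HB Require Import structures.
From mathcomp Require Import all_boot all_order all_algebra generic_quotient.
From mathcomp Require Import all_classical all_reals all_analysis measurable_realfun.
Set Implicit Arguments.
Unset Strict Implicit.
Unset Printing Implicit Defensive.
Import Order.TTheory GRing.Theory Num.Theory.
Import numFieldNormedType.Exports.
Local Open Scope classical_set_scope.
Local Open Scope ring_scope.
Local Open Scope quotient_scope.

Definition borel (T : ptopologicalType) := g_sigma_algebraType (@open T).

(* The library lacks the join of the product topology and the product point. *)
HB.instance Definition _ (T U : ptopologicalType) := Pointed.on (T * U)%type.

Section Euclidean.
Context {R : realType} {d : nat}.

(* The norm that the library puts on matrices is the sup norm; it induces the
   same topology, but the balls and norms of the statement are Euclidean. *)
Definition enorm (v : 'rV[R]_d) : R := Num.sqrt (\sum_i (v 0 i) ^+ 2).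

Definition eball (c : 'rV[R]_d) (r : R) : set 'rV[R]_d :=
  [set v | enorm (v - c) < r].

End Euclidean.

Section ConsMeasure.
Context {R : realType} (n : nat).
Variable m : {sigma_finite_measure set (n.-tuple R) -> \bar R}.

Definition cons_pair (z : R * n.-tuple R) : n.+1.-tuple R :=
  [tuple of z.1 :: z.2].

Let measurable_cons_pair : measurable_fun setT cons_pair.
Proof. exact: measurable_cons. Qed.

Definition cons_measure : set (n.+1.-tuple R) -> \bar R :=
  pushforward (lebesgue_measure \x m)%E cons_pair.

Let cons_measure0 : cons_measure set0 = 0%E.
Proof. by rewrite /cons_measure /pushforward preimage_set0 measure0. Qed.

Let cons_measure_ge0 A : (0 <= cons_measure A)%E.
Proof. exact: measure_ge0. Qed.

Let cons_measure_sigma_additive : semi_sigma_additive cons_measure.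
Proof.
have h := @measure_semi_sigma_additive _ _ _
  (measure_function_pushforward__canonical__measure_function_Measure
     (lebesgue_measure \x m)%E measurable_cons_pair).
exact: h.
Qed.

HB.instance Definition _ := isMeasure.Build _ _ _ cons_measure
  cons_measure0 cons_measure_ge0 cons_measure_sigma_additive.

Let cons_measure_sigma_finite : sigma_finite setT cons_measure.
Proof.
have /sigma_finiteP[F [FT ndF Foo]] := sigma_finiteT (@lebesgue_measure R).
have /sigma_finiteP[G [GT ndG Goo]] := sigma_finiteT m.
pose uncons (t : n.+1.-tuple R) := (thead t, [tuple of behead t]).
have consK z : uncons (cons_pair z) = z.
  case: z => x t; rewrite /uncons /cons_pair /= theadE; congr pair.
  exact: val_inj.
have muncons : measurable_fun setT uncons.
  apply: measurable_fun_pair; last exact: measurable_behead.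
  exact: (measurable_tnth ord0).
exists (fun k => uncons @^-1` (F k `*` G k)).
  rewrite -preimage_bigcup; apply/esym/seteqP; split => // t _ /=.
  have [i _ Fi] : (\bigcup_i F i) (uncons t).1 by rewrite -FT.
  have [j _ Gj] : (\bigcup_i G i) (uncons t).2 by rewrite -GT.
  exists (maxn i j) => //; split.
    by move: (uncons t).1 Fi; exact/subsetPset/ndF/leq_maxl.
  by move: (uncons t).2 Gj; exact/subsetPset/ndG/leq_maxr.
move=> k; have [mF Fk] := Foo k; have [mG Gk] := Goo k.
split; first by rewrite -[X in measurable X]setTI; apply: muncons => //;
  exact: measurableX.
rewrite /cons_measure /pushforward.
have -> : cons_pair @^-1` (uncons @^-1` (F k `*` G k)) = F k `*` G k.
  rewrite -comp_preimage (_ : uncons \o cons_pair = id)//; exact/funext.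
by rewrite product_measure1E// lte_mul_pinfty// ge0_fin_numE.
Qed.

HB.instance Definition _ :=
  Measure_isSigmaFinite.Build _ _ _ cons_measure cons_measure_sigma_finite.

End ConsMeasure.

Section Lebesgue.
Context {R : realType}.

Fixpoint lebesgue_tuple (n : nat) :
    {sigma_finite_measure set (n.-tuple R) -> \bar R} :=
  match n with
  | 0 => [the {sigma_finite_measure set (0.-tuple R) -> \bar R} of
            \d_([tuple] : 0.-tuple R)]
  | n.+1 => [the {sigma_finite_measure set (n.+1.-tuple R) -> \bar R} of
            cons_measure (lebesgue_tuple n)]
  end.

Context {d : nat}.

Definition row_of_tuple (t : d.-tuple R) : borel 'rV[R]_d := \row_i tnth t i.

Let measurable_row_of_tuple : measurable_fun setT row_of_tuple.
Proof.
apply: (@measurability _ _ _ (borel 'rV[R]_d) setT row_of_tuple (@open 'rV[R]_d)) => //.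
move=> _ [U oU <-].
rewrite setTI.
pose D := [set qk : 'rV[rat]_d * nat |
  ball (map_mx ratr qk.1 : 'rV[R]_d) (qk.2.+1%:R^-1) `<=` U].
pose B (qk : 'rV[rat]_d * nat) : set (d.-tuple R) :=
  \bigcap_(i in [set: 'I_d])
   ((@tnth _ R ^~ i) @^-1` ball (ratr (qk.1 0 i) : R) (qk.2.+1%:R^-1)).
have -> : row_of_tuple @^-1` U = \bigcup_qk (if qk \in D then B qk else set0).
  rewrite -bigcup_mkcond; apply/seteqP; split => t /=; last first.
    move=> [[q k] /= Dqk tq]; apply: Dqk; split; first by rewrite invr_gt0.
    by move=> i j; rewrite !mxE ord1; exact: tq.
  move=> Ut.
  have /nbhs_ballP[e /= e0 eU] : nbhs (row_of_tuple t : 'rV[R]_d) U.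
    by apply: open_nbhs_nbhs.
  have [k ke] : exists k, k.+1%:R^-1 < e / 2.
    have /ltr_add_invr [k] : 0 < e / 2 by rewrite divr_gt0.
    by rewrite add0r => ?; exists k.
  have k0 : (0 : R) < k.+1%:R^-1 by rewrite invr_gt0.
  have qP i : exists q : rat, ball (tnth t i) (k.+1%:R^-1) (ratr q).
    have [x [bx [q _ qx]]] := @dense_rat R (ball (tnth t i) k.+1%:R^-1)
      (ex_intro _ _ (ballxx _ k0)) (ball_open _ _).
    by exists q; rewrite qx.
  have {qP}[q qP] := choice qP.
  exists (\row_i q i, k).
    move=> /= v [_ bv]; apply: eU; split=> // i j.
    have := bv i j; rewrite !mxE !ord1 => bj.
    rewrite (splitr e).
    apply: (@ball_triangle _ R (ratr (q j) : R)).
      by apply: le_ball (qP j); exact: ltW.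
    by apply: le_ball bj; exact: ltW.
  by move=> i _ /=; rewrite mxE; apply: ball_sym; exact: qP.
apply: countable_bigcupT_measurable => // qk; case: ifP => // _.
apply: fin_bigcap_measurable => // i _.
rewrite -[X in measurable X]setTI; apply: (measurable_tnth i) => //.
by apply: open_measurable; apply: ball_open.
Qed.

Definition lebesgue_row : set (borel 'rV[R]_d) -> \bar R :=
  pushforward (lebesgue_tuple d) row_of_tuple.

Let lebesgue_row0 : lebesgue_row set0 = 0%E.
Proof. by rewrite /lebesgue_row /pushforward preimage_set0 measure0. Qed.

Let lebesgue_row_ge0 A : (0 <= lebesgue_row A)%E.
Proof. exact: measure_ge0. Qed.

Let lebesgue_row_sigma_additive : semi_sigma_additive lebesgue_row.
Proof.
have h := @measure_semi_sigma_additive _ _ _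
  (measure_function_pushforward__canonical__measure_function_Measure
     (lebesgue_tuple d) measurable_row_of_tuple).
exact: h.
Qed.

HB.instance Definition _ := isMeasure.Build _ _ _ lebesgue_row
  lebesgue_row0 lebesgue_row_ge0 lebesgue_row_sigma_additive.

Lemma lebesgue_tuple_box n (A : 'I_n -> set R) :
  (forall i, measurable (A i)) ->
  lebesgue_tuple n [set t | forall i, A i (tnth t i)] =
  (\prod_i lebesgue_measure (A i))%E.
Proof.
elim: n A => [|n IH] A mA.
  by rewrite big_ord0 /= diracE mem_set//=; case.
rewrite big_ord_recl -IH; last by move=> i; exact: mA.
rewrite /= -product_measure1E//; [|exact: mA|]; last first.
  rewrite (_ : [set t | _] =
      \bigcap_(i in [set: 'I_n]) ((@tnth _ R ^~ i) @^-1` A (lift ord0 i))).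
    apply: fin_bigcap_measurable => // i _.
    rewrite -[X in measurable X]setTI.
    by apply: (measurable_tnth i) => //; exact: mA.
  by apply/seteqP; split => [t h i _|t h i]; exact: h.
apply: (congr1 (lebesgue_measure \x lebesgue_tuple n)%E).
apply/seteqP; split => [[x t] h|[x t] [hx ht] i].
  split => [|i]; first exact: (h ord0).
  by have := h (lift ord0 i); rewrite /cons_pair tnthS.
have [j ->|->] := unliftP ord0 i => //.
by rewrite /cons_pair tnthS; exact: ht.
Qed.

Lemma lebesgue_row_box (A : 'I_d -> set R) :
  (forall i, measurable (A i)) ->
  lebesgue_row [set v | forall i, A i (v 0 i)] =
  (\prod_i lebesgue_measure (A i))%E.
Proof.
move=> mA; rewrite -lebesgue_tuple_box// /lebesgue_row /pushforward.
by congr (_ _); apply/seteqP; split => t h i; have := h i; rewrite mxE.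
Qed.

End Lebesgue.

Section Torus.
Context (R : realType) (d : nat).

Definition lattice_equiv (x y : 'rV[R]_d) : bool :=
  (x - y) \is a mxOver Num.int.

Let lattice_equiv_refl : reflexive lattice_equiv.
Proof.
by move=> x; apply/mxOverP => i j; rewrite !mxE subrr rpred0.
Qed.

Let lattice_equiv_sym : symmetric lattice_equiv.
Proof.
by move=> x y; apply/mxOverP/mxOverP => h i j;
  have := h i j; rewrite !mxE -rpredN opprB.
Qed.

Let lattice_equiv_trans : transitive lattice_equiv.
Proof.
move=> y x z /mxOverP xy /mxOverP yz; apply/mxOverP => i j.
have := rpredD (xy i j) (yz i j); rewrite !mxE.
by rewrite addrA subrK.
Qed.

Canonical lattice_equiv_rel :=
  EquivRel lattice_equiv lattice_equiv_refl lattice_equiv_sym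
    lattice_equiv_trans.

Definition torus := quotient_topology {eq_quot lattice_equiv}.

HB.instance Definition _ := PointedTopological.on torus.

End Torus.

Section TorusTheory.
Context {R : realType} {d : nat}.

Definition torus_pi (x : 'rV[R]_d) : torus R d :=
  (\pi_{eq_quot (@lattice_equiv R d)} x)%qT.

(* Translation x + w of a point of the torus by a vector of R^d; it does not
   depend on the representative, as torus_translate_pi states. *)
Definition torus_translate (x : torus R d) (w : 'rV[R]_d) : torus R d :=
  torus_pi (repr x + w).

Lemma torus_piP (x y : 'rV[R]_d) :
  torus_pi x = torus_pi y <-> (x - y) \is a mxOver Num.int.
Proof. by split=> [/eqmodP|h]; last exact/eqmodP. Qed.

Lemma torus_translate_pi (x w : 'rV[R]_d) :
  torus_translate (torus_pi x) w = torus_pi (x + w).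
Proof.
apply/torus_piP; rewrite opprD addrACA subrr addr0; apply/torus_piP.
exact: reprK.
Qed.

End TorusTheory.

Definition C1_on (R : realType) (E : normedModType R) (U : set E) (f : E -> R) :=
  {in U, forall z, differentiable f z} /\
  forall w : E, {in U, continuous (fun z => 'd f z w)}.

Section Kinetic.
Context {R : realType} {d : nat}.
Local Notation Rd := 'rV[R]_d.
Local Notation Td := (torus R d).
Implicit Types (V : set Rd) (p : Rd -> Rd -> R) (sigma : Td -> R).

Local Notation phase := (borel (Td * Rd)%type).

(* The velocity space V is an open subset of R^d.  A Borel probability measure
   on T^d x V is encoded as one on T^d x R^d that gives mass 1 to T^d x V, and
   a function on T^d x V as a function on T^d x R^d of which only the values on
   T^d x V matter. *)
Definition phase_set V : set (Td * Rd) := setT `*` V.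

Definition prob_on V (mu : probability phase R) := mu (phase_set V) = 1%E.

Definition Cb V (phi : Td * Rd -> R) :=
  {in phase_set V, continuous phi} /\
  exists M : R, forall z, phase_set V z -> `|phi z| <= M.

(* The norm of the signed measure mu - nu, with the integral against mu - nu
   expanded by linearity. *)
Definition tv_dist V (mu nu : probability phase R) : R :=
  sup [set y | exists phi : Td * Rd -> R,
    [/\ Cb V phi, (forall z, phase_set V z -> `|phi z| <= 1) &
        y = \int[mu]_(z in phase_set V) phi z
          - \int[nu]_(z in phase_set V) phi z]].

Definition bounded_away_from_origin V :=
  exists2 delta : R, 0 < delta & forall v, V v -> delta <= enorm v.

Definition transition_kernel V p :=
  [/\ C1_on (V `*` V) (fun z : Rd * Rd => p z.1 z.2),
      (forall v v', V v -> V v' -> 0 <= p v v') &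
      forall v', V v' -> (\int[lebesgue_row]_(v in V) (p v v')%:E = 1)%E].

(* phi is given on all of R x T^d x R^d: in space it is C^1 through its lift to
   R^d, at t = 0 it is C^1 up to the boundary (as the restriction to t >= 0 of a
   C^1 function), and being compactly supported in the open set V it vanishes
   outside V. *)
Definition test_function V (S : R) (phi : R -> Td -> Rd -> R) :=
  C1_on setT (fun z : R * Rd * Rd => phi z.1.1 (torus_pi z.1.2) z.2) /\
  exists K : set (R * Td * Rd),
    [/\ compact K, K `<=` (`[0, S[ `*` setT) `*` V &
        forall t x v, 0 <= t -> phi t x v != 0 -> K (t, x, v)].

Definition time_derivative (phi : R -> Td -> Rd -> R) t x v : R :=
  derive1 (fun s : R => phi s x v) t.

(* v . nabla_x phi (t, x, v) *)
Definition transport (phi : R -> Td -> Rd -> R) t x v : R :=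
  derive1 (fun s : R => phi t (torus_translate x (s *: v)) v) 0.

Definition dual_collision V p (phi : R -> Td -> Rd -> R) t x v : R :=
  \int[lebesgue_row]_(v' in V) (p v' v * phi t x v') - phi t x v.

Definition mv_solution V p sigma (mu : R -> probability phase R) :=
  [/\ forall t, 0 <= t -> prob_on V (mu t),
      forall phi : Td * Rd -> R, Cb V phi ->
        {within `[0, +oo[, continuous
          (fun t => \int[mu t]_(z in phase_set V) phi z)} &
      forall (S : R) (phi : R -> Td -> Rd -> R), 0 < S ->
        test_function V S phi ->
        \int[lebesgue_measure]_(t in `[0, S])
          (\int[mu t]_(z in phase_set V)
            (time_derivative phi t z.1 z.2 + transport phi t z.1 z.2
             + sigma z.1 * dual_collision V p phi t z.1 z.2))
        = - \int[mu 0]_(z in phase_set V) phi 0 z.1 z.2].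

Definition equilibrium V p sigma (nu : probability phase R) :=
  prob_on V nu /\ mv_solution V p sigma (fun=> nu).

Definition geometric_control V sigma (T kappa : R) :=
  (kappa%:E <= ereal_inf
     [set \int[lebesgue_measure]_(t in `[0%R, T])
            (sigma (torus_translate z.1 (- (t *: z.2))))%:E
     | z in phase_set V])%E.

Definition sup_norm sigma : R := sup (range (fun x => `|sigma x|)).

End Kinetic.

(* Main.v *)
(* A weak solution satisfies the Duhamel formula
     mu_t(f) = e^(-Sg t) mu_0(X_t f),   Sg = sup sigma,
   where X_t is the series over the number of collisions of the positive operators obtained by adding Sg to the
   collision operator. Keeping the terms with at least two collisions gives a Doeblin minorization at time 2 T + T_*:
   by geometric control a first collision occurs during [0, T] and a last one during [T + T_*, 2 T + T_*], up to a
   factor kappa each; each collision redistributes the velocity over the ball B(v_*, r0) up to a factor gamma; and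
   after a free flight of duration at least T_* the ball of velocities covers the torus, since averaging over a unit
   cube first shows that a translate of B(v_*, r0 / 2) dilated by T_* contains one. Hence the total variation
   distance of two solutions is contracted by 1 - alpha on each interval of length 2 T + T_*.

   For existence, let P be the expectation of the process at the first ring of a clock of rate Sg, or at time h if it
   comes first. The same two collisions minorize P^2, so the oscillation of P^(2n) f tends to 0 and its limit L f is
   a P-invariant positive functional. Composing L with the occupation functional W of that step gives, up to
   normalization, a measure that annihilates the generator, because W sends the generator to P - 1. *)

Require Import Defs.
From HB Require Import structures.
From mathcomp Require Import all_boot all_order all_algebra.
From mathcomp Require Import all_classical all_reals all_analysis.
From mathcomp Require Import measurable_realfun ring lra.
Import Order.TTheory GRing.Theory Num.Theory.
Import numFieldNormedType.Exports.
Set Implicit Arguments.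
Unset Strict Implicit.
Unset Printing Implicit Defensive.
Local Open Scope classical_set_scope.
Local Open Scope ring_scope.

(** Of a weak solution only the pairing with compactly supported C^1 functions is known, while the
    dual functions that compare two trajectories are merely continuous. Composing test functions
    with the free flow cancels the unbounded transport term and leaves the bounded operator
    [dual_coll] conjugated by the flow; the resulting identity survives bounded pointwise limits and
    so reaches C_b. The dual iterates are never differentiated: their increments are controlled up
    to a quadratic error and summed.

    No integrable function is assumed to dominate p(., v) as v varies. Continuity of the dual kernel
    rests on Scheffe's argument, all these densities having mass 1. Since [V] is open, weak limits
    of probabilities may lose mass, so the equilibrium is not taken as one: a functional on bounded
    Borel functions, continuous under bounded pointwise convergence, is turned into a measure.

    In the constant, 2^-d is the price of halving the radius, one factor |B| comes from the flight
    between the collisions and the other is the mass of the reference measure [ball_avg]. The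
    exponent loses one period because t / [tau] is rounded down. *)

Local Notation repr := generic_quotient.repr.


(** * C^1 functions, the torus and bumps *)

Section C1.
Context {R : realType}.
Implicit Types (E : normedModType R).

Lemma C1_cst E (c : R) : C1_on setT (fun _ : E => c).
Proof.
split=> [z _|w z _]; first exact: differentiable_cst.
rewrite (_ : (fun z => _) = cst 0); first exact: cvg_cst.
by apply/funext => y; rewrite (_ : (fun _ : E => c) = cst c)// diff_cst.
Qed.

Lemma C1D E (f g : E -> R) : C1_on setT f -> C1_on setT g ->
  C1_on setT (f \+ g).
Proof.
move=> [df cf] [dg cg]; split=> [z zT|w z zT].
  by apply: differentiableD; [exact: df|exact: dg].
rewrite (_ : (fun z => _) = (fun z => 'd f z w + 'd g z w)).
  by apply: cvgD; [exact: cf|exact: cg].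
by apply/funext => y; rewrite diffD//; [apply: df|apply: dg]; rewrite inE.
Qed.

Lemma C1M E (f g : E -> R) : C1_on setT f -> C1_on setT g ->
  C1_on setT (f \* g).
Proof.
move=> [df cf] [dg cg]; split=> [z zT|w z zT].
  by apply: differentiableM; [exact: df|exact: dg].
rewrite (_ : (fun z => _) = (fun z => f z * 'd g z w + g z * 'd f z w)).
  apply: cvgD; apply: cvgM; try by [exact: cf|exact: cg].
  - by apply: differentiable_continuous; exact: df.
  - by apply: differentiable_continuous; exact: dg.
by apply/funext => y; rewrite diffM//; [apply: df|apply: dg]; rewrite inE.
Qed.

Lemma C1_comp E (f : E -> R) (g g' : R -> R) : C1_on setT f ->
  (forall x : R, is_derive x (1 : R) g (g' x)) -> continuous g' -> C1_on setT (g \o f).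
Proof.
move=> [df cf] dg cg'; have dgd x : differentiable g x.
  by apply/derivable1_diffP; case: (dg x).
split=> [z zT|w z zT].
  by apply: differentiable_comp => //; exact: df.
rewrite (_ : (fun z => _) = (fun z => 'd f z w * g' (f z))).
  apply: cvgM; first exact: cf.
  apply: (@continuous_comp _ _ _ f g'); last exact: cg'.
  by apply: differentiable_continuous; exact: df.
apply/funext => y; rewrite diff_comp//; last by apply: df; rewrite inE.
rewrite /= (@deriv1E _ _ g); last by case: (dg (f y)).
by rewrite derive1E; case: (dg (f y)) => _ ->.
Qed.

Lemma C1_lin E (f : E -> R) : linear f -> continuous f -> C1_on setT f.
Proof.
move=> lf cf; pose fM := GRing.isLinear.Build _ _ _ _ _ lf.
pose fL : {linear E -> R} := HB.pack f fM.
have fE : f = fL by [].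
split=> [z zT|w z zT]; first by rewrite fE; apply: linear_differentiable.
rewrite (_ : (fun z => _) = cst (f w)); first exact: cvg_cst.
by apply/funext => y; rewrite fE diff_lin.
Qed.

Lemma C1_prod E (I : Type) (r : seq I) (F : I -> E -> R) :
  (forall i, C1_on setT (F i)) -> C1_on setT (fun z => \prod_(i <- r) F i z).
Proof.
move=> hF; elim: r => [|i r IH].
  rewrite (_ : (fun z => _) = cst 1); first exact: C1_cst.
  by apply/funext => z; rewrite big_nil.
rewrite (_ : (fun z => _) = (F i \* (fun z => \prod_(i <- r) F i z))).
  exact: (C1M (hF i) IH).
by apply/funext => z; rewrite big_cons.
Qed.

Lemma C1_derive (f : R -> R) (x : R) : C1_on setT f -> is_derive x (1 : R) f (derive1 f x).
Proof.
move=> [df _]; rewrite derive1E; apply: derivableP.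
by apply/derivable1_diffP; apply: df; rewrite inE.
Qed.

Lemma C1_cont E (f : E -> R) : C1_on setT f -> continuous f.
Proof.
by move=> [df _] x; apply: differentiable_continuous; apply: df; rewrite inE.
Qed.

(** The square makes the truncation C^1 at 0, where [Num.max 0 u] has a corner; all bumps and time
    cutoffs are built from it. *)
Definition sqp (u : R) : R := (Num.max 0 u) ^+ 2.

Lemma is_derive_sqp (x : R) : is_derive x (1 : R) sqp (2 * Num.max 0 x).
Proof.
have [x0|x0|->] := ltgtP x 0.
- rewrite mulr0; apply: (near_eq_is_derive (f := cst 0)) => //.
  near=> y; rewrite /sqp max_l ?expr0n//; apply: ltW; near: y.
  by apply: lt_nbhsl.
- have -> : 2 * x = x *+ 1 + x *+ 1 by rewrite -mulr2n mulr_natl.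
  apply: (@near_eq_is_derive R R R (fun y : R => y * y)) => //.
    by near=> y; rewrite /sqp max_r ?expr2//; apply: ltW; near: y; apply: lt_nbhsr.
  have := @is_deriveM R R id id x 1 1 1 (is_derive_id _ _) (is_derive_id _ _).
  by rewrite /GRing.scale/= mulr1.
- rewrite mulr0.
  (* At the origin the difference quotient is [Num.max 0 h] itself, which tends to 0. *)
  have H : h^-1 *: (sqp (h + 0) - sqp 0) @[h --> 0^'] --> (0 : R).
    apply: (@cvg_trans _ ((fun h : R => Num.max 0 h) @ 0^')).
      apply: near_eq_cvg.
      near=> h; rewrite /sqp addr0 maxxx expr0n subr0 /GRing.scale/=.
      have h0 : h != 0 by near: h; exact: nbhs_dnbhs_neq.
      have [hp|hn] := leP 0 h; last by rewrite expr0n mulr0.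
      by rewrite expr2 mulKf.
    apply: cvg_within_filter.
    apply/cvgrPdist_le => e e0; near=> h; rewrite sub0r normrN.
    have he : `|h| <= e by near: h; apply: cvgr0_norm_le => //; exact: cvg_id.
    apply: le_trans he; have [hp|hn] := leP 0 h => //; first by rewrite normr0.
  apply: DeriveDef; first by apply/cvg_ex; exists 0; under eq_fun do rewrite /GRing.scale/= mulr1; exact: H.
  apply: cvg_lim => //.
  by under eq_fun do rewrite /GRing.scale/= mulr1; exact: H.
Unshelve. all: by end_near. Qed.

End C1.

(** * Topology of the torus *)

Section TorusTopology.
Context {R : realType} {d : nat}.
Local Notation Rd := 'rV[R]_d.
Local Notation Td := (torus R d).

(** Openness is recorded, rather than the quotient property alone, because it passes to products
    with R and R^d, where continuity has to be checked. *)
Definition openmap {A B : topologicalType} (m : A -> B) :=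
  forall a S, nbhs a S -> nbhs (m a) (m @` S).

(** The image under [m] of a neighbourhood of [a] on which [f \o m] is close to its limit is a
    neighbourhood of [m a]. Continuity claims on the torus are thereby reduced to their lifts to
    R^d. *)
Lemma openmap_cvg {A B C : topologicalType} (m : A -> B) (f : B -> C) a
    (l : set_system C) :
  openmap m -> (f \o m) x @[x --> a] --> l -> f y @[y --> m a] --> l.
Proof.
move=> om fl S lS; have := om a _ (fl _ lS) => /= h.
by apply: filterS h => y [x /= Sx <-].
Qed.

Lemma openmap_id (A : topologicalType) : openmap (@id A).
Proof. by move=> a S; rewrite image_id. Qed.

Lemma openmap_pair (A B A' B' : topologicalType) (m : A -> B) (n : A' -> B') :
  openmap m -> openmap n -> openmap (fun z => (m z.1, n z.2)).
Proof.
move=> om om2 [a a'] S [[P Q] /= [hP hQ] PQS]; have {}hP := om _ _ hP; have {}hQ := om2 _ _ hQ.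
exists (m @` P, n @` Q) => //= -[b b'] /= [[x Px <-] [y Qy <-]].
by exists (x, y) => //; exact: (PQS (x, y)).
Qed.

Lemma torus_reprK (z : Td) : torus_pi (repr z) = z.
Proof. exact: generic_quotient.reprK. Qed.

(** The saturation of an open set is the union of its lattice translates: around a point [y]
    equivalent to [o], subtracting [y - o] carries a neighbourhood of [y] into [O]. *)
Lemma openmap_torus_pi : openmap (@torus_pi R d).
Proof.
move=> x S; rewrite nbhsE; case=> O [oO Ox] OS.
apply: (filterS (P := torus_pi @` O)); first exact: image_subset.
apply: open_nbhs_nbhs; split; last by exists x.
rewrite /open/= /quotient_open openE => y [ o Oo oy].
have {}oy : torus_pi o = torus_pi y by [].
have c : (fun u : Rd => u - (y - o)) @ y --> nbhs o.
  rewrite -[X in _ --> nbhs X](subKr y o).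
  exact: (cvgB (@cvg_id _ (nbhs y)) (cvg_cst _)).
have : nbhs y [set u : Rd | O (u - (y - o))].
  by apply: c; apply: open_nbhs_nbhs.
rewrite /interior/=; apply: filterS => u Ou; exists (u - (y - o)) => //.
apply/torus_piP; rewrite addrAC subrr add0r opprB.
exact/torus_piP.
Qed.

Lemma openmap_torus_lift :
  openmap (fun z : Rd * Rd => (torus_pi z.1, z.2) : Td * Rd).
Proof. exact: (openmap_pair openmap_torus_pi (@openmap_id Rd)). Qed.

Lemma torus_pi_continuous : continuous (@torus_pi R d).
Proof. exact: pi_continuous. Qed.

Lemma torus_translate_continuous :
  continuous (fun z : Td * Rd => torus_translate z.1 z.2).
Proof.
move=> [x w]; rewrite -(torus_reprK x).
have om := openmap_pair openmap_torus_pi (@openmap_id Rd).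
apply: (@openmap_cvg _ _ _ _ _ (repr x, w) _ om) => /=.
rewrite torus_translate_pi.
under [X in X @ _]eq_fun do rewrite /= torus_translate_pi.
apply: (@continuous_comp _ _ _ (fun z : Rd * Rd => z.1 + z.2)).
  by apply: cvgD; [exact: cvg_fst|exact: cvg_snd].
exact: torus_pi_continuous.
Qed.

Lemma torus_translateA (x : Td) w w' :
  torus_translate (torus_translate x w) w' = torus_translate x (w + w').
Proof. by rewrite -(torus_reprK x) !torus_translate_pi addrA. Qed.

Lemma torus_translate0 (x : Td) : torus_translate x 0 = x.
Proof. by rewrite -(torus_reprK x) torus_translate_pi addr0. Qed.

(** Fractional parts give every point a representative in the closed unit cube, whose image is
    compact. *)
Lemma torus_compact : compact [set: Td].
Proof.
have -> : [set: Td] = torus_pi @` [set v : Rd | forall i, `[0, 1]%classic (v ord0 i)].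
  apply/esym/seteqP; split=> // z _.
  exists (\row_i (repr z 0 i - (Num.floor (repr z 0 i))%:~R)).
    move=> i /=; rewrite mxE in_itv/=; have := floor_itv (repr z 0 i).
    by rewrite intrD => /andP[? ?]; apply/andP; split; lra.
  rewrite -[RHS]torus_reprK; apply/torus_piP/mxOverP => i j; rewrite !mxE ord1.
  by rewrite addrAC subrr add0r rpredN intr_int.
apply: continuous_compact; first exact/continuous_subspaceT/torus_pi_continuous.
by apply: (@rV_compact R d (fun=> `[0, 1]%classic)) => i; exact: segment_compact.
Qed.

End TorusTopology.

(** * A countable family of C^1 bumps on phase space *)

Section Bump.
Context {R : realType} {d : nat}.
Local Notation Rd := 'rV[R]_d.
Local Notation Td := (torus R d).
Local Notation idx := ('rV[rat]_d * 'rV[rat]_d * nat)%type.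
Implicit Types k : idx.

(** A smooth 1-periodic substitute for the squared distance to the integers, hence well defined on
    the torus. *)
Definition versin (s : R) : R := 1 - cos ((pi *+ 2) * s).

Lemma versinD_int s m : versin (s + m%:~R) = versin s.
Proof.
have pn (n : nat) (u : R) : versin (u + n%:R) = versin u.
  rewrite /versin mulrDr mulr_natr.
  by rewrite (periodicn (@cosD2pi R)).
case: m => n; first exact: pn.
by rewrite NegzE -[in RHS](subrK n.+1%:R s) pn intrN.
Qed.

(** On [0, 1/2] [versin] is increasing, so its value at [Num.min e (1 / 2)] is the threshold;
    rounding [s + 1 / 2] down brings every [s] to that interval, up to sign. *)
Lemma versin_small (e : R) : 0 < e -> exists2 eps, 0 < eps &
  forall s, versin s < eps -> exists m : int, `|s - m%:~R| < e.
Proof.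
move=> e0; pose e' := Num.min e (1 / 2).
have e'0 : 0 < e' by rewrite lt_min e0 divr_gt0.
have e'2 : e' <= 1 / 2 by rewrite ge_min lexx orbT.
have p2 : 0 < pi *+ 2 :> R by rewrite pmulrn_lgt0// pi_gt0.
have inI (u : R) : 0 <= u -> u <= 1 / 2 -> (pi *+ 2) * u \in `[(0 : R), pi].
  move=> u0 u2; rewrite in_itv/= mulr_ge0 ?(ltW p2)//=.
  rewrite (le_trans (ler_wpM2l (ltW p2) u2))// mulr2n; lra.
have cd (u v : R) : 0 <= u -> u <= 1 / 2 -> 0 <= v -> v <= 1 / 2 ->
    (cos ((pi *+ 2) * u) < cos ((pi *+ 2) * v)) = (v < u).
  by move=> *; rewrite ltr_cos ?inI// ltr_pM2l.
exists (versin e').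
  rewrite /versin subr_gt0 -[ltRHS]cos0 -[in ltRHS](mulr0 (pi *+ 2)).
  by rewrite cd// ?(ltW e'0)// divr_ge0.
move=> s; pose m := Num.floor (s + 1 / 2); pose u := s - m%:~R.
have um : versin s = versin `|u|.
  rewrite -(subrK m%:~R s) versinD_int /versin -/u -[in RHS](ger0_norm (ltW p2)).
  by rewrite -normrM cos_norm.
have u2 : `|u| <= 1 / 2.
  have := floor_itv (s + 1 / 2); rewrite -/m intrD /u => /andP[? ?].
  by rewrite ler_norml; apply/andP; split; lra.
rewrite um /versin ltrD2l ltrN2 cd// ?(ltW e'0)// => ue.
by exists m; apply: lt_le_trans ue _; rewrite ge_min lexx.
Qed.

(* A function on T^d x R^d through its lift; [versin] makes it periodic and [sqp] makes it C^1 where it meets 0. *)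
Definition bumpL k (x v : Rd) : R :=
  \prod_i sqp (k.2.+1%:R^-1 - versin (x 0 i - ratr (k.1.1 0 i))) *
  \prod_i sqp (k.2.+1%:R^-1 - (v 0 i - ratr (k.1.2 0 i)) ^+ 2).

Definition bump k (z : Td * Rd) : R := bumpL k (repr z.1) z.2.

(** A closed box carrying the velocities at which the bump is non-zero; the non-strict inequality
    makes it compact. *)
Definition bumpbox k : set Rd :=
  [set v | forall i, (v 0 i - ratr (k.1.2 0 i)) ^+ 2 <= k.2.+1%:R^-1].

Lemma bump_pi k x v : bump k (torus_pi x, v) = bumpL k x v.
Proof.
rewrite /bump /bumpL /=; congr (_ * _); apply: eq_bigr => i _; congr (sqp (_ - _)).
have /torus_piP/mxOverP/(_ 0 i) := torus_reprK (torus_pi x).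
rewrite !mxE => /intrP[m hm].
have -> : repr (torus_pi x) 0 i = x 0 i + m%:~R by rewrite -hm addrCA subrr addr0.
by rewrite addrAC versinD_int.
Qed.

Lemma sqp_ge0 (u : R) : 0 <= sqp u. Proof. exact: sqr_ge0. Qed.

Lemma sqp_le1 (u : R) : u <= 1 -> sqp u <= 1.
Proof. by move=> u1; rewrite /sqp exprn_ile1// ?le_max ?lexx// ge_max ler01. Qed.

Lemma sqp_gt0 (u : R) : (0 < sqp u) = (0 < u).
Proof.
rewrite /sqp; have [u0|u0] := leP u 0; first by rewrite expr0n/= ltxx.
by rewrite exprn_gt0.
Qed.

Lemma versin_ge0 s : 0 <= versin s.
Proof. by rewrite subr_ge0 cos_le1. Qed.

Lemma bump_ge0 k z : 0 <= bump k z.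
Proof. by rewrite mulr_ge0// prodr_ge0// => i _; exact: sqp_ge0. Qed.

Lemma bump_le1 k z : bump k z <= 1.
Proof.
have k1 : k.2.+1%:R^-1 <= 1 :> R by rewrite invf_le1// ler1n.
rewrite /bump /bumpL mulr_ile1//.
- by rewrite prodr_ge0// => i _; exact: sqp_ge0.
- by rewrite prodr_ge0// => i _; exact: sqp_ge0.
- apply: prodr_ile1 => i _; rewrite sqp_ge0 sqp_le1//.
  by rewrite lerBlDr (le_trans k1)// lerDl versin_ge0.
- apply: prodr_ile1 => i _; rewrite sqp_ge0 sqp_le1//.
  by rewrite lerBlDr (le_trans k1)// lerDl sqr_ge0.
Qed.

Lemma bumpL_gt0 k x v : 0 < bumpL k x v <->
  forall i, versin (x 0 i - ratr (k.1.1 0 i)) < k.2.+1%:R^-1 /\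
    (v 0 i - ratr (k.1.2 0 i)) ^+ 2 < k.2.+1%:R^-1.
Proof.
split=> [h i|h]; last first.
  by rewrite mulr_gt0// prodr_gt0// => i _; rewrite sqp_gt0 subr_gt0; case: (h i).
have : bumpL k x v != 0 by rewrite gt_eqF.
rewrite mulf_eq0 negb_or => /andP[/prodf_neq0 h1 /prodf_neq0 h2].
by split; rewrite -subr_gt0 -sqp_gt0 lt_neqAle sqp_ge0 andbT eq_sym; [exact: h1|exact: h2].
Qed.

Lemma C1_bumpL (E : normedModType R) k (x v : E -> Rd) :
  (forall i, C1_on setT (fun z => x z 0 i)) ->
  (forall i, C1_on setT (fun z => v z 0 i)) ->
  C1_on setT (fun z => bumpL k (x z) (v z)).
Proof.
move=> hx hv; have C1sqp (f : E -> R) : C1_on setT f -> C1_on setT (fun z => sqp (f z)).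
  move=> hf; apply: (C1_comp hf is_derive_sqp).
  move=> y; apply: cvgM; first exact: cvg_cst.
  by apply: (@continuous_max R R (cst 0) id); [exact: cvg_cst|exact: cvg_id].
apply: C1M; apply: C1_prod => i; apply: C1sqp; apply: C1D (C1_cst _ _) _.
- apply: (@C1_comp _ _ (fun z => x z 0 i) (fun s => - versin (s - _))
    (fun s => - ((pi *+ 2) * sin ((pi *+ 2) * (s - ratr (k.1.1 0 i)))))) => //.
    move=> s; rewrite /versin; apply: is_derive_eq.
    by rewrite /GRing.scale/=; ring.
  move=> s; apply: cvgN; apply: cvgM; first exact: cvg_cst.
  apply: (@continuous_comp _ _ _ (fun s : R => (pi *+ 2) * (s - ratr (k.1.1 0 i))) sin);
    last exact: continuous_sin.
  by apply: cvgM; [exact: cvg_cst|apply: cvgB; [exact: cvg_id|exact: cvg_cst]].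
- apply: (@C1_comp _ _ (fun z => v z 0 i) (fun s => - (s - _) ^+ 2)
    (fun s => - (2 * (s - ratr (k.1.2 0 i))))) => //.
    move=> s; apply: is_derive_eq.
    by rewrite /GRing.scale/=; ring.
  move=> s; apply: cvgN; apply: cvgM; first exact: cvg_cst.
  by apply: cvgB; [exact: cvg_id|exact: cvg_cst].
Qed.

Lemma torus_lift_continuous :
  continuous (fun z : Rd * Rd => (torus_pi z.1, z.2) : Td * Rd).
Proof.
move=> z.
have c1 : torus_pi y.1 @[y --> z] --> torus_pi z.1.
  apply: (@continuous_comp _ _ _ fst (@torus_pi R d)); first exact: cvg_fst.
  exact: torus_pi_continuous.
have c2 : y.2 @[y --> z] --> z.2 by exact: cvg_snd.
exact: (cvg_pair c1 c2).
Qed.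

Lemma C1_bumpLpair k : C1_on setT (fun z : Rd * Rd => bumpL k z.1 z.2).
Proof.
apply: (@C1_bumpL _ k fst snd) => i; apply: C1_lin.
- by move=> c y w /=; rewrite !mxE.
- move=> y; apply: (@continuous_comp _ _ _ fst (fun w : Rd => w 0 i)).
    exact: cvg_fst.
  exact: coord_continuous.
- by move=> c y w /=; rewrite !mxE.
- move=> y; apply: (@continuous_comp _ _ _ snd (fun w : Rd => w 0 i)).
    exact: cvg_snd.
  exact: coord_continuous.
Qed.
Lemma bumpL_continuous k : continuous (fun z : Rd * Rd => bumpL k z.1 z.2).
Proof. exact: (C1_cont (C1_bumpLpair k)). Qed.
Lemma bump_continuous k : continuous (bump k : Td * Rd -> R).
Proof.
move=> [x v]; rewrite -(torus_reprK x).
have om := @openmap_torus_lift R d.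
suff h : (bump k \o (fun z : Rd * Rd => (torus_pi z.1, z.2))) y @[y --> (repr x, v)]
    --> bump k (torus_pi (repr x), v).
  exact: (openmap_cvg om h).
rewrite bump_pi (_ : _ \o _ = fun z : Rd * Rd => bumpL k z.1 z.2); last first.
  by apply/funext => z /=; rewrite bump_pi.
exact: (@bumpL_continuous k (repr x, v)).
Qed.

Lemma compact_bumpbox k : compact (bumpbox k).
Proof.
set e : R := k.2.+1%:R^-1.
pose A i := `[ratr (k.1.2 0 i) - Num.sqrt e, ratr (k.1.2 0 i) + Num.sqrt e]%classic : set R.
rewrite (_ : bumpbox k = [set v : Rd | forall i, A i (v ord0 i)]).
  by apply: (@rV_compact R d A) => i; exact: segment_compact.
have e0 : 0 <= e by rewrite invr_ge0.
apply/seteqP; split=> v /= h i; have := h i; rewrite /A/= in_itv/= -/e.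
  rewrite -ler_sqrt// sqrtr_sqr ler_norml => /andP[? ?].
  by apply/andP; split; lra.
move=> /andP[? ?].
by rewrite -ler_sqrt// sqrtr_sqr ler_norml; apply/andP; split; lra.
Qed.

Lemma bump_box k (z : Td * Rd) : bump k z != 0 -> bumpbox k z.2.
Proof.
move=> b0; have /bumpL_gt0 h : 0 < bump k z by rewrite lt_neqAle eq_sym b0 bump_ge0.
by move=> i; case: (h i) => _ /ltW.
Qed.

(** Serves twice: the first two clauses give a countable base of the topology, and the third
    confines the velocity support to [V], as [test_function] demands. *)
Lemma bump_basis (U : set (Td * Rd)) (V : set Rd) z : open U -> U z -> open V -> V z.2 ->
  exists k, [/\ 0 < bump k z, (forall y, 0 < bump k y -> U y) & bumpbox k `<=` V].
Proof.
case: z => x v oU Uz oV Vv; rewrite -(torus_reprK x) in Uz *.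
set x0 := repr x in Uz *.
have : nbhs (x0, v) (fun z : Rd * Rd => U (torus_pi z.1, z.2)).
  by apply: torus_lift_continuous; exact: open_nbhs_nbhs.
move=> /nbhs_ballP[e1 /= e10 he1].
have /nbhs_ballP[e2 /= e20 he2] : nbhs v V by exact: open_nbhs_nbhs.
pose e := Num.min e1 e2; have e0 : 0 < e by rewrite lt_min e10.
have e2p : 0 < e / 2 by rewrite divr_gt0.
have [eps eps0 heps] := versin_small e2p.
(* One precision serves both factors: below [eps] for [versin] in space, below the square of [e / 2]
   for the squared distance in velocity. *)
have [n hn] : exists n : nat, n.+1%:R^-1 < Num.min eps ((e / 2) ^+ 2).
  have /ltr_add_invr[n] : 0 < Num.min eps ((e / 2) ^+ 2).
    by rewrite lt_min eps0 exprn_gt0.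
  by rewrite add0r => ?; exists n.
have [hn1 hn2] : n.+1%:R^-1 < eps /\ n.+1%:R^-1 < (e / 2) ^+ 2.
  by move: hn; rewrite lt_min => /andP.
have q1P i : exists q : rat, versin (x0 0 i - ratr q) < n.+1%:R^-1 /\ `|x0 0 i - ratr q| < e / 2.
  have : \forall s \near x0 0 i, versin (x0 0 i - s) < n.+1%:R^-1 /\ `|x0 0 i - s| < e / 2.
    have c : versin (x0 0 i - s) @[s --> x0 0 i] --> (0 : R).
      rewrite (_ : 0 = versin (x0 0 i - x0 0 i)); last first.
        by rewrite /versin subrr mulr0 cos0 subrr.
      apply: cvgB; first exact: cvg_cst.
      apply: (@continuous_comp _ _ _ (fun s : R => (pi *+ 2) * (x0 0 i - s)) cos);
        last exact: continuous_cos.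
      by apply: cvgM; [exact: cvg_cst|apply: cvgB; [exact: cvg_cst|exact: cvg_id]].
    near=> s; split.
      rewrite -[ltLHS]ger0_norm ?versin_ge0//; near: s.
      by apply: cvgr0_norm_lt => //.
    by near: s; exact: (nbhsx_ballx (x0 0 i) (e / 2) e2p).
  move=> /nbhs_ballP[r /= r0 hr].
  have [s [bs [q _ qs]]] := @dense_rat R (ball (x0 0 i) r)
    (ex_intro _ _ (ballxx _ r0)) (ball_open _ _).
  by exists q; rewrite qs; apply: hr.
have q2P i : exists q : rat, (v 0 i - ratr q) ^+ 2 < n.+1%:R^-1 /\ `|v 0 i - ratr q| < e / 2.
  have : \forall s \near v 0 i, (v 0 i - s) ^+ 2 < n.+1%:R^-1 /\ `|v 0 i - s| < e / 2.
    have c : (v 0 i - s) ^+ 2 @[s --> v 0 i] --> (0 : R).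
      rewrite (_ : 0 = (v 0 i - v 0 i) ^+ 2); last by rewrite subrr expr0n.
      by apply: cvgM; apply: cvgB; [exact: cvg_cst|exact: cvg_id|exact: cvg_cst|exact: cvg_id].
    near=> s; split.
      rewrite -[ltLHS]ger0_norm ?sqr_ge0//; near: s.
      by apply: cvgr0_norm_lt => //.
    by near: s; exact: (nbhsx_ballx (v 0 i) (e / 2) e2p).
  move=> /nbhs_ballP[r /= r0 hr].
  have [s [bs [q _ qs]]] := @dense_rat R (ball (v 0 i) r)
    (ex_intro _ _ (ballxx _ r0)) (ball_open _ _).
  by exists q; rewrite qs; apply: hr.
have {q1P}[q1 hq1] := choice q1P; have {q2P}[q2 hq2] := choice q2P.
have sq (u : R) : u ^+ 2 <= n.+1%:R^-1 -> `|u| < e / 2.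
  move=> un; rewrite -(@ltr_pXn2r _ 2)// ?nnegrE ?(ltW e2p)//.
  by rewrite real_normK ?num_real//; exact: le_lt_trans un hn2.
exists (\row_i q1 i, \row_i q2 i, n); split=> /=.
- by rewrite bump_pi; apply/bumpL_gt0 => i /=; rewrite !mxE; case: (hq1 i) (hq2 i) => ? _ [].
- move=> [y w] /bumpL_gt0 /= hy; rewrite -(torus_reprK y).
  (* Where the bump is positive the point is near the centre only modulo the lattice; the integers
     [m] select the representative within [e / 2] of the rational centre. *)
  have /choice[m hm] : forall i, exists m : int, `|repr y 0 i - ratr (q1 i) - m%:~R| < e / 2.
    by move=> i; apply: heps; have [+ _] := hy i; rewrite mxE => /lt_trans; apply.
  rewrite (_ : torus_pi (repr y) = torus_pi (\row_i (repr y 0 i - (m i)%:~R))); last first.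
    apply/torus_piP/mxOverP => i j; rewrite !mxE ord1 opprB addrC addrNK intr_int//.
  apply: (he1 (_, _)); split; rewrite /=.
    split=> // i j; rewrite !ord1 mxE /ball/=.
    rewrite (splitr e1) (_ : x0 0 j - _ = (x0 0 j - ratr (q1 j)) -
      (repr y 0 j - ratr (q1 j) - (m j)%:~R)); last by ring.
    rewrite (le_lt_trans (ler_normB _ _))// -splitr.
    rewrite (@lt_le_trans _ _ e)// ?ge_min ?lexx// [ltRHS]splitr.
    by apply: ltrD; [case: (hq1 j)|exact: hm].
  split=> // i j; rewrite !ord1 /ball/=.
  rewrite (_ : v 0 j - _ = (v 0 j - ratr (q2 j)) - (w 0 j - ratr (q2 j))); last by ring.
  rewrite (le_lt_trans (ler_normB _ _))//.
  rewrite (@lt_le_trans _ _ e)// ?ge_min ?lexx// [ltRHS]splitr.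
  apply: ltrD; first by case: (hq2 j).
  by apply: sq; have [_ /ltW] := hy j; rewrite mxE.
- move=> w /= hw; apply: he2; split=> // i j; rewrite !ord1 /ball/=.
  rewrite (_ : v 0 j - _ = (v 0 j - ratr (q2 j)) - (w 0 j - ratr (q2 j))); last by ring.
  rewrite (le_lt_trans (ler_normB _ _))//.
  rewrite (@lt_le_trans _ _ e)// ?ge_min ?lexx ?orbT// [ltRHS]splitr.
  apply: ltrD; first by case: (hq2 j).
  by apply: sq; have := hw j; rewrite mxE.
Unshelve. all: by end_near. Qed.

End Bump.

(** * Borel maps and bounded convergence *)

Section BorelMaps.

(** A countable base splits an open subset of a product into countably many open rectangles; this is
    how a pair of Borel maps is seen to be Borel for the product topology. *)
Definition countable_base (T : topologicalType) (I : countType) (B : I -> set T) :=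
  (forall i, open (B i)) /\
  forall U x, open U -> U x -> exists2 i, B i x & B i `<=` U.

(** Measurability stated against a topology, so that intermediate spaces such as products of R, T^d
    and R^d need no sigma-algebra of their own. *)
Definition borel_fun {d} {T : measurableType d} {Y : topologicalType} (f : T -> Y) :=
  forall U, open U -> measurable (f @^-1` U).

Lemma countable_base_prod (A C : topologicalType) (I J : countType) (B1 : I -> set A)
    (B2 : J -> set C) :
  countable_base B1 -> countable_base B2 -> countable_base (fun ij : I * J => B1 ij.1 `*` B2 ij.2).
Proof.
move=> [ ob1 b1] [ ob2 b2]; split=> [[i j]|W [a c] oW Wac] /=.
  rewrite openE => -[x y] [/= B1x B2y].
  by exists (B1 i, B2 j) => //=; split; exact: open_nbhs_nbhs.
have [[P Q] /= [/nbhs_interior hP /nbhs_interior hQ] PQ] : nbhs (a, c) W.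
  exact: open_nbhs_nbhs.
have [i Bia iP] := b1 P^° a (open_interior _) (nbhs_singleton hP).
have [j Bjc jQ] := b2 Q^° c (open_interior _) (nbhs_singleton hQ).
exists (i, j) => //= -[x y] [/= /iP /interior_subset Px /jQ /interior_subset Qy].
exact: PQ.
Qed.

Lemma countable_base_bigcup (T : topologicalType) (I : countType) (B : I -> set T) U :
  countable_base B -> open U -> U = \bigcup_(i in [set i | B i `<=` U]) B i.
Proof.
move=> [ ob b] oU; apply/seteqP; split=> [x Ux|x [i iU]]; last exact: iU.
by have [i Bix iU] := b U x oU Ux; exists i.
Qed.

Context {d} {T : measurableType d}.

Lemma borel_fun_countable_base (Y : topologicalType) (I : countType) (B : I -> set Y) (f : T -> Y) :
  countable_base B -> (forall i, measurable (f @^-1` B i)) -> borel_fun f.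
Proof.
move=> bB mB U oU; rewrite (countable_base_bigcup bB oU) preimage_bigcup bigcup_mkcond.
by apply: countable_bigcupT_measurable => // i; case: ifP.
Qed.

Lemma borel_fun_pair (A C : topologicalType) (I J : countType) (B1 : I -> set A)
    (B2 : J -> set C) (f : T -> A) (g : T -> C) :
  countable_base B1 -> countable_base B2 -> borel_fun f -> borel_fun g -> borel_fun (fun t => (f t, g t)).
Proof.
move=> b1 b2 mf mg; apply: (borel_fun_countable_base (countable_base_prod b1 b2)) => -[i j] /=.
rewrite (_ : _ @^-1` _ = f @^-1` B1 i `&` g @^-1` B2 j)//.
by apply: measurableI; [apply: mf; case: b1|apply: mg; case: b2].
Qed.

Lemma borel_fun_comp (A C : topologicalType) (f : T -> A) (h : A -> C) :
  continuous h -> borel_fun f -> borel_fun (h \o f).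
Proof. by move=> /continuousP ch mf U oU; exact: (mf _ (ch _ oU)). Qed.

Lemma borel_fun_borel (Y : ptopologicalType) (f : T -> Y) :
  borel_fun f -> measurable_fun setT (f : T -> borel Y).
Proof.
move=> mf; apply: (@measurability _ _ _ (borel Y) setT f (@open Y)) => //.
by move=> _ [U oU <-]; rewrite setTI; exact: mf.
Qed.

Lemma borel_borel_fun (Y : ptopologicalType) (f : T -> borel Y) :
  measurable_fun setT f -> @borel_fun _ _ Y f.
Proof.
move=> mf U oU; rewrite -[X in measurable X]setTI.
have mU : measurable (U : set (borel Y)) by exact: sub_sigma_algebra.
exact: (mf measurableT U mU).
Qed.

Lemma open_borel (Y : ptopologicalType) (U : set Y) :
  open U -> measurable (U : set (borel Y)).
Proof. exact: sub_sigma_algebra. Qed.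

Context {R : realType}.

Lemma borel_fun_R (f : T -> R) : measurable_fun setT f -> borel_fun f.
Proof.
move=> mf U oU; rewrite -[X in measurable X]setTI.
exact: (mf measurableT U (open_measurable oU)).
Qed.

(** Continuity is asked on the open set [D] alone, because functions on T^d x V are arbitrary where
    the velocity is outside [V]. *)
Lemma borel_fun_contfun (Y : topologicalType) (D : set Y) (f : T -> Y) (h : Y -> R) :
  open D -> {in D, continuous h} -> borel_fun f -> measurable_fun (f @^-1` D) (h \o f).
Proof.
move=> oD ch mf; apply: (measurability _ (@RGenOpens.measurableE R)).
move=> _ [_ [a [b ->] <-]].
rewrite (_ : _ `&` _ = f @^-1` (D `&` h @^-1` `]a, b[)) //.
apply: (mf (D `&` h @^-1` `]a, b[)); rewrite openE => y [Dy hy]; apply: filterI.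
  exact: open_nbhs_nbhs.
by apply: ch; [rewrite inE|apply: open_nbhs_nbhs; split => //; exact: interval_open].
Qed.

End BorelMaps.

Lemma countable_base_R {R : realType} :
  countable_base (fun qn : rat * nat => ball (ratr qn.1 : R) qn.2.+1%:R^-1).
Proof.
split=> [i|U x oU Ux]; first exact: ball_open.
have /nbhs_ballP[e /= e0 he] : nbhs x U by exact: open_nbhs_nbhs.
have [n hn] : exists n : nat, n.+1%:R^-1 < e / 2.
  have /ltr_add_invr[n] : 0 < e / 2 by rewrite divr_gt0.
  by rewrite add0r => ?; exists n.
have n0 : 0 < n.+1%:R^-1 :> R by rewrite invr_gt0.
have [s [bs [q _ qs]]] := @dense_rat R (ball x n.+1%:R^-1)
  (ex_intro _ _ (ballxx _ n0)) (ball_open _ _).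
exists (q, n); first by rewrite /= qs; exact: ball_sym.
move=> y /= hy; apply: he; rewrite (splitr e).
apply: (@ball_triangle _ _ s).
  by apply: le_ball bs; exact: ltW.
by rewrite -qs; apply: le_ball hy; exact: ltW.
Qed.

Lemma countable_base_X {R : realType} {d : nat} :
  countable_base (fun k => [set z : torus R d * 'rV[R]_d | 0 < bump k z]).
Proof.
split=> [k|U z oU Uz].
  by have /continuousP/(_ _ (@open_gt R 0)) := @bump_continuous R d k.
have [k [b0 bU _]] := bump_basis oU Uz (@openT _) (I : setT z.2).
by exists k.
Qed.

Section CbaseRow.
Context {R : realType} {d : nat}.
Definition rbox (k : 'rV[rat]_d * nat) : set 'rV[R]_d :=
  [set v | forall i, ball (ratr (k.1 0 i) : R) k.2.+1%:R^-1 (v 0 i)].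

Lemma rbox_ball k : rbox k = ball (map_mx ratr k.1 : 'rV[R]_d) k.2.+1%:R^-1.
Proof.
apply/seteqP; split=> v /=.
  by move=> h; split; [rewrite invr_gt0|move=> i j; rewrite ord1 mxE; exact: h].
by move=> [_ h] i; have := h 0 i; rewrite mxE.
Qed.

Lemma countable_base_row : countable_base rbox.
Proof.
split=> [k|U v oU Uv]; first by rewrite rbox_ball; exact: ball_open.
have /nbhs_ballP[e /= e0 he] : nbhs v U by exact: open_nbhs_nbhs.
have [n hn] : exists n : nat, n.+1%:R^-1 < e / 2.
  have /ltr_add_invr[n] : 0 < e / 2 by rewrite divr_gt0.
  by rewrite add0r => ?; exists n.
have n0 : 0 < n.+1%:R^-1 :> R by rewrite invr_gt0.
have qP i : exists q : rat, ball (v 0 i) n.+1%:R^-1 (ratr q).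
  have [s [bs [q _ qs]]] := @dense_rat R (ball (v 0 i) n.+1%:R^-1)
    (ex_intro _ _ (ballxx _ n0)) (ball_open _ _).
  by exists q; rewrite qs.
have {qP}[q qP] := choice qP.
have vb : ball (map_mx ratr (\row_i q i) : 'rV[R]_d) n.+1%:R^-1 v.
  by rewrite -(rbox_ball (_, n)) => i /=; rewrite mxE; apply: ball_sym.
exists (\row_i q i, n); rewrite rbox_ball//=.
move=> w hw; apply: he; rewrite (splitr e).
apply: (@ball_triangle _ _ (map_mx ratr (\row_i q i) : 'rV[R]_d)).
  by apply: ball_sym; apply: le_ball vb; exact: ltW.
by apply: le_ball hw; exact: ltW.
Qed.
End CbaseRow.

(** * Dominated convergence for real-valued integrals *)

Section RintegralTools.
Context {d} {T : measurableType d} {R : realType}.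
Variable mu : {measure set T -> \bar R}.
Implicit Types (D : set T) (f g : T -> R).

Lemma integrable_bnd D f (M : R) : measurable D -> (mu D < +oo)%E ->
  measurable_fun D f -> (forall x, D x -> `|f x| <= M) ->
  mu.-integrable D (EFin \o f).
Proof.
move=> mD Doo mf fM; apply: measurable_bounded_integrable => //.
exists M; split; first by rewrite num_real.
by move=> x Mx y Dy /=; apply: le_trans (fM y Dy) (ltW Mx).
Qed.

Lemma Rintegral_dct D (f_ : nat -> T -> R) f g : measurable D ->
  (forall n, measurable_fun D (f_ n)) -> measurable_fun D f ->
  mu.-integrable D (EFin \o g) ->
  (forall n x, D x -> `|f_ n x| <= g x) ->
  (forall x, D x -> f_ n x @[n --> \oo] --> f x) ->
  \int[mu]_(x in D) f_ n x @[n --> \oo] --> \int[mu]_(x in D) f x.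
Proof.
move=> mD mf_ mf ig fg ff; rewrite /Rintegral.
have fgE x : D x -> `|f x| <= g x.
  move=> Dx; apply: (ler_cvg_to (cvg_norm (ff x Dx)) (@cvg_cst _ (g x) _ \oo _)).
  by apply: nearW => n; exact: fg.
have [|||//|_ _] := @dominated_convergence _ _ _ mu D mD
    (fun n => EFin \o f_ n) (EFin \o f) (EFin \o g) _ _ _ ig.
- by move=> n; exact/measurable_EFinP.
- exact/measurable_EFinP.
- by apply: aeW => x Dx; apply: cvg_EFin; [exact: nearW|exact: ff].
- by apply: aeW => x n Dx; rewrite lee_fin; exact: fg.
move=> h; apply: fine_cvg; rewrite fineK; first exact: h.
apply: integrable_fin_num => //.
apply: le_integrable ig => //; first exact/measurable_EFinP.
by move=> x Dx; rewrite /= lee_fin (le_trans (fgE x Dx))// ler_norm.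
Qed.

Lemma Rintegral_bnd D f (M : R) : measurable D -> (mu D < +oo)%E ->
  measurable_fun D f -> (forall x, D x -> `|f x| <= M) ->
  `|\int[mu]_(x in D) f x| <= M * fine (mu D).
Proof.
move=> mD Doo mf fM; have If := integrable_bnd mD Doo mf fM.
apply: le_trans (le_normr_Rintegral mD If) _.
rewrite -Rintegral_cst//; apply: le_Rintegral => //.
- exact: (integrable_norm If).
- by apply: (@integrable_bnd _ _ `|M|).
Qed.

Lemma Rintegral_bdct D (f_ : nat -> T -> R) f (M : R) : measurable D ->
  (mu D < +oo)%E ->
  (forall n, measurable_fun D (f_ n)) -> measurable_fun D f ->
  (forall n x, D x -> `|f_ n x| <= M) ->
  (forall x, D x -> f_ n x @[n --> \oo] --> f x) ->
  \int[mu]_(x in D) f_ n x @[n --> \oo] --> \int[mu]_(x in D) f x.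
Proof.
move=> mD Doo mf_ mf fM ff; apply: (@Rintegral_dct D f_ f (cst M)) => //.
by apply: (@integrable_bnd _ _ `|M|).
Qed.

End RintegralTools.

(** * Layer-cake approximation *)

Section LayerCake.
Context {R : realType}.

(** A staircase with [n.+1] steps over [-M, M], written as a combination of indicators of superlevel
    sets. Composed with a continuous function it involves only indicators of open sets. *)
Definition steps (M : R) (n : nat) (y : R) : R :=
  - M + (2 * M / n.+1%:R) * \sum_(k < n.+1) ((- M + 2 * M * k.+1%:R / n.+1%:R < y)%R : bool)%:R.

Lemma count_close (N : nat) (w : R) : 0 <= w <= N%:R ->
  \sum_(k < N) ((k.+1%:R < w)%R : bool)%:R <= w <= \sum_(k < N) ((k.+1%:R < w)%R : bool)%:R + 1.
Proof.
elim: N => [|N IH] /andP[w0 wN].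
  by rewrite big_ord0; apply/andP; split; lra.
rewrite big_ord_recr/= (ltNge _ w) wN addr0.
have [wN'|Nw] := leP w N%:R; first by apply: IH; rewrite w0.
rewrite (eq_bigr (fun=> 1)) => [|k _]; last first.
  by rewrite (le_lt_trans _ Nw)// ler_nat.
by rewrite sumr_const card_ord (ltW Nw)/= natr1.
Qed.

Lemma steps_close (M : R) n y : 0 < M -> `|y| <= M -> `|steps M n y - y| <= 2 * M / n.+1%:R.
Proof.
move=> M0; rewrite ler_norml => /andP[My yM].
set N := n.+1; have n0 : 0 < N%:R :> R by [].
pose w := (y + M) / (2 * M) * N%:R.
have M2 : 0 < 2 * M by rewrite mulr_gt0.
have wN : 0 <= w <= N%:R.
  have yM0 : 0 <= y + M by lra.
  apply/andP; split; first by rewrite /w mulr_ge0// divr_ge0// ?ltW.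
  by rewrite /w ler_piMl// ler_pdivrMr//; lra.
have /andP[h1 h2] := count_close wN.
have yE : y = - M + 2 * M / N%:R * w by rewrite /w; field; rewrite ?gt_eqF.
have -> : steps M n y = - M + 2 * M / N%:R * \sum_(k < N) ((k.+1%:R < w)%R : bool)%:R.
  congr (_ + _ * _); apply: eq_bigr => k _; congr (nat_of_bool _)%:R.
  rewrite /w -ltr_pdivrMr// ltr_pdivlMr//.
  rewrite -[LHS](ltrD2l M) addrA subrr add0r (addrC M).
  by congr (_ < _); rewrite [RHS]mulrC mulrA.
rewrite [in X in _ - X]yE opprD addrACA subrr add0r -mulrBr normrM ger0_norm ?divr_ge0 ?(ltW M2)//.
rewrite ler_piMr ?divr_ge0 ?(ltW M2)// ler_norml.
by apply/andP; split; lra.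
Qed.

Lemma steps_cvg (M y : R) : 0 < M -> `|y| <= M -> steps M n y @[n --> \oo] --> y.
Proof.
move=> M0 yM; apply/cvgrPdist_le => e e0.
near=> n; rewrite distrC (le_trans (steps_close n M0 yM))//.
rewrite ler_pdivrMr// -ler_pdivrMl//.
apply: (@le_trans _ _ n%:R); last by rewrite ler_nat.
near: n; exact: nbhs_infty_ger.
Unshelve. all: by end_near. Qed.

Lemma steps_bnd (M y : R) n : 0 < M -> `|y| <= M -> `|steps M n y| <= 3 * M.
Proof.
move=> M0 yM; rewrite -(subrK y (steps M n y)) (le_trans (ler_normD _ _))//.
rewrite (_ : 3 * M = 2 * M + M); last by ring.
rewrite lerD// (le_trans (steps_close n M0 yM))//.
by rewrite ler_pdivrMr// ler_peMr ?mulr_ge0 ?(ltW M0)// ler1n.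
Qed.

End LayerCake.

(** * Lebesgue measure on R^d and on the torus *)

Section LebesgueRow.
Context {R : realType} {d : nat}.
Local Notation Rd := 'rV[R]_d.
Local Notation brow := (borel 'rV[R]_d).
Local Notation leb := (@lebesgue_row R d).

Definition obox (l u : Rd) : set Rd := [set v | forall i, `]l 0 i, u 0 i[%classic (v 0 i)].

Lemma obox_open l u : open (obox l u).
Proof.
rewrite openE => v hv.
apply: (@filter_forall _ _ (fun i w => `]l 0 i, u 0 i[%classic (w 0 i)) (nbhs v)) => i.
have c : (fun w : Rd => w 0 i) @ v --> v 0 i by exact: coord_continuous.
have h : nbhs (v 0 i) `]l 0 i, u 0 i[%classic.
  by apply: open_nbhs_nbhs; split; [exact: interval_open|exact: hv].
exact: (c _ h).
Qed.

(** Open boxes are a pi-system ([obox_setI]); knowing that they generate the Borel sets allows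
    measures to be identified by their values on boxes. *)
Lemma borel_row_obox : @measurable _ brow = <<s [set A | exists l u, A = obox l u] >>.
Proof.
apply/seteqP; split.
  apply: smallest_sub; first exact: smallest_sigma_algebra.
  move=> U oU; rewrite (countable_base_bigcup countable_base_row oU) bigcup_mkcond.
  have : sigma_algebra setT <<s [set A | exists l u : Rd, A = obox l u] >> by exact: smallest_sigma_algebra.
  move=> sa; have mT := @countable_bigcupT_measurable _
    (g_sigma_algebraType [set A | exists l u : Rd, A = obox l u]).
  apply: (mT _ _ _) => // k; case: ifP => _; last exact: (@measurable0 _ (g_sigma_algebraType _)).
  apply: sub_sigma_algebra.
  exists (\row_i (ratr (k.1 0 i) - k.2.+1%:R^-1)), (\row_i (ratr (k.1 0 i) + k.2.+1%:R^-1)).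
  apply/seteqP; split=> v h i; have := h i; rewrite !mxE /ball/= in_itv/= ltr_distlC//.
apply: smallest_sub; first exact: sigma_algebra_measurable.
by move=> _ [l [u ->]]; apply: sub_sigma_algebra; exact: obox_open.
Qed.

Lemma obox_setI : setI_closed [set A | exists l u : Rd, A = obox l u].
Proof.
move=> _ _ [l [u ->]] [l' [u' ->]].
exists (\row_i Num.max (l 0 i) (l' 0 i)), (\row_i Num.min (u 0 i) (u' 0 i)).
apply/seteqP; split=> v /=.
  by move=> [h h'] i; have := h i; have := h' i; rewrite !mxE /= !in_itv/= gt_max lt_min => /andP[-> ->] /andP[-> ->].
move=> h; split=> i; have := h i; rewrite !mxE /= !in_itv/= gt_max lt_min.
  by move=> /andP[/andP[-> _] /andP[-> _]].
by move=> /andP[/andP[_ ->] /andP[_ ->]].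
Qed.

Definition nbox (n : nat) : set Rd := obox (const_mx (- n%:R)) (const_mx n%:R).

Lemma nbox_cover : \bigcup_n nbox n = setT.
Proof.
apply/seteqP; split=> // v _.
exists (Num.truncn `|v|).+1 => // i /=; rewrite !mxE in_itv/= -ltr_norml.
rewrite (le_lt_trans _ (truncnS_gt _))//.
by rewrite [leRHS](mx_normrE v); exact: (le_bigmax _ (fun k : 'I_1 * 'I_d => `|v k.1 k.2|) (0, i)).
Qed.

Lemma lebesgue_obox l u : leb (obox l u) = (\prod_i lebesgue_measure `](l 0%R i), (u 0%R i)[%classic)%E.
Proof. by rewrite -lebesgue_row_box. Qed.

Lemma lebesgue_obox_lty l u : (leb (obox l u) < +oo)%E.
Proof.
rewrite -ge0_fin_numE ?measure_ge0// lebesgue_obox.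
apply: prode_fin_num => i _.
by rewrite lebesgue_measure_itv/=; case: ifP.
Qed.

Lemma lebesgue_row_sigma_finite : sigma_finite setT leb.
Proof.
exists nbox; first by rewrite nbox_cover.
by move=> n; split; [apply: sub_sigma_algebra; exact: obox_open|exact: lebesgue_obox_lty].
Qed.

HB.instance Definition _ :=
  Measure_isSigmaFinite.Build _ _ _ leb lebesgue_row_sigma_finite.

Definition affine (c : R) (a : Rd) (v : Rd) : Rd := c *: v + a.

Lemma measurable_affine c a : measurable_fun setT (affine c a : brow -> brow).
Proof.
apply: borel_fun_borel => U oU; apply: open_borel.
have /continuousP cA : continuous (affine c a).
  by move=> v; exact: (cvgD (@scaler_continuous _ _ c v) (cvg_cst a)).
exact: (cA _ oU).
Qed.

(** Both sides are measures in [A], finite on the boxes [nbox] that exhaust the space, and they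
    agree on open boxes, where each side length is divided by [c]. *)
Lemma lebesgue_affine c a (A : set brow) : 0 < c -> measurable A ->
  leb (affine c a @^-1` A) = ((c ^- d)%:E * leb A)%E.
Proof.
move=> c0 mA.
have cd0 : 0 <= c ^- d by rewrite invr_ge0 exprn_ge0// ltW.
have := @measure_unique _ R brow _ nbox borel_row_obox obox_setI.
move=> /(_ _ nbox_cover (measure_function_pushforward__canonical__measure_function_Measure leb
  (measurable_affine c a)) (mscale (NngNum cd0) leb)).
apply => //.
- by move=> n; exists (const_mx (- n%:R)), (const_mx n%:R).
- move=> _ [l [u ->]].
  have E : affine c a @^-1` obox l u = obox (c^-1 *: (l - a)) (c^-1 *: (u - a)).
    apply/seteqP; split=> v h i; have := h i; rewrite /affine !mxE/= !in_itv/=.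
      by rewrite ltr_pdivrMl// ltr_pdivlMl// ltrBlDr ltrBrDr.
    by rewrite ltr_pdivrMl// ltr_pdivlMl// ltrBlDr ltrBrDr.
  transitivity (leb (affine c a @^-1` obox l u)); first by [].
  transitivity ((c ^- d)%:E * leb (obox l u))%E; last by [].
  rewrite E.
  rewrite !lebesgue_obox.
  rewrite (eq_bigr (fun i => ((c^-1)%:E * lebesgue_measure `](l 0%R i), (u 0%R i)[%classic)%E)); last first.
    move=> i _; rewrite !lebesgue_measure_itv/= !mxE !lte_fin.
    rewrite ltr_pM2l ?invr_gt0// ltrD2r; case: ifP => _; last by rewrite mule0.
    by rewrite -!EFinB -EFinM -mulrBr opprB addrA subrK.
  rewrite (_ : c ^- d = \prod_(i < d) c^-1); last by rewrite prodr_const card_ord exprVn.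
  elim/big_rec3: _ => [|i x y z _ ->]; first by rewrite mul1e.
  by rewrite EFinM muleACA.
- move=> n.
  suff : (leb (affine c a @^-1` nbox n) < +oo)%E by [].
  have -> : affine c a @^-1` nbox n = obox (c^-1 *: (const_mx (- n%:R) - a)) (c^-1 *: (const_mx n%:R - a)).
    apply/seteqP; split=> v h i; have := h i; rewrite /affine !mxE/= !in_itv/=.
      by rewrite ltr_pdivrMl// ltr_pdivlMl// ltrBlDr ltrBrDr.
    by rewrite ltr_pdivrMl// ltr_pdivlMl// ltrBlDr ltrBrDr.
  exact: lebesgue_obox_lty.
Qed.

Lemma lebesgue_shift_ge0 a (f : brow -> \bar R) :
  measurable_fun setT f -> (forall v, 0 <= f v)%E ->
  (\int[leb]_v f ((v : Rd) + a)%R = \int[leb]_v f v)%E.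
Proof.
move=> mf f0.
have := @ge0_integral_pushforward _ _ _ _ _ _ (measurable_affine 1 a) leb setT f measurableT mf
  (fun y _ => f0 y).
rewrite preimage_setT => h.
transitivity (\int[leb]_v (f \o affine 1 a) v)%E.
  by apply: eq_integral => v _; rewrite /= /affine scale1r.
rewrite -h; apply: eq_measure_integral; first exact: measurable_affine.
move=> mphi A mA _.
have := lebesgue_affine a ltr01 mA; rewrite expr1n invr1 mul1e.
exact.
Qed.

End LebesgueRow.

(** * Euclidean balls *)

Section EBall.
Context {R : realType} {d : nat}.
Local Notation Rd := 'rV[R]_d.
Local Notation leb := (@lebesgue_row R d).

Lemma enorm_continuous : continuous (@enorm R d).
Proof.
move=> v; apply: (@continuous_comp _ _ _ (fun w : Rd => \sum_i w 0 i ^+ 2) Num.sqrt);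
  last exact: sqrt_continuous.
move: (index_enum _) v => s; elim: s => [|i s IH].
  have -> : (fun w : Rd => \sum_(i <- [::]) w 0 i ^+ 2) = cst 0.
    by apply/funext => w; rewrite big_nil.
  exact: cst_continuous.
have -> : (fun w : Rd => \sum_(j <- i :: s) w 0 j ^+ 2) =
    (fun w => w 0 i * w 0 i + \sum_(i <- s) w 0 i ^+ 2).
  by apply/funext => w; rewrite big_cons expr2.
move=> v.
have c : (fun w : Rd => w 0 i) @ v --> v 0 i by exact: coord_continuous.
exact: (cvgD (cvgM c c) (IH v)).
Qed.

Lemma enorm_ge0 (v : Rd) : 0 <= enorm v. Proof. exact: sqrtr_ge0. Qed.

Lemma enorm_coord (v : Rd) i : `|v 0 i| <= enorm v.
Proof.
rewrite -sqrtr_sqr ler_wsqrtr// (bigD1 i)//= lerDl.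
by apply: sumr_ge0 => j _; exact: sqr_ge0.
Qed.

Lemma enorm_max (v : Rd) (e : R) : 0 <= e -> (forall i, `|v 0 i| <= e) ->
  enorm v <= Num.sqrt d%:R * e.
Proof.
move=> e0 ve; rewrite -[e in leRHS]ger0_norm// -sqrtr_sqr -sqrtrM// ler_wsqrtr//.
apply: (@le_trans _ _ (\sum_(i < d) e ^+ 2)).
  apply: ler_sum => i _; rewrite -[X in X ^+ 2 <= _]/(v 0 i) -(@real_normK _ (v 0 i)) ?num_real//.
  by rewrite lerXn2r// ?nnegrE.
by rewrite sumr_const card_ord mulr_natl.
Qed.

(** The inequality (a + b)^2 <= 2 (a^2 + b^2) in each coordinate replaces the triangle inequality,
    and loses nothing when both norms are bounded by r / 2. *)
Lemma enorm_half (v w : Rd) r : enorm v < r / 2 -> enorm w <= r / 2 -> enorm (v + w) < r.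
Proof.
move=> vr wr.
have S0 (u : Rd) : 0 <= \sum_i u 0 i ^+ 2 by apply: sumr_ge0 => i _; exact: sqr_ge0.
have r0 : 0 < r by have := enorm_ge0 v; lra.
have sv : \sum_i v 0 i ^+ 2 < (r / 2) ^+ 2.
  by rewrite -[ltLHS]sqr_sqrtr// ltrXn2r// ?nnegrE ?enorm_ge0//; lra.
have sw : \sum_i w 0 i ^+ 2 <= (r / 2) ^+ 2.
  by rewrite -[leLHS]sqr_sqrtr// lerXn2r// ?nnegrE ?enorm_ge0//; lra.
rewrite -[ltRHS]ger0_norm ?(ltW r0)// -sqrtr_sqr ltr_sqrt ?exprn_gt0//.
apply: (@le_lt_trans _ _ (2 * (\sum_i v 0 i ^+ 2 + \sum_i w 0 i ^+ 2))); last first.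
  by move: sv sw; rewrite expr_div_n; lra.
rewrite -big_split/= mulr_sumr; apply: ler_sum => i _; rewrite mxE.
have := sqr_ge0 (v 0 i - w 0 i); rewrite sqrrB sqrrD; lra.
Qed.

Lemma enormZ (c : R) (v : Rd) : 0 <= c -> enorm (c *: v) = c * enorm v.
Proof.
move=> c0; rewrite /enorm -[c in RHS]ger0_norm// -sqrtr_sqr -sqrtrM ?sqr_ge0//.
congr Num.sqrt; rewrite mulr_sumr; apply: eq_bigr => i _.
by rewrite !mxE exprMn.
Qed.

Lemma eball_open (c : Rd) r : open (eball c r).
Proof.
have /continuousP/(_ _ (@open_lt R r)) : continuous (fun v : Rd => enorm (v - c)).
  move=> v; apply: (@continuous_comp _ _ _ (fun v : Rd => v - c) enorm);
    last exact: enorm_continuous.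
  exact: (cvgB (@cvg_id _ (nbhs v)) (cvg_cst c)).
exact.
Qed.

Lemma eball_lty (c : Rd) r : (leb (eball c r) < +oo)%E.
Proof.
apply: le_lt_trans (lebesgue_obox_lty (c - const_mx r) (c + const_mx r)).
apply: le_measure; [by rewrite inE; apply: open_borel; exact: eball_open|
  by rewrite inE; apply: open_borel; exact: obox_open|].
move=> v /= vr i; rewrite /= !mxE in_itv/= -ltr_distl.
by have := enorm_coord (v - c) i; rewrite !mxE => /le_lt_trans; apply.
Qed.

Lemma eball_gt0 (c : Rd) r : 0 < r -> (0 < leb (eball c r))%E.
Proof.
(* The added 1 makes the cube of half-side [e] fit strictly inside the ball, for every [d] including
   0. *)
move=> r0; pose e := r / (Num.sqrt d%:R + 1).
have e0 : 0 < e by rewrite divr_gt0// ltr_wpDl// sqrtr_ge0.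
apply: (@lt_le_trans _ _ (leb (obox (c - const_mx e) (c + const_mx e)))).
  rewrite lebesgue_obox; elim/big_ind : _ => //; first exact: mule_gt0.
  move=> i _; rewrite lebesgue_measure_itv/= !mxE lte_fin ltrD2l ifT; last lra.
  by rewrite -EFinB lte_fin; lra.
apply: le_measure; [by rewrite inE; apply: open_borel; exact: obox_open|
  by rewrite inE; apply: open_borel; exact: eball_open|].
move=> v /= h; apply: (@le_lt_trans _ _ (Num.sqrt d%:R * e)).
  apply: enorm_max => [|i]; first exact: ltW.
  by have := h i; rewrite /= !mxE in_itv/= -ltr_distl => /ltW.
rewrite /e mulrA ltr_pdivrMr ?ltr_wpDl ?sqrtr_ge0//.
by rewrite mulrC ltr_pM2l// ltrDl.
Qed.

(** The dilation by 2 centred at [c] maps the half ball onto the ball; this is the source of 2^d in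
    the rate. *)
Lemma eball_half (c : Rd) r : 
  leb (eball c (r / 2)) = ((2 ^- d)%:E * leb (eball c r))%E.
Proof.
have m2 : 0 < 2 :> R by [].
rewrite -(lebesgue_affine (- c) m2 (open_borel (@eball_open c r))).
rewrite (_ : eball c (r / 2) = affine 2 (- c) @^-1` eball c r)//.
apply/seteqP; split=> v; rewrite /eball/affine/=.
  rewrite (_ : 2 *: v - c - c = 2 *: (v - c)); last by rewrite scalerBr -addrA -opprD [2 *: c]scaler_nat mulr2n.
  by rewrite enormZ// ltr_pdivlMr// [_ * 2]mulrC.
rewrite (_ : 2 *: v - c - c = 2 *: (v - c)); last by rewrite scalerBr -addrA -opprD [2 *: c]scaler_nat mulr2n.
by rewrite enormZ// ltr_pdivlMr// [_ * 2]mulrC.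
Qed.

End EBall.

(** * Averages of periodic functions over the unit cube *)

Section Cube.
Context {R : realType} {d : nat}.
Local Notation Rd := 'rV[R]_d.
Local Notation brow := (borel 'rV[R]_d).
Local Notation leb := (@lebesgue_row R d).

Lemma borel_fun_idrow : @borel_fun _ brow Rd id.
Proof. by move=> U oU; exact: open_borel. Qed.

Lemma measurable_coord i : measurable_fun setT (fun v : brow => (v : Rd) 0 i).
Proof.
have := @borel_fun_contfun _ brow R Rd setT id (fun v : Rd => v 0 i) openT.
rewrite preimage_setT; apply; last exact: borel_fun_idrow.
by move=> v _; exact: coord_continuous.
Qed.

Lemma measurable_shift_row a : measurable_fun setT (fun v : brow => (v : Rd) + a : brow).
Proof.
have := measurable_affine 1 a; apply: eq_measurable_fun => v _.
by rewrite /affine scale1r.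
Qed.

Definition cube : set Rd := [set v | forall i, `[0, 1[%classic (v 0 i)].

Lemma measurable_halfspace (i : 'I_d) (A : set R) : measurable A ->
  measurable ([set v | A (v 0 i)] : set brow).
Proof.
move=> mA; rewrite -[X in measurable X]setTI.
exact: (measurable_coord i measurableT mA).
Qed.

Lemma measurable_cube : measurable (cube : set brow).
Proof.
rewrite (_ : cube = \bigcap_(i in [set: 'I_d]) [set v | `[0, 1[%classic (v 0 i)]).
  by apply: fin_bigcap_measurable => // i _; exact: measurable_halfspace.
by apply/seteqP; split=> v h i; [move=> _|]; exact: h.
Qed.

Lemma lebesgue_cube : leb cube = 1%E.
Proof.
rewrite (@lebesgue_row_box R d (fun=> `[0, 1[%classic))// big1// => i _.
by rewrite lebesgue_measure_itv/= lte_fin ltr01 sube0.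
Qed.

Definition periodic_row {T : Type} (g : Rd -> T) :=
  forall x m, m \is a mxOver Num.int -> g (x + m) = g x.

Lemma lebesgue_shift_set a (A : set brow) (f : brow -> \bar R) :
  measurable A -> measurable_fun setT f -> (forall v, 0 <= f v)%E ->
  (\int[leb]_(v in [set v | A ((v : Rd) + a)%R]) f ((v : Rd) + a)%R
   = \int[leb]_(v in A) f v)%E.
Proof.
move=> mA mf f0; rewrite integral_mkcond [RHS]integral_mkcond.
rewrite -[RHS](lebesgue_shift_ge0 a).
- apply: eq_integral => v _; rewrite !patchE.
  by congr (if _ then _ else _); apply/idP/idP; rewrite !inE.
- apply: (iffLR (measurable_restrictT _ mA)).
  exact: measurable_funTS.
- by move=> v; rewrite patchE; case: ifP.
Qed.

Definition cube_shift_inv (z : Rd) := forall g : brow -> \bar R,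
  measurable_fun setT g -> (forall v, 0 <= g v)%E -> periodic_row g ->
  (\int[leb]_(u in cube) g ((u : Rd) + z)%R = \int[leb]_(u in cube) g u)%E.

(** Shifted by [t] along one axis, the cube sticks out on one side; the slice that leaves is brought
    back by one period. The cut is at [1 - t] before the shift and at [t] after it. *)
Lemma cube_shift_inv1 i (t : R) : 0 <= t < 1 -> cube_shift_inv (t *: delta_mx 0 i).
Proof.
move=> /andP[t0 t1] g mg g0 pg; set e : Rd := delta_mx 0 i.
have ej (c : R) (u : Rd) j : (u + c *: e) 0 j = u 0 j + (if j == i then c else 0).
  by rewrite !mxE eqxx/=; case: eqP => _; rewrite ?mulr1 ?mulr0.
pose H (A : set R) : set brow := [set u | A (u 0 i)].
have mH (A : set R) : measurable A -> measurable (H A) by exact: measurable_halfspace.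
have mgz : measurable_fun setT (fun u : brow => g ((u : Rd) + t *: e)).
  exact: (measurableT_comp mg (measurable_shift_row _)).
pose Hl (c : R) := H `]-oo, c[%classic; pose Hr (c : R) := H `[c, +oo[%classic.
have split_cube (c : R) (h : brow -> \bar R) : measurable_fun setT h -> (forall v, 0 <= h v)%E ->
    (\int[leb]_(u in cube) h u = \int[leb]_(u in cube `&` Hl c) h u
      + \int[leb]_(u in cube `&` Hr c) h u)%E.
  move=> mh h0; rewrite -ge0_integral_setU//=.
  - congr (integral _ _ _); rewrite -setIUr (_ : _ `|` _ = setT) ?setIT//.
    apply/seteqP; split=> // u _; rewrite /Hl/Hr/H/= !in_itv/= andbT.
    by case: (ltP (u 0 i) c); [left|right].
  - by apply: measurableI; [exact: measurable_cube|exact: mH].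
  - by apply: measurableI; [exact: measurable_cube|exact: mH].
  - exact: measurable_funTS.
  - apply/disj_setPS => u /= [[_]]; rewrite /Hl/Hr/H/= !in_itv/= andbT => h1 [_ h2].
    by move: h1; rewrite ltNge h2.
rewrite (split_cube (1 - t) _ mgz)// (split_cube t g mg g0) addeC; congr (_ + _)%E.
- rewrite -(@lebesgue_shift_set ((t - 1) *: e) (cube `&` Hl t)) //; last first.
    by apply: measurableI; [exact: measurable_cube|exact: mH].
  transitivity (\int[leb]_(v in cube `&` Hr (1 - t)%R) g ((v : Rd) + (t - 1) *: e)%R)%E.
    apply: eq_integral => u _; rewrite -[RHS](pg _ e).
      by rewrite -addrA scalerBl scale1r subrK.
    by apply/mxOverP => a b; rewrite mxE rpred_nat.
  congr (integral _ _ _); apply/seteqP; split=> u; rewrite /Hl/Hr/H/= !in_itv/= andbT.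
    move=> [hc hi]; split; last by rewrite ej eqxx; have := hc i; rewrite /= in_itv/=; lra.
    move=> j; rewrite ej; have := hc j; rewrite /= !in_itv/=.
    by case: eqP => [->|_]; [move: hi; rewrite /=; lra|lra].
  move=> [hc]; rewrite ej eqxx => hi; split; last first.
    by have := hc i; rewrite /= ej eqxx in_itv/=; lra.
  move=> j; have := hc j; rewrite /= ej !in_itv/=.
  by case: eqP => [->|_]; [move: hi; rewrite /=; lra|lra].
- rewrite -(@lebesgue_shift_set (t *: e) (cube `&` Hr t)) //; last first.
    by apply: measurableI; [exact: measurable_cube|exact: mH].
  congr (integral _ _ _); apply/seteqP; split=> u; rewrite /Hl/Hr/H/= !in_itv/= andbT.
    move=> [hc hi]; split; last by rewrite ej eqxx; have := hc i; rewrite /= in_itv/=; lra.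
    move=> j; rewrite ej; have := hc j; rewrite /= !in_itv/=.
    by case: eqP => [->|_]; [move: hi; rewrite /=; lra|lra].
  move=> [hc]; rewrite ej eqxx => hi; split; last first.
    by have := hc i; rewrite /= ej eqxx in_itv/=; lra.
  move=> j; have := hc j; rewrite /= ej !in_itv/=.
  by case: eqP => [->|_]; [move: hi; rewrite /=; lra|lra].
Qed.

Lemma cube_shift_invD z z' : cube_shift_inv z -> cube_shift_inv z' ->
  cube_shift_inv (z + z').
Proof.
move=> hz hz' g mg g0 pg; rewrite -(hz' g mg g0 pg).
rewrite -(hz (fun u => g ((u : Rd) + z'))) //.
- by apply: eq_integral => u _; rewrite addrA.
- exact: (measurableT_comp mg (measurable_shift_row _)).
- by move=> x m mint; rewrite addrAC pg.
Qed.

(** The vector is a sum of multiples of coordinate vectors; in each, periodicity absorbs the integer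
    part and [cube_shift_inv1] handles the fractional part. *)
Lemma cube_shift (z : Rd) : cube_shift_inv z.
Proof.
rewrite (row_sum_delta z).
elim/big_ind : _ => [g mg g0 pg|z1 z2|i _].
- by apply: eq_integral => u _; rewrite addr0.
- exact: cube_shift_invD.
set t := z 0 i; have /andP[t1 t2] := floor_itv t.
move=> g mg g0 pg; rewrite -(@cube_shift_inv1 i (t - (Num.floor t)%:~R) _ g)//; last first.
  by move: t2; rewrite intrD => ?; apply/andP; split; lra.
apply: eq_integral => u _.
rewrite -[in LHS](subrK (Num.floor t)%:~R t) scalerDl addrA pg//.
apply/mxOverP => a b; rewrite !mxE.
by rewrite rpredM ?intr_int ?rpred_nat.
Qed.

Lemma borel_fun_add2 (s : R) (x : Rd) :
  @borel_fun _ (brow * brow)%type Rd (fun z => x + s *: (z.1 : Rd) + z.2).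
Proof.
have h : @borel_fun _ (brow * brow)%type (Rd * Rd)%type (fun z => (z.1 : Rd, z.2 : Rd)).
  apply: (borel_fun_pair countable_base_row countable_base_row).
    exact: (borel_borel_fun measurable_fst).
  exact: (borel_borel_fun measurable_snd).
apply: (borel_fun_comp (h := fun z : Rd * Rd => x + s *: z.1 + z.2) _ h) => z.
have c1 : (fun z : Rd * Rd => s *: z.1) @ z --> s *: z.1.
  by apply: (@continuous_comp _ _ _ fst (fun v : Rd => s *: v)); [exact: cvg_fst|exact: scaler_continuous].
have c2 : (fun z : Rd * Rd => z.2) @ z --> z.2 by exact: cvg_snd.
exact: (cvgD (cvgD (cvg_cst x) c1) c2).
Qed.

Lemma eball_shift_cube (c w u : Rd) (r s : R) : eball c (r / 2) w -> cube u ->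
  0 < s -> 2 * Num.sqrt d%:R <= s * r -> eball c r (w + s^-1 *: u).
Proof.
move=> hw hu s0 sr; rewrite /eball/= addrAC; apply: enorm_half => //.
rewrite enormZ ?invr_ge0 ?(ltW s0)// ler_pdivrMl//.
apply: (@le_trans _ _ (Num.sqrt d%:R * 1)); last by lra.
apply: enorm_max => // i; have := hu i; rewrite /= in_itv/= => /andP[? ?].
by rewrite ger0_norm// ltW.
Qed.

Lemma scaler_shiftK (x w u : Rd) (s : R) : 0 < s ->
  x + s *: (w + s^-1 *: u) = x + s *: w + u.
Proof. by move=> s0; rewrite scalerDr scalerA divff ?gt_eqF// scale1r addrA. Qed.

(* Averaging first over a unit cube: a ball of radius r/2 translated by u/s with
   u in the cube stays in the ball of radius r as soon as sqrt d / s <= r / 2. *)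
Lemma ball_covers_torus (g : brow -> \bar R) (c x : Rd) (r s : R) :
  measurable_fun setT g -> (forall v, 0 <= g v)%E -> periodic_row g ->
  0 < s -> 2 * Num.sqrt d%:R <= s * r ->
  ((2 ^- d)%:E * leb (eball c r) * \int[leb]_(u in cube) g u <=
   \int[leb]_(w in eball c r) g (x + s *: (w : Rd))%R)%E.
Proof.
move=> mg g0 pg s0 sr.
have mB r' : measurable (eball c r' : set brow) by apply: open_borel; exact: eball_open.
have mC := measurable_cube.
rewrite -eball_half.
pose Bh : set brow := eball c (r / 2); pose Cb : set brow := cube.
pose F (z : brow * brow) := g (x + s *: (z.1 : Rd) + z.2).
have mF : measurable_fun setT F.
  by apply: (measurableT_comp mg); apply: borel_fun_borel; exact: borel_fun_add2.
pose G : brow * brow -> \bar R := F \_ (Bh `*` Cb).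
have mBC : measurable (Bh `*` Cb) by apply: measurableX => //; exact: mB.
have mG : measurable_fun setT G.
  by apply/(measurable_restrictT _ mBC); exact: measurable_funTS.
have G0 z : (0 <= G z)%E by rewrite /G patchE; case: ifP => // _; exact: g0.
have GE w u : G (w, u) = (if w \in Bh then if u \in Cb then F (w, u) else 0 else 0)%E.
  rewrite /G patchE; case: (boolP (w \in Bh)) => hw; case: (boolP (u \in Cb)) => hu;
    case: ifP => //; rewrite ?inE/= => h; exfalso; move: hw hu h; rewrite ?inE ?notin_setE => hw hu.
  - by move/negP; apply; rewrite inE.
  - by case.
  - by case.
  - by case.
have fub := @fubini_tonelli _ _ _ _ _ leb leb G mG G0.
(* For fixed [w] the cube average does not see the offset [x + s *: w], which produces the left-hand
   side. *)
have E1 : (\int[leb]_w \int[leb]_u G (w, u) = leb Bh * \int[leb]_(u in cube) g u)%E.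
  rewrite muleC -(integral_cst leb (mB (r / 2))).
  rewrite [RHS]integral_mkcond; apply: eq_integral => w _; rewrite patchE.
  case: ifP => hw; last by apply: integral0_eq => u _; rewrite GE hw.
  rewrite -(@cube_shift (x + s *: (w : Rd)) g mg g0 pg) [RHS]integral_mkcond.
  by apply: eq_integral => u _; rewrite GE hw patchE /F addrC.
rewrite -/Bh -E1 fub.
have mI : measurable_fun setT (fun w : brow => g (x + s *: (w : Rd))).
  have := measurableT_comp mg (measurable_affine s x).
  by apply: eq_measurable_fun => w _; rewrite /= /affine addrC.
pose I := (\int[leb]_(w in eball c r) g (x + s *: (w : Rd))%R)%E.
have I0 : (0 <= I)%E by apply: integral_ge0 => w _; exact: g0.
(* In the other order, for each fixed [u] the substitution of [w + s^-1 *: u] for [w] remains in the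
   larger ball, so the inner integral is at most [I]; the cube has measure 1. *)
apply: (@le_trans _ _ (\int[leb]_(u in cube) cst I u)%E); last first.
  suff -> : (\int[leb]_(u in cube) cst I u = I * leb cube)%E by rewrite lebesgue_cube mule1.
  exact: (integral_cst leb mC I).
rewrite [leRHS]integral_mkcond; apply: ge0_le_integral.
- exact: measurableT.
- by move=> u _; apply: integral_ge0 => w _; exact: G0.
- exact: (measurable_fun_fubini_tonelli_G (m1 := leb) G mG G0).
- by apply/(measurable_restrictT _ mC); exact: measurable_cst.
move=> u _; rewrite patchE; case: ifP => hu; last first.
  by rewrite (_ : integral _ _ _ = 0%E); [exact: lexx|apply: integral0_eq => w _; rewrite GE hu; case: ifP].
pose J : brow -> \bar R := (fun w : brow => g (x + s *: (w : Rd))) \_ (eball c r).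
have mJ : measurable_fun setT J.
  by apply/(measurable_restrictT _ (mB r)); exact: measurable_funTS.
have J0 w : (0 <= J w)%E by rewrite /J patchE; case: ifP.
have IE : I = (\int[leb]_w J w)%E by rewrite /I integral_mkcond.
have -> : cst I u = (\int[leb]_w J ((w : Rd) + s^-1 *: (u : Rd))%R)%E.
  by rewrite lebesgue_shift_ge0.
apply: ge0_le_integral.
- exact: measurableT.
- by move=> w _; exact: G0.
- exact: (measurableT_comp mG (@measurable_pair2 _ _ _ _ u)).
- exact: (measurableT_comp mJ (measurable_shift_row _)).
move=> w _; rewrite GE hu; case: ifP => hw; last by rewrite /J patchE; case: ifP.
have hB := eball_shift_cube (set_mem hw) (set_mem hu) s0 sr.
by rewrite /J patchE (mem_set hB) /F (scaler_shiftK _ _ _ s0) lexx.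
Qed.

End Cube.

(** * Sequential continuity and Scheffe's lemma *)

Section SequentialContinuity.
Context {R : realType} {E : normedModType R}.

(** Convergence theorems for integrals speak of sequences, so continuity in a parameter is tested
    along sequences, here confined to a neighbourhood on which the integrand is under control. *)
Lemma cvg_seq_near (f : E -> R) (a : E) (O : set E) : nbhs a O ->
  (forall u : nat -> E, (forall n, O (u n)) -> u n @[n --> \oo] --> a ->
     f (u n) @[n --> \oo] --> f a) ->
  f x @[x --> a] --> f a.
Proof.
move=> aO h; apply: contrapT => fa.
have [e e0 He] : exists2 e : R, 0 < e &
    forall n : nat, exists x, [/\ O x, `|a - x| < n.+1%:R^-1 & e <= `|f a - f x|].
  apply: contrapT => H; apply: fa; apply/cvgrPdist_lt => e e0.
  apply: contrapT => nf; apply: H; exists e => // n.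
  have n0 : 0 < n.+1%:R^-1 :> R by rewrite invr_gt0.
  apply: contrapT => /forallNP hn; apply: nf.
  have /cvgrPdist_lt/(_ _ n0) an : id @ nbhs a --> a by exact: cvg_id.
  near=> x; rewrite ltNge; apply/negP => ex; apply: (hn x).
  split; [by near: x|by near: x|exact: ex].
have /choice[u hu] := He.
have ua : u n @[n --> \oo] --> a.
  apply/cvgrPdist_lt => r r0; near=> n.
  have [_ un _] := hu n; apply: lt_le_trans un _.
  rewrite -[leRHS]invrK lef_pV2 ?posrE ?invr_gt0//.
  apply: (@le_trans _ _ n%:R); last by rewrite ler_nat.
  by near: n; exact: nbhs_infty_ger.
have /cvgrPdist_lt/(_ e e0)[N _ /(_ N (leqnn N))] := h u (fun n => let: And3 x _ _ := hu n in x) ua.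
by have [_ _] := hu N; rewrite /= leNgt => /negP.
Unshelve. all: by end_near. Qed.

End SequentialContinuity.

Section Scheffe.
Context {d} {T : measurableType d} {R : realType}.
Variable mu : {measure set T -> \bar R}.
Variable D : set T.
Hypothesis mD : measurable D.

Lemma integrable_density (r : T -> R) (c : R) : measurable_fun D r ->
  (forall x, D x -> 0 <= r x) -> (\int[mu]_(x in D) (r x)%:E = c%:E)%E ->
  mu.-integrable D (EFin \o r).
Proof.
move=> mr r0 ic; apply/integrableP; split; first exact/measurable_EFinP.
rewrite (_ : integral _ _ _ = c%:E) ?ltry// -ic; apply: eq_integral => x /set_mem Dx.
by rewrite /= ger0_norm// r0.
Qed.

Lemma integrable_densityM (r g : T -> R) (M : R) : measurable_fun D r ->
  mu.-integrable D (EFin \o r) -> measurable_fun D g ->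
  (forall x, D x -> `|g x| <= M) -> mu.-integrable D (EFin \o (fun x => r x * g x)).
Proof.
move=> mr ir mg gM.
apply: (@le_integrable _ _ _ mu D mD _ (EFin \o (fun x => M * r x))).
- by apply/measurable_EFinP; exact: measurable_funM.
- move=> x Dx; rewrite /= lee_fin !normrM mulrC ler_wpM2r//.
  by rewrite (le_trans (gM x Dx))// ler_norm.
- by apply: (@integrableZl _ _ _ mu D mD M (EFin \o r)).
Qed.

(** The [r_ n] have no common integrable bound, but the positive part h_n of r - r_n is dominated by
    r, so its integral tends to 0. It controls the whole difference: |r_n - r| = (r_n - r) + 2 h_n,
    and the two masses are equal. *)
Lemma scheffe_cvg (r_ g_ : nat -> T -> R) (r g : T -> R) (c M : R) :
  (forall n, measurable_fun D (r_ n)) -> (forall n x, D x -> 0 <= r_ n x) ->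
  (forall n, \int[mu]_(x in D) (r_ n x)%:E = c%:E)%E ->
  measurable_fun D r -> (forall x, D x -> 0 <= r x) ->
  (\int[mu]_(x in D) (r x)%:E = c%:E)%E ->
  (forall n, measurable_fun D (g_ n)) -> measurable_fun D g ->
  (forall n x, D x -> `|g_ n x| <= M) -> (forall x, D x -> `|g x| <= M) ->
  (forall x, D x -> r_ n x @[n --> \oo] --> r x) ->
  (forall x, D x -> g_ n x @[n --> \oo] --> g x) ->
  \int[mu]_(x in D) (r_ n x * g_ n x) @[n --> \oo] --> \int[mu]_(x in D) (r x * g x).
Proof.
move=> mr_ r_0 ir_ mr r0 ir mg_ mg g_M gM rr gg.
have Ir := integrable_density mr r0 ir.
have Ir_ n := integrable_density (mr_ n) (r_0 n) (ir_ n).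
pose h n x := Num.max 0 (r x - r_ n x).
have mh n : measurable_fun D (h n).
  by apply: measurable_maxr; [exact: measurable_cst|exact: measurable_funB].
have h0 n x : 0 <= h n x by rewrite le_max lexx.
have hr n x : D x -> h n x <= r x.
  by move=> Dx; rewrite ge_max r0//= gerBl r_0.
have Ih n : mu.-integrable D (EFin \o h n).
  apply: (le_integrable mD _ _ Ir); first exact/measurable_EFinP.
  by move=> x Dx; rewrite /= lee_fin ger0_norm// ger0_norm ?hr// r0.
have h_cvg : \int[mu]_(x in D) h n x @[n --> \oo] --> (0 : R).
  rewrite -(_ : \int[mu]_(x in D) (cst 0 x) = 0); last first.
    by rewrite Rintegral_cst// mul0r.
  apply: (Rintegral_dct mD mh (measurable_cst _) Ir).
    by move=> n x Dx; rewrite ger0_norm// hr.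
  move=> x Dx; rewrite /cst/=.
  apply/cvgrPdist_le => e e0; near=> n; rewrite sub0r normrN ger0_norm//.
  rewrite /h ge_max (ltW e0)/= (le_trans (ler_norm _))//.
  by near: n; apply: cvgr_dist_le (rr x Dx) _ e0.
have D1 n : `|\int[mu]_(x in D) (r_ n x * g_ n x) - \int[mu]_(x in D) (r x * g_ n x)|
    <= `|M| * (2 * \int[mu]_(x in D) h n x).
  have I1 := integrable_densityM (mr_ n) (Ir_ n) (mg_ n) (g_M n).
  have I2 := integrable_densityM mr Ir (mg_ n) (g_M n).
  rewrite -RintegralB//.
  have I3 := integrableB mD I1 I2.
  apply: le_trans (le_normr_Rintegral mD I3) _.
  have E : \int[mu]_(x in D) (r_ n x - r x + 2 * h n x) = 2 * \int[mu]_(x in D) h n x.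
    rewrite RintegralD//; last 2 first.
    - exact: (integrableB mD (Ir_ n) Ir).
    - exact: (@integrableZl _ _ _ mu D mD 2 (EFin \o h n) (Ih n)).
    rewrite RintegralB// RintegralZl// /Rintegral ir_ ir subrr add0r//.
  rewrite -E -RintegralZl//; last first.
    apply: (@integrableD _ _ _ mu D mD (EFin \o (fun x => r_ n x - r x)) (EFin \o (fun x => 2 * h n x))).
      exact: (integrableB mD (Ir_ n) Ir).
    exact: (@integrableZl _ _ _ mu D mD 2 (EFin \o h n) (Ih n)).
  apply: le_Rintegral => //.
  - exact: (integrable_norm I3).
  - apply: (@integrableZl _ _ _ mu D mD `|M| (EFin \o (fun x => r_ n x - r x + 2 * h n x))).
    apply: (@integrableD _ _ _ mu D mD (EFin \o (fun x => r_ n x - r x)) (EFin \o (fun x => 2 * h n x))).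
      exact: (integrableB mD (Ir_ n) Ir).
    exact: (@integrableZl _ _ _ mu D mD 2 (EFin \o h n) (Ih n)).
  move=> x Dx; rewrite -mulrBl normrM mulrC ler_pM//.
    by rewrite (le_trans (g_M n x Dx))// ler_norm.
  rewrite /h; have [hx|hx] := leP 0 (r x - r_ n x).
    by rewrite ler0_norm; lra.
  by rewrite ger0_norm; lra.
have D2 : \int[mu]_(x in D) (r x * g_ n x) @[n --> \oo] --> \int[mu]_(x in D) (r x * g x).
  apply: (@Rintegral_dct _ _ _ mu D (fun n x => r x * g_ n x) (fun x => r x * g x) (fun x => M * r x) mD).
  - by move=> n; exact: measurable_funM.
  - exact: measurable_funM.
  - exact: (@integrableZl _ _ _ mu D mD M (EFin \o r)).
  - by move=> n x Dx; rewrite normrM (ger0_norm (r0 x Dx)) mulrC ler_wpM2r ?r0 ?g_M.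
  - by move=> x Dx; apply: cvgM; [exact: cvg_cst|exact: gg].
rewrite -[X in _ --> X]add0r.
rewrite (_ : (fun n => _) = (fun n => (\int[mu]_(x in D) (r_ n x * g_ n x)
    - \int[mu]_(x in D) (r x * g_ n x)) + \int[mu]_(x in D) (r x * g_ n x))); last first.
  by apply/funext => n; rewrite subrK.
apply: cvgD D2.
have h2 : `|M| * (2 * \int[mu]_(x in D) h n x) @[n --> \oo] --> (0 : R).
  have := cvgM (cvg_cst `|M|) (cvgM (cvg_cst (2 : R)) h_cvg).
  by rewrite !mulr0; apply.
apply/cvgrPdist_le => e e0; near=> n; rewrite sub0r normrN (le_trans (D1 n))//.
rewrite (le_trans (ler_norm _))//.
near: n; have /cvgrPdist_le/(_ e e0) := h2.
by apply: filterS => n; rewrite sub0r normrN.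
Unshelve. all: by end_near. Qed.

End Scheffe.

(** * The free flow and the dual kernel *)

Section PhaseFunctions.
Context {R : realType} {d : nat}.
Local Notation Rd := 'rV[R]_d.
Local Notation Td := (torus R d).
Local Notation X := (Td * Rd)%type.
Local Notation phase := (borel (Td * Rd)%type).
Local Notation brow := (borel 'rV[R]_d).
Local Notation leb := (@lebesgue_row R d).
Variable V : set Rd.
Hypothesis oV : open V.
Local Notation PV := (phase_set V : set X).

Definition flow (s : R) (z : X) : X := (torus_translate z.1 (s *: z.2), z.2).

Lemma flowD s t z : flow s (flow t z) = flow (s + t) z.
Proof. by rewrite /flow /= torus_translateA -scalerDl addrC. Qed.

Lemma flow0 z : flow 0 z = z.
Proof. by case: z => x v; rewrite /flow/= scale0r torus_translate0. Qed.

Lemma flowNK s z : flow (- s) (flow s z) = z.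
Proof. by rewrite flowD addNr flow0. Qed.

Lemma flowKN s z : flow s (flow (- s) z) = z.
Proof. by rewrite flowD subrr flow0. Qed.

Lemma flow_continuous : continuous (fun y : R * X => flow y.1 y.2).
Proof.
move=> y.
have c1 : (fun y : R * X => y.2.2) @ y --> y.2.2.
  by apply: (@continuous_comp _ _ _ snd snd); exact: cvg_snd.
have c2 : (fun y : R * X => y.1 *: y.2.2) @ y --> y.1 *: y.2.2.
  by apply: cvgZ => //; exact: cvg_fst.
have c3 : (fun y : R * X => y.2.1) @ y --> y.2.1.
  by apply: (@continuous_comp _ _ _ snd fst); [exact: cvg_snd|exact: cvg_fst].
have c4 : (fun y : R * X => torus_translate y.2.1 (y.1 *: y.2.2)) @ y -->
    torus_translate y.2.1 (y.1 *: y.2.2).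
  apply: (@continuous_comp _ _ _ (fun y : R * X => (y.2.1, y.1 *: y.2.2))
    (fun w : Td * Rd => torus_translate w.1 w.2)); last exact: torus_translate_continuous.
  exact: (cvg_pair c3 c2).
exact: (cvg_pair c4 c1).
Qed.

Lemma flow_cont s : continuous (flow s).
Proof.
move=> z; apply: (@continuous_comp _ _ _ (fun z : X => (s, z)) (fun y : R * X => flow y.1 y.2));
  last exact: flow_continuous.
exact: (cvg_pair (cvg_cst s) (@cvg_id _ (nbhs z))).
Qed.

Lemma PV_open : open PV.
Proof.
have /continuousP/(_ _ oV) : continuous (@snd Td Rd) by move=> z; exact: cvg_snd.
by rewrite (_ : snd @^-1` V = PV)//; apply/seteqP; split=> z //= [].
Qed.

Lemma measurable_PV : measurable (PV : set phase).
Proof. by apply: open_borel; exact: PV_open. Qed.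

(** Time is a parameter of [g], so that one notion covers plain functions, their orbits under the
    flow and time-dependent dual functions. Points over [V] only are considered, since [p] is
    regular on V x V alone. *)
Definition jcontinuous (g : R -> X -> R) :=
  forall q z, PV z -> {for (q, z), continuous (fun y : R * X => g y.1 y.2)}.

Definition lift (g : R -> X -> R) (e : R * (Rd * Rd)) : R := g e.1 (torus_pi e.2.1, e.2.2).

Lemma openmap_lift :
  openmap (fun e : R * (Rd * Rd) => (e.1, (torus_pi e.2.1, e.2.2)) : R * X).
Proof. exact: (openmap_pair (@openmap_id R) (@openmap_torus_lift R d)). Qed.

Lemma lift_continuous :
  continuous (fun e : R * (Rd * Rd) => (e.1, (torus_pi e.2.1, e.2.2)) : R * X).
Proof.
move=> e.
have c : (fun e : R * (Rd * Rd) => (torus_pi e.2.1, e.2.2) : X) @ e --> (torus_pi e.2.1, e.2.2).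
  by apply: (@continuous_comp _ _ _ snd (fun z : Rd * Rd => (torus_pi z.1, z.2) : X));
    [exact: cvg_snd|exact: torus_lift_continuous].
have c1 : (fun e : R * (Rd * Rd) => e.1) @ e --> e.1 by exact: cvg_fst.
exact: (cvg_pair c1 c).
Qed.

Lemma jcontinuous_lift g : (forall e : R * (Rd * Rd), V e.2.2 -> {for e, continuous (lift g)}) -> jcontinuous g.
Proof.
move=> h q [x v] [_ /= Vv]; rewrite -(torus_reprK x).
exact: (openmap_cvg openmap_lift (h (q, (repr x, v)) Vv)).
Qed.

Lemma jcontinuous_unlift g e : jcontinuous g -> V e.2.2 -> {for e, continuous (lift g)}.
Proof.
move=> cg Vv; apply: (@continuous_comp _ _ _
  (fun e : R * (Rd * Rd) => (e.1, (torus_pi e.2.1, e.2.2)) : R * X) (fun y : R * X => g y.1 y.2)).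
  exact: lift_continuous.
exact: cg.
Qed.

Lemma jcontinuous_comp g (a : R -> R) (h : R -> X -> X) : jcontinuous g -> continuous a ->
  continuous (fun y : R * X => h y.1 y.2) -> (forall q z, PV z -> PV (h q z)) ->
  jcontinuous (fun q z => g (a q) (h q z)).
Proof.
move=> cg ca ch hP q z Pz.
apply: (@continuous_comp _ _ _ (fun y : R * X => (a y.1, h y.1 y.2)) (fun y : R * X => g y.1 y.2)).
  have c1 : {for (q, z), continuous (fun y : R * X => a y.1)}.
    by apply: (@continuous_comp _ _ _ fst a); [exact: cvg_fst|exact: ca].
  exact: (cvg_pair c1 (ch (q, z))).
by apply: cg; exact: hP.
Qed.

Lemma jcontinuousD g h : jcontinuous g -> jcontinuous h -> jcontinuous (fun q z => g q z + h q z).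
Proof. by move=> cg ch q z Pz; exact: (cvgD (cg q z Pz) (ch q z Pz)). Qed.

Lemma jcontinuousB g h : jcontinuous g -> jcontinuous h -> jcontinuous (fun q z => g q z - h q z).
Proof. by move=> cg ch q z Pz; exact: (cvgB (cg q z Pz) (ch q z Pz)). Qed.

Lemma jcontinuousM g h : jcontinuous g -> jcontinuous h -> jcontinuous (fun q z => g q z * h q z).
Proof. by move=> cg ch q z Pz; exact: (cvgM (cg q z Pz) (ch q z Pz)). Qed.

Lemma jcontinuous_cst c : jcontinuous (fun _ _ => c).
Proof. by move=> q z _; exact: cvg_cst. Qed.

Lemma jcontinuous_space f : {in PV, continuous f} -> jcontinuous (fun=> f).
Proof.
move=> cf q z Pz; apply: (@continuous_comp _ _ _ snd f); first exact: cvg_snd.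
by apply: cf; rewrite inE.
Qed.

Lemma jcontinuous_fix g q : jcontinuous g -> {in PV, continuous (g q)}.
Proof.
move=> cg z /set_mem Pz.
apply: (@continuous_comp _ _ _ (fun z : X => (q, z)) (fun y : R * X => g y.1 y.2)).
  exact: (cvg_pair (cvg_cst q) (@cvg_id _ (nbhs z))).
exact: cg.
Qed.

Lemma jcontinuous_fixz g z : jcontinuous g -> PV z -> continuous (g^~ z).
Proof.
move=> cg Pz q.
apply: (@continuous_comp _ _ _ (fun q : R => (q, z)) (fun y : R * X => g y.1 y.2)).
  exact: (cvg_pair (@cvg_id _ (nbhs q)) (cvg_cst z)).
exact: cg.
Qed.

Lemma borel_fun_idphase : @borel_fun _ phase X id.
Proof. by move=> U oU; exact: open_borel. Qed.

Lemma measurable_PVcont (f : phase -> R) : {in PV, continuous (f : X -> R)} ->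
  measurable_fun (PV : set phase) f.
Proof. by move=> cf; exact: (borel_fun_contfun PV_open cf borel_fun_idphase). Qed.

Lemma measurable_Vcont (f : brow -> R) : {in V, continuous (f : Rd -> R)} ->
  measurable_fun (V : set brow) f.
Proof. by move=> cf; exact: (borel_fun_contfun oV cf borel_fun_idrow). Qed.

Lemma measurable_V : measurable (V : set brow).
Proof. exact: open_borel. Qed.

Lemma borel_fun_Rphase : @borel_fun _ (R * phase)%type (R * X)%type id.
Proof.
have := @borel_fun_pair _ (R * phase)%type R X _ _ _ _ fst snd countable_base_R countable_base_X.
rewrite (_ : (fun t => _) = id); last by apply/funext => -[].
by apply; [apply: borel_fun_R; exact: measurable_fst|exact: (borel_borel_fun measurable_snd)].
Qed.

Lemma measurable_jcontinuous g : jcontinuous g ->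
  measurable_fun (setT `*` PV : set (R * phase)) (fun y => g y.1 y.2).
Proof.
move=> cg; apply: (@borel_fun_contfun _ (R * phase)%type R (R * X)%type (setT `*` PV) id (fun y => g y.1 y.2)).
- have /continuousP/(_ _ PV_open) : continuous (@snd R X) by move=> z; exact: cvg_snd.
  rewrite (_ : snd @^-1` _ = setT `*` PV)//.
  by apply/seteqP; split=> -[q z] //= [].
- by move=> [q z] /set_mem[_ Pz]; exact: cg.
- exact: borel_fun_Rphase.
Qed.


Variable p : Rd -> Rd -> R.
Hypothesis pk : transition_kernel V p.

(** The adjoint of the gain term, acting on observables: the outgoing velocity is integrated against
    p(., v). As p(., v) is a probability density this is a Markov operator, so signs and sup bounds
    pass through it. *)
Definition dual_kernel (f : X -> R) (z : X) : R := \int[leb]_(v' in V) (p v' z.2 * f (z.1, v')).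

Lemma kernel_continuous v' v : V v' -> V v -> {for (v', v), continuous (fun z : Rd * Rd => p z.1 z.2)}.
Proof.
move=> Vv' Vv; case: pk => -[dp _] _ _; apply: differentiable_continuous.
by apply: dp; rewrite inE.
Qed.

Lemma kernel_ge0 v' v : V v' -> V v -> 0 <= p v' v.
Proof. by case: pk => _ + _; apply. Qed.

Lemma kernel_int1 v : V v -> (\int[leb]_(v' in V) (p v' v)%:E = 1%:E)%E.
Proof. by case: pk => _ _; apply. Qed.

Lemma kernel_cont1 v : V v -> {in V, continuous (p^~ v)}.
Proof.
move=> Vv v' /set_mem Vv'.
apply: (@continuous_comp _ _ _ (fun w : Rd => (w, v)) (fun z : Rd * Rd => p z.1 z.2)).
  exact: (cvg_pair (@cvg_id _ (nbhs v')) (cvg_cst v)).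
exact: kernel_continuous.
Qed.

Lemma kernel_cont2 v' : V v' -> {in V, continuous (p v')}.
Proof.
move=> Vv' v /set_mem Vv.
apply: (@continuous_comp _ _ _ (fun w : Rd => (v', w)) (fun z : Rd * Rd => p z.1 z.2)).
  exact: (cvg_pair (cvg_cst v') (@cvg_id _ (nbhs v))).
exact: kernel_continuous.
Qed.

Lemma measurable_kernel1 v : V v -> measurable_fun (V : set brow) (p^~ v : brow -> R).
Proof. by move=> Vv; apply: measurable_Vcont; exact: kernel_cont1. Qed.

Lemma integrable_kernel v : V v -> leb.-integrable V (EFin \o (p^~ v : brow -> R)).
Proof.
move=> Vv; have p0 v' : V v' -> 0 <= p v' v by move=> Vv'; exact: kernel_ge0.
have := @integrable_density _ brow R leb V (p^~ v : brow -> R) 1.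
by move=> /(_ (measurable_kernel1 Vv) p0 (kernel_int1 Vv)).
Qed.

(** What [dual_kernel] needs of a bounded [f], and no more: it only integrates in the velocity, at
    fixed position. *)
Definition vmeasurable (f : X -> R) := forall x, measurable_fun (V : set brow) (fun v' : brow => f (x, v' : Rd)).

Lemma integrable_dual_kernel (f : X -> R) M z : PV z -> vmeasurable f -> (forall z, PV z -> `|f z| <= M) ->
  leb.-integrable V (EFin \o (fun v' : brow => p v' z.2 * f (z.1, v' : Rd))).
Proof.
move=> [_ Vz] mf fM; apply: (@integrable_densityM _ _ _ leb V measurable_V _ _ M).
- exact: measurable_kernel1.
- exact: integrable_kernel.
- exact: mf.
- by move=> v' Vv'; exact: fM.
Qed.

Lemma dual_kernelZ f M c z : PV z -> vmeasurable f -> (forall z, PV z -> `|f z| <= M) ->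
  dual_kernel (fun z => c * f z) z = c * dual_kernel f z.
Proof.
move=> Pz mf fM; rewrite /dual_kernel -RintegralZl; [|exact: measurable_V|exact: integrable_dual_kernel fM].
by apply: eq_Rintegral => v' _; rewrite mulrCA.
Qed.

Lemma dual_kernelD f g M M' z : PV z -> vmeasurable f -> vmeasurable g -> (forall z, PV z -> `|f z| <= M) ->
  (forall z, PV z -> `|g z| <= M') -> dual_kernel (fun z => f z + g z) z = dual_kernel f z + dual_kernel g z.
Proof.
move=> Pz mf mg fM gM; rewrite /dual_kernel -RintegralD;
  [|exact: measurable_V|exact: integrable_dual_kernel fM|exact: integrable_dual_kernel gM].
by apply: eq_Rintegral => v' _; rewrite mulrDr.
Qed.

Lemma dual_kernelB f g M M' z : PV z -> vmeasurable f -> vmeasurable g -> (forall z, PV z -> `|f z| <= M) ->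
  (forall z, PV z -> `|g z| <= M') -> dual_kernel (fun z => f z - g z) z = dual_kernel f z - dual_kernel g z.
Proof.
move=> Pz mf mg fM gM; rewrite /dual_kernel -RintegralB;
  [|exact: measurable_V|exact: integrable_dual_kernel fM|exact: integrable_dual_kernel gM].
by apply: eq_Rintegral => v' _; rewrite mulrBr.
Qed.

Lemma dual_kernel1 z : PV z -> dual_kernel (fun=> 1) z = 1.
Proof.
move=> [_ Vz]; rewrite /dual_kernel; under eq_Rintegral do rewrite mulr1.
by rewrite /Rintegral kernel_int1.
Qed.

Lemma dual_kernel_cst c z : PV z -> dual_kernel (fun=> c) z = c.
Proof.
move=> Pz; rewrite -[RHS]mulr1 -(dual_kernel1 Pz) -(@dual_kernelZ _ 1)//.
- by rewrite /dual_kernel; apply: eq_Rintegral => v' _; rewrite mulr1.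
- by move=> y _; rewrite normr1.
Qed.

Lemma le_dual_kernel f g M M' z : PV z -> vmeasurable f -> vmeasurable g -> (forall z, PV z -> `|f z| <= M) ->
  (forall z, PV z -> `|g z| <= M') -> (forall z, PV z -> f z <= g z) -> dual_kernel f z <= dual_kernel g z.
Proof.
move=> Pz mf mg fM gM fg; apply: le_Rintegral.
- exact: measurable_V.
- exact: integrable_dual_kernel fM.
- exact: integrable_dual_kernel gM.
by move=> v' Vv'; rewrite ler_wpM2l ?kernel_ge0//; [case: Pz|exact: fg].
Qed.

Lemma dual_kernel_ge0 f z : PV z -> (forall z, PV z -> 0 <= f z) -> 0 <= dual_kernel f z.
Proof.
move=> [_ Vz] f0; apply: Rintegral_ge0 => v' Vv'.
by rewrite mulr_ge0 ?kernel_ge0//; exact: f0.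
Qed.

Lemma eq_dual_kernel f g z : (forall z, PV z -> f z = g z) -> dual_kernel f z = dual_kernel g z.
Proof.
move=> fg; apply: eq_Rintegral => v' /set_mem Vv'.
by rewrite fg.
Qed.

Lemma dual_kernel_bnd f M z : PV z -> vmeasurable f -> (forall z, PV z -> `|f z| <= M) -> `|dual_kernel f z| <= M.
Proof.
move=> Pz mf fM; rewrite ler_norml.
have cM (c : R) : vmeasurable (fun=> c) by move=> x; exact: measurable_cst.
have bM (c : R) z' : PV z' -> `|c| <= `|c| by [].
apply/andP; split.
  rewrite -(dual_kernel_cst (- M) Pz); apply: (le_dual_kernel Pz (cM _) mf (bM _) fM).
  by move=> y Py; have := fM y Py; rewrite ler_norml => /andP[].
rewrite -(dual_kernel_cst M Pz); apply: (le_dual_kernel Pz mf (cM _) fM (bM _)).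
by move=> y Py; have := fM y Py; rewrite ler_norml => /andP[].
Qed.

Lemma vmeasurable_cont f : {in PV, continuous f} -> vmeasurable f.
Proof.
move=> cf x; apply: measurable_Vcont => v /set_mem Vv.
apply: (@continuous_comp _ _ _ (fun w : Rd => (x, w) : X) f).
  exact: (cvg_pair (cvg_cst x) (@cvg_id _ (nbhs v))).
by apply: cf; rewrite inE.
Qed.

(** As the incoming velocity moves, the densities p(., v) are only known to converge pointwise;
    their common mass 1 upgrades this through [scheffe_cvg]. *)
Lemma jcontinuous_dual_kernel g M : jcontinuous g -> (forall q z, PV z -> `|g q z| <= M) ->
  jcontinuous (fun q z => dual_kernel (g q) z).
Proof.
move=> cg gM; apply: jcontinuous_lift => e Ve.
have cs2 : continuous (fun e : R * (Rd * Rd) => e.2.2).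
  by move=> e'; apply: (@continuous_comp _ _ _ snd snd); exact: cvg_snd.
pose O : set (R * (Rd * Rd))%type := [set e | V e.2.2].
have oO : nbhs e O by apply: (cs2 e); exact: open_nbhs_nbhs.
apply: (@cvg_seq_near R (R * (Rd * Rd))%type _ e O oO) => u uO ue.
rewrite /lift /dual_kernel /=.
apply: (@scheffe_cvg _ _ _ leb V measurable_V (fun n v' => p v' (u n).2.2)
  (fun n v' => g (u n).1 (torus_pi (u n).2.1, v')) (p^~ e.2.2)
  (fun v' => g e.1 (torus_pi e.2.1, v')) 1 M).
- by move=> n; exact: measurable_kernel1 (uO n).
- by move=> n v' Vv'; exact: kernel_ge0 (uO n).
- by move=> n; exact: kernel_int1 (uO n).
- exact: measurable_kernel1.
- by move=> v' Vv'; exact: kernel_ge0.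
- exact: kernel_int1.
- by move=> n; exact: (vmeasurable_cont (jcontinuous_fix cg)).
- exact: (vmeasurable_cont (jcontinuous_fix cg)).
- by move=> n v' Vv'; exact: gM.
- by move=> v' Vv'; exact: gM.
- move=> v' Vv'; apply: (@cvg_comp _ _ _ (fun n => (u n).2.2) (p v') _ (nbhs e.2.2)).
    exact: (cvg_comp _ _ ue (cs2 e)).
  by apply: kernel_cont2 => //; rewrite inE.
- move=> v' Vv'.
  apply: (@cvg_comp _ _ _ u (fun e : R * (Rd * Rd) => g e.1 (torus_pi e.2.1, v')) _ (nbhs e)) => //.
  apply: (@continuous_comp _ _ _ (fun e : R * (Rd * Rd) => (e.1, (e.2.1, v')) : R * (Rd * Rd)) (lift g)).
    have c1 : (fun e : R * (Rd * Rd) => e.1) @ e --> e.1 by exact: cvg_fst.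
    have c2 : (fun e : R * (Rd * Rd) => e.2.1) @ e --> e.2.1.
      by apply: (@continuous_comp _ _ _ snd fst); [exact: cvg_snd|exact: cvg_fst].
    exact: (cvg_pair c1 (cvg_pair c2 (cvg_cst v'))).
  exact: jcontinuous_unlift.
Qed.

End PhaseFunctions.

Lemma FTC2_C1 {R : realType} (F f : R -> R) (a b : R) : a <= b ->
  (forall x : R, is_derive x (1 : R) F (f x)) -> continuous f ->
  \int[lebesgue_measure]_(x in `[a, b]) f x = F b - F a.
Proof.
rewrite le_eqVlt => /predU1P[->|ab] dF cf.
  by rewrite set_itv1 Rintegral_set1 subrr.
have cF : continuous F.
  by move=> x; apply: differentiable_continuous; apply/derivable1_diffP; case: (dF x).
rewrite /Rintegral (@continuous_FTC2 _ f F a b ab) //.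
- exact: continuous_subspaceT.
- split=> [x _| |]; first by case: (dF x).
    by apply: cvg_at_right_filter; exact: cF.
  by apply: cvg_at_left_filter; exact: cF.
- by move=> x _; rewrite derive1E; case: (dF x).
Qed.

(** * Weak solutions along the flow *)

Section WeakSolutions.
Context {R : realType} {d : nat}.
Local Notation Rd := 'rV[R]_d.
Local Notation Td := (torus R d).
Local Notation X := (Td * Rd)%type.
Local Notation phase := (borel (Td * Rd)%type).
Local Notation brow := (borel 'rV[R]_d).
Local Notation leb := (@lebesgue_row R d).
Variable V : set Rd.
Hypothesis oV : open V.
Variable p : Rd -> Rd -> R.
Hypothesis pk : transition_kernel V p.
Variable sigma : Td -> R.
Hypothesis csigma : continuous sigma.
Variable Sg : R.
Hypothesis sigma_itv : forall x, 0 <= sigma x <= Sg.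
Local Notation PV := (phase_set V : set X).
Local Notation K := (dual_kernel V p).

Definition bnd (f : X -> R) (M : R) := forall z, PV z -> `|f z| <= M.

Definition dual_coll (f : X -> R) (z : X) : R := sigma z.1 * (K f z - f z).

Lemma bnd_ge0 f M z : PV z -> bnd f M -> 0 <= M.
Proof. by move=> Pz fM; apply: le_trans (fM z Pz). Qed.

Lemma dual_coll_bnd f M z : PV z -> vmeasurable V f -> bnd f M -> `|dual_coll f z| <= 2 * Sg * M.
Proof.
move=> Pz mf fM; have /andP[s0 s1] := sigma_itv z.1.
have M0 := bnd_ge0 Pz fM.
rewrite normrM (ger0_norm s0) (mulrC 2) -mulrA ler_pM//.
rewrite (le_trans (ler_normB _ _))// mulr_natl mulr2n lerD//; last exact: fM.
exact: (dual_kernel_bnd oV pk Pz mf fM).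
Qed.

Lemma dual_collZ f M c z : PV z -> vmeasurable V f -> bnd f M -> dual_coll (fun z => c * f z) z = c * dual_coll f z.
Proof.
by move=> Pz mf fM; rewrite /dual_coll (dual_kernelZ oV pk _ Pz mf fM) -mulrBr mulrCA.
Qed.

Lemma dual_collD f g M M' z : PV z -> vmeasurable V f -> vmeasurable V g -> bnd f M -> bnd g M' ->
  dual_coll (fun z => f z + g z) z = dual_coll f z + dual_coll g z.
Proof.
move=> Pz mf mg fM gM; rewrite /dual_coll (dual_kernelD oV pk Pz mf mg fM gM) -mulrDr; congr (_ * _).
by rewrite opprD addrACA.
Qed.

Lemma dual_collB f g M M' z : PV z -> vmeasurable V f -> vmeasurable V g -> bnd f M -> bnd g M' ->
  dual_coll (fun z => f z - g z) z = dual_coll f z - dual_coll g z.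
Proof.
move=> Pz mf mg fM gM; rewrite /dual_coll (dual_kernelB oV pk Pz mf mg fM gM) -mulrBr; congr (_ * _).
by rewrite !opprD opprK addrACA.
Qed.

Lemma sigma_fst_cont : continuous (fun z : X => sigma z.1).
Proof. by move=> z; apply: (@continuous_comp _ _ _ fst sigma); [exact: cvg_fst|exact: csigma]. Qed.

Lemma jcontinuous_sigma : jcontinuous V (fun _ z => sigma z.1).
Proof. by apply: jcontinuous_space => z _; exact: sigma_fst_cont. Qed.

Lemma jcontinuous_dual_coll g M : jcontinuous V g -> (forall q, bnd (g q) M) -> jcontinuous V (fun q z => dual_coll (g q) z).
Proof.
move=> cg gM; apply: (jcontinuousM jcontinuous_sigma); apply: jcontinuousB => //.
exact: (jcontinuous_dual_kernel oV pk cg gM).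
Qed.

Lemma dual_coll_cont f M : {in PV, continuous f} -> bnd f M -> {in PV, continuous (dual_coll f)}.
Proof.
move=> cf fM; have := @jcontinuous_fix _ _ _ _ 0 (@jcontinuous_dual_coll (fun=> f) M (jcontinuous_space cf) (fun=> fM)).
exact.
Qed.

Lemma cont_flow (f : X -> R) q : {in PV, continuous f} -> {in PV, continuous (f \o flow q)}.
Proof.
move=> cf z /set_mem Pz; apply: continuous_comp; first exact: flow_cont.
by apply: cf; rewrite inE.
Qed.

(** The last clause quantifies over all C^1 parametrizations of (x, v), so that composing with the
    flow, in the variables (t, x, v), needs no chain rule for vector-valued maps. *)
Definition smooth_compact (psi : X -> R) :=
  [/\ continuous psi, (exists M, forall z, `|psi z| <= M),
    (exists KV, [/\ compact KV, KV `<=` V & forall z, psi z != 0 -> KV z.2]) &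
    forall (E : normedModType R) (x v : E -> Rd),
      (forall i, C1_on setT (fun e => x e 0 i)) ->
      (forall i, C1_on setT (fun e => v e 0 i)) ->
      C1_on setT (fun e => psi (torus_pi (x e), v e))].

(** The flow does not change velocities, so all transported functions vanish off the same compact
    set T^d x KV, on which joint continuity is uniform in the phase point. *)
Lemma smooth_compact_flow_supcont psi (q0 e : R) : smooth_compact psi -> 0 < e ->
  \forall q \near q0, forall z, `|psi (flow (- q) z) - psi (flow (- q0) z)| <= e.
Proof.
move=> [cpsi _ [KV [cKV KVV KV0]] _] e0.
have cK : compact (setT `*` KV : set X) by apply: compact_setX => //; exact: torus_compact.
have cF : continuous (fun y : R * X => psi (flow (- y.1) y.2)).
  move=> y; apply: (@continuous_comp _ _ _ (fun y : R * X => flow (- y.1) y.2) psi); last exact: cpsi.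
  apply: (@continuous_comp _ _ _ (fun y : R * X => (- y.1, y.2)) (fun y : R * X => flow y.1 y.2));
    last exact: flow_continuous.
  have c1 : (fun y : R * X => - y.1) @ y --> - y.1.
    by apply: cvgN; exact: cvg_fst.
  have c2 : (fun y : R * X => y.2) @ y --> y.2 by exact: cvg_snd.
  exact: (cvg_pair c1 c2).
have /compact_near_coveringP ncK := cK.
have H : \forall q \near q0, (setT `*` KV : set X) `<=`
    (fun z => `|psi (flow (- q) z) - psi (flow (- q0) z)| <= e).
  apply: (ncK R (nbhs q0) (fun q z => `|psi (flow (- q) z) - psi (flow (- q0) z)| <= e)).
  move=> z Kz.
  have e20 : 0 < e / 2 by rewrite divr_gt0.
  have /cvgrPdist_le/(_ _ e20) [[A B] /= [Aq Bz] AB] := cF (q0, z).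
  exists (B, A) => //= -[z' q] /= [Bz' Aq'].
  have h1 := AB (q, z') (conj Aq' Bz').
  have h2 := AB (q0, z') (conj (nbhs_singleton Aq) Bz').
  move: h1 h2 => /=; set a := psi _; set b := psi _; set c := psi (flow (- q0) z') => h1 h2.
  rewrite (_ : b - c = (a - c) - (a - b)); last by ring.
  by rewrite (le_trans (ler_normB _ _))// [leRHS]splitr lerD.
apply: filterS H => q H z.
have [Kz|nKz] := pselect (KV z.2); first by apply: H.
have zero s : psi (flow s z) = 0.
  by apply: contrapT => /eqP h; apply: nKz; exact: (KV0 (flow s z) h).
by rewrite !zero subrr normr0 ltW.
Qed.

Lemma smooth_compact_Cb psi : smooth_compact psi -> Cb V psi.
Proof.
move=> [cpsi [M pM] _ _]; split; first by move=> z _; exact: cpsi.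
by exists M => z _; exact: pM.
Qed.

Lemma Cb_flow f q : Cb V f -> Cb V (f \o flow q).
Proof.
move=> [cf [M fM]]; split; first exact: cont_flow.
by exists M => z Pz; exact: fM.
Qed.

Lemma Cb_dual_coll f : Cb V f -> Cb V (dual_coll f).
Proof.
move=> [cf [M fM]]; split; first exact: dual_coll_cont fM.
by exists (2 * Sg * M) => z Pz; apply: dual_coll_bnd => //; exact: vmeasurable_cont.
Qed.

Lemma Cb_vmeasurable f : Cb V f -> vmeasurable V f.
Proof. by move=> [cf _]; exact: vmeasurable_cont. Qed.

Lemma near0_within (f : R -> R) :
  (forall q0 : R, 0 <= q0 -> forall e : R, 0 < e -> \forall q \near q0, 0 <= q -> `|f q - f q0| <= e) ->
  {within `[0, +oo[, continuous f}.
Proof.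
move=> H; apply/subspace_continuousP => q0; rewrite /= in_itv/= andbT => q00.
apply/cvgrPdist_le => e e0; rewrite near_withinE.
apply: filterS (H q0 q00 e e0) => q h; rewrite /= in_itv/= andbT => q1.
by rewrite distrC h.
Qed.

Section Trajectory.
Variable mu : R -> probability phase R.
Hypothesis mu_prob : forall t, 0 <= t -> prob_on V (mu t).
Hypothesis mu_cont : forall phi : X -> R, Cb V phi ->
  {within `[0, +oo[, continuous (fun t => \int[mu t]_(z in PV) phi z)}.

Lemma mu_lty t : (mu t PV < +oo)%E.
Proof. by rewrite (le_lt_trans (probability_le1 _ (measurable_PV oV)))// ltry. Qed.

Lemma mu_fine t : 0 <= t -> fine (mu t PV) = 1.
Proof. by move=> t0; rewrite (mu_prob t0). Qed.

Lemma mu_integrable t f M : measurable_fun (PV : set phase) f -> bnd f M ->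
  (mu t).-integrable (PV : set phase) (EFin \o f).
Proof. by move=> mf fM; apply: (integrable_bnd (measurable_PV oV) (mu_lty t) mf fM). Qed.

Lemma Cb_measurable f : Cb V f -> measurable_fun (PV : set phase) (f : phase -> R).
Proof. by move=> [cf _]; exact: measurable_PVcont. Qed.

Lemma Cb_integrable t f : Cb V f -> (mu t).-integrable (PV : set phase) (EFin \o f).
Proof. by move=> Cf; have [_ [M fM]] := Cf; apply: (mu_integrable t (Cb_measurable Cf) fM). Qed.

Lemma mu_bnd t f M : 0 <= t -> measurable_fun (PV : set phase) f -> bnd f M ->
  `|\int[mu t]_(z in PV) f z| <= M.
Proof.
move=> t0 mf fM; rewrite -[leRHS]mulr1 -(mu_fine t0).
exact: (Rintegral_bnd (measurable_PV oV) (mu_lty t) mf fM).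
Qed.

Lemma mu_supcont (phi : R -> X -> R) (q0 : R) : 0 <= q0 -> (forall q, Cb V (phi q)) ->
  (forall e, 0 < e -> \forall q \near q0, bnd (fun z => phi q z - phi q0 z) e) ->
  forall e, 0 < e -> \forall q \near q0, 0 <= q ->
    `|\int[mu q]_(z in PV) phi q z - \int[mu q0]_(z in PV) phi q0 z| <= e.
Proof.
move=> q00 Cphi sup e e0.
have e20 : 0 < e / 2 by rewrite divr_gt0.
have /subspace_continuousP/(_ q0) := mu_cont (Cphi q0).
rewrite /= in_itv/= andbT => /(_ q00)/cvgrPdist_le/(_ _ e20).
rewrite near_withinE => H1.
have H2 := sup _ e20.
near=> q => q_ge0.
have h1 : `|\int[mu q0]_(z in PV) phi q0 z - \int[mu q]_(z in PV) phi q0 z| <= e / 2.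
  by move: q_ge0; near: q; apply: filterS H1 => q; rewrite /= in_itv/= andbT.
have h2 : bnd (fun z => phi q z - phi q0 z) (e / 2) by near: q.
have mf : measurable_fun (PV : set phase) (fun z : phase => phi q z - phi q0 z).
  by apply: measurable_funB; exact: Cb_measurable.
have := mu_bnd q_ge0 mf h2.
rewrite (RintegralB (measurable_PV oV) (Cb_integrable q (Cphi q)) (Cb_integrable q (Cphi q0))).
move: h1; set a := \int[_]_(_ in _) _; set b := \int[_]_(_ in _) _; set c := \int[_]_(_ in _) _.
move=> h1 h3; rewrite (_ : c - a = (c - b) - (a - b)); last by ring.
by rewrite (le_trans (ler_normB _ _))// [leRHS]splitr lerD.
Unshelve. all: by end_near. Qed.

(* Transporting [f] along the flow removes the transport term: [mt r f] has derivative [bt r f] in [r]. *)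
Definition mt (r : R) (f : X -> R) : R := \int[mu r]_(z in PV) f (flow (- r) z).
Definition bt (r : R) (f : X -> R) : R := \int[mu r]_(z in PV) dual_coll (f \o flow (- r)) z.

Lemma smooth_compact_mt_near psi (q0 : R) : smooth_compact psi -> 0 <= q0 -> forall e : R, 0 < e ->
  \forall q \near q0, 0 <= q -> `|mt q psi - mt q0 psi| <= e.
Proof.
move=> Spsi q00; apply: (@mu_supcont (fun q => psi \o flow (- q))) => //.
  by move=> q; apply: Cb_flow; exact: smooth_compact_Cb.
by move=> e e0; apply: filterS (smooth_compact_flow_supcont q0 Spsi e0) => q h z _; exact: h.
Qed.

Lemma smooth_compact_bt_near psi (q0 : R) : smooth_compact psi -> 0 <= q0 -> forall e : R, 0 < e ->
  \forall q \near q0, 0 <= q -> `|bt q psi - bt q0 psi| <= e.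
Proof.
move=> Spsi q00; have Cp q : Cb V (psi \o flow (- q)) by apply: Cb_flow; exact: smooth_compact_Cb.
apply: (@mu_supcont (fun q => dual_coll (psi \o flow (- q)))) => //.
  by move=> q; exact: Cb_dual_coll.
move=> e e0.
have S0 : 0 <= Sg by have /andP[/le_trans] := sigma_itv point; apply.
(* The collision operator multiplies sup bounds by at most [2 * Sg]; the added 1 keeps the divisor
   positive. *)
have e'0 : 0 < e / (2 * Sg + 1) by rewrite divr_gt0// ltr_wpDl// mulr_ge0.
apply: filterS (smooth_compact_flow_supcont q0 Spsi e'0) => q h z Pz.
have [_ [M1 b1]] := Cp q; have [_ [M2 b2]] := Cp q0.
rewrite -(dual_collB Pz (Cb_vmeasurable (Cp q)) (Cb_vmeasurable (Cp q0)) b1 b2).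
have b3 : bnd (fun z => (psi \o flow (- q)) z - (psi \o flow (- q0)) z) (e / (2 * Sg + 1)).
  by move=> z' _; exact: h.
have vm : vmeasurable V (fun z => (psi \o flow (- q)) z - (psi \o flow (- q0)) z).
  by move=> x; apply: measurable_funB; exact: Cb_vmeasurable.
apply: (le_trans (dual_coll_bnd Pz vm b3)).
rewrite mulrA ler_pdivrMr ?ltr_wpDl ?mulr_ge0// mulrC ler_wpM2l ?(ltW e0)//.
by rewrite lerDl.
Qed.


Lemma flow_pi s x v : flow s (torus_pi x, v) = (torus_pi (x + s *: v), v) :> X.
Proof. by rewrite /flow/= torus_translate_pi. Qed.

Lemma C1_idR : C1_on setT (fun r : R => r).
Proof. by apply: C1_lin => [c x y|x]; [|exact: cvg_id]. Qed.

Lemma smooth_compact_line psi (z : X) : smooth_compact psi -> C1_on setT (fun r : R => psi (flow r z)).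
Proof.
case: z => x v [_ _ _ C].
rewrite (_ : (fun r => _) = (fun r : R => psi (torus_pi (repr x + r *: v), v))).
  apply: (C R (fun r => repr x + r *: v) (fun=> v)) => i; last exact: C1_cst.
  rewrite (_ : (fun e => _) = (fun=> repr x 0 i) \+ ((fun r : R => r) \* (fun=> v 0 i))).
    by apply: C1D; [exact: C1_cst|apply: C1M; [exact: C1_idR|exact: C1_cst]].
  by apply/funext => r; rewrite !mxE.
by apply/funext => r; rewrite -flow_pi torus_reprK.
Qed.

(** * Test functions carried by the flow, with a cutoff in time *)

Section CutOff.
Variables (chi chi' : R -> R).
Hypothesis dchi : forall t : R, is_derive t (1 : R) chi (chi' t).
Hypothesis cchi' : continuous chi'.
Variable psi : X -> R.
Hypothesis Spsi : smooth_compact psi.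

Let phi (t : R) (x : Td) (v : Rd) : R := chi t * psi (flow (- t) (x, v)).

(** Velocities are preserved and [chi] vanishes from [S'] on, so the support lies in [0, S'] x T^d x
    KV; the strict inequality between [S'] and [S] fits this closed interval into the half-open
    one. *)
Lemma cutoff_test (S' S : R) : 0 < S' -> S' < S -> (forall t, S' <= t -> chi t = 0) ->
  test_function V S phi.
Proof.
move=> S'0 S'S chi0; split.
  rewrite (_ : (fun z => _) = (fun z : R * Rd * Rd => chi z.1.1) \*
      (fun z : R * Rd * Rd => psi (torus_pi (z.1.2 + (- z.1.1) *: z.2), z.2))); last first.
    by apply/funext => z; rewrite /phi flow_pi.
  have C11 : C1_on setT (fun z : R * Rd * Rd => z.1.1).
    by apply: C1_lin => // z; apply: (@continuous_comp _ _ _ fst fst); exact: cvg_fst.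
  have C12 i : C1_on setT (fun z : R * Rd * Rd => z.1.2 0 i).
    apply: C1_lin => [c x y|z]; first by rewrite /= !mxE.
    apply: (@continuous_comp _ _ _ (fun z : R * Rd * Rd => z.1.2) (fun w : Rd => w 0 i));
      last exact: coord_continuous.
    by apply: (@continuous_comp _ _ _ fst snd); [exact: cvg_fst|exact: cvg_snd].
  have C2 i : C1_on setT (fun z : R * Rd * Rd => z.2 0 i).
    apply: C1_lin => [c x y|z]; first by rewrite /= !mxE.
    apply: (@continuous_comp _ _ _ snd (fun w : Rd => w 0 i)); first exact: cvg_snd.
    exact: coord_continuous.
  apply: C1M; first exact: (C1_comp C11 dchi cchi').
  case: Spsi => _ _ _ C; apply: (C _ (fun z : R * Rd * Rd => z.1.2 + (- z.1.1) *: z.2) snd); last exact: C2.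
  move=> i.
  rewrite (_ : (fun e => _) = (fun z : R * Rd * Rd => z.1.2 0 i) \+
      ((fun=> -1) \* ((fun z : R * Rd * Rd => z.1.1) \* (fun z : R * Rd * Rd => z.2 0 i)))).
    exact: (C1D (C12 i) (C1M (C1_cst _ (-1)) (C1M C11 (C2 i)))).
  by apply/funext => z; rewrite !mxE /= mulN1r mulNr.
case: Spsi => _ _ [KV [cKV KVV KV0]] _.
exists ((`[0, S'] `*` setT) `*` KV); split.
- apply: compact_setX => //; apply: compact_setX; first exact: segment_compact.
  exact: torus_compact.
- move=> [[t x] v] [[/= tS _] Kv]; split; last exact: KVV.
  by split=> //=; move: tS; rewrite !in_itv/= => /andP[-> /le_lt_trans]; apply.
- move=> t x v t0; rewrite /phi mulf_eq0 negb_or => /andP[ct pt].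
  split; last exact: (KV0 _ pt).
  split=> //=; rewrite in_itv/= t0/=.
  by rewrite leNgt; apply/negP => /ltW /chi0 h; rewrite h eqxx in ct.
Qed.

(** The factor [psi (flow (- t) (x, v))] is constant along characteristics, so its time derivative
    and its transport term cancel, and only the derivative of [chi] survives. *)
Lemma cutoff_transport t x v :
  time_derivative phi t x v + transport phi t x v = chi' t * psi (flow (- t) (x, v)).
Proof.
pose k (r : R) := psi (flow r (x, v)).
have dk (r : R) : is_derive r (1 : R) k (derive1 k r) by apply: C1_derive; exact: smooth_compact_line.
have E1 : time_derivative phi t x v = chi t * (derive1 k (- t) * -1) + k (- t) * chi' t.
  rewrite /time_derivative derive1E.
  have dN : is_derive t (1 : R) (-%R) (-1 : R).
    by have := is_deriveN (is_derive_id t (1 : R)).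
  have dkN := is_derive1_comp (dk (- t)) dN.
  have [_ h] := is_deriveM (dchi t) dkN; exact: h.
have E2 : transport phi t x v = chi t * derive1 k (- t).
  rewrite /transport derive1E.
  have dS : is_derive (0 : R) (1 : R) (fun s : R => s - t) 1.
    have := is_deriveB (is_derive_id (0 : R) (1 : R)) (is_derive_cst t (0 : R) (1 : R)).
    by rewrite subr0.
  have dk0 : is_derive (0 - t) (1 : R) k (derive1 k (- t)) by rewrite -[X in derive1 k X](sub0r t); exact: dk.
  have dkS := @is_derive1_comp _ k (fun s : R => s - t) 0 _ _ dk0 dS.
  have [_] := is_deriveM (is_derive_cst (chi t) (0 : R) (1 : R)) dkS.
  rewrite (_ : _ * _ = fun s : R => phi t (torus_translate x (s *: v)) v).
    by move=> ->; rewrite /GRing.scale/= mulr0 addr0 mulr1.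
  apply/funext => s; rewrite /phi /k /=.
  rewrite (_ : (torus_translate x (s *: v), v) = flow s (x, v))// flowD.
  by rewrite addrC.
by rewrite E1 E2 /k; ring.
Qed.

Lemma cutoff_collision t x v : V v ->
  sigma x * dual_collision V p phi t x v = chi t * dual_coll (psi \o flow (- t)) (x, v).
Proof.
move=> Vv; have Cp : Cb V (psi \o flow (- t)) by apply: Cb_flow; exact: smooth_compact_Cb.
have [_ [M pM]] := Cp.
rewrite -(dual_collZ (chi t) (z := (x, v)) _ (Cb_vmeasurable Cp) pM)//.
Qed.

Hypothesis mu_weak : forall (S : R) (phi : R -> Td -> Rd -> R), 0 < S ->
  test_function V S phi ->
  \int[lebesgue_measure]_(t in `[0, S])
    (\int[mu t]_(z in PV)
      (time_derivative phi t z.1 z.2 + transport phi t z.1 z.2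
       + sigma z.1 * dual_collision V p phi t z.1 z.2))
  = - \int[mu 0]_(z in PV) phi 0 z.1 z.2.

Lemma cutoff_weak (S' S : R) : 0 < S' -> S' < S -> (forall t, S' <= t -> chi t = 0) ->
  \int[lebesgue_measure]_(t in `[0, S]) (chi' t * mt t psi + chi t * bt t psi)
  = - (chi 0 * mt 0 psi).
Proof.
move=> S'0 S'S chi0; have := mu_weak (lt_trans S'0 S'S) (cutoff_test S'0 S'S chi0).
have Cp t : Cb V (psi \o flow (- t)) by apply: Cb_flow; exact: smooth_compact_Cb.
rewrite (_ : \int[mu 0]_(z in PV) _ = chi 0 * mt 0 psi); last first.
  rewrite /mt -RintegralZl; [|exact: measurable_PV|exact: Cb_integrable (Cp 0)].
  by apply: eq_Rintegral => -[x v].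
move=> <-; apply: eq_Rintegral => t _.
rewrite /mt /bt -RintegralZl; [|exact: measurable_PV|exact: Cb_integrable (Cp t)].
rewrite -RintegralZl; [|exact: measurable_PV|exact: Cb_integrable (Cb_dual_coll (Cp t))].
rewrite -RintegralD.
- apply: eq_Rintegral => -[x v] /set_mem[_ Vv] /=.
  by rewrite cutoff_transport cutoff_collision.
- exact: measurable_PV.
- apply: (@integrableZl _ _ _ (mu t) _ (measurable_PV oV) (chi' t) (EFin \o (psi \o flow (- t)))).
  exact: Cb_integrable (Cp t).
- apply: (@integrableZl _ _ _ (mu t) _ (measurable_PV oV) (chi t) (EFin \o (dual_coll (psi \o flow (- t))))).
  exact: Cb_integrable (Cb_dual_coll (Cp t)).
Qed.

End CutOff.

End Trajectory.

(** A C^1 approximation of the indicator of t <= t0 that reaches 0 at [t0 + n.+1%:R^-1]. The inner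
    [sqp] smooths the departure from 1, the outer one the arrival at 0. *)
Definition cut (t0 : R) (n : nat) (t : R) : R := sqp (1 - sqp (n.+1%:R * (t - t0))).
Definition dcut (t0 : R) (n : nat) (t : R) : R :=
  2 * Num.max 0 (1 - sqp (n.+1%:R * (t - t0))) * (- (2 * Num.max 0 (n.+1%:R * (t - t0)) * n.+1%:R)).

Lemma max0_continuous : continuous (fun y : R => Num.max 0 y).
Proof.
by move=> y; apply: (@continuous_max R R (cst 0) id); [exact: cvg_cst|exact: cvg_id].
Qed.

Lemma sqp_continuous : continuous (@sqp R).
Proof.
move=> y; apply: differentiable_continuous; apply/derivable1_diffP.
by case: (is_derive_sqp y).
Qed.

Lemma is_derive_cut (t0 : R) n (t : R) : is_derive t (1 : R) (cut t0 n) (dcut t0 n t).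
Proof.
have d1 : is_derive t (1 : R) (fun t : R => n.+1%:R * (t - t0)) n.+1%:R.
  apply: is_derive_eq; rewrite /GRing.scale/=; ring.
have d2 := @is_derive1_comp _ (@sqp R) (fun t : R => n.+1%:R * (t - t0)) t _ _ (is_derive_sqp (n.+1%:R * (t - t0))) d1.
have d3 := is_deriveB (is_derive_cst (1 : R) t (1 : R)) d2.
have d4 := @is_derive1_comp _ (@sqp R) (fun t : R => 1 - sqp (n.+1%:R * (t - t0))) t _ _ (is_derive_sqp (1 - sqp (n.+1%:R * (t - t0)))) d3.
by move: d4; rewrite sub0r.
Qed.

Lemma dcut_continuous (t0 : R) n : continuous (dcut t0 n).
Proof.
have c1 : continuous (fun t : R => n.+1%:R * (t - t0)).
  by move=> t; apply: cvgM; [exact: cvg_cst|apply: cvgB; [exact: cvg_id|exact: cvg_cst]].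
have c2 : continuous (fun t : R => Num.max 0 (n.+1%:R * (t - t0))).
  by move=> t; apply: (@continuous_comp _ _ _ (fun t : R => n.+1%:R * (t - t0)) (fun y : R => Num.max 0 y));
    [exact: c1|exact: max0_continuous].
have c3 : continuous (fun t : R => Num.max 0 (1 - sqp (n.+1%:R * (t - t0)))).
  move=> t; apply: (@continuous_comp _ _ _ (fun t : R => 1 - sqp (n.+1%:R * (t - t0))) (fun y : R => Num.max 0 y));
    last exact: max0_continuous.
  apply: cvgB; first exact: cvg_cst.
  by apply: (@continuous_comp _ _ _ (fun t : R => n.+1%:R * (t - t0)) (@sqp R)); [exact: c1|exact: sqp_continuous].
move=> t; apply: cvgM; first by apply: cvgM; [exact: cvg_cst|exact: c3].
apply: cvgN; apply: cvgM; last exact: cvg_cst.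
by apply: cvgM; [exact: cvg_cst|exact: c2].
Qed.

(** A constant sign together with total mass -1 makes [dcut] behave, in the limit, like minus a
    Dirac mass at [t0]. *)
Lemma dcut_le0 (t0 : R) n (t : R) : dcut t0 n t <= 0.
Proof. by rewrite /dcut mulrN oppr_le0 !mulr_ge0// le_max lexx. Qed.

Lemma sqp_neg (u : R) : u <= 0 -> sqp u = 0.
Proof. by move=> u0; rewrite /sqp max_l// expr0n. Qed.

Lemma cut1 (t0 : R) n (t : R) : t <= t0 -> cut t0 n t = 1.
Proof.
move=> tt; rewrite /cut (sqp_neg (u := n.+1%:R * _)) ?mulr_ge0_le0 ?subr_le0//.
by rewrite subr0 /sqp max_r// expr1n.
Qed.

Lemma cut0 (t0 : R) n (t : R) : t0 + n.+1%:R^-1 <= t -> cut t0 n t = 0.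
Proof.
move=> tt; apply: sqp_neg; rewrite subr_le0.
have h : 1 <= n.+1%:R * (t - t0) by rewrite -ler_pdivrMl// mulr1 lerBrDl.
by rewrite /sqp max_r ?expr_ge1// (le_trans ler01).
Qed.

Lemma dcut0 (t0 : R) n (t : R) : t <= t0 \/ t0 + n.+1%:R^-1 <= t -> dcut t0 n t = 0.
Proof.
case=> tt.
  by rewrite /dcut (max_l (y := n.+1%:R * _)) ?mulr_ge0_le0 ?subr_le0// mulr0 mul0r oppr0 mulr0.
have h : 1 <= n.+1%:R * (t - t0) by rewrite -ler_pdivrMl// mulr1 lerBrDl.
rewrite /dcut [Num.max 0 (1 - _)]max_l ?mulr0 ?mul0r//.
by rewrite subr_le0 /sqp max_r ?expr_ge1// (le_trans ler01).
Qed.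

Lemma cut_itv (t0 : R) n (t : R) : 0 <= cut t0 n t <= 1.
Proof. by rewrite sqp_ge0/= sqp_le1// gerBl sqp_ge0. Qed.

Definition mv_weak (mu : R -> probability phase R) := forall (S : R) (phi : R -> Td -> Rd -> R), 0 < S ->
  test_function V S phi ->
  \int[lebesgue_measure]_(t in `[0, S])
    (\int[mu t]_(z in PV)
      (time_derivative phi t z.1 z.2 + transport phi t z.1 z.2
       + sigma z.1 * dual_collision V p phi t z.1 z.2))
  = - \int[mu 0]_(z in PV) phi 0 z.1 z.2.

End WeakSolutions.

Lemma measurable_along {e1 e2 e3} {U1 : measurableType e1} {U2 : measurableType e2}
    {U3 : measurableType e3} (D : set U1) (F : set U2) (f : U1 -> U2) (g : U2 -> U3) :
  measurable F -> (forall x, D x -> F (f x)) -> measurable_fun F g -> measurable_fun D f ->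
  measurable_fun D (fun x => g (f x)).
Proof. by move=> mF DF mg mf; apply: (measurable_comp mF _ mg mf) => _ [x Dx <-]; exact: DF. Qed.

(** * Joint measurability *)

Section FubiniBounded.
Context {d1 d2} {T1 : measurableType d1} {T2 : measurableType d2} {R : realType}.

Lemma measurable_Rintegral2 (m2 : {sigma_finite_measure set T2 -> \bar R})
    (D1 : set T1) (D2 : set T2) (f : T1 * T2 -> R) :
  measurable D1 -> measurable D2 -> measurable_fun (D1 `*` D2) f ->
  (forall x y, D1 x -> D2 y -> 0 <= f (x, y)) ->
  measurable_fun D1 (fun x => \int[m2]_(y in D2) f (x, y)).
Proof.
move=> mD1 mD2 mf f0; have mD := measurableX mD1 mD2.
pose F : T1 * T2 -> \bar R := EFin \o (f \_ (D1 `*` D2)).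
have mF : measurable_fun setT F.
  by apply/measurable_EFinP; apply/(measurable_restrictT _ mD).
have F0 z : (0 <= F z)%E.
  rewrite /F/= patchE lee_fin; case: ifPn => //; rewrite inE; case: z => x y [/= D1x D2y].
  exact: f0.
have mI : measurable_fun setT (fubini_F m2 F) by exact: measurable_fun_fubini_tonelli_F.
apply: (@eq_measurable_fun _ _ _ _ _ (fine \o fubini_F m2 F)).
  move=> x; rewrite inE => D1x; rewrite /= /fubini_F /Rintegral; congr fine; rewrite [RHS]integral_mkcond.
  apply: eq_integral => y _; rewrite /F /= !patchE !in_setX mem_set//=.
  by case: ifP.
apply: measurable_funTS; apply: (measurableT_comp _ mI); exact: fine_measurable.
Qed.

Section Bounded.
Variables (D1 : set T1) (D2 : set T2) (f : T1 * T2 -> R) (M : R).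
Hypotheses (mD1 : measurable D1) (mD2 : measurable D2).
Hypothesis mf : measurable_fun (D1 `*` D2) f.
Hypothesis fM : forall x y, D1 x -> D2 y -> `|f (x, y)| <= M.

Lemma measurable_section1 x : D1 x -> measurable_fun D2 (fun y => f (x, y)).
Proof.
move=> D1x; apply: (measurable_along (F := D1 `*` D2) (g := f) (f := pair x)).
- exact: measurableX.
- by move=> y D2y.
- exact: mf.
- exact: measurable_funTS.
Qed.

Lemma measurable_section2 y : D2 y -> measurable_fun D1 (fun x => f (x, y)).
Proof.
move=> D2y; apply: (measurable_along (F := D1 `*` D2) (g := f) (f := pair^~ y)).
- exact: measurableX.
- by move=> x D1x.
- exact: mf.
- exact: measurable_funTS.
Qed.

Variable m2 : {sigma_finite_measure set T2 -> \bar R}.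
Hypothesis fin2 : (m2 D2 < +oo)%E.

(** Tonelli requires a sign: the integrand is raised by [M], and the constant this adds, finite by
    [fin2], is taken off afterwards. *)
Lemma measurable_Rintegral_bnd : measurable_fun D1 (fun x => \int[m2]_(y in D2) f (x, y)).
Proof.
apply: (@eq_measurable_fun _ _ _ _ _
    (fun x => \int[m2]_(y in D2) (f (x, y) + M) - M * fine (m2 D2))).
  move=> x; rewrite inE => D1x; rewrite RintegralD//.
  - by rewrite Rintegral_cst// addrK.
  - apply: (@integrable_bnd _ _ _ _ _ _ M) => //; first exact: measurable_section1.
    by move=> y D2y; exact: fM.
  - by apply: (@integrable_bnd _ _ _ _ _ _ `|M|).
apply: measurable_funB; last exact: measurable_cst.
apply: (@measurable_Rintegral2 m2 D1 D2 (fun z => f z + M)) => //.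
  by apply: measurable_funD => //; exact: measurable_cst.
by move=> x y D1x D2y; have := fM D1x D2y; rewrite ler_norml => /andP[h _]; lra.
Qed.

End Bounded.

End FubiniBounded.

Section FubiniSwap.
Context {d1 d2} {T1 : measurableType d1} {T2 : measurableType d2} {R : realType}.

Lemma measurable_Rintegral_bnd2 (m1 : {sigma_finite_measure set T1 -> \bar R})
    (D1 : set T1) (D2 : set T2) (f : T1 * T2 -> R) (M : R) :
  measurable D1 -> measurable D2 -> measurable_fun (D1 `*` D2) f ->
  (forall x y, D1 x -> D2 y -> `|f (x, y)| <= M) -> (m1 D1 < +oo)%E ->
  measurable_fun D2 (fun y => \int[m1]_(x in D1) f (x, y)).
Proof.
move=> mD1 mD2 mf fM fin.
have mf2 : measurable_fun (D2 `*` D1) (fun y : T2 * T1 => f (y.2, y.1)).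
  apply: (measurable_along (F := D1 `*` D2) (g := f) (f := fun y : T2 * T1 => (y.2, y.1))) => //.
  - exact: measurableX.
  - by move=> [y x] [/= h1 h2].
  - by apply: measurable_funTS; apply: measurable_fun_pair; [exact: measurable_snd|exact: measurable_fst].
have := @measurable_Rintegral_bnd _ _ T2 T1 R D2 D1 _ M mD2 mD1 mf2 (fun y x h h' => fM x y h' h) m1 fin.
exact.
Qed.

Section Swap.
Variables (m1 : {sigma_finite_measure set T1 -> \bar R}) (m2 : {sigma_finite_measure set T2 -> \bar R}).
Variables (D1 : set T1) (D2 : set T2).
Hypotheses (mD1 : measurable D1) (mD2 : measurable D2).
Hypotheses (fin1 : (m1 D1 < +oo)%E) (fin2 : (m2 D2 < +oo)%E).

Lemma Rintegral_swap_ge0 (f : T1 * T2 -> R) (M : R) : measurable_fun (D1 `*` D2) f ->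
  (forall x y, D1 x -> D2 y -> 0 <= f (x, y) <= M) ->
  \int[m1]_(x in D1) \int[m2]_(y in D2) f (x, y) =
  \int[m2]_(y in D2) \int[m1]_(x in D1) f (x, y).
Proof.
move=> mf f0M; have mD := measurableX mD1 mD2.
pose F : T1 * T2 -> \bar R := EFin \o (f \_ (D1 `*` D2)).
have mF : measurable_fun setT F.
  by apply/measurable_EFinP; apply/(measurable_restrictT _ mD).
have F0 z : (0 <= F z)%E.
  rewrite /F/= patchE lee_fin; case: ifPn => //; rewrite inE; case: z => x y [/= D1x D2y].
  by have /andP[] := f0M x y D1x D2y.
have fM x y : D1 x -> D2 y -> `|f (x, y)| <= M.
  by move=> h1 h2; have /andP[? ?] := f0M x y h1 h2; rewrite ger0_norm.
have E1 : (\int[m1]_(x in D1) (\int[m2]_(y in D2) f (x, y))%:E = \int[m1]_x \int[m2]_y F (x, y))%E.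
  rewrite [LHS]integral_mkcond; apply: eq_integral => x _; rewrite patchE.
  case: ifPn => D1x; last first.
    by rewrite integral0_eq// => y _; rewrite /F/= patchE in_setX (negbTE D1x).
  rewrite fineK; last first.
    apply: integrable_fin_num => //; apply: (@integrable_bnd _ _ _ _ _ _ M) => //.
      exact: (measurable_section1 mD1 mD2 mf (set_mem D1x)).
    by move=> y; apply: fM; rewrite -inE.
  rewrite integral_mkcond; apply: eq_integral => y _.
  by rewrite /F/= !patchE in_setX D1x/=; case: ifP.
have E2 : (\int[m2]_(y in D2) (\int[m1]_(x in D1) f (x, y))%:E = \int[m2]_y \int[m1]_x F (x, y))%E.
  rewrite [LHS]integral_mkcond; apply: eq_integral => y _; rewrite patchE.
  case: ifPn => D2y; last first.
    by rewrite integral0_eq// => x _; rewrite /F/= patchE in_setX (negbTE D2y) andbF.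
  rewrite fineK; last first.
    apply: integrable_fin_num => //; apply: (@integrable_bnd _ _ _ _ _ _ M) => //.
      exact: (measurable_section2 mD1 mD2 mf (set_mem D2y)).
    by move=> x h; apply: fM => //; rewrite -inE.
  rewrite integral_mkcond; apply: eq_integral => x _.
  by rewrite /F/= !patchE in_setX D2y andbT; case: ifP.
by rewrite {1}/Rintegral [RHS]/Rintegral E1 E2 fubini_tonelli.
Qed.

(** Raising the integrand by [M] makes it non-negative and changes both orders of integration by the
    same finite constant. *)
Lemma Rintegral_swap (f : T1 * T2 -> R) (M : R) : measurable_fun (D1 `*` D2) f ->
  (forall x y, D1 x -> D2 y -> `|f (x, y)| <= M) ->
  \int[m1]_(x in D1) \int[m2]_(y in D2) f (x, y) =
  \int[m2]_(y in D2) \int[m1]_(x in D1) f (x, y).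
Proof.
move=> mf fM.
have h : \int[m1]_(x in D1) \int[m2]_(y in D2) (f (x, y) + M) =
    \int[m2]_(y in D2) \int[m1]_(x in D1) (f (x, y) + M).
  apply: (@Rintegral_swap_ge0 (fun z => f z + M) (2 * M)).
    by apply: measurable_funD => //; exact: measurable_cst.
  move=> x y D1x D2y; have := fM x y D1x D2y; rewrite ler_norml => /andP[h1 h2].
  by apply/andP; split; lra.
have e1 : \int[m1]_(x in D1) \int[m2]_(y in D2) (f (x, y) + M) =
    \int[m1]_(x in D1) \int[m2]_(y in D2) f (x, y) + M * fine (m2 D2) * fine (m1 D1).
  rewrite -Rintegral_cst// -RintegralD//.
  - apply: eq_Rintegral => x; rewrite inE => D1x; rewrite RintegralD//.
    + by rewrite Rintegral_cst.
    + apply: (@integrable_bnd _ _ _ _ _ _ M) => //; first exact: (measurable_section1 mD1 mD2 mf D1x).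
      by move=> y D2y; exact: fM.
    + by apply: (@integrable_bnd _ _ _ _ _ _ `|M|).
  - apply: (@integrable_bnd _ _ _ _ _ _ (M * fine (m2 D2))) => //.
      exact: (measurable_Rintegral_bnd mD1 mD2 mf fM fin2).
    move=> x D1x; apply: Rintegral_bnd => //; first exact: (measurable_section1 mD1 mD2 mf D1x).
    by move=> y D2y; exact: fM.
  - by apply: (@integrable_bnd _ _ _ _ _ _ `|M * fine (m2 D2)|).
have e2 : \int[m2]_(y in D2) \int[m1]_(x in D1) (f (x, y) + M) =
    \int[m2]_(y in D2) \int[m1]_(x in D1) f (x, y) + M * fine (m1 D1) * fine (m2 D2).
  rewrite -Rintegral_cst// -RintegralD//.
  - apply: eq_Rintegral => y; rewrite inE => D2y; rewrite RintegralD//.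
    + by rewrite Rintegral_cst.
    + apply: (@integrable_bnd _ _ _ _ _ _ M) => //; first exact: (measurable_section2 mD1 mD2 mf D2y).
      by move=> x D1x; exact: fM.
    + by apply: (@integrable_bnd _ _ _ _ _ _ `|M|).
  - apply: (@integrable_bnd _ _ _ _ _ _ (M * fine (m1 D1))) => //.
      have := @measurable_Rintegral_bnd2 m1 D1 D2 f M mD1 mD2 mf fM fin1; exact.
    move=> y D2y; apply: Rintegral_bnd => //; first exact: (measurable_section2 mD1 mD2 mf D2y).
    by move=> x D1x; exact: fM.
  - by apply: (@integrable_bnd _ _ _ _ _ _ `|M * fine (m1 D1)|).
by move: h; rewrite e1 e2 mulrAC => /addIr.
Qed.

End Swap.
End FubiniSwap.

Section JointMeasurability.
Context {R : realType} {d : nat}.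
Local Notation Rd := 'rV[R]_d.
Local Notation Td := (torus R d).
Local Notation X := (Td * Rd)%type.
Local Notation phase := (borel (Td * Rd)%type).
Local Notation RT := (measurableTypeR R).
Local Notation brow := (borel 'rV[R]_d).
Local Notation leb := (@lebesgue_row R d).
Variable V : set Rd.
Hypothesis oV : open V.
Variable p : Rd -> Rd -> R.
Hypothesis pk : transition_kernel V p.
Local Notation PV := (phase_set V : set X).

Definition jmeasurable (g : R -> X -> R) :=
  measurable_fun (setT `*` PV : set (RT * phase)) (fun y : RT * phase => g y.1 y.2).

Definition pmeasurable (f : X -> R) := measurable_fun (PV : set phase) (f : phase -> R).

Lemma measurable_TPV : measurable (setT `*` PV : set (RT * phase)).
Proof. by apply: measurableX => //; exact: measurable_PV. Qed.

Lemma jmeasurable_fix g q : jmeasurable g -> pmeasurable (g q).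
Proof.
move=> mg; apply: (measurable_along (F := setT `*` PV : set (RT * phase))
  (g := fun y : RT * phase => g y.1 y.2) (f := pair q)).
- exact: measurable_TPV.
- by move=> z Pz.
- exact: mg.
- exact: measurable_funTS.
Qed.

Lemma jmeasurable_fixz g z (D : set R) : PV z -> jmeasurable g -> measurable_fun D (g^~ z).
Proof.
move=> Pz mg; apply: (measurable_along (F := setT `*` PV : set (RT * phase))
  (g := fun y : RT * phase => g y.1 y.2) (f := fun q => (q, z))).
- exact: measurable_TPV.
- by move=> q Dq.
- exact: mg.
- exact: measurable_funTS.
Qed.

Lemma jmeasurable_space f : pmeasurable f -> jmeasurable (fun=> f).
Proof.
move=> mf; apply: (measurable_along (F := PV : set phase) (g := f : phase -> R) (f := snd)).
- exact: measurable_PV.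
- by move=> y [_ Py].
- exact: mf.
- by apply: measurable_funTS; exact: measurable_snd.
Qed.

Lemma jmeasurable_time (a : R -> R) : measurable_fun setT a -> jmeasurable (fun q _ => a q).
Proof.
by move=> ma; apply: measurable_funTS; apply: measurableT_comp => //; exact: measurable_fst.
Qed.

Lemma measurable_flow2 (a : R -> R) : continuous a ->
  measurable_fun setT (fun y : RT * phase => (y.1, flow (a y.1) y.2) : RT * phase).
Proof.
move=> ca; apply: measurable_fun_pair; first exact: measurable_fst.
apply: (@borel_fun_borel _ (RT * phase)%type X (fun y : RT * phase => flow (a y.1) y.2)).
apply: (@borel_fun_comp _ (RT * phase)%type (R * X)%type X id (fun y : R * X => flow (a y.1) y.2)).
  move=> y; apply: (@continuous_comp _ _ _ (fun y : R * X => (a y.1, y.2)) (fun y : R * X => flow y.1 y.2));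
    last exact: flow_continuous.
  have c1 : {for y, continuous (fun y : R * X => a y.1)}.
    by apply: (@continuous_comp _ _ _ fst a); [exact: cvg_fst|exact: ca].
  exact: (cvg_pair c1 cvg_snd).
exact: borel_fun_Rphase.
Qed.

Lemma jmeasurable_flow g (a : R -> R) : continuous a -> jmeasurable g -> jmeasurable (fun q z => g q (flow (a q) z)).
Proof.
move=> ca mg; apply: (measurable_along (F := setT `*` PV : set (RT * phase))
  (g := fun y : RT * phase => g y.1 y.2) (f := fun y : RT * phase => (y.1, flow (a y.1) y.2))).
- exact: measurable_TPV.
- by move=> y [_ Py].
- exact: mg.
- by apply: measurable_funTS; exact: measurable_flow2.
Qed.

Lemma pmeasurable_flow f q : pmeasurable f -> pmeasurable (f \o flow q).
Proof.
move=> mf; have := jmeasurable_fix 0 (jmeasurable_flow (@cst_continuous R R q) (jmeasurable_space mf)).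
exact.
Qed.

Lemma borel_fun_Xrow : @borel_fun _ (phase * brow)%type (X * Rd)%type id.
Proof.
have := @borel_fun_pair _ (phase * brow)%type X Rd _ _ _ _ fst snd countable_base_X (@countable_base_row R d).
rewrite (_ : (fun t => _) = id); last by apply/funext => -[].
by apply; [exact: (borel_borel_fun measurable_fst)|exact: (borel_borel_fun measurable_snd)].
Qed.

Lemma measurable_replace :
  measurable_fun setT (fun y : phase * brow => (y.1.1, y.2) : phase).
Proof.
apply: (@borel_fun_borel _ (phase * brow)%type X).
apply: (@borel_fun_comp _ (phase * brow)%type (X * Rd)%type X id (fun y : X * Rd => (y.1.1, y.2))).
  move=> y; have c1 : {for y, continuous (fun y : X * Rd => y.1.1)}.
    by apply: (@continuous_comp _ _ _ fst fst); exact: cvg_fst.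
  exact: (cvg_pair c1 cvg_snd).
exact: borel_fun_Xrow.
Qed.

Lemma pmeasurable_vmeasurable f : pmeasurable f -> vmeasurable V f.
Proof.
(* The slice is parametrized by overwriting the velocity of a base point taken in [V]; an empty [V]
   is settled apart. *)
move=> mf x; have [->|/set0P[v0 Vv0]] := eqVneq V set0; first exact: measurable_fun_set0.
apply: (measurable_along (F := PV : set phase) (g := f : phase -> R)
  (f := fun v : brow => (x, v) : phase)).
- exact: measurable_PV.
- by move=> v Vv.
- exact: mf.
- apply: measurable_funTS.
  apply: (measurable_along (F := setT) (g := fun y : phase * brow => (y.1.1, y.2) : phase)
    (f := fun v : brow => ((x, v0) : phase, v))) => //.
    exact: measurable_replace.
  by apply: measurable_fun_pair; [exact: measurable_cst|exact: measurable_id].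
Qed.

Lemma measurable_kernel2 : measurable_fun ((setT `*` PV) `*` V : set ((RT * phase) * brow))
  (fun y : (RT * phase) * brow => p y.2 y.1.2.2).
Proof.
pose D : set (X * Rd) := PV `*` V.
have oD : open D.
  rewrite openE => -[z v] [/= Pz Vv]; exists (PV, V) => //=.
  by split; apply: open_nbhs_nbhs; split=> //; exact: PV_open.
have h := @borel_fun_contfun _ ((RT * phase) * brow)%type R (X * Rd)%type D
  (fun y : (RT * phase) * brow => (y.1.2, y.2)) (fun y : X * Rd => p y.2 y.1.2) oD.
rewrite (_ : _ `*` V = (fun y : (RT * phase) * brow => (y.1.2, y.2)) @^-1` D); last first.
  by apply/seteqP; split=> -[[q z] v] //= [[_ ? ] ?].
apply: h.
  move=> [z v] /set_mem[/= [_ Vz] Vv].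
  apply: (@continuous_comp _ _ _ (fun y : X * Rd => (y.2, y.1.2) : Rd * Rd) (fun z : Rd * Rd => p z.1 z.2)).
    have c1 : {for (z, v), continuous (fun y : X * Rd => y.1.2)}.
      by apply: (@continuous_comp _ _ _ fst snd); [exact: cvg_fst|exact: cvg_snd].
    exact: (cvg_pair cvg_snd c1).
  exact: (kernel_continuous pk).
apply: (@borel_fun_pair _ _ X Rd _ _ _ _ _ _ countable_base_X (@countable_base_row R d)).
  apply: (@borel_borel_fun _ ((RT * phase) * brow)%type X (fun y => y.1.2)).
  by apply: (measurable_along (F := setT) (g := snd) (f := fst)).
exact: (@borel_borel_fun _ ((RT * phase) * brow)%type Rd snd measurable_snd).
Qed.

(** [V] may have infinite Lebesgue measure, so the sign needed by Tonelli is obtained by adding [M]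
    under the kernel, where [dual_kernel] of the constant [M] is again [M]. *)
Lemma jmeasurable_dual_kernel g M : jmeasurable g -> (forall q, bnd V (g q) M) -> jmeasurable (fun q z => dual_kernel V p (g q) z).
Proof.
move=> mg gM.
have mV := @measurable_V _ _ V oV.
have mG : measurable_fun ((setT `*` PV) `*` V : set ((RT * phase) * brow))
    (fun y : (RT * phase) * brow => g y.1.1 (y.1.2.1, y.2)).
  apply: (measurable_along (F := setT `*` PV : set (RT * phase))
    (g := fun y : RT * phase => g y.1 y.2)
    (f := fun y : (RT * phase) * brow => (y.1.1, (y.1.2.1, y.2)) : RT * phase)).
  - exact: measurable_TPV.
  - by move=> [[q z] v] [[_ _] /= Vv].
  - exact: mg.
  - apply: measurable_funTS; apply: measurable_fun_pair.
      by apply: (measurable_along (F := setT) (g := fst) (f := fst)).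
    apply: (measurable_along (F := setT) (g := fun y : phase * brow => (y.1.1, y.2) : phase)
      (f := fun y : (RT * phase) * brow => (y.1.2, y.2))) => //; first exact: measurable_replace.
    apply: measurable_fun_pair; last exact: measurable_snd.
    by apply: (measurable_along (F := setT) (g := snd) (f := fst)).
have mI := @measurable_Rintegral2 _ _ (RT * phase)%type brow R leb (setT `*` PV) V
  (fun y : (RT * phase) * brow => p y.2 y.1.2.2 * (g y.1.1 (y.1.2.1, y.2) + M)) measurable_TPV mV.
have vg q : vmeasurable V (g q) by apply: pmeasurable_vmeasurable; exact: jmeasurable_fix.
apply: (@eq_measurable_fun _ _ (RT * phase)%type R _
    (fun y : RT * phase => dual_kernel V p (fun z => g y.1 z + M) y.2 - M)).
  move=> [q z] /set_mem[_ Pz] /=.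
  have cM : vmeasurable V (fun=> M) by move=> x; exact: measurable_cst.
  have bM : bnd V (fun=> M) `|M| by [].
  by rewrite (dual_kernelD oV pk Pz (vg q) cM (gM q) bM) (dual_kernel_cst oV pk)// addrK.
apply: measurable_funB; last exact: measurable_cst.
apply: mI.
  apply: measurable_funM; first exact: measurable_kernel2.
  by apply: measurable_funD => //; exact: measurable_cst.
move=> [q z] v [_ [_ Vz]] Vv /=; rewrite mulr_ge0 ?(kernel_ge0 pk)//.
by have := gM q (z.1, v) (conj I Vv); rewrite ler_norml => /andP[h _]; lra.
Qed.

Lemma pmeasurable_dual_kernel f M : pmeasurable f -> bnd V f M -> pmeasurable (dual_kernel V p f).
Proof.
move=> mf fM; have := jmeasurable_fix 0 (@jmeasurable_dual_kernel (fun=> f) M (jmeasurable_space mf) (fun=> fM)).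
exact.
Qed.

Section TimeIntegral.
Variables (g : R -> X -> R) (M a b : R).
Hypotheses (mg : jmeasurable g) (gM : forall q, bnd V (g q) M).

Lemma jmeasurable_swap : measurable_fun (PV `*` `[a, b]%classic : set (phase * RT)) (fun y : phase * RT => g y.2 y.1).
Proof.
apply: (measurable_along (F := setT `*` PV : set (RT * phase))
  (g := fun y : RT * phase => g y.1 y.2) (f := fun y : phase * RT => (y.2, y.1))).
- exact: measurable_TPV.
- by move=> [z q] [/= Pz _].
- exact: mg.
- by apply: measurable_funTS; by apply: measurable_fun_pair; [exact: measurable_snd|exact: measurable_fst].
Qed.

Let itvR : set RT := `[a, b]%classic.

Let itvR_lty : (@lebesgue_measure R itvR < +oo)%E.
Proof. by rewrite lebesgue_measure_itv/=; case: ifP => // _; rewrite -EFinB ltry. Qed.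

Lemma pmeasurable_int : pmeasurable (fun z => \int[lebesgue_measure]_(q in `[a, b]) g q z).
Proof.
have mab : measurable itvR by exact: measurable_itv.
have gM' (z : phase) (q : RT) : PV z -> itvR q -> `|g q z| <= M by move=> Pz _; exact: gM.
exact: (@measurable_Rintegral_bnd _ _ phase RT R PV itvR _ M (measurable_PV oV) mab jmeasurable_swap gM'
  (@lebesgue_measure R) itvR_lty).
Qed.

Lemma Rintegral_swap_time (m : probability phase R) :
  \int[m]_(z in PV) \int[lebesgue_measure]_(q in `[a, b]) g q z =
  \int[lebesgue_measure]_(q in `[a, b]) \int[m]_(z in PV) g q z.
Proof.
have mPV := @measurable_PV R d V oV.
have mab : measurable itvR by exact: measurable_itv.
have gM' (z : phase) (q : RT) : PV z -> itvR q -> `|g q z| <= M by move=> Pz _; exact: gM.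
have mlty : (m PV < +oo)%E by rewrite (le_lt_trans (probability_le1 _ mPV))// ltry.
exact: (@Rintegral_swap _ _ phase RT R m (@lebesgue_measure R) PV itvR mPV mab mlty itvR_lty _ M jmeasurable_swap gM').
Qed.

End TimeIntegral.
End JointMeasurability.

(** * The Duhamel formula for bounded continuous functions *)

Section OpenApproximation.
Context {R : realType} {d : nat}.
Local Notation Rd := 'rV[R]_d.
Local Notation Td := (torus R d).
Local Notation X := (Td * Rd)%type.
Variable V : set Rd.
Hypothesis oV : open V.
Local Notation PV := (phase_set V : set X).

Lemma smooth_compact0 : smooth_compact V (fun=> 0 : R).
Proof.
split; first by move=> z; exact: cvg_cst.
- by exists 0 => z; rewrite normr0.
- by exists set0; split; [exact: compact0|by []|by move=> z; rewrite eqxx].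
- by move=> E x v _ _; exact: C1_cst.
Qed.

Lemma smooth_compactD f g : smooth_compact V f -> smooth_compact V g -> smooth_compact V (fun z => f z + g z).
Proof.
move=> [cf [M fM] [A [cA AV fA]] Df] [cg [N gN] [B [cB BV gB]] Dg]; split.
- by move=> z; apply: cvgD; [exact: cf|exact: cg].
- by exists (M + N) => z; rewrite (le_trans (ler_normD _ _))// lerD.
- exists (A `|` B); split; first exact: compactU.
    by move=> v [/AV|/BV].
  move=> z fg; have [f0|/fA] := eqVneq (f z) 0; last by left.
  by right; apply: gB; move: fg; rewrite f0 add0r.
- by move=> E x v hx hv; apply: (C1D (Df E x v hx hv) (Dg E x v hx hv)).
Qed.

Lemma smooth_compactM f g : smooth_compact V f -> smooth_compact V g -> smooth_compact V (fun z => f z * g z).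
Proof.
move=> [cf [M fM] [A [cA AV fA]] Df] [cg [N gN] _ Dg]; split.
- by move=> z; apply: cvgM; [exact: cf|exact: cg].
- by exists (M * N) => z; rewrite normrM ler_pM.
- exists A; split=> // z; rewrite mulf_eq0 negb_or => /andP[f0 _]; exact: fA.
- by move=> E x v hx hv; apply: (C1M (Df E x v hx hv) (Dg E x v hx hv)).
Qed.

Lemma smooth_compactN f : smooth_compact V f -> smooth_compact V (fun z => - f z).
Proof.
move=> [cf [M fM] [A [cA AV fA]] Df]; split.
- by move=> z; apply: cvgN; exact: cf.
- by exists M => z; rewrite normrN.
- by exists A; split=> // z; rewrite oppr_eq0; exact: fA.
- move=> E x v hx hv; rewrite (_ : (fun e => _) = (fun=> -1) \* (fun e => f (torus_pi (x e), v e))).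
    by apply: C1M (Df E x v hx hv); exact: C1_cst.
  by apply/funext => e /=; rewrite mulN1r.
Qed.

Lemma smooth_compact_bump k : bumpbox k `<=` V -> smooth_compact V (bump k).
Proof.
move=> kV; split.
- exact: bump_continuous.
- by exists 1 => z; rewrite ger0_norm ?bump_ge0// bump_le1.
- exists (bumpbox k); split=> //; first exact: compact_bumpbox.
  exact: bump_box.
- move=> E x v hx hv; rewrite (_ : (fun e => _) = (fun e => bumpL k (x e) (v e))).
    exact: C1_bumpL.
  by apply/funext => e; rewrite bump_pi.
Qed.

(** By 1 - f g = (1 - f) + (1 - g) - (1 - f)(1 - g), functions equal to 1 outside a compact set of
    velocities are stable under products, although they are not compactly supported themselves. *)
Lemma smooth_compact_1subM f g : smooth_compact V (fun z => 1 - f z) -> smooth_compact V (fun z => 1 - g z) ->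
  smooth_compact V (fun z => 1 - f z * g z).
Proof.
move=> Sf Sg; have := smooth_compactD (smooth_compactD Sf Sg) (smooth_compactN (smooth_compactM Sf Sg)).
by congr smooth_compact; apply/funext => z; ring.
Qed.

(** A C^1 substitute for a supremum of bumps: 1 minus the product of the [(1 - h j z) ^+ n] stays in
    [0, 1], vanishes off [U], and tends to 1 as soon as a single [h j] is positive at the point. *)
Lemma open_approx (U : set X) : open U -> exists S_ : nat -> X -> R,
  [/\ forall n, smooth_compact V (S_ n), forall n z, 0 <= S_ n z <= 1 &
      forall z, PV z -> S_ n z @[n --> \oo] --> ((z \in U)%:R : R)].
Proof.
move=> oU.
pose good (k : 'rV[rat]_d * 'rV[rat]_d * nat) := (forall y : X, 0 < bump k y -> U y) /\ (bumpbox k : set Rd) `<=` V.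
(* The countably many bumps are enumerated; those leaking out of [U], or whose velocity box leaves
   [V], are replaced by 0. *)
pose h (j : nat) : X -> R := if unpickle j is Some k then (if `[< good k >] then bump k else fun=> 0) else fun=> 0.
have Sh j : smooth_compact V (h j).
  rewrite /h; case: unpickle => [k|]; last exact: smooth_compact0.
  by case: asboolP => [[_ kV]|_]; [exact: smooth_compact_bump|exact: smooth_compact0].
have h01 j z : 0 <= h j z <= 1.
  rewrite /h; case: unpickle => [k|]; last by rewrite lexx ler01.
  by case: asboolP => _; [rewrite bump_ge0 bump_le1|rewrite lexx ler01].
have hU j z : ~ U z -> h j z = 0.
  rewrite /h; case: unpickle => [k|//] nU; case: asboolP => [[kU _]|//].
  by apply/eqP; apply/negPn/negP => b0; apply: nU; apply: kU; rewrite lt_neqAle eq_sym b0 bump_ge0.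
have hP z : U z -> PV z -> exists j, 0 < h j z.
  move=> Uz [_ Vz]; have [k [b0 kU kV]] := bump_basis oU Uz oV Vz.
  by exists (pickle k); rewrite /h pickleK asboolT.
pose P (n m : nat) z : R := \prod_(j < n) (1 - h j z) ^+ m.
have SX j m : smooth_compact V (fun z => 1 - (1 - h j z) ^+ m).
  elim: m => [|m IH].
    by have := smooth_compact0; congr smooth_compact; apply/funext => z; rewrite expr0 subrr.
  have S1 : smooth_compact V (fun z => 1 - (1 - h j z)).
    by have := Sh j; congr smooth_compact; apply/funext => z; rewrite subKr.
  have := smooth_compact_1subM S1 IH.
  by congr smooth_compact; apply/funext => z; rewrite exprS.
have SP n m : smooth_compact V (fun z => 1 - P n m z).
  elim: n => [|n IH].
    by have := smooth_compact0; congr smooth_compact; apply/funext => z; rewrite /P big_ord0 subrr.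
  have := smooth_compact_1subM IH (SX n m).
  by congr smooth_compact; apply/funext => z; rewrite /P big_ord_recr.
have X01 j m z : 0 <= (1 - h j z) ^+ m <= 1.
  have /andP[h0 h1] := h01 j z; rewrite exprn_ge0 ?subr_ge0//=.
  by rewrite exprn_ile1 ?subr_ge0// gerBl.
have P01 n m z : 0 <= P n m z <= 1.
  by rewrite /P prodr_ge0 ?prodr_ile1// => i _; have /andP[] := X01 i m z.
exists (fun n z => 1 - P n n z); split; [by move=> n; exact: SP|move=> n z|move=> z Pz].
  by have /andP[? ?] := P01 n n z; rewrite subr_ge0 gerBl; apply/andP.
have [Uz|nUz] := boolP (z \in U); last first.
  apply: (@cvg_trans _ (cst 0 @ \oo)); last exact: cvg_cst.
  apply: near_eq_cvg; apply: nearW => n /=.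
  rewrite /P big1 ?subrr// => i _; rewrite hU ?subr0 ?expr1n//.
  by move=> h0; move: nUz; rewrite mem_set.
have [j hj] := hP z (set_mem Uz) Pz.
have /andP[_ hj1] := h01 j z.
rewrite -[X in _ --> X]subr0; apply: cvgB; first exact: cvg_cst.
apply: (@squeeze_cvgr _ _ _ _ (cst 0) (fun n => (1 - h j z) ^+ n)); last first.
- by apply: cvg_expr; rewrite ger0_norm ?subr_ge0// gtrBl.
- exact: cvg_cst.
near=> n; have /andP[P0 _] := P01 n n z; rewrite P0/=.
have jn : (j < n)%N by near: n; exact: nbhs_infty_gt.
rewrite /P (bigD1 (Ordinal jn))//= ler_piMr//; first by have /andP[] := X01 j n z.
by apply: prodr_ile1 => i _.
Unshelve. all: by end_near. Qed.

End OpenApproximation.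

(** * Evolution of a weak solution in the frame of the flow *)

Section DuhamelFormula.
Context {R : realType} {d : nat}.
Local Notation Rd := 'rV[R]_d.
Local Notation Td := (torus R d).
Local Notation X := (Td * Rd)%type.
Local Notation RT := (measurableTypeR R).
Local Notation phase := (borel (Td * Rd)%type).
Variable V : set Rd.
Hypothesis oV : open V.
Variable p : Rd -> Rd -> R.
Hypothesis pk : transition_kernel V p.
Variable sigma : Td -> R.
Hypothesis csigma : continuous sigma.
Variable Sg : R.
Hypothesis sigma_itv : forall x, 0 <= sigma x <= Sg.
Local Notation PV := (phase_set V : set X).
Variable mu : R -> probability phase R.
Hypothesis mu_prob : forall t, 0 <= t -> prob_on V (mu t).
Hypothesis mu_cont : forall phi : X -> R, Cb V phi ->
  {within `[0, +oo[, continuous (fun t => \int[mu t]_(z in PV) phi z)}.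
Hypothesis mu_weak : mv_weak V p sigma mu.
Local Notation mt := (mt V mu).
Local Notation bt := (bt V p sigma mu).
Local Notation dual_coll := (dual_coll V p sigma).

Lemma measurable_near0 (f : R -> R) (S : R) :
  (forall q0 : R, 0 <= q0 -> forall e : R, 0 < e -> \forall q \near q0, 0 <= q -> `|f q - f q0| <= e) ->
  measurable_fun (`[0, S]%classic : set RT) f.
Proof.
move=> H; suff h : measurable_fun (`[0, S]%classic : set R) f by exact: h.
apply: (@measurable_funS _ _ _ _ (`[0, +oo[%classic : set R)) => //.
  by move=> x /=; rewrite !in_itv/= andbT => /andP[].
by apply: subspace_continuous_measurable_fun => //; exact: near0_within.
Qed.

Lemma measurable_contR (D : set RT) (f : R -> R) : continuous f -> measurable_fun D f.
Proof.
move=> cf; apply: measurable_funTS.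
suff h : measurable_fun [set: R] f by exact: h.
exact: continuous_measurable_fun.
Qed.

Lemma itv_lty (a b : R) : (lebesgue_measure (`[a, b]%classic : set RT) < +oo)%E.
Proof. by rewrite lebesgue_measure_itv/=; case: ifP => // _; rewrite -EFinB ltry. Qed.

Lemma fine_itv (a b : R) : a <= b -> fine (lebesgue_measure (`[a, b]%classic : set RT)) = b - a.
Proof.
move=> ab; rewrite lebesgue_measure_itv/= lte_fin.
by have [//|ba] := ltP a b; rewrite (le_anti (introT andP (conj ab ba))) subrr.
Qed.

(** The weak formulation is tested on [cut t0 n] times the transported [psi]. As [n] grows the
    derivative of the cutoff concentrates at [t0], and the cutoff tends to the indicator of
    [0, t0]. *)
Lemma smooth_compact_duhamel0 psi (t0 : R) : 0 <= t0 -> smooth_compact V psi ->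
  mt t0 psi - mt 0 psi = \int[lebesgue_measure]_(r in `[0, t0]) bt r psi.
Proof.
(* Every cutoff vanishes from [t0 + 1] on, strictly before [S]. *)
move=> t00 Spsi; pose S := t0 + 2.
have mS : measurable (`[0, S]%classic : set RT) by exact: measurable_itv.
have ma := measurable_near0 (S := S) (fun q q0 => smooth_compact_mt_near oV mu_prob mu_cont Spsi q0).
have mb := measurable_near0 (S := S) (fun q q0 => smooth_compact_bt_near oV pk csigma sigma_itv mu_prob mu_cont Spsi q0).
have Cp t : Cb V (psi \o flow (- t)) by apply: Cb_flow; exact: smooth_compact_Cb.
have [M pM] : exists M, forall z, `|psi z| <= M by case: Spsi.
have S0 : 0 <= Sg by have /andP[/le_trans] := sigma_itv point; apply.
have aM (t : R) : 0 <= t -> `|mt t psi| <= M.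
  move=> tt; have pM' : bnd V (psi \o flow (- t)) M by move=> z _; exact: pM.
  have := mu_bnd oV mu_prob tt (Cb_measurable oV (Cp t)) pM'.
  exact.
have bM (t : R) : 0 <= t -> `|bt t psi| <= 2 * Sg * M.
  move=> tt; have pM' : bnd V (psi \o flow (- t)) M by move=> z _; exact: pM.
  have pB : bnd V (dual_coll (psi \o flow (- t))) (2 * Sg * M).
    by move=> z Pz; apply: (dual_coll_bnd oV pk sigma_itv Pz (Cb_vmeasurable oV (Cp t)) pM').
  have := mu_bnd oV mu_prob tt (Cb_measurable oV (Cb_dual_coll oV pk csigma sigma_itv (Cp t))) pB.
  exact.
have inS t : `[0, S]%classic t -> 0 <= t by rewrite /= in_itv/= => /andP[].
have ccut n : continuous (cut t0 n).
  by move=> t; apply: differentiable_continuous; apply/derivable1_diffP; case: (is_derive_cut t0 n t).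
have mcut n : measurable_fun (`[0, S]%classic : set RT) (cut t0 n).
  exact: measurable_contR.
have mdcut n : measurable_fun (`[0, S]%classic : set RT) (dcut t0 n).
  by apply: measurable_contR; exact: dcut_continuous.
have idcut n : lebesgue_measure.-integrable (`[0, S]%classic : set RT) (EFin \o dcut t0 n).
  apply: continuous_compact_integrable; first exact: segment_compact.
  by apply: continuous_subspaceT; exact: dcut_continuous.
have ia n : lebesgue_measure.-integrable (`[0, S]%classic : set RT) (EFin \o (fun t => dcut t0 n t * mt t psi)).
  apply: (@le_integrable _ _ _ lebesgue_measure _ mS _ (EFin \o (fun t => M * dcut t0 n t))).
  - by apply/measurable_EFinP; exact: measurable_funM.
  - move=> t /inS tt; rewrite /= lee_fin !normrM mulrC ler_wpM2r//.
    by rewrite (le_trans (aM t tt))// ler_norm.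
  - exact: (@integrableZl _ _ _ lebesgue_measure _ mS M (EFin \o dcut t0 n)).
have ib n : lebesgue_measure.-integrable (`[0, S]%classic : set RT) (EFin \o (fun t => cut t0 n t * bt t psi)).
  apply: (@integrable_bnd _ _ _ _ _ _ (2 * Sg * M) mS (itv_lty _ _)).
    exact: measurable_funM.
  move=> t /inS tt; rewrite normrM -[leRHS]mul1r ler_pM// ?bM//.
  by have /andP[c0 c1] := cut_itv t0 n t; rewrite ger0_norm.
have eq n : \int[lebesgue_measure]_(t in `[0, S]) (dcut t0 n t * mt t psi)
    + \int[lebesgue_measure]_(t in `[0, S]) (cut t0 n t * bt t psi) = - mt 0 psi.
  rewrite -RintegralD// (cutoff_weak oV pk csigma sigma_itv (is_derive_cut t0 n)
    (@dcut_continuous _ t0 n) Spsi mu_weak (S' := t0 + 1) (S := S)).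
  - by rewrite cut1// mul1r.
  - by rewrite ltr_wpDl.
  - by rewrite /S ltrD2l ltr1n.
  - by move=> t tt; apply: cut0; rewrite (le_trans _ tt)// lerD2l invf_le1// ler1n.
(* [dcut] is non-positive with integral -1 and lives on [t0, t0 + 1 / (n + 1)], where [mt] is within
   [e] of its value at [t0]; the error is thus at most [e] times a mass of 1. *)
have lim1 : \int[lebesgue_measure]_(t in `[0, S]) (dcut t0 n t * mt t psi) @[n --> \oo] --> - mt t0 psi.
  apply/cvgrPdist_le => e e0.
  have /nbhs_ballP[r /= r0 hr] := smooth_compact_mt_near oV mu_prob mu_cont Spsi t00 e0.
  near=> n.
  have nr : n.+1%:R^-1 < r.
    rewrite -[ltRHS]invrK ltf_pV2 ?posrE ?invr_gt0//.
    apply: (@le_lt_trans _ _ n%:R); last by rewrite ltr_nat.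
    by near: n; exact: nbhs_infty_ger.
  have int1 : \int[lebesgue_measure]_(t in `[0, S]) dcut t0 n t = -1.
    rewrite (FTC2_C1 _ (is_derive_cut t0 n) (@dcut_continuous _ t0 n)) ?addr_ge0//.
    rewrite [cut _ _ 0]cut1// [cut _ _ S]cut0 ?sub0r// /S lerD2l (le_trans (_ : _ <= 1))//.
      by rewrite invf_le1// ler1n.
    by rewrite ler1n.
  rewrite -[- mt t0 psi]mulN1r -int1 -RintegralZr//.
  rewrite -RintegralB//; last first.
    apply: (eq_integrable mS (EFin \o (fun t => mt t0 psi * dcut t0 n t))).
      by move=> t _; rewrite /= mulrC.
    exact: (@integrableZl _ _ _ lebesgue_measure _ mS (mt t0 psi) (EFin \o dcut t0 n)).
  have I3 : lebesgue_measure.-integrable (`[0, S]%classic : set RT)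
      (EFin \o (fun t => dcut t0 n t * mt t0 psi - dcut t0 n t * mt t psi)).
    apply: (@integrableB _ _ _ lebesgue_measure _ mS (EFin \o (fun t => dcut t0 n t * mt t0 psi)) (EFin \o (fun t => dcut t0 n t * mt t psi))) => //.
    apply: (eq_integrable mS (EFin \o (fun t => mt t0 psi * dcut t0 n t))).
      by move=> t _; rewrite /= mulrC.
    exact: (@integrableZl _ _ _ lebesgue_measure _ mS (mt t0 psi) (EFin \o dcut t0 n)).
  apply: (le_trans (le_normr_Rintegral mS I3)).
  rewrite [leRHS](_ : e = \int[lebesgue_measure]_(t in `[0, S]) (- e * dcut t0 n t)); last first.
    by rewrite RintegralZl// int1 mulrN1 opprK.
  apply: le_Rintegral => //.
  - exact: (integrable_norm I3).
  - exact: (@integrableZl _ _ _ lebesgue_measure _ mS (- e) (EFin \o dcut t0 n)).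
  move=> t /inS tt; rewrite -mulrBr normrM (ler0_norm (dcut_le0 _ _ _)) [leRHS]mulNr -[leRHS]mulrN [leRHS](mulrC e).
  have [tl|tl] := leP t t0; first by rewrite dcut0 ?oppr0 ?mul0r//; left.
  have [tr|tr] := leP (t0 + n.+1%:R^-1) t; first by rewrite dcut0 ?oppr0 ?mul0r//; right.
  rewrite ler_wpM2l ?oppr_ge0 ?dcut_le0// distrC.
  apply: hr => //; rewrite /ball/= distrC ger0_norm ?subr_ge0 ?(ltW tl)//.
  by apply: lt_trans nr; rewrite ltrBlDl.
have lim2 : \int[lebesgue_measure]_(t in `[0, S]) (cut t0 n t * bt t psi) @[n --> \oo] -->
    \int[lebesgue_measure]_(r in `[0, t0]) bt r psi.
  rewrite (_ : \int[lebesgue_measure]_(r in `[0, t0]) bt r psi =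
      \int[lebesgue_measure]_(t in `[0, S]) (if t <= t0 then bt t psi else 0)); last first.
    rewrite Rintegral_mkcond [RHS]Rintegral_mkcond; apply: eq_Rintegral => t _.
    rewrite !patchE; case: ifPn => h1; case: ifPn => h2 //.
    - by move: h1; rewrite inE/= in_itv/= => /andP[_ ->].
    - exfalso; move/negP: h2; apply; move: h1; rewrite !inE/= !in_itv/= => /andP[-> h].
      by rewrite /S (le_trans h)// lerDl.
    - move/negP: h1; move: h2; rewrite !inE/= !in_itv/= => /andP[-> _] /negP/negPf /= ->.
      by [].
  apply: (@Rintegral_bdct _ _ _ _ _ _ _ (2 * Sg * M) mS (itv_lty _ _)).
  - by move=> n; exact: measurable_funM.
  - apply: (measurable_fun_if mS).
    + by apply: measurable_fun_ler; [exact: measurable_id|exact: measurable_cst].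
    + apply: (measurable_funS mS _ mb); exact: subIsetl.
    + exact: measurable_cst.
  - move=> n t /inS tt; rewrite normrM -[leRHS]mul1r ler_pM// ?bM//.
    by have /andP[c0 c1] := cut_itv t0 n t; rewrite ger0_norm.
  move=> t /inS tt; have [tl|tl] := leP t t0.
    by under eq_fun do rewrite cut1// mul1r; exact: cvg_cst.
  apply: (@cvg_trans _ (cst 0 @ \oo)); last exact: cvg_cst.
  apply: near_eq_cvg; near=> n; rewrite cut0 ?mul0r//.
  rewrite -lerBrDl -[leRHS]invrK lef_pV2 ?posrE ?invr_gt0 ?subr_gt0//.
  apply: (@le_trans _ _ n%:R); last by rewrite ler_nat.
  by near: n; exact: nbhs_infty_ger.
have : (fun n : nat => - mt 0 psi) @ \oo --> - mt t0 psi + \int[lebesgue_measure]_(r in `[0, t0]) bt r psi.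
  rewrite (_ : (fun n : nat => - mt 0 psi) = (fun n => \int[lebesgue_measure]_(t in `[0, S]) (dcut t0 n t * mt t psi)
    + \int[lebesgue_measure]_(t in `[0, S]) (cut t0 n t * bt t psi))); last by apply/funext => n; rewrite eq.
  exact: (cvgD lim1 lim2).
move=> /cvg_lim => /(_ (@Rhausdorff R)); rewrite lim_cst// => h.
by apply: (addrI (- mt t0 psi)); rewrite -h addrA addNr sub0r.
Unshelve. all: by end_near. Qed.


(* This class contains the test functions and is closed under bounded pointwise limits, hence contains C_b. *)
Definition duhamel (psi : X -> R) := [/\ pmeasurable V psi, (exists M, bnd V psi M),
  (forall S : R, measurable_fun (`[0, S]%classic : set RT) (fun r => bt r psi)) &
  forall t : R, 0 <= t -> mt t psi - mt 0 psi = \int[lebesgue_measure]_(r in `[0, t]) bt r psi].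

Lemma smooth_compact_duhamel psi : smooth_compact V psi -> duhamel psi.
Proof.
move=> Spsi; split.
- by apply: (Cb_measurable oV); exact: smooth_compact_Cb.
- by have [_ [M pM] _ _] := Spsi; exists M => z _; exact: pM.
- by move=> S; apply: measurable_near0 => q q0 e e0; exact: (smooth_compact_bt_near oV pk csigma sigma_itv mu_prob mu_cont Spsi q0 e0).
- by move=> t t0; exact: smooth_compact_duhamel0.
Qed.

Lemma pmeasurable_sigma : pmeasurable V (fun z => sigma z.1).
Proof. by apply: (measurable_PVcont oV) => z _; exact: sigma_fst_cont. Qed.

Lemma pmeasurable_dual_coll f M : pmeasurable V f -> bnd V f M -> pmeasurable V (dual_coll f).
Proof.
move=> mf fM; apply: measurable_funM; first exact: pmeasurable_sigma.
by apply: measurable_funB; [exact: (pmeasurable_dual_kernel oV pk mf fM)|exact: mf].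
Qed.

Lemma bnd_flow f M q : bnd V f M -> bnd V (f \o flow q) M.
Proof. by move=> fM z Pz; exact: fM. Qed.

Lemma mt_bnd f M t : 0 <= t -> pmeasurable V f -> bnd V f M -> `|mt t f| <= M.
Proof.
move=> t0 mf fM; have := mu_bnd oV mu_prob t0 (pmeasurable_flow oV (- t) mf) (bnd_flow (- t) fM).
exact.
Qed.

Lemma pmeasurable_Bflow f M t : pmeasurable V f -> bnd V f M -> pmeasurable V (dual_coll (f \o flow (- t))).
Proof. by move=> mf fM; apply: (pmeasurable_dual_coll (pmeasurable_flow oV (- t) mf) (bnd_flow (- t) fM)). Qed.

Lemma Bflow_bnd f M t : pmeasurable V f -> bnd V f M -> bnd V (dual_coll (f \o flow (- t))) (2 * Sg * M).
Proof.
move=> mf fM z Pz; apply: (dual_coll_bnd oV pk sigma_itv Pz _ (bnd_flow (- t) fM)).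
exact: (pmeasurable_vmeasurable oV (pmeasurable_flow oV (- t) mf)).
Qed.

Lemma bt_bnd f M t : 0 <= t -> pmeasurable V f -> bnd V f M -> `|bt t f| <= 2 * Sg * M.
Proof.
move=> t0 mf fM; have := mu_bnd oV mu_prob t0 (pmeasurable_Bflow t mf fM) (Bflow_bnd t mf fM).
exact.
Qed.

Lemma mt_integrable f M t : pmeasurable V f -> bnd V f M ->
  (mu t).-integrable (PV : set phase) (EFin \o (fun z : phase => f (flow (- t) z))).
Proof.
move=> mf fM; have := mu_integrable oV mu t (pmeasurable_flow oV (- t) mf) (bnd_flow (- t) fM).
exact.
Qed.

Lemma bt_integrable f M t : pmeasurable V f -> bnd V f M ->
  (mu t).-integrable (PV : set phase) (EFin \o (fun z : phase => dual_coll (f \o flow (- t)) z)).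
Proof.
move=> mf fM; have := mu_integrable oV mu t (pmeasurable_Bflow t mf fM) (Bflow_bnd t mf fM).
exact.
Qed.

Lemma mtD f g M M' t : pmeasurable V f -> bnd V f M -> pmeasurable V g -> bnd V g M' ->
  mt t (fun z => f z + g z) = mt t f + mt t g.
Proof.
move=> mf fM mg gM; rewrite /mt -(RintegralD (measurable_PV oV) (mt_integrable t mf fM) (mt_integrable t mg gM)).
exact: eq_Rintegral.
Qed.

Lemma mtZ c f M t : pmeasurable V f -> bnd V f M -> mt t (fun z => c * f z) = c * mt t f.
Proof.
move=> mf fM; rewrite /mt -(RintegralZl c (measurable_PV oV) (mt_integrable t mf fM)).
exact: eq_Rintegral.
Qed.

Lemma btD f g M M' t : pmeasurable V f -> bnd V f M -> pmeasurable V g -> bnd V g M' ->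
  bt t (fun z => f z + g z) = bt t f + bt t g.
Proof.
move=> mf fM mg gM; rewrite /bt -(RintegralD (measurable_PV oV) (bt_integrable t mf fM) (bt_integrable t mg gM)).
apply: eq_Rintegral => z; rewrite inE => Pz.
have := dual_collD oV pk sigma Pz (pmeasurable_vmeasurable oV (pmeasurable_flow oV (- t) mf)) (pmeasurable_vmeasurable oV (pmeasurable_flow oV (- t) mg))
  (bnd_flow (- t) fM) (bnd_flow (- t) gM).
exact.
Qed.

Lemma btZ c f M t : pmeasurable V f -> bnd V f M -> bt t (fun z => c * f z) = c * bt t f.
Proof.
move=> mf fM; rewrite /bt -(RintegralZl c (measurable_PV oV) (bt_integrable t mf fM)).
apply: eq_Rintegral => z; rewrite inE => Pz.
have := dual_collZ oV pk sigma c Pz (pmeasurable_vmeasurable oV (pmeasurable_flow oV (- t) mf)) (bnd_flow (- t) fM).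
exact.
Qed.

Lemma bt_itv_integrable f M t : (forall S : R, measurable_fun (`[0, S]%classic : set RT) (fun r => bt r f)) ->
  pmeasurable V f -> bnd V f M ->
  lebesgue_measure.-integrable (`[0, t]%classic : set RT) (EFin \o (fun r : RT => bt r f)).
Proof.
move=> mb mf fM; apply: (@integrable_bnd _ RT R lebesgue_measure `[0, t]%classic _ (2 * Sg * M)).
- exact: measurable_itv.
- exact: itv_lty.
- exact: mb.
- by move=> r /=; rewrite in_itv/= => /andP[r0 _]; exact: bt_bnd.
Qed.

Lemma duhamelD f g : duhamel f -> duhamel g -> duhamel (fun z => f z + g z).
Proof.
move=> [mf [M fM] bf df] [mg [M' gM] bg dg]; split.
- exact: (measurable_funD mf mg).
- exists (M + M') => z Pz; rewrite (le_trans (ler_normD _ _))// lerD//; [exact: fM|exact: gM].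
- move=> S; rewrite (_ : (fun r => bt r _) = (fun r => bt r f + bt r g)); first exact: (measurable_funD (bf S) (bg S)).
  by apply/funext => r; rewrite (btD r mf fM mg gM).
- move=> t t0; rewrite !(mtD _ mf fM mg gM) opprD addrACA df// dg//.
  rewrite -RintegralD; [|exact: measurable_itv|exact: (bt_itv_integrable t bf mf fM)|exact: (bt_itv_integrable t bg mg gM)].
  by apply: eq_Rintegral => r _; rewrite (btD r mf fM mg gM).
Qed.

Lemma duhamelZ c f : duhamel f -> duhamel (fun z => c * f z).
Proof.
move=> [mf [M fM] bf df]; split.
- by apply: measurable_funM; [exact: measurable_cst|exact: mf].
- by exists (`|c| * M) => z Pz; rewrite normrM ler_wpM2l//; exact: fM.
- move=> S; rewrite (_ : (fun r => bt r _) = (fun r => c * bt r f)).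
    by apply: measurable_funM; [exact: measurable_cst|exact: (bf S)].
  by apply/funext => r; rewrite (btZ c r mf fM).
- move=> t t0; rewrite !(mtZ _ _ mf fM) -mulrBr df//.
  rewrite -RintegralZl; [|exact: measurable_itv|exact: (bt_itv_integrable t bf mf fM)].
  by apply: eq_Rintegral => r _; rewrite (btZ c r mf fM).
Qed.

Lemma dual_kernel_cvg (f_ : nat -> X -> R) f M z : PV z -> (forall n, pmeasurable V (f_ n)) -> pmeasurable V f ->
  (forall n, bnd V (f_ n) M) -> (forall z, PV z -> f_ n z @[n --> \oo] --> f z) ->
  dual_kernel V p (f_ n) z @[n --> \oo] --> dual_kernel V p f z.
Proof.
move=> [_ Vz] mf_ mf fM ff.
apply: (@Rintegral_dct _ (borel 'rV[R]_d) R lebesgue_row V (fun n v' => p v' z.2 * f_ n (z.1, v'))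
  (fun v' => p v' z.2 * f (z.1, v')) (fun v' => M * p v' z.2) (measurable_V oV)).
- move=> n; apply: measurable_funM; first exact: (measurable_kernel1 oV pk).
  exact: (pmeasurable_vmeasurable oV (mf_ n)).
- apply: measurable_funM; first exact: (measurable_kernel1 oV pk).
  exact: (pmeasurable_vmeasurable oV mf).
- exact: (@integrableZl _ (borel 'rV[R]_d) R lebesgue_row V (measurable_V oV) M (EFin \o (fun v' => p v' z.2)) (integrable_kernel oV pk Vz)).
- move=> n v' Vv'; rewrite normrM (ger0_norm (kernel_ge0 pk Vv' Vz)) mulrC ler_wpM2r ?(kernel_ge0 pk)//.
  exact: fM.
- by move=> v' Vv'; apply: cvgM; [exact: cvg_cst|exact: ff].
Qed.

Lemma mt_cvg (f_ : nat -> X -> R) f M t : 0 <= t -> (forall n, pmeasurable V (f_ n)) -> pmeasurable V f ->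
  (forall n, bnd V (f_ n) M) -> (forall z, PV z -> f_ n z @[n --> \oo] --> f z) ->
  mt t (f_ n) @[n --> \oo] --> mt t f.
Proof.
move=> t0 mf_ mf fM ff.
apply: (@Rintegral_bdct _ _ _ _ _ _ _ M (measurable_PV oV) (mu_lty oV mu t)).
- by move=> n; exact: (pmeasurable_flow oV (- t) (mf_ n)).
- exact: (pmeasurable_flow oV (- t) mf).
- by move=> n z Pz; exact: fM.
- by move=> z Pz; exact: ff.
Qed.

Lemma bt_cvg (f_ : nat -> X -> R) f M t : 0 <= t -> (forall n, pmeasurable V (f_ n)) -> pmeasurable V f ->
  (forall n, bnd V (f_ n) M) -> bnd V f M -> (forall z, PV z -> f_ n z @[n --> \oo] --> f z) ->
  bt t (f_ n) @[n --> \oo] --> bt t f.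
Proof.
move=> t0 mf_ mf f_M fM ff.
apply: (@Rintegral_bdct _ _ _ _ _ _ _ (2 * Sg * M) (measurable_PV oV) (mu_lty oV mu t)).
- by move=> n; exact: (pmeasurable_Bflow t (mf_ n) (f_M n)).
- exact: (pmeasurable_Bflow t mf fM).
- by move=> n z Pz; exact: (Bflow_bnd t (mf_ n) (f_M n)).
- move=> z Pz; apply: cvgM; first exact: cvg_cst.
  apply: cvgB; last exact: ff.
  apply: (@dual_kernel_cvg (fun n => f_ n \o flow (- t)) (f \o flow (- t)) M) => //.
  + by move=> n; exact: (pmeasurable_flow oV (- t) (mf_ n)).
  + exact: (pmeasurable_flow oV (- t) mf).
  + by move=> n; exact: bnd_flow.
  + by move=> z' Pz'; exact: ff.
Qed.

(** Dominated convergence is used three times: inside the kernel, against the measures, and in time,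
    where [2 * Sg * M] bounds all the [bt]. *)
Lemma duhamel_lim (f_ : nat -> X -> R) f M : (forall n, duhamel (f_ n)) ->
  (forall n, bnd V (f_ n) M) -> (forall z, PV z -> f_ n z @[n --> \oo] --> f z) -> duhamel f.
Proof.
move=> Df f_M ff.
have mf_ n : pmeasurable V (f_ n) by case: (Df n).
have mf : pmeasurable V f by exact: (@measurable_fun_cvg _ phase R PV f_ f mf_ ff).
have fM : bnd V f M.
  move=> z Pz; apply: (ler_cvg_to (cvg_norm (ff z Pz)) (@cvg_cst _ M _ \oo _)).
  by apply: nearW => n; exact: f_M.
have bc t : 0 <= t -> bt t (f_ n) @[n --> \oo] --> bt t f by move=> t0; exact: bt_cvg.
have mb S : measurable_fun (`[0, S]%classic : set RT) (fun r => bt r f).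
  apply: (@measurable_fun_cvg _ RT R `[0, S]%classic (fun n r => bt r (f_ n)) (fun r => bt r f)).
    by move=> n; case: (Df n).
  by move=> r /=; rewrite in_itv/= => /andP[r0 _]; exact: bc.
split=> //; first by exists M.
move=> t t0.
have c1 : \int[lebesgue_measure]_(r in `[0, t]) bt r (f_ n) @[n --> \oo] -->
    \int[lebesgue_measure]_(r in `[0, t]) bt r f.
  apply: (@Rintegral_bdct _ RT R lebesgue_measure `[0, t]%classic (fun n r => bt r (f_ n)) _ (2 * Sg * M)).
  - exact: measurable_itv.
  - exact: itv_lty.
  - by move=> n; case: (Df n).
  - exact: mb.
  - by move=> n r /=; rewrite in_itv/= => /andP[r0 _]; exact: bt_bnd.
  - by move=> r /=; rewrite in_itv/= => /andP[r0 _]; exact: bc.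
have c2 : (fun n => mt t (f_ n) - mt 0 (f_ n)) @ \oo --> mt t f - mt 0 f.
  exact: (cvgB (mt_cvg t0 mf_ mf f_M ff) (mt_cvg (lexx 0) mf_ mf f_M ff)).
have E : (fun n => mt t (f_ n) - mt 0 (f_ n)) = (fun n => \int[lebesgue_measure]_(r in `[0, t]) bt r (f_ n)).
  by apply/funext => n; case: (Df n) => _ _ _; apply.
rewrite E in c2.
by rewrite -(cvg_lim (@Rhausdorff R) c1) -(cvg_lim (@Rhausdorff R) c2).
Qed.

Lemma duhamel_open (U : set X) : open U -> duhamel (fun z => (z \in U)%:R).
Proof.
move=> oU; have [S_ [SS S01 Sc]] := open_approx oV oU.
apply: (duhamel_lim (M := 1) (fun n => smooth_compact_duhamel (SS n)) _ Sc).
by move=> n z Pz; have /andP[? ?] := S01 n z; rewrite ger0_norm.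
Qed.

Lemma duhamel1 : duhamel (fun=> 1).
Proof.
have := duhamel_open openT; congr duhamel.
by apply/funext => z; rewrite in_setT.
Qed.

(** The constant sequence [f] converges on [PV] to any [g] that agrees with it there, so values off
    [PV] are immaterial. *)
Lemma duhamel_eq f g : (forall z, PV z -> f z = g z) -> duhamel f -> duhamel g.
Proof.
move=> fg Df; have [_ [M fM] _ _] := Df.
apply: (@duhamel_lim (fun=> f) g M (fun=> Df) (fun=> fM)) => z Pz.
by rewrite -fg//; exact: cvg_cst.
Qed.

Lemma duhamel_level f (c : R) : {in PV, continuous f} -> duhamel (fun z => ((c < f z)%R : bool)%:R).
Proof.
move=> cf; pose U := [set z | PV z /\ c < f z].
have oU : open U.
  rewrite openE => z [Pz cz]; apply: filterI.
    by apply: open_nbhs_nbhs; split=> //; exact: PV_open.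
  have cz' : nbhs (f z) [set y | c < y] by apply: open_nbhs_nbhs; split=> //; exact: open_gt.
  exact: (cf z (mem_set Pz) _ cz').
apply: duhamel_eq (duhamel_open oU) => z Pz; congr (nat_of_bool _)%:R.
apply/idP/idP; first by rewrite inE => -[].
by move=> h; rewrite inE.
Qed.

(** A staircase of a continuous function combines indicators of superlevel sets, which are open
    within [PV] and hence covered by [duhamel_open]. *)
Lemma Cb_duhamel f : Cb V f -> duhamel f.
Proof.
move=> [cf [M0 fM0]]; pose M := `|M0| + 1.
have M_gt0 : 0 < M by rewrite ltr_wpDl.
have fM : bnd V f M by move=> z Pz; rewrite (le_trans (fM0 z Pz))// (le_trans (ler_norm _))// lerDl.
apply: (@duhamel_lim (fun n z => steps M n (f z)) f (3 * M)).
- move=> n; rewrite /steps.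
  have D1 c : duhamel (fun=> c).
    by have := duhamelZ c duhamel1; congr duhamel; apply/funext => z; rewrite mulr1.
  apply: (duhamelD (D1 _)); apply: duhamelZ.
  suff H k : duhamel (fun z => \sum_(i < k) ((- M + 2 * M * i.+1%:R / n.+1%:R < f z)%R : bool)%:R) by exact: H.
  elim: k => [|k IH].
    by have := D1 0; congr duhamel; apply/funext => z; rewrite big_ord0.
  have := duhamelD IH (duhamel_level (- M + 2 * M * k.+1%:R / n.+1%:R) cf).
  by congr duhamel; apply/funext => z; rewrite big_ord_recr.
- by move=> n z Pz; apply: steps_bnd => //; exact: fM.
- by move=> z Pz; apply: steps_cvg => //; exact: fM.
Qed.

Lemma Cb_duhamel_itv f (s t : R) : Cb V f -> 0 <= s -> s <= t ->
  mt t f - mt s f = \int[lebesgue_measure]_(r in `[s, t]) bt r f.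
Proof.
move=> Cf s0 st; have [mf [M fM] bf df] := Cb_duhamel Cf.
have I := bt_itv_integrable t bf mf fM.
have t0 := le_trans s0 st.
rewrite -[LHS](subrKA (mt 0 f)) -[X in _ + X]opprB df// df//.
rewrite -Rintegral_itv_obnd_cbnd; last first.
  apply: integrableS I => //.
  by move=> r /=; rewrite !in_itv/= => /andP[/ltW sr ->]; rewrite (le_trans s0).
by rewrite -(Rintegral_itvB I) ?bnd_simp.
Qed.

(** Transport has no modulus of continuity on C_b, but it is hidden in [mt]; only the bounded
    collision operator changes the pairing. *)
Lemma Cb_mt_lipschitz f M (s t : R) : Cb V f -> bnd V f M -> 0 <= s -> s <= t ->
  `|mt t f - mt s f| <= 2 * Sg * M * (t - s).
Proof.
move=> Cf fM s0 st; have [mf _ bf _] := Cb_duhamel Cf.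
rewrite Cb_duhamel_itv// -(fine_itv st).
apply: Rintegral_bnd; first exact: measurable_itv.
- exact: itv_lty.
- apply: measurable_funS (bf t) => //.
  by move=> r /=; rewrite !in_itv/= => /andP[/(le_trans s0)-> ->].
- by move=> r /=; rewrite in_itv/= => /andP[sr _]; apply: bt_bnd => //; exact: le_trans sr.
Qed.

End DuhamelFormula.

(** * Backward iteration *)

Section IntervalTools.
Context {R : realType}.
Local Notation RT := (measurableTypeR R).

Lemma Rintegral_itv_split (f : R -> R) (a b c : R) : a <= b -> b <= c ->
  lebesgue_measure.-integrable (`[a, c]%classic : set RT) (EFin \o f) ->
  \int[lebesgue_measure]_(x in `[a, c]) f x =
  \int[lebesgue_measure]_(x in `[a, b]) f x + \int[lebesgue_measure]_(x in `[b, c]) f x.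
Proof.
move=> ab bc I; apply/eqP; rewrite addrC -subr_eq; apply/eqP.
rewrite -[RHS]Rintegral_itv_obnd_cbnd; last first.
  apply: integrableS I => //.
  by move=> r /=; rewrite !in_itv/= => /andP[/ltW br ->]; rewrite (le_trans ab).
by rewrite -(Rintegral_itvB I) ?bnd_simp.
Qed.

Lemma cont_itv_integrable (f : R -> R) (a b : R) : continuous f ->
  lebesgue_measure.-integrable (`[a, b]%classic : set RT) (EFin \o f).
Proof.
move=> cf; apply: continuous_compact_integrable; first exact: segment_compact.
exact: continuous_subspaceT.
Qed.

Lemma Rintegral_itv_bnd (f : R -> R) (a b C : R) : a <= b ->
  measurable_fun (`[a, b]%classic : set RT) f ->
  (forall x, a <= x <= b -> `|f x| <= C) ->
  `|\int[lebesgue_measure]_(x in `[a, b]) f x| <= C * (b - a).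
Proof.
move=> ab mf fC; rewrite -(fine_itv ab); by apply: Rintegral_bnd => //; exact: itv_lty.
Qed.

Lemma Rintegral_itv_cst (a b c : R) : a <= b ->
  \int[lebesgue_measure]_(x in `[a, b]) c = c * (b - a).
Proof. by move=> ab; rewrite Rintegral_cst ?fine_itv//; exact: measurable_itv. Qed.

Lemma integral_tail_lipschitz (f : R -> R) (a b c C : R) : continuous f -> 
  (forall x, `|f x| <= C) -> a <= c -> b <= c ->
  `|\int[lebesgue_measure]_(x in `[a, c]) f x - \int[lebesgue_measure]_(x in `[b, c]) f x|
    <= C * `|a - b|.
Proof.
move=> cf fC; wlog ab : a b / a <= b.
  move=> H; have [ab|/ltW ba] := leP a b; first exact: H.
  by move=> h1 h2; rewrite distrC (distrC a); exact: H.
move=> ac bc; rewrite (Rintegral_itv_split ab bc (cont_itv_integrable a c cf)) addrK.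
rewrite (distrC a b) [X in C * X]ger0_norm ?subr_ge0//.
by apply: Rintegral_itv_bnd => //; exact: measurable_contR.
Qed.

Lemma expRN_quadratic (x : R) : 0 <= x -> `|expR (- x) - 1 + x| <= x ^+ 2.
Proof.
move=> x0; have x1 : 0 < 1 + x by rewrite ltr_wpDr.
have h1 : 1 - x <= expR (- x) by exact: expR_ge1Dx.
have h2 : expR (- x) <= (1 + x)^-1.
  by rewrite expRN lef_pV2 ?posrE ?expR_gt0// expR_ge1Dx.
have h3 : (1 + x)^-1 <= 1 - x + x ^+ 2.
  rewrite -[leLHS]mul1r ler_pdivrMr//.
  rewrite (_ : _ * (1 + x) = 1 + x ^+ 3); last by ring.
  by rewrite lerDl exprn_ge0.
by rewrite ger0_norm; lra.
Qed.

(** One step of a damped pairing: [m' - m] is close to [- S * D * m], which the exponential weight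
    compensates to first order; [expRN_quadratic] pays for the rest. *)
Lemma weighted_step (w m m' D S e C C1 : R) : 0 <= w <= 1 -> 0 <= D -> 0 <= S ->
  `|m| <= C1 -> `|m' - m + S * D * m| <= (e + C * D) * D ->
  `|w * m' - w * expR (- (S * D)) * m| <= e * D + (C + S ^+ 2 * C1) * D ^+ 2.
Proof.
move=> /andP[w0 w1] D0 S0 b2 b1.
have -> : w * m' - w * expR (- (S * D)) * m =
  w * (m' - m + S * D * m) - w * (expR (- (S * D)) - 1 + S * D) * m by ring.
have b3 : `|expR (- (S * D)) - 1 + S * D| <= (S * D) ^+ 2.
  by apply: expRN_quadratic; rewrite mulr_ge0.
rewrite (le_trans (ler_normB _ _))// !normrM (ger0_norm w0).
rewrite (_ : e * D + _ = (e + C * D) * D + S ^+ 2 * C1 * D ^+ 2); last by ring.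
apply: lerD; first by rewrite (le_trans _ b1)// ler_piMl.
rewrite (_ : S ^+ 2 * C1 * D ^+ 2 = 1 * (S * D) ^+ 2 * C1); last by ring.
by rewrite ler_pM// ?mulr_ge0// ler_pM.
Qed.

(** A derivative bound without derivatives: over [n.+1] equal steps the quadratic errors add up to
    [C * t ^+ 2 / n.+1%:R], which disappears as [n] grows. *)
Lemma telescope_bound (H : R -> R) (t e C : R) : 0 <= t -> 0 <= C ->
  (forall s s', 0 <= s -> s <= s' -> s' <= t -> `|H s' - H s| <= e * (s' - s) + C * (s' - s) ^+ 2) ->
  `|H t - H 0| <= e * t.
Proof.
move=> t0 C0 hH.
have main (n : nat) : `|H t - H 0| <= e * t + C * t ^+ 2 / n.+1%:R.
  pose g (i : nat) := t * i%:R / n.+1%:R.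
  have dg i : g i.+1 - g i = t / n.+1%:R by rewrite /g -mulrBl -mulrBr -[i.+1%:R]natr1 addrAC subrr add0r mulr1.
  have n0 : 0 <= t / n.+1%:R by rewrite divr_ge0.
  have step (k : nat) : (k <= n.+1)%N -> `|H (g k) - H (g 0)| <= k%:R * (e * (t / n.+1%:R) + C * (t / n.+1%:R) ^+ 2).
    elim: k => [|k IH] kn; first by rewrite subrr normr0 mul0r.
    rewrite -(subrKA (H (g k))) (le_trans (ler_normD _ _))// -natr1 mulrDl mul1r addrC lerD//.
      by apply: IH; exact: ltnW.
    rewrite -(dg k); apply: hH.
    - by rewrite /g divr_ge0// mulr_ge0.
    - by rewrite -subr_ge0 dg.
    - by rewrite /g ler_pdivrMr// ler_wpM2l// ler_nat.
  have := step n.+1 (leqnn _).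
  rewrite (_ : g n.+1 = t); last by rewrite /g mulfK// pnatr_eq0.
  rewrite (_ : g 0%N = 0); last by rewrite /g mulr0 mul0r.
  move=> /le_trans; apply.
  have : n.+1%:R != 0 :> R by rewrite pnatr_eq0.
  move: n.+1%:R => m m0; rewrite le_eqVlt; apply/orP; left; apply/eqP; by field.
have c : (fun n : nat => e * t + C * t ^+ 2 * n.+1%:R^-1) @ \oo --> e * t.
  rewrite -[X in _ --> X]addr0; apply: cvgD; first exact: cvg_cst.
  rewrite -[X in _ --> X](mulr0 (C * t ^+ 2)); apply: cvgM; first exact: cvg_cst.
  exact: cvg_harmonic.
apply: (ler_cvg_to (@cvg_cst _ `|H t - H 0| _ \oo _) c).
by apply: nearW => n; exact: main.
Qed.

Lemma telescope_bound_itv (H : R -> R) (a t e C : R) : a <= t -> 0 <= C ->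
  (forall s s', a <= s -> s <= s' -> s' <= t -> `|H s' - H s| <= e * (s' - s) + C * (s' - s) ^+ 2) ->
  `|H t - H a| <= e * (t - a).
Proof.
move=> a_t C0 hH; have ta : 0 <= t - a by rewrite subr_ge0.
have := @telescope_bound (fun r => H (a + r)) (t - a) e C ta C0.
rewrite addr0 (_ : a + (t - a) = t); last by ring.
apply => s s' s0 ss' s't.
have := hH (a + s) (a + s'); rewrite (_ : a + s' - (a + s) = s' - s); last by ring.
by apply; [rewrite lerDl|rewrite lerD2l|rewrite -lerBrDl].
Qed.

Lemma Rintegral_reflect (h : R -> R) (a b c : R) : a <= b -> continuous h ->
  \int[lebesgue_measure]_(s in `[a, b]) h (c - s) = \int[lebesgue_measure]_(s in `[c - b, c - a]) h s.
Proof.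
move=> ab ch; rewrite /Rintegral.
have dF (x : R) : is_derive x (1 : R) (fun x : R => c - x) (-1 : R).
  have := is_deriveB (is_derive_cst c x (1 : R)) (is_derive_id x (1 : R)).
  by rewrite sub0r.
have DF : derive1 (fun x : R => c - x) = cst (-1).
  by apply/funext => x; rewrite derive1E; case: (dF x).
have cF : continuous (fun x : R => c - x).
  by move=> x; apply: differentiable_continuous; apply/derivable1_diffP; case: (dF x).
rewrite (@integration_by_substitution_decreasing R (fun x => c - x) h a b ab).
- by congr fine; apply: eq_integral => x _; rewrite !fctE DF /= opprK mulr1.
- by move=> x y _ _ xy; rewrite ltrD2l ltrN2.
- by rewrite DF => x _; exact: cvg_cst.
- by rewrite DF; exact: is_cvg_cst.
- by rewrite DF; exact: is_cvg_cst.
- split=> [x _| |]; first by case: (dF x).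
    by apply: cvg_at_right_filter; exact: cF.
  by apply: cvg_at_left_filter; exact: cF.
- exact: continuous_subspaceT.
Qed.

End IntervalTools.

(** * The backward equation and its Picard iterates *)

Section DualIteration.
Context {R : realType} {d : nat}.
Local Notation Rd := 'rV[R]_d.
Local Notation Td := (torus R d).
Local Notation X := (Td * Rd)%type.
Local Notation RT := (measurableTypeR R).
Local Notation phase := (borel (Td * Rd)%type).
Variable V : set Rd.
Hypothesis oV : open V.
Variable p : Rd -> Rd -> R.
Hypothesis pk : transition_kernel V p.
Variable sigma : Td -> R.
Hypothesis csigma : continuous sigma.
Variable Sg : R.
Hypothesis sigma_itv : forall x, 0 <= sigma x <= Sg.
Local Notation PV := (phase_set V : set X).
Local Notation K := (dual_kernel V p).
Local Notation dual_coll := (dual_coll V p sigma).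

(* Since [sigma <= Sg], adding [Sg] times the identity turns the collision operator into a positive one. *)
Definition gain (f : X -> R) (z : X) : R := Sg * f z + dual_coll f z.
Definition Qr (q : R) (g : X -> R) (z : X) : R := gain (g \o flow (- q)) (flow q z).

Lemma Sg_ge0 : 0 <= Sg.
Proof. by have /andP[/le_trans] := sigma_itv point; apply. Qed.

(** Thinning of a clock of rate [Sg]: a ring is a collision in the proportion sigma / Sg and leaves
    the state unchanged otherwise. Both coefficients are non-negative, hence the positivity of
    [gain]. *)
Lemma gainE f z : gain f z = (Sg - sigma z.1) * f z + sigma z.1 * K f z.
Proof. by rewrite /gain /dual_coll; ring. Qed.

Lemma gain_bnd f M z : PV z -> vmeasurable V f -> bnd V f M -> `|gain f z| <= Sg * M.
Proof.
move=> Pz mf fM; have /andP[s0 s1] := sigma_itv z.1.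
rewrite gainE (le_trans (ler_normD _ _))// !normrM (ger0_norm s0) ger0_norm ?subr_ge0//.
rewrite (_ : Sg * M = (Sg - sigma z.1) * M + sigma z.1 * M); last by ring.
rewrite lerD// ler_wpM2l ?subr_ge0//; first exact: fM.
exact: (dual_kernel_bnd oV pk Pz mf fM).
Qed.

Lemma gain_ge f z : PV z -> (forall z, PV z -> 0 <= f z) -> sigma z.1 * K f z <= gain f z.
Proof.
move=> Pz f0; have /andP[s0 s1] := sigma_itv z.1.
by rewrite gainE lerDr mulr_ge0 ?subr_ge0// f0.
Qed.

Lemma gain_ge0 f z : PV z -> (forall z, PV z -> 0 <= f z) -> 0 <= gain f z.
Proof.
move=> Pz f0; apply: le_trans (gain_ge Pz f0); have /andP[s0 _] := sigma_itv z.1.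
by rewrite mulr_ge0// (dual_kernel_ge0 pk Pz).
Qed.

Lemma gainD f g M M' z : PV z -> vmeasurable V f -> vmeasurable V g -> bnd V f M -> bnd V g M' ->
  gain (fun z => f z + g z) z = gain f z + gain g z.
Proof.
move=> Pz mf mg fM gM; rewrite /gain (dual_collD oV pk sigma Pz mf mg fM gM); ring.
Qed.

Lemma gainB f g M M' z : PV z -> vmeasurable V f -> vmeasurable V g -> bnd V f M -> bnd V g M' ->
  gain (fun z => f z - g z) z = gain f z - gain g z.
Proof.
move=> Pz mf mg fM gM; rewrite /gain (dual_collB oV pk sigma Pz mf mg fM gM); ring.
Qed.

Definition bounded_jcontinuous (g : R -> X -> R) := jcontinuous V g /\ exists C, forall q, bnd V (g q) C.

Lemma jcontinuous_vmeasurable g q r : jcontinuous V g -> vmeasurable V (g q \o flow r).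
Proof. by move=> cg; apply: (vmeasurable_cont oV); apply: cont_flow; exact: jcontinuous_fix. Qed.

Lemma Qr_bnd g C q z : jcontinuous V g -> bnd V (g q) C -> PV z -> `|Qr q (g q) z| <= Sg * C.
Proof.
move=> cg gC Pz; apply: (gain_bnd _ (jcontinuous_vmeasurable q (- q) cg)) => //.
by move=> z' Pz'; exact: gC.
Qed.

Lemma jcontinuous_Qr g : bounded_jcontinuous g -> jcontinuous V (fun q z => Qr q (g q) z).
Proof.
move=> [cg [C gC]].
have fc (a : R -> R) : continuous a -> continuous (fun y : R * X => flow (a y.1) y.2).
  move=> ca y; apply: (@continuous_comp _ _ _ (fun y : R * X => (a y.1, y.2)) (fun y : R * X => flow y.1 y.2));
    last exact: flow_continuous.
  have c1 : {for y, continuous (fun y : R * X => a y.1)}.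
    by apply: (@continuous_comp _ _ _ fst a); [exact: cvg_fst|exact: ca].
  exact: (cvg_pair c1 cvg_snd).
have cN : continuous (fun q : R => - q) by move=> q; apply: cvgN; exact: cvg_id.
have cI : continuous (fun q : R => q) by move=> q; exact: cvg_id.
have h1 : jcontinuous V (fun q z => g q (flow (- q) z)).
  by apply: (@jcontinuous_comp _ _ V g id (fun q z => flow (- q) z)) => //; exact: (fc _ cN).
have hb q : bnd V (fun z => g q (flow (- q) z)) C by move=> z Pz; exact: gC.
have h2 : jcontinuous V (fun q z => gain (fun z => g q (flow (- q) z)) z).
  apply: jcontinuousD; first by apply: jcontinuousM h1; exact: jcontinuous_cst.
  exact: (jcontinuous_dual_coll oV pk csigma h1 hb).
exact: (@jcontinuous_comp _ _ V _ id (fun q z => flow q z) h2 cI (fc _ cI)).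
Qed.

(** Compactness of the time interval makes joint continuity uniform in [q]. *)
Lemma jcontinuous_int_near h (a b : R) z : jcontinuous V h -> PV z -> forall e : R, 0 < e ->
  \forall z' \near z, forall q, `[a, b]%classic q -> `|h q z' - h q z| <= e.
Proof.
move=> ch Pz e e0.
have /compact_near_coveringP ncK := @segment_compact R a b.
have H : \forall z' \near z, `[a, b]%classic `<=` (fun q => `|h q z' - h q z| <= e).
  apply: (ncK X (nbhs z) (fun z' q => `|h q z' - h q z| <= e)) => q Iq.
  have e20 : 0 < e / 2 by rewrite divr_gt0.
  have /cvgrPdist_le/(_ _ e20) [[A B] /= [Aq Bz] AB] := ch q z Pz.
  exists (A, B) => //= -[q' z'] /= [Aq' Bz'].
  have h1 := AB (q', z') (conj Aq' Bz').
  have h2 := AB (q', z) (conj Aq' (nbhs_singleton Bz)).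
  move: h1 h2 => /=; set u := h q z; set v := h q' z'; set w := h q' z => h1 h2.
  rewrite (_ : v - w = (u - w) - (u - v)); last by ring.
  by rewrite (le_trans (ler_normB _ _))// [leRHS]splitr lerD.
by apply: filterS H => z' H q; exact: H.
Qed.

Lemma jcontinuous_tail h C (c : R -> R) (t : R) : jcontinuous V h -> (forall q, bnd V (h q) C) ->
  continuous c -> (forall s, c s <= t) ->
  jcontinuous V (fun s z => \int[lebesgue_measure]_(q in `[c s, t]) h q z).
Proof.
move=> ch hC cc ct s z Pz; apply/cvgrPdist_le => e e0.
have C0 := bnd_ge0 Pz (hC 0).
have e20 : 0 <= e / 2 by rewrite divr_ge0 ?ltW.
have e1 : 0 < e / 2 / (C + 1) by rewrite !divr_gt0// ltr_wpDl.
have e2 : 0 < e / 2 / (t - c s + 1) by rewrite !divr_gt0// ltr_wpDl// subr_ge0.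
have n1 : \forall s' \near s, `|c s - c s'| <= e / 2 / (C + 1).
  by have /cvgrPdist_le/(_ _ e1) := cc s.
have n2 := jcontinuous_int_near (c s) t ch Pz e2.
have nP : \forall z' \near z, PV z' by apply: open_nbhs_nbhs; split=> //; exact: PV_open.
exists ([set s' | `|c s - c s'| <= e / 2 / (C + 1)],
  [set z' | PV z' /\ forall q, `[c s, t]%classic q -> `|h q z' - h q z| <= e / 2 / (t - c s + 1)]).
  by split=> //=; exact: filterI.
move=> [s' z'] /= [hs [Pz' hz]].
have chz y : PV y -> continuous (fun q => h q y) by move=> Py; exact: (jcontinuous_fixz ch Py).
set A := \int[_]_(_ in _) _; set B := \int[_]_(_ in _) _.
rewrite -(subrKA (\int[lebesgue_measure]_(q in `[c s, t]) h q z')) (le_trans (ler_normD _ _))//.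
rewrite [leRHS]splitr lerD//.
  rewrite -RintegralB; [|exact: measurable_itv|by apply: cont_itv_integrable; exact: chz..].
  apply: (le_trans (@Rintegral_itv_bnd _ _ _ _ (e / 2 / (t - c s + 1)) (ct s) _ _)).
  - by apply: measurable_contR => q; apply: cvgB; exact: chz.
  - by move=> q qI; rewrite distrC; apply: hz; rewrite /= in_itv.
  - rewrite mulrAC ler_pdivrMr ?ltr_wpDl ?subr_ge0//.
    by rewrite ler_wpM2l// lerDl.
apply: (le_trans (integral_tail_lipschitz (C := C) (chz z' Pz') _ (ct s) (ct s'))).
  by move=> q; exact: hC.
rewrite (le_trans (ler_wpM2l C0 hs))// mulrCA ler_piMr//.
by rewrite ler_pdivrMr ?mul1r ?lerDl// ltr_wpDl.
Qed.

Variables (t : R) (t0 : 0 <= t).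

(** Times are projected onto [0, t] so that the iterates are defined, bounded and continuous at
    every real time, as [bounded_jcontinuous] requires. *)
Definition clamp (s : R) : R := Num.max 0 (Num.min s t).

Lemma clamp_le s : clamp s <= t.
Proof. by rewrite /clamp ge_max t0 ge_min lexx orbT. Qed.

Lemma clamp_ge0 s : 0 <= clamp s.
Proof. by rewrite /clamp le_max lexx. Qed.

Lemma clamp_id s : 0 <= s -> s <= t -> clamp s = s.
Proof. by move=> s0 st; rewrite /clamp (min_l st) (max_r s0). Qed.

Lemma clamp_continuous : continuous clamp.
Proof.
move=> s; apply: (@continuous_max R R (cst 0) (fun s => Num.min s t)); first exact: cvg_cst.
by apply: (@continuous_min R R id (cst t)); [exact: cvg_id|exact: cvg_cst].
Qed.

Definition dual_step (f : X -> R) (g : R -> X -> R) (s : R) (z : X) : R :=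
  f (flow t z) + \int[lebesgue_measure]_(q in `[clamp s, t]) Qr q (g q) z.

(* Picard iterates of the backward Duhamel equation with the damping removed; started from 0 they increase to
   its solution when [f >= 0], so a finite iterate is a lower bound. *)
Definition dual_iter (f : X -> R) (N : nat) : R -> X -> R := iter N (dual_step f) (fun _ _ => 0).
Arguments dual_iter : simpl never.

Lemma bounded_jcontinuous_step f g : Cb V f -> bounded_jcontinuous g -> bounded_jcontinuous (dual_step f g).
Proof.
move=> Cf bg; have [cf [M fM]] := Cf; have [cg [C gC]] := bg.
have cQ := jcontinuous_Qr bg.
have QC q : bnd V (Qr q (g q)) (Sg * C) by move=> z Pz; apply: Qr_bnd.
split.
  apply: jcontinuousD; first by apply: jcontinuous_space; exact: cont_flow.
  exact: (jcontinuous_tail cQ QC clamp_continuous clamp_le).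
exists (M + `|Sg * C| * t) => s z Pz.
rewrite (le_trans (ler_normD _ _))// lerD//; first exact: fM.
apply: (le_trans (@Rintegral_itv_bnd _ _ _ _ `|Sg * C| (clamp_le s) _ _)).
- by apply: measurable_contR; exact: (jcontinuous_fixz cQ).
- by move=> q _; rewrite (le_trans (QC q z Pz))// ler_norm.
- by rewrite ler_wpM2l// gerBl clamp_ge0.
Qed.

Lemma bounded_jcontinuous_iter f N : Cb V f -> bounded_jcontinuous (dual_iter f N).
Proof.
move=> Cf; elim: N => [|N IH]; last exact: bounded_jcontinuous_step.
by split; [exact: jcontinuous_cst|exists 0 => q z _; rewrite normr0].
Qed.

Lemma expR_tail (s : R) : s <= t ->
  \int[lebesgue_measure]_(q in `[s, t]) (Sg * expR (Sg * (t - q))) = expR (Sg * (t - s)) - 1.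
Proof.
move=> st.
have d1 (q : R) : is_derive q (1 : R) (fun q : R => Sg * (t - q)) (- Sg).
  by apply: is_derive_eq; rewrite /GRing.scale/=; ring.
have d2 (q : R) : is_derive q (1 : R) (fun q : R => - expR (Sg * (t - q))) (Sg * expR (Sg * (t - q))).
  have := is_deriveN (@is_derive1_comp _ (@expR R) (fun q : R => Sg * (t - q)) q _ _ (is_derive_expR (Sg * (t - q))) (d1 q)).
  by rewrite mulrN opprK mulrC.
rewrite (FTC2_C1 st d2).
  by rewrite subrr mulr0 expR0 opprK addrC.
move=> q; apply: cvgM; first exact: cvg_cst.
apply: (@continuous_comp _ _ _ (fun q : R => Sg * (t - q)) (@expR R)); last exact: continuous_expR.
by apply: cvgM; [exact: cvg_cst|apply: cvgB; [exact: cvg_cst|exact: cvg_id]].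
Qed.

(** [Qr] multiplies sup bounds by at most [Sg], and the weight y(s) = exp (Sg (t - s)) solves the
    scalar majorant equation in which y(s) - 1 is Sg times the integral of y over [s, t]. *)
Lemma int_Qr_weight g A s z : bounded_jcontinuous g -> PV z -> s <= t -> 0 <= s ->
  (forall q z, 0 <= q <= t -> PV z -> `|g q z| <= A * expR (Sg * (t - q))) ->
  `|\int[lebesgue_measure]_(q in `[s, t]) Qr q (g q) z| <= A * (expR (Sg * (t - s)) - 1).
Proof.
move=> bg Pz st s0 gA; have [cg [C gC]] := bg.
have cQ := jcontinuous_fixz (jcontinuous_Qr bg) Pz.
have ce : continuous (fun q : R => Sg * expR (Sg * (t - q))).
  move=> q; apply: cvgM; first exact: cvg_cst.
  apply: (@continuous_comp _ _ _ (fun q : R => Sg * (t - q)) (@expR R)); last exact: continuous_expR.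
  by apply: cvgM; [exact: cvg_cst|apply: cvgB; [exact: cvg_cst|exact: cvg_id]].
have I1 := cont_itv_integrable s t cQ.
have I2 := cont_itv_integrable s t ce.
have mI : measurable (`[s, t]%classic : set RT) by exact: measurable_itv.
apply: (le_trans (le_normr_Rintegral mI I1)).
rewrite -(expR_tail st) -RintegralZl//.
apply: le_Rintegral.
- exact: measurable_itv.
- exact: (integrable_norm I1).
- exact: (@integrableZl _ _ _ lebesgue_measure _ mI A (EFin \o (fun q : R => Sg * expR (Sg * (t - q)))) I2).
move=> q /=; rewrite in_itv/= => /andP[sq qt].
rewrite mulrCA; apply: Qr_bnd => // z' Pz'; apply: gA => //.
by rewrite (le_trans s0 sq).
Qed.

Lemma dual_iter_bnd f M N s z : Cb V f -> bnd V f M -> PV z -> 0 <= s <= t ->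
  `|dual_iter f N s z| <= M * expR (Sg * (t - s)).
Proof.
move=> Cf fM; elim: N s z => [|N IH] s z Pz /andP[s0 st].
  by rewrite /dual_iter/= normr0 mulr_ge0 ?expR_ge0//; exact: (bnd_ge0 Pz fM).
have IH' q y : 0 <= q <= t -> PV y -> `|dual_iter f N q y| <= M * expR (Sg * (t - q)).
  by move=> h Py; exact: IH.
rewrite /dual_iter iterS -/(dual_iter f N) /dual_step clamp_id//.
rewrite (le_trans (ler_normD _ _))// (_ : M * _ = M + M * (expR (Sg * (t - s)) - 1)); last by ring.
apply: lerD; first exact: fM.
exact: (int_Qr_weight (bounded_jcontinuous_iter N Cf) Pz st s0 IH').
Qed.

Lemma bounded_jcontinuousB g h : bounded_jcontinuous g -> bounded_jcontinuous h -> bounded_jcontinuous (fun q z => g q z - h q z).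
Proof.
move=> [cg [C gC]] [ch [C' hC]]; split; first exact: jcontinuousB.
by exists (C + C') => q z Pz; rewrite (le_trans (ler_normB _ _))// lerD//; [exact: gC|exact: hC].
Qed.

Lemma QrB g h q z : bounded_jcontinuous g -> bounded_jcontinuous h -> PV z ->
  Qr q (fun z => g q z - h q z) z = Qr q (g q) z - Qr q (h q) z.
Proof.
move=> [cg [C gC]] [ch [C' hC]] Pz.
apply: (gainB (M := C) (M' := C') (z := flow q z) Pz (jcontinuous_vmeasurable q (- q) cg) (jcontinuous_vmeasurable q (- q) ch)).
- by move=> y Py; exact: gC.
- by move=> y Py; exact: hC.
Qed.

Lemma QrD g h q z : bounded_jcontinuous g -> bounded_jcontinuous h -> PV z ->
  Qr q (fun z => g q z + h q z) z = Qr q (g q) z + Qr q (h q) z.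
Proof.
move=> [cg [C gC]] [ch [C' hC]] Pz.
apply: (gainD (M := C) (M' := C') (z := flow q z) Pz (jcontinuous_vmeasurable q (- q) cg) (jcontinuous_vmeasurable q (- q) ch)).
- by move=> y Py; exact: gC.
- by move=> y Py; exact: hC.
Qed.

(** Contraction factor of [dual_step] in the norm weighted by [expR (Sg * (t - s))]: the ratio of
    [expR (Sg * (t - s)) - 1] to the weight is largest at s = 0. *)
Let rho : R := 1 - expR (- (Sg * t)).

Lemma rho_itv : 0 <= rho < 1.
Proof.
rewrite /rho subr_ge0 ltrBlDr ltrDl expR_gt0 andbT.
by rewrite -[leRHS]expR0 ler_expR oppr_le0 mulr_ge0// Sg_ge0.
Qed.

Lemma dual_iter_contract f M N s z : Cb V f -> bnd V f M -> PV z -> 0 <= s <= t ->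
  `|dual_iter f N.+1 s z - dual_iter f N s z| <= rho ^+ N * M * expR (Sg * (t - s)).
Proof.
move=> Cf fM; elim: N s z => [|N IH] s z Pz st.
  by rewrite expr0 mul1r (_ : dual_iter f 0 s z = 0)// subr0; exact: dual_iter_bnd.
have /andP[s0 s1] := st.
have b1 := bounded_jcontinuous_iter N.+1 Cf; have b0 := bounded_jcontinuous_iter N Cf.
have IH' q y : 0 <= q <= t -> PV y ->
    `|dual_iter f N.+1 q y - dual_iter f N q y| <= rho ^+ N * M * expR (Sg * (t - q)).
  by move=> h Py; exact: IH.
have E k : dual_iter f k.+1 s z = f (flow t z) + \int[lebesgue_measure]_(q in `[s, t]) Qr q (dual_iter f k q) z.
  by rewrite {1}/dual_iter iterS -/(dual_iter f k) /dual_step clamp_id.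
rewrite !E opprD addrACA subrr add0r -RintegralB; last 3 first.
- exact: measurable_itv.
- by apply: cont_itv_integrable; exact: (jcontinuous_fixz (jcontinuous_Qr b1)).
- by apply: cont_itv_integrable; exact: (jcontinuous_fixz (jcontinuous_Qr b0)).
under eq_Rintegral do rewrite -(QrB _ b1 b0 Pz).
apply: (le_trans (int_Qr_weight (bounded_jcontinuousB b1 b0) Pz s1 s0 IH')).
have M0 := bnd_ge0 Pz fM; have /andP[r0 _] := rho_itv.
rewrite exprSr -!mulrA ler_wpM2l ?exprn_ge0// mulrCA ler_wpM2l//.
rewrite /rho mulrBl mul1r -expRD lerD2l lerN2 -[leRHS]expR0 ler_expR.
by rewrite mulrBr addrA addNr sub0r oppr_le0 mulr_ge0// Sg_ge0.
Qed.

Lemma dual_iterS f N s z : 0 <= s -> s <= t ->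
  dual_iter f N.+1 s z = f (flow t z) + \int[lebesgue_measure]_(q in `[s, t]) Qr q (dual_iter f N q) z.
Proof. by move=> s0 st; rewrite {1}/dual_iter iterS -/(dual_iter f N) /dual_step clamp_id. Qed.

Lemma dual_iter_ge0 f N s z : (forall z, PV z -> 0 <= f z) -> PV z -> 0 <= dual_iter f N s z.
Proof.
move=> f0; elim: N s z => [//|N IH] s z Pz.
rewrite /dual_iter iterS -/(dual_iter f N) /dual_step addr_ge0//; first exact: f0.
by apply: Rintegral_ge0 => q _; apply: gain_ge0 => // y Py; exact: IH.
Qed.

Lemma dual_iterD f g N s z : Cb V f -> Cb V g -> PV z ->
  dual_iter (fun z => f z + g z) N s z = dual_iter f N s z + dual_iter g N s z.
Proof.
move=> Cf Cg; elim: N s z => [|N IH] s z Pz; first by rewrite /dual_iter/= addr0.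
have bf := bounded_jcontinuous_iter N Cf; have bg := bounded_jcontinuous_iter N Cg.
rewrite /dual_iter !iterS -!/(dual_iter _ N) /dual_step addrACA; congr (_ + _).
rewrite -RintegralD; last 3 first.
- exact: measurable_itv.
- by apply: cont_itv_integrable; exact: (jcontinuous_fixz (jcontinuous_Qr bf)).
- by apply: cont_itv_integrable; exact: (jcontinuous_fixz (jcontinuous_Qr bg)).
apply: eq_Rintegral => q _; rewrite -(QrD q bf bg Pz).
have E y : PV y -> dual_iter (fun z => f z + g z) N q (flow (- q) y) = dual_iter f N q (flow (- q) y) + dual_iter g N q (flow (- q) y).
  by move=> Py; exact: IH.
rewrite /Qr /gain /dual_coll /= E//; congr (_ + _ * (_ - _)).
exact: eq_dual_kernel E.
Qed.


(** * Duality between a weak solution and the iterates *)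

Section Trajectory.
Variable mu : R -> probability phase R.
Hypothesis mu_prob : forall t, 0 <= t -> prob_on V (mu t).
Hypothesis mu_cont : forall phi : X -> R, Cb V phi ->
  {within `[0, +oo[, continuous (fun t => \int[mu t]_(z in PV) phi z)}.
Hypothesis mu_weak : mv_weak V p sigma mu.
Local Notation mt := (mt V mu).
Local Notation bt := (bt V p sigma mu).
Variables (f : X -> R) (Mf : R) (N : nat).
Hypotheses (Cf : Cb V f) (fM : bnd V f Mf).
Local Notation XS := (dual_iter f N.+1).
Local Notation YS := (dual_iter f N).

Lemma dual_iter_unif : exists2 C : R, 0 <= C & forall s z, 0 <= s <= t -> PV z ->
  [/\ `|XS s z| <= C, `|YS s z| <= C &
      `|XS s z - YS s z| <= rho ^+ N * `|Mf| * expR (Sg * t)].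
Proof.
have fM' : bnd V f `|Mf| by move=> z Pz; rewrite (le_trans (fM Pz))// ler_norm.
have ee s : 0 <= s <= t -> expR (Sg * (t - s)) <= expR (Sg * t).
  by move=> /andP[s0 _]; rewrite ler_expR ler_wpM2l ?Sg_ge0// gerBl.
have /andP[r0 _] := rho_itv.
exists (`|Mf| * expR (Sg * t)); first by rewrite mulr_ge0 ?expR_ge0.
move=> s z st Pz; split.
- by rewrite (le_trans (dual_iter_bnd N.+1 Cf fM' Pz st))// ler_wpM2l// ee.
- by rewrite (le_trans (dual_iter_bnd N Cf fM' Pz st))// ler_wpM2l// ee.
- rewrite (le_trans (dual_iter_contract N Cf fM' Pz st))// ler_wpM2l ?ee//.
  by rewrite mulr_ge0// exprn_ge0.
Qed.

Lemma dual_iter_lipschitz : exists2 C : R, 0 <= C & forall s s' z, 0 <= s <= t -> 0 <= s' <= t -> PV z ->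
  `|XS s z - XS s' z| <= C * `|s - s'|.
Proof.
have bY := bounded_jcontinuous_iter N Cf; have [cY [C YC]] := bY.
exists (Sg * `|C|); first by rewrite mulr_ge0// Sg_ge0.
move=> s s' z /andP[s0 st] /andP[s'0 s't] Pz.
rewrite !dual_iterS// opprD addrACA subrr add0r.
apply: integral_tail_lipschitz => //; first exact: (jcontinuous_fixz (jcontinuous_Qr bY)).
move=> q; apply: Qr_bnd => // y Py; by rewrite (le_trans (YC q y Py))// ler_norm.
Qed.

Lemma Cb_XS k s : Cb V (dual_iter f k s).
Proof.
have [cX [C XC]] := bounded_jcontinuous_iter k Cf.
by split; [exact: jcontinuous_fix|exists C; exact: XC].
Qed.

Lemma mtB g h M M' s : pmeasurable V g -> bnd V g M -> pmeasurable V h -> bnd V h M' ->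
  mt s (fun z => g z - h z) = mt s g - mt s h.
Proof.
move=> mg gM mh hM; rewrite /mt -(RintegralB (measurable_PV oV) (mt_integrable oV mu s mg gM) (mt_integrable oV mu s mh hM)).
exact: eq_Rintegral.
Qed.

Lemma bt_mt r g : bt r g = mt r (fun z => dual_coll (g \o flow (- r)) (flow r z)).
Proof. by apply: eq_Rintegral => z _; rewrite flowKN. Qed.

(** Formally [mt s (XS s)] has derivative [bt s (XS s) - mt s (Qr s (YS s))]. As [Qr s (XS s)] is
    [Sg * XS s] plus exactly the collision term of [bt], this is [- Sg * mt s (XS s)] up to [Qr] of
    the gap between [XS] and [YS], which is of order [rho ^+ N]. *)
Lemma dual_local : exists2 C : R, 0 <= C & forall s s', 0 <= s -> s <= s' -> s' <= t ->
  `|mt s' (XS s') - mt s (XS s) + Sg * (s' - s) * mt s (XS s)|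
    <= (Sg * (rho ^+ N * `|Mf| * expR (Sg * t)) + C * (s' - s)) * (s' - s).
Proof.
have [C0 C00 HC] := dual_iter_unif; have [L L0 HL] := dual_iter_lipschitz.
have S0 := Sg_ge0.
pose e := rho ^+ N * `|Mf| * expR (Sg * t).
(* The three terms come from moving the measure from [q] to [s], from replacing [XS s'] by [XS q]
   inside the collision operator, and from replacing [XS q] by [XS s] in the damping. *)
exists (2 * Sg * (2 * Sg * C0) + 2 * Sg * L + Sg * L).
  by rewrite !addr_ge0 ?mulr_ge0.
move=> s s' s0 ss' s't.
have st : 0 <= s <= t by rewrite s0 (le_trans ss').
have s't' : 0 <= s' <= t by rewrite (le_trans s0 ss').
have bX := bounded_jcontinuous_iter N.+1 Cf; have bY := bounded_jcontinuous_iter N Cf.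
have PX k q : pmeasurable V (dual_iter f k q) by exact: (Cb_measurable oV (Cb_XS k q)).
have X0 q : 0 <= q <= t -> bnd V (XS q) C0 by move=> qt z Pz; case: (HC q z qt Pz).
have cQ := jcontinuous_Qr bY.
have [cY [CY YC]] := bY.
have QC q : bnd V (Qr q (YS q)) (Sg * CY) by move=> z Pz; exact: Qr_bnd.
have PQ q : pmeasurable V (Qr q (YS q)) by apply: (measurable_PVcont oV); exact: (@jcontinuous_fix _ _ _ _ q cQ).
have jQ : jmeasurable V (fun q z => Qr q (YS q) (flow (- s) z)).
  have jq : jmeasurable V (fun q z => Qr q (YS q) z) := measurable_jcontinuous oV cQ.
  by have := jmeasurable_flow oV (@cst_continuous R R (- s)) jq; exact.
have jQC q : bnd V (fun z => Qr q (YS q) (flow (- s) z)) (Sg * CY) by move=> z Pz; exact: QC.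
have mI : measurable (`[s, s']%classic : set RT) by exact: measurable_itv.
have E1 : mt s (XS s) - mt s (XS s') = \int[lebesgue_measure]_(q in `[s, s']) mt s (Qr q (YS q)).
  rewrite -(mtB s (PX _ _) (X0 s st) (PX _ _) (X0 s' s't')).
  rewrite -(Rintegral_swap_time oV s s' jQ jQC (mu s)).
  apply: eq_Rintegral => z; rewrite inE => Pz /=.
  have /andP[? ?] := st; have /andP[? ?] := s't'.
  rewrite !dual_iterS// opprD addrACA subrr add0r.
  rewrite (Rintegral_itv_split ss' s't); first by rewrite addrK.
  by apply: cont_itv_integrable; exact: (jcontinuous_fixz cQ).
have E2 := Cb_duhamel_itv oV pk csigma sigma_itv mu_prob mu_cont mu_weak (Cb_XS N.+1 s') s0 ss'.
have [_ _ mb _] := Cb_duhamel oV pk csigma sigma_itv mu_prob mu_cont mu_weak (Cb_XS N.+1 s').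
have mb' : measurable_fun (`[s, s']%classic : set RT) (fun r => bt r (XS s')).
  apply: measurable_funS (mb s') => //.
  by move=> r /=; rewrite !in_itv/= => /andP[/(le_trans s0)-> ->].
have mq : measurable_fun (`[s, s']%classic : set RT) (fun q => mt s (Qr q (YS q))).
  have mPV := @measurable_PV R d V oV.
  have jQC' (z : phase) (q : RT) : PV z -> `[s, s']%classic q -> `|Qr q (YS q) (flow (- s) z)| <= Sg * CY.
    by move=> Pz _; exact: jQC.
  have h := @measurable_Rintegral_bnd2 _ _ phase RT R (mu s) PV `[s, s']%classic _ _ mPV mI (jmeasurable_swap oV jQ) jQC' (mu_lty oV mu s).
  exact: h.
(* The increment is the integral of [phi]: in the first term the measure moves, in the second the
   observable, and the third compensates the damping. *)
pose phi (q : R) := bt q (XS s') - mt s (Qr q (YS q)) + Sg * mt s (XS s).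
have Ib : lebesgue_measure.-integrable (`[s, s']%classic : set RT) (EFin \o (fun r : RT => bt r (XS s'))).
  apply: (@integrable_bnd _ RT R lebesgue_measure `[s, s']%classic _ (2 * Sg * C0) mI (itv_lty _ _) mb').
  move=> r /=; rewrite in_itv/= => /andP[sr _].
  by apply: (bt_bnd oV pk csigma sigma_itv mu_prob (le_trans s0 sr) (PX _ _)); exact: X0.
have Iq : lebesgue_measure.-integrable (`[s, s']%classic : set RT) (EFin \o (fun q : RT => mt s (Qr q (YS q)))).
  apply: (@integrable_bnd _ RT R lebesgue_measure `[s, s']%classic _ (Sg * CY) mI (itv_lty _ _) mq).
  by move=> r _; exact: (mt_bnd oV mu_prob s0 (PQ r) (QC r)).
have Ic (c : R) : lebesgue_measure.-integrable (`[s, s']%classic : set RT) (EFin \o (fun=> c)).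
  by apply: cont_itv_integrable; exact: cst_continuous.
have E3 : mt s' (XS s') - mt s (XS s) + Sg * (s' - s) * mt s (XS s) = \int[lebesgue_measure]_(q in `[s, s']) phi q.
  rewrite /phi (RintegralD mI (integrableB mI Ib Iq) (Ic _)) (RintegralB mI Ib Iq) -E1 -E2.
  rewrite (Rintegral_itv_cst _ ss').
  by move: (mt s' (XS s')) (mt s (XS s)) (mt s (XS s')) => a b c; ring.
rewrite E3; apply: Rintegral_itv_bnd => //.
  apply: measurable_funD; last exact: measurable_cst.
  exact: measurable_funB.
move=> q /andP[sq qs'].
have q0 : 0 <= q by exact: le_trans sq.
have qt : 0 <= q <= t by rewrite q0 (le_trans qs').
(* Written with [G], the term [bt q] becomes an [mt q], and the Lipschitz bound on [mt] brings the
   measure back from time [q] to time [s]. *)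
pose G z := dual_coll (XS s' \o flow (- q)) (flow q z).
have PG : pmeasurable V G.
  by apply: (pmeasurable_flow oV q); exact: (pmeasurable_Bflow oV pk csigma q (PX _ _) (X0 s' s't')).
have GC : bnd V G (2 * Sg * C0).
  by move=> z Pz; exact: (Bflow_bnd oV pk sigma_itv q (PX _ _) (X0 s' s't')).
have CG : Cb V G.
  apply: (Cb_flow q); apply: (Cb_dual_coll oV pk csigma sigma_itv); apply: Cb_flow; exact: Cb_XS.
have e1 : `|bt q (XS s') - mt s G| <= 2 * Sg * (2 * Sg * C0) * (s' - s).
  rewrite bt_mt (le_trans (Cb_mt_lipschitz oV pk csigma sigma_itv mu_prob mu_cont mu_weak CG GC s0 sq))//.
  by rewrite ler_wpM2l ?mulr_ge0// lerB.
have e2 : `|mt s G - mt s (Qr q (YS q)) + Sg * mt s (XS s)| <= Sg * e + (2 * Sg * L + Sg * L) * (s' - s).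
  have hB : bnd V (fun z => G z - Qr q (YS q) z) (2 * Sg * C0 + Sg * CY).
    by move=> z Pz; rewrite (le_trans (ler_normB _ _))// lerD//; [exact: GC|exact: QC].
  have hZ : bnd V (fun z => Sg * XS s z) (Sg * C0).
    by move=> z Pz; rewrite normrM (ger0_norm S0) ler_wpM2l//; exact: X0.
  have PB : pmeasurable V (fun z => G z - Qr q (YS q) z) by exact: (measurable_funB PG (PQ q)).
  have PZ : pmeasurable V (fun z => Sg * XS s z) by apply: measurable_funM; [exact: measurable_cst|exact: PX].
  rewrite -(mtB s PG GC (PQ q) (QC q)) -(mtZ oV mu Sg s (PX N.+1 s) (X0 s st)).
  rewrite -(mtD oV mu s PB hB PZ hZ).
  apply: (mt_bnd oV mu_prob s0); first exact: (measurable_funD PB PZ).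
  move=> z Pz.
  have [vX vX' vY] : [/\ vmeasurable V (XS q \o flow (- q)), vmeasurable V (XS s' \o flow (- q)) & vmeasurable V (YS q \o flow (- q))].
    by split; apply: (pmeasurable_vmeasurable oV); apply: (pmeasurable_flow oV); exact: PX.
  have bXq : bnd V (XS q \o flow (- q)) C0 by move=> y Py; exact: X0.
  have bXs' : bnd V (XS s' \o flow (- q)) C0 by move=> y Py; exact: X0.
  have t1 : `|G z - dual_coll (XS q \o flow (- q)) (flow q z)| <= 2 * Sg * (L * (s' - s)).
    rewrite /G -(dual_collB oV pk sigma (z := flow q z) Pz vX' vX bXs' bXq).
    apply: (dual_coll_bnd oV pk sigma_itv (z := flow q z) Pz); first by move=> x; exact: measurable_funB.
    move=> y Py /=; apply: (le_trans (HL s' q (flow (- q) y) s't' qt Py)).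
    by apply: (ler_wpM2l L0); rewrite ger0_norm ?subr_ge0// lerB.
  have t2 : `|Qr q (fun z => XS q z - YS q z) z| <= Sg * e.
    have [cXY _] := bounded_jcontinuousB bX bY.
    have bXY : bnd V (fun z => XS q z - YS q z) e by move=> y Py; case: (HC q y qt Py).
    exact: (Qr_bnd (g := fun q z => XS q z - YS q z) cXY bXY Pz).
  have t3 : `|XS s z - XS q z| <= L * (s' - s).
    apply: (le_trans (HL s q z st qt Pz)); apply: (ler_wpM2l L0); rewrite distrC.
    by rewrite ger0_norm ?subr_ge0// lerB.
  rewrite (QrB q bX bY Pz) in t2.
  have t4 : Qr q (XS q) z = Sg * XS q z + dual_coll (XS q \o flow (- q)) (flow q z).
    by rewrite /Qr /gain /= flowNK.
  have -> : G z - Qr q (YS q) z + Sg * XS s z = (G z - dual_coll (XS q \o flow (- q)) (flow q z))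
      + (Qr q (XS q) z - Qr q (YS q) z) + Sg * (XS s z - XS q z) by rewrite t4; ring.
  have -> : Sg * e + (2 * Sg * L + Sg * L) * (s' - s) = 2 * Sg * (L * (s' - s)) + Sg * e + Sg * (L * (s' - s)) by ring.
  rewrite (le_trans (ler_normD _ _))// lerD//.
    by rewrite (le_trans (ler_normD _ _))// lerD.
  by rewrite normrM (ger0_norm S0) ler_wpM2l.
have -> : phi q = (bt q (XS s') - mt s G) + (mt s G - mt s (Qr q (YS q)) + Sg * mt s (XS s)).
  by rewrite /phi; ring.
rewrite (le_trans (ler_normD _ _))// (le_trans (lerD e1 e2))// -/e.
by rewrite le_eqVlt; apply/orP; left; apply/eqP; ring.
Qed.

(** The damped quantity [E s * mt s (XS s)] is constant on [s0, t] up to the iteration error; at s =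
    t the iterate is [f \o flow t], which undoes the flow hidden in [mt t]. *)
Lemma dual_approx (s0 : R) : 0 <= s0 -> s0 <= t ->
  `|\int[mu t]_(z in PV) f z - expR (- (Sg * (t - s0))) * mt s0 (XS s0)|
  <= Sg * (rho ^+ N * `|Mf| * expR (Sg * t)) * (t - s0).
Proof.
move=> s00 s0t.
have [C C0 HC] := dual_local; have [C1 C10 H1] := dual_iter_unif; have S0 := Sg_ge0.
pose E (s : R) := expR (- (Sg * (t - s))).
pose H s := E s * mt s (XS s).
have Ht : H t = \int[mu t]_(z in PV) f z.
  rewrite /H /E subrr mulr0 oppr0 expR0 mul1r; apply: eq_Rintegral => z _.
  by rewrite dual_iterS// set_itv1 Rintegral_set1 addr0 flowKN.
rewrite -Ht -/(E s0) -/(H s0); set e := Sg * _.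
have K0 : 0 <= C + Sg ^+ 2 * C1 := addr_ge0 C0 (mulr_ge0 (exprn_ge0 2 S0) C10).
apply: (@telescope_bound_itv _ H s0 t e _ s0t K0) => s s' s0s ss' s't.
have ss0 : 0 <= s := le_trans s00 s0s.
have ts : 0 <= t - s' by rewrite subr_ge0.
have D0 : 0 <= s' - s by rewrite subr_ge0.
have st : 0 <= s <= t by rewrite ss0 (le_trans ss').
have Ew : 0 <= E s' <= 1.
  by rewrite /E expR_ge0/= -[leRHS]expR0 ler_expR oppr_le0; exact: (mulr_ge0 S0 ts).
have EE : E s = E s' * expR (- (Sg * (s' - s))) by rewrite /E -expRD; congr expR; ring.
rewrite /H EE; apply: (weighted_step Ew D0 S0 _ (HC s s' ss0 ss' s't)).
apply: (mt_bnd oV mu_prob ss0 (Cb_measurable oV (Cb_XS N.+1 s))) => z Pz.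
by case: (H1 s z st Pz).
Qed.

End Trajectory.

End DualIteration.

(** * Minorization by two collisions *)

Section Minorization.
Context {R : realType} {d : nat}.
Local Notation Rd := 'rV[R]_d.
Local Notation Td := (torus R d).
Local Notation X := (Td * Rd)%type.
Local Notation RT := (measurableTypeR R).
Local Notation phase := (borel (Td * Rd)%type).
Local Notation brow := (borel 'rV[R]_d).
Local Notation leb := (@lebesgue_row R d).
Variable V : set Rd.
Hypothesis oV : open V.
Variable p : Rd -> Rd -> R.
Hypothesis pk : transition_kernel V p.
Variable sigma : Td -> R.
Hypothesis csigma : continuous sigma.
Variable Sg : R.
Hypothesis sigma_itv : forall x, 0 <= sigma x <= Sg.
Local Notation PV := (phase_set V : set X).
Local Notation K := (dual_kernel V p).
Variables (v_star : Rd) (r0 gamma : R).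
Local Notation B := (eball v_star r0).
Hypothesis gamma0 : 0 < gamma.
Hypothesis BV : B `<=` V.
Hypothesis pB : forall v v', V v -> V v' -> gamma * \1_B v <= p v v'.

Definition fiber_avg (f : X -> R) (x : Td) : R := \int[leb]_(w in B) f (x, w : Rd).
(** An integral over T^d x B weighted by the collision rate where the second collision takes place;
    the unit cube is a fundamental domain of the torus. *)
Definition sigma_avg (f : X -> R) : R :=
  \int[leb]_(y in cube) (sigma (torus_pi (y : Rd)) * fiber_avg f (torus_pi (y : Rd))).
(** The reference measure of the minorization, Lebesgue measure on T^d x B, of total mass
    [ball_volume]. *)
Definition ball_avg (f : X -> R) : R :=
  \int[leb]_(w in B) \int[leb]_(y in cube) f (torus_pi (y : Rd), w : Rd).
Definition ball_volume : R := fine (leb B).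

Lemma measurable_B : measurable (B : set brow).
Proof. by apply: open_borel; exact: eball_open. Qed.

Lemma cube_lty : (leb cube < +oo)%E.
Proof. by rewrite lebesgue_cube ltry. Qed.

Lemma fine_cube : fine (leb cube) = 1.
Proof. by rewrite lebesgue_cube. Qed.

Lemma B_lty : (leb B < +oo)%E.
Proof. exact: eball_lty. Qed.

Lemma PB x w : B w -> PV (x, w).
Proof. by move=> Bw; split=> //; exact: BV. Qed.

Lemma ball_volume_ge0 : 0 <= ball_volume.
Proof. by rewrite fine_ge0. Qed.

Lemma dual_kernel_ball g M z : PV z -> pmeasurable V g -> bnd V g M -> (forall z, PV z -> 0 <= g z) ->
  gamma * fiber_avg g z.1 <= K g z.
Proof.
move=> Pz mg gM g0; have mV := measurable_V oV; have vg := pmeasurable_vmeasurable oV mg.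
have Ip := integrable_dual_kernel oV pk Pz vg gM.
have E : fiber_avg g z.1 = \int[leb]_(v in V) (\1_B v * g (z.1, v)).
  rewrite /fiber_avg Rintegral_mkcond [RHS]Rintegral_mkcond; apply: eq_Rintegral => v _.
  rewrite !patchE indicE; case: ifPn => [Bv|nBv].
    by rewrite (mem_set (BV (set_mem Bv)))/= mul1r.
  by rewrite /= mul0r; case: ifP.
have le v : V v -> gamma * (\1_B v * g (z.1, v)) <= p v z.2 * g (z.1, v).
  by move=> Vv; rewrite mulrA ler_wpM2r ?pB ?g0//; case: Pz.
have mi : measurable_fun (V : set brow) (fun v : brow => \1_B v * g (z.1, v)).
  apply: measurable_funM; last exact: vg.
  by apply: measurable_funTS; apply: measurable_indic; exact: measurable_B.
have I1 : leb.-integrable V (EFin \o (fun v : brow => gamma * (\1_B v * g (z.1, v)))).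
  apply: le_integrable Ip => //.
    by apply/measurable_EFinP; apply: measurable_funM; [exact: measurable_cst|exact: mi].
  move=> v Vv; rewrite /= lee_fin.
  have n0 : 0 <= gamma * (\1_B v * g (z.1, v)).
    apply: mulr_ge0; first exact: ltW.
    by apply: mulr_ge0; [rewrite indicE ler0n|exact: g0].
  by rewrite !ger0_norm ?le// (le_trans n0)// le.
rewrite E -RintegralZl//.
  by apply: le_Rintegral => // v Vv; exact: le.
have h := @integrableZl _ _ _ leb V mV gamma^-1 _ I1.
move: h; apply: (eq_integrable mV) => v _; rewrite /= -EFinM mulKf// gt_eqF.
Unshelve. all: by []. Qed.

Lemma measurable_pair_pi : measurable_fun setT (fun z : brow * brow => (torus_pi (z.1 : Rd), z.2 : Rd) : phase).
Proof.
apply: (@borel_fun_borel _ (brow * brow)%type X (fun z => (torus_pi (z.1 : Rd), z.2 : Rd))).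
have h : @borel_fun _ (brow * brow)%type (Rd * Rd)%type (fun z => (z.1 : Rd, z.2 : Rd)).
  apply: (borel_fun_pair countable_base_row countable_base_row).
    exact: (borel_borel_fun measurable_fst).
  exact: (borel_borel_fun measurable_snd).
exact: (borel_fun_comp (h := fun z : Rd * Rd => (torus_pi z.1, z.2) : X) (@torus_lift_continuous R d) h).
Qed.

Lemma measurable_sigma_pi : measurable_fun setT (fun y : brow => sigma (torus_pi (y : Rd))).
Proof.
have := @borel_fun_contfun _ brow R Rd setT id (fun v : Rd => sigma (torus_pi v)) openT.
rewrite preimage_setT; apply; last exact: borel_fun_idrow.
move=> v _; apply: (@continuous_comp _ _ _ torus_pi sigma); last exact: csigma.
exact: torus_pi_continuous.
Qed.

Lemma pmeasurable_pi2 f : pmeasurable V f -> measurable_fun (setT `*` B : set (brow * brow))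
  (fun z : brow * brow => f (torus_pi (z.1 : Rd), z.2 : Rd)).
Proof.
move=> mf; apply: (measurable_along (F := PV : set phase) (g := f : phase -> R)
  (f := fun z : brow * brow => (torus_pi (z.1 : Rd), z.2 : Rd) : phase)).
- exact: (measurable_PV oV).
- by move=> [y w] [_ /= Bw]; exact: PB.
- exact: mf.
- by apply: measurable_funTS; exact: measurable_pair_pi.
Qed.

Lemma measurable_fiber f M : pmeasurable V f -> bnd V f M ->
  measurable_fun setT (fun y : brow => fiber_avg f (torus_pi (y : Rd))).
Proof.
move=> mf fM; apply: (measurable_Rintegral_bnd _ measurable_B (pmeasurable_pi2 mf) _ B_lty) => //.
by move=> y w _ Bw; apply: fM; exact: PB.
Qed.

Lemma fiber_integrable f M x : pmeasurable V f -> bnd V f M -> leb.-integrable B (EFin \o (fun w : brow => f (x, w : Rd))).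
Proof.
move=> mf fM; apply: (@integrable_bnd _ brow R leb B _ M measurable_B B_lty).
  by apply: measurable_funS (pmeasurable_vmeasurable oV mf x); [exact: (measurable_V oV)|exact: BV].
by move=> w Bw; apply: fM; exact: PB.
Qed.

Lemma fiber_bnd f M x : pmeasurable V f -> bnd V f M -> `|fiber_avg f x| <= M * ball_volume.
Proof.
move=> mf fM; apply: (Rintegral_bnd measurable_B B_lty).
  by apply: measurable_funS (pmeasurable_vmeasurable oV mf x); [exact: (measurable_V oV)|exact: BV].
by move=> w Bw; apply: fM; exact: PB.
Qed.

Lemma fiber_ge0 f x : (forall z, PV z -> 0 <= f z) -> 0 <= fiber_avg f x.
Proof. by move=> f0; apply: Rintegral_ge0 => w Bw; apply: f0; exact: PB. Qed.

Lemma ball_covers (G : Rd -> R) (C : R) (x : Rd) (s : R) :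
  measurable_fun setT (G : brow -> R) -> (forall y, 0 <= G y <= C) -> periodic_row G ->
  0 < s -> 2 * Num.sqrt d%:R <= s * r0 ->
  2 ^- d * ball_volume * \int[leb]_(y in cube) G y <= \int[leb]_(w in B) G (x + s *: (w : Rd)).
Proof.
move=> mG G0 pG s0 sr.
have := @ball_covers_torus R d (EFin \o G) v_star x r0 s.
have mGx : measurable_fun setT (fun w : brow => G (x + s *: (w : Rd))).
  have h : measurable_fun setT (fun w : brow => (affine s x w : brow)) by exact: measurable_affine.
  have := measurableT_comp mG h; apply: eq_measurable_fun => w _.
  by rewrite /affine/= addrC.
have Gb y : `|G y| <= C by have /andP[? ?] := G0 y; rewrite ger0_norm.
have i1 : leb.-integrable cube (EFin \o (G : brow -> R)).
  by apply: (@integrable_bnd _ brow R leb cube _ C measurable_cube cube_lty) => //; exact: measurable_funTS.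
have i2 : leb.-integrable B (EFin \o (fun w : brow => G (x + s *: (w : Rd)))).
  by apply: (@integrable_bnd _ brow R leb B _ C measurable_B B_lty) => //; exact: measurable_funTS.
move=> H; rewrite /Rintegral -lee_fin.
rewrite [X in (_ <= X)%E]fineK; last exact: (integrable_fin_num measurable_B i2).
rewrite EFinM fineK; last exact: (integrable_fin_num measurable_cube i1).
rewrite EFinM /ball_volume fineK; last by rewrite ge0_fin_numE// B_lty.
apply: H => //.
- exact/measurable_EFinP.
- by move=> v; rewrite lee_fin; case/andP: (G0 v).
- by move=> y m mi; rewrite /= pG.
Qed.

Lemma torus_pi_periodic (h : Td -> R) : periodic_row (fun y : Rd => h (torus_pi y)).
Proof.
move=> x m mi; congr h; apply/torus_piP.
by rewrite addrAC subrr add0r.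
Qed.

(** With the velocity [w] spread over the ball, [ball_covers] says that the position after a flight
    of length [s] dominates 2^-d |B| times the uniform measure; there the second collision acts
    through [dual_kernel_ball]. *)
Lemma sigma_avg_le (f : X -> R) (M s : R) (z : X) : pmeasurable V f -> bnd V f M -> (forall z, PV z -> 0 <= f z) ->
  0 < s -> 2 * Num.sqrt d%:R <= s * r0 -> 
  gamma * (2 ^- d * ball_volume) * sigma_avg f <=
  \int[leb]_(w in B) (sigma (flow s (z.1, w : Rd)).1 * K f (flow s (z.1, w : Rd))).
Proof.
move=> mf fM f0 s0 sr.
have S0 := Sg_ge0 sigma_itv.
have mKf : pmeasurable V (fun z => sigma z.1 * K f z).
  by apply: measurable_funM; [exact: (pmeasurable_sigma oV csigma)|exact: (pmeasurable_dual_kernel oV pk mf fM)].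
have KfM : bnd V (fun z => sigma z.1 * K f z) (Sg * M).
  move=> y Py; have /andP[g0 g1] := sigma_itv y.1; rewrite normrM (ger0_norm g0).
  by rewrite ler_pM//; exact: (dual_kernel_bnd oV pk Py (pmeasurable_vmeasurable oV mf) fM).
pose G (y : Rd) := gamma * (sigma (torus_pi y) * fiber_avg f (torus_pi y)).
have mG : measurable_fun setT (G : brow -> R).
  apply: measurable_funM; first exact: measurable_cst.
  by apply: measurable_funM; [exact: measurable_sigma_pi|exact: measurable_fiber mf fM].
have G0 y : 0 <= G y <= gamma * (Sg * `|M * ball_volume|).
  have /andP[g0 g1] := sigma_itv (torus_pi y); have f1 := fiber_ge0 (torus_pi y) f0.
  rewrite !mulr_ge0 ?(ltW gamma0)//= ler_wpM2l ?(ltW gamma0)// ler_pM//.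
  rewrite (le_trans (ler_norm _))// (le_trans (fiber_bnd _ mf fM))//.
  by rewrite ler_norm.
have pG : periodic_row G by exact: (torus_pi_periodic (fun x => gamma * (sigma x * fiber_avg f x))).
have := ball_covers (repr z.1) mG G0 pG s0 sr.
have mi1 : leb.-integrable cube (EFin \o (fun y : brow => sigma (torus_pi (y : Rd)) * fiber_avg f (torus_pi (y : Rd)))).
  apply: (@integrable_bnd _ brow R leb cube _ (Sg * `|M * ball_volume|) measurable_cube cube_lty).
    by apply: measurable_funTS; apply: measurable_funM; [exact: measurable_sigma_pi|exact: measurable_fiber mf fM].
  move=> y _; have /andP[g0 g1] := sigma_itv (torus_pi y).
  rewrite normrM (ger0_norm g0) ler_pM// (le_trans (fiber_bnd _ mf fM))// ler_norm//.
rewrite RintegralZl//; last exact: measurable_cube.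
rewrite -/(sigma_avg f) mulrCA mulrA => /le_trans; apply.
apply: le_Rintegral.
- exact: measurable_B.
- apply: (@integrable_bnd _ brow R leb B _ (gamma * (Sg * `|M * ball_volume|)) measurable_B B_lty).
    have h : measurable_fun setT (fun w : brow => (affine s (repr z.1) w : brow)) by exact: measurable_affine.
    apply: measurable_funTS; have := measurableT_comp mG h; apply: eq_measurable_fun => w _.
    by rewrite /affine/= addrC.
  by move=> w _; have /andP[? ?] := G0 (repr z.1 + s *: (w : Rd)); rewrite ger0_norm.
- exact: (fiber_integrable z.1 (pmeasurable_flow oV s mKf) (bnd_flow s KfM)).
move=> w Bw.
have Py : PV (flow s (z.1, w)) by exact: PB.
have E : torus_pi (repr z.1 + s *: w) = (flow s (z.1, w)).1 by [].
rewrite /G E mulrCA; have /andP[g0 _] := sigma_itv (flow s (z.1, w)).1.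
by rewrite ler_wpM2l//; exact: (dual_kernel_ball Py mf fM f0).
Qed.

Lemma measurable_sigma_avg (F : R -> X -> R) M : jmeasurable V F -> (forall u, bnd V (F u) M) ->
  measurable_fun setT (fun u : RT => sigma_avg (F u)).
Proof.
move=> mF FM.
have m3 : measurable_fun (setT `*` B : set ((RT * brow) * brow))
    (fun y : (RT * brow) * brow => F y.1.1 (torus_pi (y.1.2 : Rd), y.2 : Rd)).
  apply: (measurable_along (F := setT `*` PV : set (RT * phase))
    (g := fun y : RT * phase => F y.1 y.2)
    (f := fun y : (RT * brow) * brow => (y.1.1, (torus_pi (y.1.2 : Rd), y.2 : Rd)) : RT * phase)).
  - exact: measurable_TPV.
  - by move=> [[u y] w] [_ /= Bw]; split=> //; exact: PB.
  - exact: mF.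
  - apply: measurable_funTS; apply: measurable_fun_pair.
      exact: (measurableT_comp measurable_fst measurable_fst).
    apply: (measurable_along (F := setT) (g := fun z : brow * brow => (torus_pi (z.1 : Rd), z.2 : Rd) : phase)
      (f := fun y : (RT * brow) * brow => (y.1.2, y.2))) => //; first exact: measurable_pair_pi.
    apply: measurable_fun_pair; last exact: measurable_snd.
    exact: (measurableT_comp measurable_snd measurable_fst).
have m2 : measurable_fun setT (fun y : RT * brow => fiber_avg (F y.1) (torus_pi (y.2 : Rd))).
  apply: (measurable_Rintegral_bnd _ measurable_B m3 _ B_lty) => //.
  by move=> y w _ Bw; apply: FM; exact: PB.
have m1 : measurable_fun (setT `*` cube : set (RT * brow))
    (fun y : RT * brow => sigma (torus_pi (y.2 : Rd)) * fiber_avg (F y.1) (torus_pi (y.2 : Rd))).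
  apply: measurable_funTS; apply: measurable_funM => //.
  exact: (measurableT_comp measurable_sigma_pi measurable_snd).
apply: (measurable_Rintegral_bnd (M := Sg * (M * ball_volume)) _ measurable_cube m1 _ cube_lty) => //.
move=> u y _ _ /=; have /andP[g0 g1] := sigma_itv (torus_pi y).
rewrite normrM (ger0_norm g0) ler_pM//.
exact: (fiber_bnd _ (jmeasurable_fix oV u mF) (FM u)).
Qed.

Lemma sigma_avg_bnd f M : pmeasurable V f -> bnd V f M -> `|sigma_avg f| <= Sg * (M * ball_volume).
Proof.
move=> mf fM; rewrite -[leRHS]mulr1 -fine_cube; apply: (Rintegral_bnd measurable_cube cube_lty).
  by apply: measurable_funTS; apply: measurable_funM; [exact: measurable_sigma_pi|exact: measurable_fiber mf fM].
move=> y _; have /andP[g0 g1] := sigma_itv (torus_pi y).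
rewrite normrM (ger0_norm g0) ler_pM//; exact: fiber_bnd.
Qed.

(** The first collision occurs at time [q], [u] runs over the window of the second one, and [F u] is
    what follows it. The assumption on [g] bounds it below by the histories that collide in [a, b],
    after flights long enough to cover the torus. *)
Lemma double_collision (F : R -> X -> R) (g : X -> R) (M Mg a b q : R) (z : X) :
  jmeasurable V F -> (forall u z, PV z -> 0 <= F u z <= M) -> pmeasurable V g -> bnd V g Mg -> 
  (forall z, PV z -> 0 <= g z) -> a <= b ->
  (forall u, a <= u -> 0 < u - q /\ 2 * Num.sqrt d%:R <= (u - q) * r0) ->
  (forall z, PV z -> \int[lebesgue_measure]_(u in `[a, b])
     (sigma (flow (u - q) z).1 * K (F u) (flow (u - q) z)) <= g z) ->
  PV z ->
  gamma ^+ 2 * (2 ^- d * ball_volume) * \int[lebesgue_measure]_(u in `[a, b]) sigma_avg (F u) <= K g z.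
Proof.
move=> mF F0M mg gM g0 ab uq hg Pz.
have FM u : bnd V (F u) M.
  by move=> y Py; have /andP[? ?] := F0M u y Py; rewrite ger0_norm.
have F0 u y : PV y -> 0 <= F u y by move=> Py; have /andP[] := F0M u y Py.
have S0 := Sg_ge0 sigma_itv.
pose h u z := sigma (flow (u - q) z).1 * K (F u) (flow (u - q) z).
have KM u : bnd V (fun z => sigma z.1 * K (F u) z) (Sg * M).
  move=> y Py; have /andP[? ?] := sigma_itv y.1; rewrite normrM (ger0_norm (_ : 0 <= sigma y.1))//.
  by rewrite ler_pM//; exact: (dual_kernel_bnd oV pk Py (pmeasurable_vmeasurable oV (jmeasurable_fix oV u mF)) (FM u)).
have hM u : bnd V (h u) (Sg * M) by move=> y Py; exact: (KM u (flow (u - q) y)).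
have mh : jmeasurable V h.
  have c : continuous (fun u : R => u - q) by move=> u; apply: cvgB; [exact: cvg_id|exact: cvg_cst].
  have m1 : jmeasurable V (fun u z => sigma z.1 * K (F u) z).
    by apply: measurable_funM; [exact: (jmeasurable_space oV (pmeasurable_sigma oV csigma))|exact: (jmeasurable_dual_kernel oV pk mF FM)].
  by have := jmeasurable_flow oV c m1; exact.
have mI : measurable (`[a, b]%classic : set RT) by exact: measurable_itv.
have mx : measurable_fun (setT `*` B : set (RT * brow)) (fun y : RT * brow => h y.1 (z.1, y.2)).
  apply: (measurable_along (F := setT `*` PV : set (RT * phase)) (g := fun y : RT * phase => h y.1 y.2)
    (f := fun y : RT * brow => (y.1, (z.1, y.2 : Rd)) : RT * phase)).
  - exact: measurable_TPV.
  - by move=> [u w] [_ /= Bw]; split=> //; exact: PB.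
  - exact: mh.
  - apply: measurable_funTS; apply: measurable_fun_pair; first exact: measurable_fst.
    apply: (measurable_along (F := setT) (g := fun y : phase * brow => (y.1.1, y.2) : phase)
      (f := fun y : RT * brow => (z : phase, y.2))) => //; first exact: measurable_replace.
    by apply: measurable_fun_pair; [exact: measurable_cst|exact: measurable_snd].
have mx' : measurable_fun (`[a, b]%classic `*` B : set (RT * brow)) (fun y : RT * brow => h y.1 (z.1, y.2)).
  by apply: measurable_funS mx => //; [exact: (measurableX measurableT measurable_B)|move=> [u w] [_ Bw]].
have xM (u : RT) (w : brow) : `[a, b]%classic u -> B w -> `|h u (z.1, w)| <= Sg * M.
  by move=> _ Bw; apply: hM; exact: PB.
have SW := @Rintegral_swap _ _ RT brow R (@lebesgue_measure R) leb `[a, b]%classic B mI measurable_B (itv_lty a b) B_lty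
  (fun y : RT * brow => h y.1 (z.1, y.2)) (Sg * M) mx' xM.
have mfib : measurable_fun (`[a, b]%classic : set RT) (fun u : RT => fiber_avg (h u) z.1).
  exact: (measurable_Rintegral_bnd mI measurable_B mx' xM B_lty).
have mfib2 : pmeasurable V (fun z => \int[lebesgue_measure]_(u in `[a, b]) h u z) by exact: (pmeasurable_int oV a b mh hM).
apply: (le_trans _ (dual_kernel_ball Pz mg gM g0)).
rewrite expr2 -!mulrA ler_wpM2l ?(ltW gamma0)//.
have step1 : \int[lebesgue_measure]_(u in `[a, b]) fiber_avg (h u) z.1 <= fiber_avg g z.1.
  rewrite SW; apply: le_Rintegral.
  - exact: measurable_B.
  - apply: (fiber_integrable (f := fun z => \int[lebesgue_measure]_(u in `[a, b]) h u z) (M := Sg * M * (b - a)) z.1 mfib2).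
    move=> y Py; apply: Rintegral_itv_bnd => //; last by move=> u _; exact: hM.
    by apply: (jmeasurable_fixz oV Py mh).
  - exact: (fiber_integrable z.1 mg gM).
  - move=> w Bw; have Pw : PV (z.1, w) by exact: PB.
    exact: (hg _ Pw).
apply: le_trans step1.
have iS : lebesgue_measure.-integrable (`[a, b]%classic : set RT) (EFin \o (fun u : RT => sigma_avg (F u))).
  apply: (@integrable_bnd _ RT R lebesgue_measure `[a, b]%classic _ (Sg * (M * ball_volume)) mI (itv_lty _ _)).
    by apply: measurable_funTS; exact: (measurable_sigma_avg mF FM).
  by move=> u _; exact: (sigma_avg_bnd (jmeasurable_fix oV u mF) (FM u)).
rewrite !mulrA -(RintegralZl _ mI iS).
apply: le_Rintegral.
- exact: mI.
- exact: (@integrableZl _ _ _ lebesgue_measure _ mI _ (EFin \o (fun u : RT => sigma_avg (F u)))).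
- apply: (@integrable_bnd _ RT R lebesgue_measure `[a, b]%classic _ (Sg * M * ball_volume) mI (itv_lty _ _) mfib).
  by move=> u _; exact: (fiber_bnd _ (jmeasurable_fix oV u mh) (hM u)).
- move=> u /=; rewrite in_itv/= => /andP[au _]; have [u0 ur] := uq u au.
  have := sigma_avg_le z (jmeasurable_fix oV u mF) (FM u) (F0 u) u0 ur.
  by rewrite !mulrA; exact.
Qed.

Lemma cube_shiftR (G : Rd -> R) (C : R) (x : Rd) : measurable_fun setT (G : brow -> R) ->
  (forall y, 0 <= G y <= C) -> periodic_row G ->
  \int[leb]_(y in cube) G ((y : Rd) + x) = \int[leb]_(y in cube) G y.
Proof.
move=> mG G0 pG; rewrite /Rintegral; congr fine.
apply: (cube_shift x (g := EFin \o (G : brow -> R))).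
- exact/measurable_EFinP.
- by move=> v; rewrite lee_fin; case/andP: (G0 v).
- by move=> y m mi; rewrite /= pG.
Qed.

Lemma measurable_triple (h : (R * Rd) * Rd -> R) : continuous h ->
  measurable_fun setT (fun y : (RT * brow) * brow => h ((y.1.1, y.1.2 : Rd), y.2 : Rd)).
Proof.
move=> ch.
have b1 : @borel_fun _ ((RT * brow) * brow)%type ((R * Rd) * Rd)%type (fun y => ((y.1.1, y.1.2 : Rd), y.2 : Rd)).
  apply: (borel_fun_pair (countable_base_prod countable_base_R countable_base_row) countable_base_row).
    apply: (borel_fun_pair countable_base_R countable_base_row).
      have h1 : measurable_fun setT (fun y : (RT * brow) * brow => y.1.1).
        exact: (measurableT_comp measurable_fst measurable_fst).
      exact: (@borel_fun_R _ ((RT * brow) * brow)%type R _ h1).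
    have h2 : measurable_fun setT (fun y : (RT * brow) * brow => y.1.2).
      exact: (measurableT_comp measurable_snd measurable_fst).
    exact: (borel_borel_fun h2).
  exact: (borel_borel_fun measurable_snd).
have := @borel_fun_contfun _ ((RT * brow) * brow)%type R ((R * Rd) * Rd)%type setT _ h openT _ b1.
by rewrite preimage_setT; apply=> y _; exact: ch.
Qed.

Variables (T kappa c : R).
Hypothesis T0 : 0 < T.
Hypothesis gcc : forall z, PV z ->
  kappa <= \int[lebesgue_measure]_(s in `[c - T, c]) sigma (flow (- (c - s)) z).1.

(** Translating the position by the flight [(c - s) *: w] turns the rate at the collision point into
    the rate along the backward characteristic of the final point. Once the integrals are exchanged,
    the control condition applies for each final point and velocity. *)
Lemma gcc_average f M : pmeasurable V f -> (forall z, PV z -> 0 <= f z <= M) ->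
  kappa * ball_avg f <= \int[lebesgue_measure]_(s in `[c - T, c]) sigma_avg (f \o flow (c - s)).
Proof.
move=> mf f0M.
have fM : bnd V f M by move=> y Py; have /andP[? ?] := f0M y Py; rewrite ger0_norm.
have S0 := Sg_ge0 sigma_itv.
pose sh (s : R) (w y : Rd) := sigma (torus_pi (y - (c - s) *: w)).
have sh_itv s w y : 0 <= sh s w y <= Sg by exact: sigma_itv.
pose Psi (s : R) (w y : Rd) := sh s w y * f (torus_pi y, w).
have Psi_itv s w y : B w -> 0 <= Psi s w y <= Sg * M.
  move=> Bw; have /andP[g0 g1] := sh_itv s w y.
  have /andP[h0 h1] := f0M (torus_pi y, w) (PB _ Bw).
  by rewrite mulr_ge0//= ler_pM.
have PsiM s w y : B w -> `|Psi s w y| <= Sg * M.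
  by move=> Bw; have /andP[? ?] := Psi_itv s w y Bw; rewrite ger0_norm.
have mI : measurable (`[c - T, c]%classic : set RT) by exact: measurable_itv.
have csh : continuous (fun u : (R * Rd) * Rd => sigma (torus_pi (u.2 - (c - u.1.1) *: u.1.2))).
  move=> u; apply: (@continuous_comp _ _ _ (fun u : (R * Rd) * Rd => torus_pi (u.2 - (c - u.1.1) *: u.1.2)) sigma); last exact: csigma.
  apply: (@continuous_comp _ _ _ (fun u : (R * Rd) * Rd => u.2 - (c - u.1.1) *: u.1.2) (@torus_pi R d)); last exact: torus_pi_continuous.
  have c1 : (fun u : (R * Rd) * Rd => u.1.1) @ u --> u.1.1.
    by apply: (@continuous_comp _ _ _ fst fst); exact: cvg_fst.
  have c2 : (fun u : (R * Rd) * Rd => u.1.2) @ u --> u.1.2.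
    by apply: (@continuous_comp _ _ _ fst snd); [exact: cvg_fst|exact: cvg_snd].
  have c3 : (fun u : (R * Rd) * Rd => u.2) @ u --> u.2 by exact: cvg_snd.
  exact: (cvgB c3 (cvgZ (cvgB (cvg_cst c) c1) c2)).
have msh := measurable_triple csh.
have mf3 : measurable_fun ((setT `*` B) `*` setT : set ((RT * brow) * brow))
    (fun y : (RT * brow) * brow => f (torus_pi (y.2 : Rd), y.1.2 : Rd)).
  apply: (measurable_along (F := setT `*` B : set (brow * brow))
    (g := fun z : brow * brow => f (torus_pi (z.1 : Rd), z.2 : Rd))
    (f := fun y : (RT * brow) * brow => (y.2, y.1.2))).
  - exact: (measurableX measurableT measurable_B).
  - by move=> [[u w] y] [[_ Bw] _].
  - exact: pmeasurable_pi2.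
  - apply: measurable_funTS; apply: measurable_fun_pair; first exact: measurable_snd.
    exact: (measurableT_comp measurable_snd measurable_fst).
have mB' : measurable (setT `*` B : set (RT * brow)) := measurableX measurableT measurable_B.
have mPsi : measurable_fun ((setT `*` B) `*` setT : set ((RT * brow) * brow))
    (fun y : (RT * brow) * brow => Psi y.1.1 (y.1.2 : Rd) (y.2 : Rd)).
  by apply: measurable_funM; [exact: measurable_funTS msh|exact: mf3].
have mPsiC : measurable_fun ((setT `*` B) `*` cube : set ((RT * brow) * brow))
    (fun y : (RT * brow) * brow => Psi y.1.1 (y.1.2 : Rd) (y.2 : Rd)).
  apply: measurable_funS mPsi; first exact: (measurableX mB' measurableT).
  by move=> [[u w] y] [[_ Bw] _].
have mH : measurable_fun (setT `*` B : set (RT * brow))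
    (fun y : RT * brow => \int[leb]_(v in cube) Psi y.1 (y.2 : Rd) (v : Rd)).
  apply: (measurable_Rintegral_bnd (M := Sg * M) mB' measurable_cube mPsiC _ cube_lty).
  by move=> [u w] y [_ Bw] _; exact: PsiM.
have mH' : measurable_fun (`[c - T, c]%classic `*` B : set (RT * brow))
    (fun y : RT * brow => \int[leb]_(v in cube) Psi y.1 (y.2 : Rd) (v : Rd)).
  by apply: measurable_funS mH => //; move=> [u w] [_ Bw].
have mPw s (w : Rd) : B w -> measurable_fun setT (fun y : brow => Psi s w (y : Rd)).
  move=> Bw; exact: (measurable_section1 mB' measurableT mPsi (x := (s : RT, w : brow)) (conj I Bw)).
have HM s w : B w -> `|\int[leb]_(v in cube) Psi s w (v : Rd)| <= Sg * M.
  move=> Bw; rewrite -[leRHS]mulr1 -fine_cube; apply: (Rintegral_bnd measurable_cube cube_lty).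
    by apply: measurable_funTS; exact: mPw.
  by move=> y _; exact: PsiM.
have stepa s : sigma_avg (f \o flow (c - s)) = \int[leb]_(w in B) \int[leb]_(v in cube) Psi s (w : Rd) (v : Rd).
  have mfs := pmeasurable_flow oV (c - s) mf; have fsM := bnd_flow (c - s) fM.
  have m2 : measurable_fun (cube `*` B : set (brow * brow))
      (fun z : brow * brow => sigma (torus_pi (z.1 : Rd)) * f (flow (c - s) (torus_pi (z.1 : Rd), z.2 : Rd))).
    apply: measurable_funM.
      by apply: measurable_funTS; exact: (measurableT_comp measurable_sigma_pi measurable_fst).
    apply: measurable_funS (pmeasurable_pi2 mfs); first exact: (measurableX measurableT measurable_B).
    by move=> [y w] [_ Bw].
  have m2M (y w : brow) : cube y -> B w -> `|sigma (torus_pi (y : Rd)) * f (flow (c - s) (torus_pi (y : Rd), w : Rd))| <= Sg * M.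
    move=> _ Bw; have /andP[g0 g1] := sigma_itv (torus_pi (y : Rd)).
    by rewrite normrM (ger0_norm g0) ler_pM//; apply: fsM; exact: PB.
  have := Rintegral_swap measurable_cube measurable_B cube_lty B_lty m2 m2M.
  rewrite /sigma_avg => E.
  rewrite (_ : \int[leb]_(y in cube) _ = \int[leb]_(y in cube) \int[leb]_(w in B)
      (sigma (torus_pi (y : Rd)) * f (flow (c - s) (torus_pi (y : Rd), w : Rd)))); last first.
    apply: eq_Rintegral => y _.
    by rewrite (RintegralZl (sigma (torus_pi (y : Rd))) measurable_B (fiber_integrable (torus_pi (y : Rd)) mfs fsM)).
  rewrite E; apply: eq_Rintegral => w; rewrite inE => Bw.
  have pP : periodic_row (Psi s w).
    move=> y m mi; rewrite /Psi /sh; congr (sigma _ * f (_, _)); apply/torus_piP.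
      by rewrite (addrC y) -(addrA m y) addrK.
    by rewrite addrAC subrr add0r.
  rewrite -(cube_shiftR ((c - s) *: w) (mPw s w Bw) (fun y => Psi_itv s w y Bw) pP).
  apply: eq_Rintegral => y _; rewrite /Psi /sh /= addrK; congr (_ * f (_, _)).
  by rewrite torus_translate_pi.
rewrite (_ : \int[lebesgue_measure]_(s in `[c - T, c]) _ =
    \int[lebesgue_measure]_(s in `[c - T, c]) \int[leb]_(w in B) \int[leb]_(v in cube) Psi s (w : Rd) (v : Rd)); last first.
  by apply: eq_Rintegral => s _; exact: stepa.
have HM' (s : RT) (w : brow) : `[c - T, c]%classic s -> B w -> `|\int[leb]_(v in cube) Psi s (w : Rd) (v : Rd)| <= Sg * M.
  by move=> _ Bw; exact: HM.
have SW := @Rintegral_swap _ _ RT brow R (@lebesgue_measure R) leb `[c - T, c]%classic B mI measurable_B (itv_lty (c - T) c) B_lty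
  (fun y : RT * brow => \int[leb]_(v in cube) Psi y.1 (y.2 : Rd) (v : Rd)) (Sg * M) mH' HM'.
rewrite SW /ball_avg.
have mfw (w : Rd) : B w -> measurable_fun setT (fun y : brow => f (torus_pi (y : Rd), w)).
  move=> Bw; exact: (measurable_section2 measurableT measurable_B (pmeasurable_pi2 mf) (y := (w : brow)) Bw).
have mfi : leb.-integrable B (EFin \o (fun w : brow => \int[leb]_(y in cube) f (torus_pi (y : Rd), w : Rd))).
  apply: (@integrable_bnd _ brow R leb B _ M measurable_B B_lty).
    have mpi : measurable_fun (cube `*` B : set (brow * brow)) (fun z : brow * brow => f (torus_pi (z.1 : Rd), z.2 : Rd)).
      apply: measurable_funS (pmeasurable_pi2 mf); first exact: (measurableX measurableT measurable_B).
      by move=> [y w] [_ Bw].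
    apply: (measurable_Rintegral_bnd2 (M := M) measurable_cube measurable_B mpi _ cube_lty).
    by move=> y w _ Bw; apply: fM; exact: PB.
  move=> w Bw; rewrite -[leRHS]mulr1 -fine_cube; apply: (Rintegral_bnd measurable_cube cube_lty).
    by apply: measurable_funTS; exact: mfw.
  by move=> y _; apply: fM; exact: PB.
rewrite -(RintegralZl _ measurable_B mfi).
apply: le_Rintegral; first exact: measurable_B.
- exact: (@integrableZl _ _ _ leb _ measurable_B kappa (EFin \o (fun w : brow => \int[leb]_(y in cube) f (torus_pi (y : Rd), w : Rd)))).
- apply: (@integrable_bnd _ brow R leb B _ (Sg * M * (c - (c - T))) measurable_B B_lty).
    exact: (measurable_Rintegral_bnd2 mI measurable_B mH' HM' (itv_lty (c - T) c)).
  move=> w Bw; apply: Rintegral_itv_bnd; first by rewrite gerBl ltW.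
    exact: (measurable_section2 mI measurable_B mH' (y := (w : brow)) Bw).
  by move=> s _; exact: HM.
move=> w Bw.
have mT : measurable (`[c - T, c]%classic `*` cube : set (RT * brow)) := measurableX mI measurable_cube.
have mPc : measurable_fun (`[c - T, c]%classic `*` cube : set (RT * brow)) (fun y : RT * brow => Psi y.1 w (y.2 : Rd)).
  apply: (measurable_along (F := (setT `*` B) `*` setT : set ((RT * brow) * brow))
    (g := fun y : (RT * brow) * brow => Psi y.1.1 (y.1.2 : Rd) (y.2 : Rd))
    (f := fun y : RT * brow => ((y.1, w : brow), y.2))).
  - exact: (measurableX mB' measurableT).
  - by move=> [u y] _.
  - exact: mPsi.
  - apply: measurable_funTS; apply: measurable_fun_pair; last exact: measurable_snd.
    by apply: measurable_fun_pair; [exact: measurable_fst|exact: measurable_cst].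
have pmeasurable' (s : RT) (y : brow) : `[c - T, c]%classic s -> cube y -> `|Psi s w (y : Rd)| <= Sg * M.
  by move=> _ _; exact: PsiM.
have SW2 := @Rintegral_swap _ _ RT brow R (@lebesgue_measure R) leb `[c - T, c]%classic cube mI measurable_cube (itv_lty (c - T) c) cube_lty
  (fun y : RT * brow => Psi y.1 w (y.2 : Rd)) (Sg * M) mPc pmeasurable'.
rewrite SW2.
have iw : leb.-integrable cube (EFin \o (fun y : brow => f (torus_pi (y : Rd), w))).
  apply: (@integrable_bnd _ brow R leb cube _ M measurable_cube cube_lty).
    by apply: measurable_funTS; exact: mfw.
  by move=> y _; apply: fM; exact: PB.
rewrite -(RintegralZl _ measurable_cube iw).
apply: le_Rintegral; first exact: measurable_cube.
- exact: (@integrableZl _ _ _ leb _ measurable_cube kappa (EFin \o (fun y : brow => f (torus_pi (y : Rd), w)))).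
- apply: (@integrable_bnd _ brow R leb cube _ (Sg * M * (c - (c - T))) measurable_cube cube_lty).
    exact: (measurable_Rintegral_bnd2 mI measurable_cube mPc pmeasurable' (itv_lty (c - T) c)).
  move=> y Cy; apply: Rintegral_itv_bnd; first by rewrite gerBl ltW.
    exact: (measurable_section2 mI measurable_cube mPc Cy).
  by move=> s _; exact: PsiM.
move=> y Cy.
have cs : continuous (fun s : R => sigma (flow (- (c - s)) (torus_pi (y : Rd), w)).1).
  have c1 : continuous (fun s : R => - (c - s)).
    by move=> s; apply: cvgN; apply: cvgB; [exact: cvg_cst|exact: cvg_id].
  move=> s; apply: (@continuous_comp _ _ _ (fun s : R => (- (c - s), (torus_pi (y : Rd), w) : X)) (fun u : R * X => sigma (flow u.1 u.2).1)).
    exact: (cvg_pair (c1 s) (cvg_cst _)).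
  apply: (@continuous_comp _ _ _ (fun u : R * X => flow u.1 u.2) (fun z : X => sigma z.1)).
    exact: flow_continuous.
  exact: sigma_fst_cont.
have E : \int[lebesgue_measure]_(s in `[c - T, c]) Psi s w (y : Rd) =
    (\int[lebesgue_measure]_(s in `[c - T, c]) sigma (flow (- (c - s)) (torus_pi (y : Rd), w)).1) * f (torus_pi (y : Rd), w).
  rewrite -(RintegralZr _ mI (cont_itv_integrable (c - T) c cs)).
  by apply: eq_Rintegral => s _; rewrite /Psi /sh /flow/= torus_translate_pi scaleNr.
rewrite E; apply: ler_wpM2r; first by have /andP[] := f0M _ (PB (torus_pi (y : Rd)) Bw).
by apply: gcc; exact: PB.
Qed.

End Minorization.

(** * Contraction in total variation *)

Section TotalVariation.
Context {R : realType} {d : nat}.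
Local Notation Rd := 'rV[R]_d.
Local Notation Td := (torus R d).
Local Notation X := (Td * Rd)%type.
Local Notation phase := (borel (Td * Rd)%type).
Variable V : set Rd.
Hypothesis oV : open V.
Local Notation PV := (phase_set V : set X).
Variables mu nu : probability phase R.
Hypotheses (mu1 : prob_on V mu) (nu1 : prob_on V nu).

Definition pairing (f : X -> R) : R := \int[mu]_(z in PV) f z - \int[nu]_(z in PV) f z.

Let prob_integrable (m : probability phase R) f : Cb V f -> m.-integrable (PV : set phase) (EFin \o f).
Proof.
move=> Cf; have [_ [M fM]] := Cf.
by apply: (integrable_bnd (measurable_PV oV) _ (Cb_measurable oV Cf) fM); exact: (mu_lty oV (fun=> m) 0).
Qed.

Lemma prob_on_bnd (m : probability phase R) f M : prob_on V m -> Cb V f -> bnd V f M ->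
  `|\int[m]_(z in PV) f z| <= M.
Proof.
move=> m1 Cf fM; rewrite -[leRHS]mulr1 (_ : 1 = fine (m PV)); last by rewrite m1.
by apply: (Rintegral_bnd (measurable_PV oV) _ (Cb_measurable oV Cf) fM); exact: (mu_lty oV (fun=> m) 0).
Qed.

Lemma pairingZ a f : Cb V f -> pairing (fun z => a * f z) = a * pairing f.
Proof.
move=> Cf; rewrite /pairing mulrBr -!RintegralZl//; do ?[exact: measurable_PV|exact: prob_integrable].
Qed.

(** Both measures have mass 1. This is what lets the minorized part of the dual solution, a
    constant, be subtracted at no cost. *)
Lemma pairingB_cst f a : Cb V f -> pairing (fun z => f z - a) = pairing f.
Proof.
move=> Cf; have Ca : Cb V (fun=> a) by split; [move=> z _; exact: cvg_cst|exists `|a|].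
have mPV := @measurable_PV R d V oV.
have m1 : fine (mu PV) = 1 by rewrite mu1.
have n1 : fine (nu PV) = 1 by rewrite nu1.
rewrite /pairing !RintegralB//; do ?exact: prob_integrable.
by rewrite !Rintegral_cst// m1 n1; ring.
Qed.

Lemma tv_set_sup : has_sup [set y | exists phi : X -> R,
    [/\ Cb V phi, (forall z, PV z -> `|phi z| <= 1) & y = pairing phi]].
Proof.
split.
  exists (pairing (fun=> 0)), (fun=> 0); split=> //.
    by split; [move=> z _; exact: cvg_cst|exists 0 => z _; rewrite normr0].
  by move=> z _; rewrite normr0.
exists 2 => _ [phi [Cphi phi1 ->]]; rewrite /pairing (le_trans (ler_norm _))//.
rewrite (le_trans (ler_normB _ _))// (_ : 2 = 1 + 1)// lerD//.
  exact: (prob_on_bnd mu1 Cphi phi1).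
exact: (prob_on_bnd nu1 Cphi phi1).
Qed.

Lemma pairing_le_tv f : Cb V f -> bnd V f 1 -> pairing f <= tv_dist V mu nu.
Proof.
move=> Cf f1; apply: sup_upper_bound; first exact: tv_set_sup.
by exists f.
Qed.

Lemma tv_ge0 : 0 <= tv_dist V mu nu.
Proof.
have C0 : Cb V (fun=> 0 : R) by split; [move=> z _; exact: cvg_cst|exists 0 => z _; rewrite normr0].
have := @pairing_le_tv (fun=> 0) C0 _.
rewrite /pairing !Rintegral_cst ?mul0r ?subr0; do ?exact: measurable_PV.
by apply=> z _; rewrite normr0.
Qed.

Lemma tv_le C : (forall f, Cb V f -> bnd V f 1 -> pairing f <= C) -> tv_dist V mu nu <= C.
Proof.
move=> H; apply: ge_sup; first by case: tv_set_sup.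
by move=> _ [phi [Cphi phi1 ->]]; exact: H.
Qed.

Lemma pairing_scaled f c : Cb V f -> bnd V f c -> 0 <= c -> pairing f <= c * tv_dist V mu nu.
Proof.
(* A zero bound cannot be divided out, but then [f] vanishes on [PV]. *)
move=> Cf fc; rewrite le_eqVlt => /predU1P[c0|c0].
  have f0 (m : probability phase R) : \int[m]_(z in PV) f z = 0.
    rewrite (_ : \int[m]_(z in PV) f z = \int[m]_(z in PV) (fun=> 0) z); last first.
      apply: eq_Rintegral => z; rewrite inE => Pz; apply/eqP.
      by rewrite -normr_le0 c0; exact: fc.
    by rewrite Rintegral_cst ?mul0r//; exact: measurable_PV.
  by rewrite /pairing !f0 -c0 mul0r subr0.
rewrite -ler_pdivrMl// -pairingZ//; apply: pairing_le_tv.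
  have [cf [M fM]] := Cf; split.
    by move=> z Pz; apply: cvgM; [exact: cvg_cst|exact: cf].
  by exists (`|c^-1| * M) => z Pz; rewrite normrM ler_wpM2l//; exact: fM.
move=> z Pz; rewrite normrM ger0_norm ?invr_ge0 ?(ltW c0)//.
by rewrite ler_pdivrMl// mulr1; exact: fc.
Qed.

End TotalVariation.


Section ContractionArithmetic.
Context {R : realType}.

Lemma shift_itv (x : R) : `|x| <= 1 -> 0 <= 1 + x <= 2.
Proof. by rewrite ler_norml => /andP[? ?]; apply/andP; split; lra. Qed.

(** Here [x1], [x], [x'] stand for the dual solutions of 1, f, -f and [b], [m], [m'] for their
    reference averages. Lower bounds for 1 + f and 1 - f and the upper bound for 1 confine [E * x]
    to the interval centred at [c * E * m] of half-width [1 - c * E * b]. *)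
Lemma contract_arith (E e c b x1 x x' m m' : R) : 0 < E -> E * e = 1 ->
  c * (b + m) <= x1 + x -> c * (b + m') <= x1 + x' -> x1 <= e -> 0 = x + x' -> 0 = m + m' ->
  `|E * x - c * E * m| <= 1 - c * E * b.
Proof.
move=> E0 EE L1 L2 U1 D3 A3.
have x'E : x' = - x by lra.
have m'E : m' = - m by lra.
rewrite x'E m'E in L2.
have := ler_wpM2l (ltW E0) L1; have := ler_wpM2l (ltW E0) L2; have := ler_wpM2l (ltW E0) U1.
rewrite EE !mulrDr !mulrN => h1 h2 h3.
have r1 : c * E * m = E * (c * m) by ring.
have r2 : c * E * b = E * (c * b) by ring.
by rewrite r1 r2 ler_norml; apply/andP; split; lra.
Qed.

End ContractionArithmetic.

(** * Doeblin contraction over one period *)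

Section Contraction.
Context {R : realType} {d : nat}.
Local Notation Rd := 'rV[R]_d.
Local Notation Td := (torus R d).
Local Notation X := (Td * Rd)%type.
Local Notation RT := (measurableTypeR R).
Local Notation phase := (borel (Td * Rd)%type).
Local Notation brow := (borel 'rV[R]_d).
Local Notation leb := (@lebesgue_row R d).
Variable V : set Rd.
Hypothesis oV : open V.
Variable p : Rd -> Rd -> R.
Hypothesis pk : transition_kernel V p.
Variable sigma : Td -> R.
Hypothesis csigma : continuous sigma.
Variable Sg : R.
Hypothesis sigma_itv : forall x, 0 <= sigma x <= Sg.
Local Notation PV := (phase_set V : set X).
Local Notation K := (dual_kernel V p).
Variables (v_star : Rd) (r0 gamma : R).
Local Notation B := (eball v_star r0).
Hypothesis gamma0 : 0 < gamma.
Hypothesis BV : B `<=` V.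
Hypothesis pB : forall v v', V v -> V v' -> gamma * \1_B v <= p v v'.
Variables (T kappa : R).
Hypotheses (T0 : 0 < T) (kappa0 : 0 < kappa).
Hypothesis gcc0 : forall z, PV z ->
  kappa <= \int[lebesgue_measure]_(s in `[0, T]) sigma (flow (- s) z).1.
Hypotheses (r00 : 0 < r0) (d0 : (0 < d)%N).

Lemma sigma_flow_continuous (a : R -> R) z : continuous a -> continuous (fun s : R => sigma (flow (a s) z).1).
Proof.
move=> ca s; apply: (@continuous_comp _ _ _ (fun s : R => (a s, z)) (fun u : R * X => sigma (flow u.1 u.2).1)).
  exact: (cvg_pair (ca s) (cvg_cst _)).
apply: (@continuous_comp _ _ _ (fun u : R * X => flow u.1 u.2) (fun z : X => sigma z.1)).
  exact: flow_continuous.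
exact: sigma_fst_cont.
Qed.

Lemma gccR c z : PV z ->
  kappa <= \int[lebesgue_measure]_(s in `[c - T, c]) sigma (flow (- (c - s)) z).1.
Proof.
move=> Pz; have cN : continuous (fun s : R => - s) by move=> s; apply: cvgN; exact: cvg_id.
have ab : c - T <= c by rewrite gerBl ltW.
rewrite (Rintegral_reflect c ab (sigma_flow_continuous (z := z) cN)) subrr subKr.
exact: gcc0.
Qed.

(** The free flow is reversible: the backward condition at the end point [flow (s0 + T) z] is a
    forward condition along the orbit of [z]. *)
Lemma gcc_forward s0 z : PV z ->
  kappa <= \int[lebesgue_measure]_(s in `[s0, s0 + T]) sigma (flow s z).1.
Proof.
move=> Pz; have := @gccR (s0 + T) (flow (s0 + T) z) Pz; rewrite addrK.
move=> /le_trans; apply; rewrite le_eqVlt; apply/orP; left; apply/eqP.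
by apply: eq_Rintegral => s _; rewrite flowD opprB subrK.
Qed.

Definition T_star : R := 2 * Num.sqrt d%:R / r0.
Definition tau : R := 2 * T + T_star.
Local Notation bv := (ball_volume v_star r0).
Local Notation mB := (@measurable_B R d v_star r0).
Local Notation BL := (@B_lty R d v_star r0).
Local Notation bavg := (ball_avg v_star r0).

Lemma T_star_gt0 : 0 < T_star.
Proof. by rewrite divr_gt0// mulr_gt0// sqrtr_gt0 ltr0n. Qed.

Lemma tau_gt0 : 0 < tau.
Proof. by apply: addr_gt0; [rewrite mulr_gt0|exact: T_star_gt0]. Qed.

Lemma T_star_covers s : T_star <= s -> 0 < s /\ 2 * Num.sqrt d%:R <= s * r0.
Proof.
move=> h; split; first exact: lt_le_trans T_star_gt0 h.
by rewrite -ler_pdivrMr.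
Qed.

(** Two iterates are spent on the collisions, at [q] in [s0, s0 + T] and at [u] in [t - T, t], and a
    third supplies [f \o flow t] for the last free flight; hence [N.+3]. *)
Lemma dual_lower f M N s0 z : Cb V f -> (forall z, PV z -> 0 <= f z <= M) -> 0 <= s0 -> PV z ->
  gamma ^+ 2 * (2 ^- d * bv) * kappa ^+ 2 * bavg f <= dual_iter V p sigma Sg (s0 + tau) f N.+3 s0 z.
Proof.
move=> Cf f0M s00 Pz.
set t := s0 + tau; set XI := dual_iter V p sigma Sg t f.
have tau0 := tau_gt0; have Ts0 := T_star_gt0.
have t0 : 0 <= t by rewrite addr_ge0// ltW.
have s0t : s0 <= t by rewrite lerDl ltW.
have fM : bnd V f M by move=> y Py; have /andP[? ?] := f0M y Py; rewrite ger0_norm.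
have f0 y : PV y -> 0 <= f y by move=> Py; have /andP[] := f0M y Py.
have X0 k q y : PV y -> 0 <= XI k q y by move=> Py; exact: (dual_iter_ge0 pk sigma_itv _ _ _ f0 Py).
have bX k : bounded_jcontinuous V (XI k) by exact: (bounded_jcontinuous_iter oV pk csigma sigma_itv t0).
pose c := gamma ^+ 2 * (2 ^- d * bv).
have c0 : 0 <= c.
  by rewrite /c mulr_ge0 ?exprn_ge0 ?(ltW gamma0)// mulr_ge0 ?invr_ge0 ?exprn_ge0// ball_volume_ge0.
have PMf : pmeasurable V f := Cb_measurable oV Cf.
have CQ k y : PV y -> continuous (fun q => Qr V p sigma Sg q (XI k q) y).
  by move=> Py; exact: (jcontinuous_fixz (jcontinuous_Qr oV pk csigma (bX k))).
have QX0 k q y : PV y -> 0 <= Qr V p sigma Sg q (XI k q) y.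
  by move=> Py; apply: (gain_ge0 pk sigma_itv) => // y' Py'; exact: X0.
have inner q y : s0 <= q <= s0 + T -> PV y ->
    c * (kappa * bavg f) <= K (XI N.+2 q \o flow (- q)) y.
  move=> /andP[sq qT] Py.
  have q0 : 0 <= q := le_trans s00 sq.
  (* The two windows are separated by exactly [T_star], so every flight [u - q] covers the torus. *)
  have tE : t - T = s0 + T + T_star by rewrite /t /tau; ring.
  have qt : q <= t - T by rewrite tE; lra.
  have tT : t - T <= t by lra.
  have qt' : q <= t by lra.
  pose F u := f \o flow (t - u).
  have cF : continuous (fun u : R => t - u) by move=> u; apply: cvgB; [exact: cvg_cst|exact: cvg_id].
  have jF : jmeasurable V F by have := jmeasurable_flow oV cF (jmeasurable_space oV PMf); exact.
  have FM u y' : PV y' -> 0 <= F u y' <= M by move=> Py'; exact: f0M.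
  have [_ [CX XC]] := bX N.+2.
  have PG : pmeasurable V (XI N.+2 q \o flow (- q)).
    apply: (Cb_measurable oV); apply: Cb_flow.
    exact: (Cb_XS oV pk csigma sigma_itv t0 Cf).
  have DC := @double_collision R d V oV p pk sigma csigma Sg sigma_itv v_star r0 gamma gamma0 BV pB
    F (XI N.+2 q \o flow (- q)) M CX (t - T) t q y jF FM PG (bnd_flow (- q) (XC q)).
  apply: le_trans (DC _ tT _ _ Py).
  - rewrite -/c; apply: (ler_wpM2l c0).
    have := @gcc_average R d V oV sigma csigma Sg sigma_itv v_star r0 BV T kappa t T0 (@gccR t) f M PMf f0M.
    exact.
  - by move=> y' Py'; exact: X0.
  - move=> u au; apply: T_star_covers; move: au; rewrite tE; lra.
  - move=> y' Py'.
    have qt0 : 0 <= q <= t by rewrite q0.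
    rewrite /comp /XI dual_iterS// -/XI.
    have cQ := CQ N.+1 (flow (- q) y') Py'.
    rewrite (Rintegral_itv_split qt tT (cont_itv_integrable q t cQ)).
    have i0 : 0 <= \int[lebesgue_measure]_(u in `[q, t - T]) Qr V p sigma Sg u (XI N.+1 u) (flow (- q) y').
      by apply: Rintegral_ge0 => u _; exact: QX0.
    have f0' := f0 (flow t (flow (- q) y')) Py'.
    (* The histories with no further collision and those colliding in [q, t - T] contribute
       non-negative terms, which are dropped. *)
    apply: (le_trans _ (_ : \int[lebesgue_measure]_(u in `[t - T, t]) Qr V p sigma Sg u (XI N.+1 u) (flow (- q) y') <= _)); last first.
      by rewrite addrA lerDr; exact: addr_ge0.
    have mI : measurable (`[t - T, t]%classic : set RT) by exact: measurable_itv.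
    have jK : jmeasurable V (fun u z => sigma z.1 * K (F u) z).
      apply: measurable_funM; first exact: (jmeasurable_space oV (pmeasurable_sigma oV csigma)).
      apply: (@jmeasurable_dual_kernel R d V oV p pk F M jF) => u y2 Py2.
      by have /andP[? ?] := FM u y2 Py2; rewrite ger0_norm.
    have cuq : continuous (fun u : R => u - q) by move=> u; apply: cvgB; [exact: cvg_id|exact: cvg_cst].
    apply: le_Rintegral; first exact: mI.
    + apply: (@integrable_bnd _ RT R lebesgue_measure `[t - T, t]%classic _ (Sg * M) mI (itv_lty _ _)).
        have jh := jmeasurable_flow oV cuq jK.
        exact: (@jmeasurable_fixz R d V oV _ y' `[t - T, t]%classic Py' jh).
      move=> u _; have /andP[g0 g1] := sigma_itv (flow (u - q) y').1.
      rewrite normrM (ger0_norm g0) ler_pM//.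
      apply: (dual_kernel_bnd oV pk (z := flow (u - q) y') Py'); first exact: (pmeasurable_vmeasurable oV (jmeasurable_fix oV u jF)).
      by move=> y2 Py2; have /andP[? ?] := FM u y2 Py2; rewrite ger0_norm.
    + exact: cont_itv_integrable.
    + move=> u _.
      have := @gain_ge R d V p sigma Sg sigma_itv (XI N.+1 u \o flow (- u)) (flow (u - q) y') Py' (fun y2 Py2 => X0 N.+1 u (flow (- u) y2) Py2).
      rewrite /Qr flowD; move=> /(le_trans _); apply.
      apply: ler_wpM2l; first by have /andP[] := sigma_itv (flow (u - q) y').1.
      have [_ [CX1 XC1]] := bX N.+1.
      apply: (le_dual_kernel oV pk (z := flow (u - q) y') (M := M) (M' := CX1) Py').
      * exact: (pmeasurable_vmeasurable oV (jmeasurable_fix oV u jF)).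
      * apply: (pmeasurable_vmeasurable oV); apply: (Cb_measurable oV); apply: Cb_flow.
        exact: (Cb_XS oV pk csigma sigma_itv t0 Cf).
      * by move=> y2 Py2; have /andP[? ?] := FM u y2 Py2; rewrite ger0_norm.
      * by move=> y2 Py2; exact: (XC1 u (flow (- u) y2)).
      * move=> y2 Py2; rewrite /F /= /XI.
        rewrite /dual_step flowD.
        rewrite lerDl; apply: Rintegral_ge0 => r _.
        by apply: (gain_ge0 pk sigma_itv) => // y3 Py3; exact: (X0 N).
rewrite /XI dual_iterS// -/XI.
have sT : s0 <= s0 + T by rewrite lerDl ltW.
have Tt : s0 + T <= t by rewrite lerD2l /tau; lra.
have cQ := CQ N.+2 z Pz.
rewrite (Rintegral_itv_split sT Tt (cont_itv_integrable s0 t cQ)).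
have i0 : 0 <= \int[lebesgue_measure]_(u in `[s0 + T, t]) Qr V p sigma Sg u (XI N.+2 u) z.
  by apply: Rintegral_ge0 => u _; exact: QX0.
have f0' := f0 (flow t z) Pz.
apply: (le_trans _ (_ : \int[lebesgue_measure]_(u in `[s0, s0 + T]) Qr V p sigma Sg u (XI N.+2 u) z <= _)); last first.
  by rewrite addrCA lerDl; exact: addr_ge0.
have cs := sigma_flow_continuous (z := z) (fun q : R => @cvg_id _ (nbhs q)).
have b0 : 0 <= bavg f.
  apply: Rintegral_ge0 => w Bw; apply: Rintegral_ge0 => y _; apply: f0; exact: (PB BV).
pose C := c * (kappa * bavg f).
have C0 : 0 <= C by rewrite mulr_ge0// mulr_ge0// ltW.
apply: (@le_trans _ _ (\int[lebesgue_measure]_(u in `[s0, s0 + T]) (C * sigma (flow u z).1))).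
  have mI : measurable (`[s0, s0 + T]%classic : set RT) by exact: measurable_itv.
  rewrite (RintegralZl C mI (cont_itv_integrable s0 (s0 + T) cs)).
  have := ler_wpM2l C0 (gcc_forward s0 Pz).
  by rewrite (_ : C * kappa = c * kappa ^+ 2 * bavg f)//; rewrite /C; ring.
apply: le_Rintegral; first exact: measurable_itv.
- by apply: cont_itv_integrable => u; apply: cvgM; [exact: cvg_cst|exact: cs].
- exact: cont_itv_integrable.
move=> u; rewrite /= in_itv/= => uI.
have := @gain_ge R d V p sigma Sg sigma_itv (XI N.+2 u \o flow (- u)) (flow u z) Pz (fun y2 Py2 => X0 N.+2 u (flow (- u) y2) Py2).
move=> /(le_trans _); apply; rewrite mulrC.
apply: ler_wpM2l; first by have /andP[] := sigma_itv (flow u z).1.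
exact: inner.
Qed.

(** The last factor [bv] is the mass of the reference measure, and [expR (- (Sg * tau))] restores
    over one period the damping left out of the iterates. *)
Definition alpha : R := gamma ^+ 2 * (2 ^- d * bv) * kappa ^+ 2 * expR (- (Sg * tau)) * bv.

Lemma ball_avg_integrable f M : pmeasurable V f -> bnd V f M ->
  [/\ forall w : Rd, B w -> leb.-integrable cube (EFin \o (fun y : brow => f (torus_pi (y : Rd), w))) &
   leb.-integrable B (EFin \o (fun w : brow => \int[leb]_(y in cube) f (torus_pi (y : Rd), w : Rd)))].
Proof.
move=> mf fM; have mfw (w : Rd) : B w -> measurable_fun setT (fun y : brow => f (torus_pi (y : Rd), w)).
  move=> Bw; exact: (measurable_section2 measurableT mB (pmeasurable_pi2 oV BV mf) (y := (w : brow)) Bw).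
split=> [w Bw|].
  apply: (@integrable_bnd _ brow R leb cube _ M measurable_cube cube_lty).
    by apply: measurable_funTS; exact: mfw.
  by move=> y _; apply: fM; exact: (PB BV).
apply: (@integrable_bnd _ brow R leb B _ M mB BL).
  have mpi : measurable_fun (cube `*` B : set (brow * brow)) (fun z : brow * brow => f (torus_pi (z.1 : Rd), z.2 : Rd)).
    apply: measurable_funS (pmeasurable_pi2 oV BV mf); first exact: (measurableX measurableT mB).
    by move=> [y w] [_ Bw].
  apply: (measurable_Rintegral_bnd2 (M := M) measurable_cube mB mpi _ cube_lty).
  by move=> y w _ Bw; apply: fM; exact: (PB BV).
move=> w Bw; rewrite -[leRHS]mulr1 -(@fine_cube R d); apply: (Rintegral_bnd measurable_cube cube_lty).
  by apply: measurable_funTS; exact: mfw.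
by move=> y _; apply: fM; exact: (PB BV).
Qed.

Lemma ball_avgD f g M M' : pmeasurable V f -> bnd V f M -> pmeasurable V g -> bnd V g M' ->
  bavg (fun z => f z + g z) = bavg f + bavg g.
Proof.
move=> mf fM mg gM; have [f1 f2] := ball_avg_integrable mf fM; have [g1 g2] := ball_avg_integrable mg gM.
rewrite /ball_avg -(RintegralD mB f2 g2); apply: eq_Rintegral => w; rewrite inE => Bw.
by rewrite (RintegralD measurable_cube (f1 w Bw) (g1 w Bw)).
Qed.

Lemma ball_avg_cst (a : R) : bavg (fun=> a) = a * bv.
Proof.
rewrite /ball_avg (_ : \int[leb]_(w in B) _ = \int[leb]_(w in B) a).
  by rewrite Rintegral_cst//; exact: mB.
apply: eq_Rintegral => w _; rewrite Rintegral_cst; last exact: measurable_cube.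
by rewrite fine_cube mulr1.
Qed.

Lemma Cb_cst (a : R) : Cb V (fun=> a : R).
Proof. by split; [move=> z _; exact: cvg_cst|exists `|a|]. Qed.

Lemma CbD f g : Cb V f -> Cb V g -> Cb V (fun z => f z + g z).
Proof.
move=> [cf [M fM]] [cg [N gN]]; split.
  by move=> z Pz; apply: cvgD; [exact: cf|exact: cg].
by exists (M + N) => z Pz; rewrite (le_trans (ler_normD _ _))// lerD//; [exact: fM|exact: gN].
Qed.

Lemma CbZ a f : Cb V f -> Cb V (fun z => a * f z).
Proof.
move=> [cf [M fM]]; split; first by move=> z Pz; apply: cvgM; [exact: cvg_cst|exact: cf].
by exists (`|a| * M) => z Pz; rewrite normrM ler_wpM2l//; exact: fM.
Qed.

Lemma CbN f : Cb V f -> Cb V (fun z => - f z).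
Proof. by move=> /(CbZ (-1)); congr Cb; apply/funext => z; rewrite mulN1r. Qed.

(** The lower bound is applied to 1 + f and 1 - f, both non-negative, and additivity of the iterates
    recombines them. The subtracted average does not depend on [z], so a difference of two
    probabilities does not see it. *)
Lemma dual_contract f N s0 z : Cb V f -> bnd V f 1 -> 0 <= s0 -> PV z ->
  forall E, E = expR (- (Sg * tau)) ->
  `|E * dual_iter V p sigma Sg (s0 + tau) f N.+3 s0 z
    - gamma ^+ 2 * (2 ^- d * bv) * kappa ^+ 2 * E * bavg f| <= 1 - alpha.
Proof.
move=> Cf f1 s00 Pz E hE.
have tau0 := tau_gt0; pose t := s0 + tau.
have t0 : 0 <= t by rewrite addr_ge0// ltW.
have s0t : 0 <= s0 <= t by rewrite s00 lerDl ltW.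
have C1 := Cb_cst 1.
have CN := CbN Cf.
have b1 : bnd V (fun=> 1 : R) 1 by move=> y _; rewrite normr1.
have bN : bnd V (fun z => - f z) 1 by move=> y Py; rewrite normrN; exact: f1.
have D1 := dual_iterD oV pk csigma sigma_itv t0 N.+3 s0 C1 Cf Pz.
have D2 := dual_iterD oV pk csigma sigma_itv t0 N.+3 s0 C1 CN Pz.
have D3 := dual_iterD oV pk csigma sigma_itv t0 N.+3 s0 Cf CN Pz.
(* Additivity yields oddness once the iterate of [f - f] is known to vanish, and its sup bound is
   0. *)
have D0 : dual_iter V p sigma Sg t (fun z => f z + - f z) N.+3 s0 z = 0.
  have C0 := CbD Cf CN.
  have b0 : bnd V (fun z => f z + - f z) 0 by move=> y Py; rewrite subrr normr0.
  have := dual_iter_bnd oV pk csigma sigma_itv t0 N.+3 C0 b0 Pz s0t.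
  by rewrite mul0r normr_le0 => /eqP.
have pmeasurable1 := Cb_measurable oV C1; have PMf := Cb_measurable oV Cf; have pmeasurableN := Cb_measurable oV CN.
have A1 := ball_avgD pmeasurable1 b1 PMf f1; have A2 := ball_avgD pmeasurable1 b1 pmeasurableN bN; have A3 := ball_avgD PMf f1 pmeasurableN bN.
have A0 : bavg (fun z => f z + - f z) = 0.
  by rewrite -[RHS](mul0r bv) -ball_avg_cst; congr bavg; apply/funext => y; rewrite subrr.
have f2 y : PV y -> 0 <= 1 + f y <= 2.
  by move=> Py; apply: shift_itv; exact: f1.
have f3 y : PV y -> 0 <= 1 + - f y <= 2.
  by move=> Py; apply: shift_itv; exact: bN.
have L1 := dual_lower N (CbD C1 Cf) f2 s00 Pz.
have L2 := dual_lower N (CbD C1 CN) f3 s00 Pz.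
have U1 := dual_iter_bnd oV pk csigma sigma_itv t0 N.+3 C1 b1 Pz s0t.
rewrite mul1r (_ : t - s0 = tau) in U1; last by rewrite /t; ring.
rewrite -/t D1 A1 ball_avg_cst mul1r in L1; rewrite -/t D2 A2 ball_avg_cst mul1r in L2.
rewrite D0 in D3; rewrite A0 in A3.
have {U1} U1 := le_trans (ler_norm _) U1.
have E0 : 0 < E by rewrite hE expR_gt0.
have EE : E * expR (Sg * tau) = 1 by rewrite hE -expRD addNr expR0.
have := contract_arith E0 EE L1 L2 U1 D3 A3.
rewrite /alpha -hE; congr (_ <= _); ring.
Qed.

Lemma alpha_le1 : PV !=set0 -> alpha <= 1.
Proof.
move=> [z Pz]; have b1 : bnd V (fun=> 1 : R) 1 by move=> y _; rewrite normr1.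
have := @dual_contract (fun=> 1) 0 0 z (Cb_cst 1) b1 (lexx 0) Pz _ erefl.
by move=> /(le_trans (normr_ge0 _)); rewrite subr_ge0.
Qed.

Lemma alpha_ge0 : 0 <= alpha.
Proof.
have b0 := ball_volume_ge0 v_star r0.
by rewrite /alpha !mulr_ge0 ?exprn_ge0 ?expR_ge0 ?invr_ge0 ?exprn_ge0// ltW.
Qed.

Lemma pairing_limit (x y e0 rho : R) (e : nat -> R) : 0 <= rho < 1 ->
  (forall N, x <= y + rho ^+ N * e0) -> x <= y.
Proof.
move=> /andP[r0' r1] H.
have c : (fun N : nat => y + rho ^+ N * e0) @ \oo --> y.
  rewrite -[X in _ --> X]addr0; apply: cvgD; first exact: cvg_cst.
  rewrite -[X in _ --> X](mul0r e0); apply: cvgM; last exact: cvg_cst.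
  by apply: cvg_expr; rewrite ger0_norm.
apply: (ler_cvg_to (@cvg_cst _ x _ \oo _) c).
by apply: nearW => N; exact: H.
Qed.

Section TwoTrajectories.
Variables mu nu : R -> probability phase R.
Hypothesis mu_sol : mv_solution V p sigma mu.
Hypothesis nu_sol : mv_solution V p sigma nu.

(** Duality carries both measures from [t] back to [s0], paying the iteration error once per
    trajectory; [b] cancels between two probabilities and is free to be chosen. *)
Lemma pairing_dual f N s0 t (a b : R) : Cb V f -> bnd V f 1 -> 0 <= s0 -> s0 <= t -> 0 <= a ->
  (forall z, PV z -> `|expR (- (Sg * (t - s0))) * dual_iter V p sigma Sg t f N.+1 s0 z - b| <= a) ->
  pairing V (mu t) (nu t) f <= a * tv_dist V (mu s0) (nu s0) +
    (1 - expR (- (Sg * t))) ^+ N * (2 * (Sg * expR (Sg * t) * (t - s0))).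
Proof.
move=> Cf f1 s00 s0t a0 H.
have t0 : 0 <= t := le_trans s00 s0t.
have [mp mc mw] := mu_sol; have [np nc nw] := nu_sol.
have A1 := dual_approx oV pk csigma sigma_itv t0 mp mc mw N Cf f1 s00 s0t.
have A2 := dual_approx oV pk csigma sigma_itv t0 np nc nw N Cf f1 s00 s0t.
set E := expR (- (Sg * (t - s0))) in A1 A2 H.
set XI := dual_iter V p sigma Sg t f N.+1 s0 in A1 A2 H.
have CX : Cb V (XI \o flow (- s0)).
  by apply: Cb_flow; exact: (Cb_XS oV pk csigma sigma_itv t0 Cf).
pose g z := E * (XI \o flow (- s0)) z - b.
have CEX := CbZ E CX.
have Cg : Cb V g by exact: (CbD CEX (Cb_cst (- b))).
have ga : bnd V g a by move=> z Pz; exact: (H (flow (- s0) z)).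
have P1 := pairing_scaled oV (mp s0 s00) (np s0 s00) Cg ga a0.
rewrite /g (pairingB_cst oV (mp s0 s00) (np s0 s00) b CEX) (pairingZ oV _ _ E CX) in P1.
have E1 : pairing V (mu s0) (nu s0) (XI \o flow (- s0)) = mt V mu s0 XI - mt V nu s0 XI by [].
rewrite E1 mulrBr in P1.
move: A1 A2; rewrite normr1 mulr1 !ler_norml => /andP[_ A1] /andP[A2 _].
rewrite /pairing.
set I1 := \int[mu t]_(z in _) _ in A1 *; set I2 := \int[nu t]_(z in _) _ in A2 *.
set r := (1 - _) ^+ N in A1 A2 *.
set et := expR (Sg * t) in A1 A2 *.
have -> : r * (2 * (Sg * et * (t - s0))) = Sg * (r * et) * (t - s0) + Sg * (r * et) * (t - s0) by ring.
move: P1 A1 A2; set u := E * _; set v := E * _; set w := a * _; set k := Sg * _ * _.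
by move: I1 I2 u v w k => I1 I2 u v w k; lra.
Qed.

Lemma tv_contract s0 : PV !=set0 -> 0 <= s0 ->
  tv_dist V (mu (s0 + tau)) (nu (s0 + tau)) <= (1 - alpha) * tv_dist V (mu s0) (nu s0).
Proof.
move=> PV0 s00; have tau0 := tau_gt0.
have t0 : 0 <= s0 + tau by rewrite addr_ge0// ltW.
have s0t : s0 <= s0 + tau by rewrite lerDl ltW.
have [mp _ _] := mu_sol; have [np _ _] := nu_sol.
apply: (tv_le oV (mp _ t0) (np _ t0)) => f Cf f1.
have rI := rho_itv sigma_itv t0.
apply: (@pairing_limit _ _ ((1 - expR (- (Sg * (s0 + tau)))) ^+ 2 * (2 * (Sg * expR (Sg * (s0 + tau)) * (s0 + tau - s0))))
  (1 - expR (- (Sg * (s0 + tau)))) (fun=> 0) rI) => N.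
(* The minorization holds for iterates of order at least 3, so the error is used with exponent
   [N + 2], the square being put into the constant. *)
rewrite (mulrA (_ ^+ N)) -exprD addn2.
have a0 : 0 <= 1 - alpha by rewrite subr_ge0; exact: alpha_le1.
apply: (@pairing_dual f N.+2 s0 (s0 + tau) (1 - alpha) _ Cf f1 s00 s0t a0) => z Pz.
rewrite (_ : s0 + tau - s0 = tau); last by ring.
exact: (dual_contract N Cf f1 s00 Pz erefl).
Qed.

(** The same duality without centring: the damped iterate never exceeds the sup bound of [f]. *)
Lemma tv_nonexp s0 t : 0 <= s0 -> s0 <= t ->
  tv_dist V (mu t) (nu t) <= tv_dist V (mu s0) (nu s0).
Proof.
move=> s00 s0t; have t0 := le_trans s00 s0t.
have [mp _ _] := mu_sol; have [np _ _] := nu_sol.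
apply: (tv_le oV (mp _ t0) (np _ t0)) => f Cf f1.
have rI := rho_itv sigma_itv t0.
apply: (@pairing_limit _ _ (2 * (Sg * expR (Sg * t) * (t - s0)))
  (1 - expR (- (Sg * t))) (fun=> 0) rI) => N.
rewrite -[X in _ <= X + _]mul1r.
apply: (@pairing_dual f N s0 t 1 0 Cf f1 s00 s0t ler01) => z Pz.
rewrite subr0 normrM ger0_norm ?expR_ge0// expRN ler_pdivrMl ?expR_gt0//.
have := dual_iter_bnd oV pk csigma sigma_itv t0 N.+1 Cf f1 Pz (introT andP (conj s00 s0t)).
by rewrite mul1r mulr1.
Qed.

Lemma tv_iterate n : PV !=set0 ->
  tv_dist V (mu (n%:R * tau)) (nu (n%:R * tau)) <= (1 - alpha) ^+ n * tv_dist V (mu 0) (nu 0).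
Proof.
move=> PV0; elim: n => [|n IH]; first by rewrite mul0r expr0 mul1r.
have a0 : 0 <= 1 - alpha by rewrite subr_ge0; exact: alpha_le1.
rewrite -natr1 mulrDl mul1r exprS -mulrA.
have nt : 0 <= n%:R * tau by rewrite mulr_ge0// ltW// tau_gt0.
by apply: (le_trans (tv_contract PV0 nt)); apply: ler_wpM2l.
Qed.

(** Only whole periods contract. With n the integer part of t / [tau] one has n >= t / [tau] - 1,
    and the lost period is the shift by 2 T + T_* in the exponent. *)
Lemma tv_decay t : PV !=set0 -> T_star <= t ->
  tv_dist V (mu t) (nu t) <=
  expR (- (- (1 / tau) * ln (1 - alpha)) * (t - 2 * T - T_star)) * tv_dist V (mu 0) (nu 0).
Proof.
move=> PV0 Tt; have tau0 := tau_gt0.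
have t0 : 0 <= t by rewrite (le_trans _ Tt)// ltW// T_star_gt0.
have [mp _ _] := mu_sol; have [np _ _] := nu_sol.
have D0 : 0 <= tv_dist V (mu 0) (nu 0) by apply: (tv_ge0 oV (mp _ (lexx 0)) (np _ (lexx 0))).
have al0 := alpha_ge0; have al1 := alpha_le1 PV0.
set l := ln (1 - alpha).
have l0 : l <= 0 by apply: ln_le0; rewrite gerBl.
rewrite (_ : - (- (1 / tau) * l) * (t - 2 * T - T_star) = l * (t / tau - 1)); last first.
  have tn : tau != 0 by rewrite gt_eqF.
  by rewrite (_ : t - 2 * T - T_star = t - tau); [field|rewrite /tau; ring].
(* When [alpha] is 1 the convention that [ln] vanishes at 0 makes the rate 0, and the claim is mere
   non-expansion. *)
have [a1|a1] := eqVneq alpha 1.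
  rewrite (_ : l = 0); last by rewrite /l a1 subrr ln0.
  by rewrite mul0r expR0 mul1r; exact: tv_nonexp.
have a1' : 0 < 1 - alpha by rewrite subr_gt0 lt_neqAle a1.
pose n := Num.trunc (t / tau).
have /andP[n1 n2] : n%:R <= t / tau < n.+1%:R by apply: Num.Theory.truncn_itv; rewrite divr_ge0// ltW.
have nt : n%:R * tau <= t by rewrite -ler_pdivlMr.
have nt0 : 0 <= n%:R * tau by rewrite mulr_ge0// ltW.
apply: (le_trans (tv_nonexp nt0 nt)); apply: (le_trans (tv_iterate n PV0)).
apply: ler_wpM2r => //.
rewrite -[1 - alpha]lnK ?posrE// -/l -expRM_natr ler_expR mulrC.
have h : t / tau - 1 <= n%:R by rewrite lerBlDr natr1 ltW.
by rewrite mulrC ler_wnM2l.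
Qed.

End TwoTrajectories.

End Contraction.

(** * The equilibrium *)

Section FunctionalMeasure.
Context {R : realType} {d : nat}.
Local Notation Rd := 'rV[R]_d.
Local Notation Td := (torus R d).
Local Notation X := (Td * Rd)%type.
Local Notation phase := (borel (Td * Rd)%type).
Variable V : set Rd.
Hypothesis oV : open V.
Local Notation PV := (phase_set V : set X).

(** Continuous functions would not do: the functional has to be evaluated on indicators in order to
    become a measure. *)
Definition bounded_borel (f : X -> R) := pmeasurable V f /\ exists M, bnd V f M.

Lemma bounded_borel_cst (a : R) : bounded_borel (fun=> a).
Proof. by split; [exact: measurable_cst|exists `|a|]. Qed.

Lemma bounded_borel_lin (a : R) f g : bounded_borel f -> bounded_borel g ->
  bounded_borel (fun z => a * f z + g z).
Proof.
move=> [mf [M fM]] [mg [M' gM]]; split.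
  by apply: measurable_funD => //; apply: measurable_funM => //; exact: measurable_cst.
exists (`|a| * M + M') => z Pz; rewrite (le_trans (ler_normD _ _))// lerD//; last exact: gM.
by rewrite normrM ler_wpM2l//; exact: fM.
Qed.

Lemma bounded_borel_indic (A : set phase) : measurable A -> bounded_borel (\1_A : X -> R).
Proof.
move=> mA; split; first by apply: measurable_funTS; exact: measurable_indic.
by exists 1 => z _; rewrite indicE ger0_norm// lern1 leq_b1.
Qed.

Variable N : (X -> R) -> R.
Hypothesis N_lin : forall a f g, bounded_borel f -> bounded_borel g ->
  N (fun z => a * f z + g z) = a * N f + N g.
Hypothesis N_ge0 : forall f, bounded_borel f -> (forall z, PV z -> 0 <= f z) -> 0 <= N f.
Hypothesis N_cvg : forall (f_ : nat -> X -> R) f M, (forall n, bounded_borel (f_ n)) ->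
  bounded_borel f -> (forall n, bnd V (f_ n) M) ->
  (forall z, PV z -> f_ n z @[n --> \oo] --> f z) -> N (f_ n) @[n --> \oo] --> N f.
Hypothesis N1 : N (fun=> 1) = 1.

Lemma functional0 : N (fun=> 0) = 0.
Proof.
have := N_lin (-1) (bounded_borel_cst 1) (bounded_borel_cst 1).
by rewrite N1 mulN1r addNr.
Qed.

Lemma functionalD f g : bounded_borel f -> bounded_borel g -> N (fun z => f z + g z) = N f + N g.
Proof.
by move=> bf bg; rewrite -[N f]mul1r -N_lin//; congr N; apply/funext => z; rewrite mul1r.
Qed.

Lemma functionalZ a f : bounded_borel f -> N (fun z => a * f z) = a * N f.
Proof.
move=> bf; rewrite -[RHS]addr0 -functional0 -N_lin//; last exact: bounded_borel_cst.
by congr N; apply/funext => z; rewrite addr0.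
Qed.

(** Positivity makes [N] blind to values off [PV]: the difference, taken with either sign, is
    non-negative on [PV]. *)
Lemma functional_eq f g : bounded_borel f -> bounded_borel g -> (forall z, PV z -> f z = g z) -> N f = N g.
Proof.
move=> bf bg fg.
have h : 0 <= N (fun z => -1 * f z + g z).
  by apply: N_ge0; [exact: bounded_borel_lin|move=> z Pz; rewrite fg// mulN1r addNr].
have h' : 0 <= N (fun z => -1 * g z + f z).
  by apply: N_ge0; [exact: bounded_borel_lin|move=> z Pz; rewrite fg// mulN1r addNr].
by rewrite !N_lin// in h h'; lra.
Qed.

(* The absolute value only matters for non-measurable [A], where [N] is unconstrained. *)
Definition functional_measure (A : set phase) : \bar R := (`|N \1_A|)%:E.

Lemma functional_measureE (A : set phase) : measurable A -> functional_measure A = (N \1_A)%:E.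
Proof.
move=> mA; rewrite /functional_measure ger0_norm//; apply: N_ge0; first exact: bounded_borel_indic.
by move=> z _; rewrite indicE ler0n.
Qed.

Lemma functional_measure0 : functional_measure set0 = 0%E.
Proof. by rewrite functional_measureE// indic0 (_ : cst 0 = fun=> 0)// functional0. Qed.

Lemma functional_measure_ge0 A : (0 <= functional_measure A)%E.
Proof. by rewrite lee_fin. Qed.

Lemma sum_indic_trivIset (F : nat -> set phase) n z j : trivIset setT F -> F j z ->
  \sum_(0 <= i < n) \1_(F i) z = ((j < n)%N : bool)%:R :> R.
Proof.
move=> tF Fj; have off i : i != j -> \1_(F i) z = 0 :> R.
  move=> ij; rewrite indicE memNset// => Fi; move/eqP: ij; apply.
  by have /trivIsetP/(_ i j I I) := tF; case: eqVneq => // ne /(_ isT) h; exfalso; have : (F i `&` F j) z by []; rewrite h.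
have [jn|nj] := ltnP j n.
  rewrite big_mkord (bigD1 (Ordinal jn))//= indicE mem_set// big1 ?addr0// => i ij.
  by apply: off; apply: contraNN ij => /eqP ij; apply/eqP; apply: val_inj.
rewrite big_nat_cond big1// => i /andP[/andP[_ ni] _]; apply: off.
by rewrite neq_ltn (leq_trans ni nj).
Qed.

(** Partial sums of disjoint indicators are bounded by 1 and converge pointwise to the indicator of
    the union, so countable additivity is an instance of [N_cvg]. *)
Lemma functional_measure_sigma_additive : semi_sigma_additive functional_measure.
Proof.
move=> F mF tF mU.
pose s (n : nat) (z : X) : R := \sum_(0 <= i < n) \1_(F i) z.
have bs n : bounded_borel (s n).
  elim: n => [|n IH].
    have := bounded_borel_cst 0; congr bounded_borel.
    by apply/funext => z; rewrite /s big_geq.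
  have := bounded_borel_lin 1 IH (bounded_borel_indic (mF n)).
  by congr bounded_borel; apply/funext => z; rewrite /s big_nat_recr//= mul1r.
have Ns n : N (s n) = \sum_(0 <= i < n) N \1_(F i).
  elim: n => [|n IH].
    rewrite big_geq// -[RHS]functional0; congr N.
    by apply/funext => z; rewrite /s big_geq.
  rewrite big_nat_recr//= -IH -functionalD//; last exact: bounded_borel_indic.
  by congr N; apply/funext => z; rewrite /s big_nat_recr.
have sval n z : (exists j, F j z /\ s n z = ((j < n)%N : bool)%:R) \/ ((forall j, ~ F j z) /\ s n z = 0).
  have [[j Fj]|nF] := pselect (exists j, F j z); [left|right].
    by exists j; split=> //; exact: sum_indic_trivIset.
  split; first by move=> j Fj; apply: nF; exists j.
  rewrite /s big1// => i _; rewrite indicE memNset// => Fi; apply: nF; by exists i.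
rewrite functional_measureE//.
rewrite (_ : (fun n => _) = (fun n => (N (s n))%:E)); last first.
  apply/funext => n; rewrite Ns -sumEFin; apply: eq_bigr => i _.
  exact: functional_measureE.
apply: cvg_EFin; first exact: nearW.
apply: (N_cvg (M := 1) bs (bounded_borel_indic mU)).
  move=> n z _; case: (sval n z) => [[j [_ ->]]|[_ ->]]; last by rewrite normr0.
  by rewrite ger0_norm// lern1 leq_b1.
move=> z _; have [[j Fj]|nF] := pselect (exists j, F j z).
  apply: (@cvg_trans _ (cst (1 : R) @ \oo)); last first.
    rewrite indicE mem_set; last by exists j.
    exact: cvg_cst.
  apply: near_eq_cvg; near=> n.
  rewrite /s (@sum_indic_trivIset F n z j)// (_ : (j < n)%N = true)//.
  by near: n; exact: nbhs_infty_gt.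
rewrite indicE memNset; last by move=> [j _ Fj]; apply: nF; exists j.
apply: (@cvg_trans _ (cst (0 : R) @ \oo)); last exact: cvg_cst.
apply: near_eq_cvg; apply: nearW => n /=.
case: (sval n z) => [[j [Fj _]]|[_ ->]]//.
by exfalso; apply: nF; exists j.
Unshelve. all: by end_near. Qed.

HB.instance Definition _ := isMeasure.Build _ _ _ functional_measure
  functional_measure0 functional_measure_ge0 functional_measure_sigma_additive.

Lemma functional_measureT : functional_measure setT = 1%E.
Proof.
rewrite functional_measureE//; congr EFin; rewrite -[RHS]N1.
by apply: functional_eq; [exact: bounded_borel_indic|exact: bounded_borel_cst|move=> z _; rewrite indicT].
Qed.

HB.instance Definition _ := Measure_isProbability.Build _ _ _ functional_measure functional_measureT.

(** Integral and functional agree on indicators by construction, on staircases by linearity, and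
    then on all bounded Borel functions, because both pass to the limit of the staircases. *)
Lemma functional_measure_exists : exists nu : probability phase R, prob_on V nu /\
  forall f, bounded_borel f -> \int[nu]_(z in PV) f z = N f.
Proof.
have mPV := @measurable_PV R d V oV.
pose nu : probability phase R := functional_measure.
have nuE (A : set phase) : measurable A -> nu A = (N \1_A)%:E by move=> mA; exact: functional_measureE.
have n1 : prob_on V nu.
  rewrite /prob_on nuE//; congr EFin; rewrite -[RHS]N1.
  apply: functional_eq; [exact: bounded_borel_indic|exact: bounded_borel_cst|].
  by move=> z Pz; rewrite indicE mem_set.
have fn1 : fine (nu PV) = 1 by rewrite n1.
exists nu; split=> // f [mf [M0 fM0]].
have lty : (nu PV < +oo)%E by rewrite n1 ltry.
have Ibb g : bounded_borel g -> nu.-integrable (PV : set phase) (EFin \o g).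
  by move=> [mg [M gM]]; exact: (integrable_bnd mPV lty mg gM).
pose M := `|M0| + 1.
have M_gt0 : 0 < M by rewrite ltr_wpDl.
have fM : bnd V f M by move=> z Pz; rewrite (le_trans (fM0 z Pz))// (le_trans (ler_norm _))// lerDl.
pose good (g : X -> R) := bounded_borel g /\ \int[nu]_(z in PV) g z = N g.
have gcst c : good (fun=> c).
  split; first exact: bounded_borel_cst.
  rewrite (Rintegral_cst _ mPV) fn1 -[in LHS]N1 -functionalZ; last exact: bounded_borel_cst.
  by congr N; apply/funext => z; rewrite mulr1.
have glin a g h : good g -> good h -> good (fun z => a * g z + h z).
  move=> [bg Ig] [bh Ih]; split; first exact: bounded_borel_lin.
  have bag : bounded_borel (fun z => a * g z).
    have := bounded_borel_lin a bg (bounded_borel_cst 0).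
    by congr bounded_borel; apply/funext => z; rewrite addr0.
  by rewrite N_lin// -Ig -Ih (RintegralD mPV (Ibb _ bag) (Ibb _ bh)) (RintegralZl a mPV (Ibb _ bg)).
have glevel c : good (fun z => ((c < f z)%R : bool)%:R).
  pose A : set phase := PV `&` [set z | c < f z].
  have mA : measurable A.
    by have := mf mPV _ (measurable_itv `]c, +oo[); congr measurable; apply/seteqP; split=> z /=; rewrite in_itv/= andbT.
  have bA := bounded_borel_indic mA.
  have E z : PV z -> ((c < f z)%R : bool)%:R = \1_A z :> R.
    move=> Pz; rewrite indicE; congr (nat_of_bool _)%:R; apply/idP/idP.
      by move=> h; rewrite inE.
    by rewrite inE => -[].
  have bl : bounded_borel (fun z => ((c < f z)%R : bool)%:R).
    split; last by exists 1 => z _; rewrite ger0_norm// lern1 leq_b1.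
    case: bA => mI _; apply: eq_measurable_fun mI => z; rewrite inE => Pz.
    by rewrite E.
  split=> //; rewrite (functional_eq bl bA E).
  rewrite (_ : \int[nu]_(z in PV) _ = \int[nu]_(z in PV) \1_A z); last first.
    by apply: eq_Rintegral => z; rewrite inE => Pz; exact: E.
  rewrite /Rintegral integral_indic//.
  rewrite (_ : A `&` PV = A); last by apply/seteqP; split=> z [] // [].
  exact: (congr1 fine (nuE A mA)).
have gsteps n : good (fun z => steps M n (f z)).
  rewrite /steps.
  have gsum k : good (fun z => \sum_(i < k) ((- M + 2 * M * i.+1%:R / n.+1%:R < f z)%R : bool)%:R).
    elim: k => [|k IH].
      by have := gcst 0; congr good; apply/funext => z; rewrite big_ord0.
    have := glin 1 _ _ IH (glevel (- M + 2 * M * k.+1%:R / n.+1%:R)).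
    by congr good; apply/funext => z; rewrite big_ord_recr mul1r.
  have := glin (2 * M / n.+1%:R) _ _ (gsum n.+1) (gcst (- M)).
  by congr good; apply/funext => z; rewrite addrC.
have c1 : N (fun z => steps M n (f z)) @[n --> \oo] --> N f.
  apply: (N_cvg (M := 3 * M)).
  - by move=> n; case: (gsteps n).
  - by split=> //; exists M.
  - by move=> n z Pz; apply: steps_bnd => //; exact: fM.
  - by move=> z Pz; apply: steps_cvg => //; exact: fM.
have c2 : \int[nu]_(z in PV) steps M n (f z) @[n --> \oo] --> \int[nu]_(z in PV) f z.
  apply: (Rintegral_bdct mPV lty _ mf).
  - by move=> n; case: (gsteps n) => -[].
  - by move=> n z Pz; apply: steps_bnd => //; exact: fM.
  - by move=> z Pz; apply: steps_cvg => //; exact: fM.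
have E : (fun n => \int[nu]_(z in PV) steps M n (f z)) = (fun n => N (fun z => steps M n (f z))).
  by apply/funext => n; case: (gsteps n).
rewrite E in c2.
by rewrite -(cvg_lim (@Rhausdorff R) c1) -(cvg_lim (@Rhausdorff R) c2).
Qed.

End FunctionalMeasure.

(** * The invariant functional of a Markov operator under a Doeblin condition *)

Section InvariantFunctional.
Context {R : realType} {d : nat}.
Local Notation Rd := 'rV[R]_d.
Local Notation Td := (torus R d).
Local Notation X := (Td * Rd)%type.
Variable V : set Rd.
Local Notation PV := (phase_set V : set X).
Local Notation bb := (bounded_borel V).
Variable P : (X -> R) -> X -> R.
Hypothesis P_bb : forall f, bb f -> bb (P f).
Hypothesis P_lin : forall a f g z, bb f -> bb g -> PV z ->
  P (fun z => a * f z + g z) z = a * P f z + P g z.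
Hypothesis P_ge0 : forall f z, bb f -> (forall z, PV z -> 0 <= f z) -> PV z -> 0 <= P f z.
Hypothesis P_cvg : forall (f_ : nat -> X -> R) f M z, (forall n, bb (f_ n)) ->
  bb f -> (forall n, bnd V (f_ n) M) ->
  (forall z, PV z -> f_ n z @[n --> \oo] --> f z) -> PV z -> P (f_ n) z @[n --> \oo] --> P f z.
Hypothesis P1 : forall z, PV z -> P (fun=> 1) z = 1.
Variable m : (X -> R) -> R.
Hypothesis m_lin : forall a f g, bb f -> bb g -> m (fun z => a * f z + g z) = a * m f + m g.
Hypothesis m_ge0 : forall f, bb f -> (forall z, PV z -> 0 <= f z) -> 0 <= m f.
Hypothesis m_minor : forall f z, bb f -> (forall z, PV z -> 0 <= f z) -> PV z -> m f <= P (P f) z.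
Hypothesis m1 : 0 < m (fun=> 1).
Variable z0 : X.
Hypothesis Pz0 : PV z0.

Local Notation cst_bb a := (bounded_borel_cst V a).

Lemma operator_cst a z : PV z -> P (fun=> a) z = a.
Proof.
move=> Pz; have P0 : P (fun=> 0) z = 0.
  have := P_lin (-1) (cst_bb 1) (cst_bb 1) Pz.
  by rewrite P1// mulr1 addNr.
have := P_lin a (cst_bb 1) (cst_bb 0) Pz.
by rewrite P1// mulr1 P0 !addr0.
Qed.

Lemma affine_bb (a b : R) f : bb f -> bb (fun z => a * f z + b).
Proof. by move=> bf; exact: (bounded_borel_lin a bf (cst_bb b)). Qed.

Lemma operator_range (a b : R) f : bb f -> (forall z, PV z -> a <= f z <= b) ->
  forall z, PV z -> a <= P f z <= b.
Proof.
move=> bf fab z Pz.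
have h1 : 0 <= P (fun z => 1 * f z + - a) z.
  by apply: P_ge0 => // [|y Py]; [exact: affine_bb|have /andP[? ?] := fab y Py; rewrite mul1r subr_ge0].
have h2 : 0 <= P (fun z => -1 * f z + b) z.
  by apply: P_ge0 => // [|y Py]; [exact: affine_bb|have /andP[? ?] := fab y Py; rewrite mulN1r addrC subr_ge0].
rewrite (P_lin _ bf (cst_bb _) Pz) operator_cst// in h1.
rewrite (P_lin _ bf (cst_bb _) Pz) operator_cst// in h2.
by apply/andP; split; lra.
Qed.

Lemma functional_cst a : m (fun=> a) = a * m (fun=> 1).
Proof.
have m0 : m (fun=> 0) = 0.
  have := m_lin (-1) (cst_bb 1) (cst_bb 1).
  rewrite (_ : (fun _ : X => -1 * 1 + 1) = fun=> 0); last by apply/funext => y; rewrite mulr1 addNr.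
  by move=> ->; rewrite mulN1r addNr.
have := m_lin a (cst_bb 1) (cst_bb 0).
rewrite (_ : (fun _ : X => a * 1 + 0) = fun=> a); last by apply/funext => y; rewrite mulr1 addr0.
by rewrite m0 addr0.
Qed.

Let theta := m (fun=> 1).

Lemma theta_le1 : theta <= 1.
Proof.
have h := m_minor (cst_bb 1) (fun _ _ => ler01) Pz0.
have e : P (P (fun=> 1)) z0 = 1.
  have b1 (z : X) : PV z -> 1 <= (fun=> 1 : R) z <= 1 by rewrite lexx.
  have := operator_range (P_bb (cst_bb 1)) (operator_range (cst_bb 1) b1) Pz0.
  by move=> /andP[h1 h2]; apply/eqP; rewrite eq_le h1 h2.
by rewrite e in h.
Qed.

(** Applied to [f - a] and to [b - f], the minorization raises the lower bound by [m f - a * theta]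
    and lowers the upper one by [b * theta - m f]; together the interval shrinks by
    [theta * (b - a)]. *)
Lemma operator2_range (a b : R) f : bb f -> (forall z, PV z -> a <= f z <= b) ->
  exists a' b', [/\ a <= a', b' <= b, b' - a' = (1 - theta) * (b - a) &
    forall z, PV z -> a' <= P (P f) z <= b'].
Proof.
move=> bf fab; exists (a + (m f - a * theta)), (b - (b * theta - m f)).
have g0 y : PV y -> 0 <= 1 * f y + - a by move=> Py; have /andP[? ?] := fab y Py; rewrite mul1r subr_ge0.
have g1 y : PV y -> 0 <= -1 * f y + b by move=> Py; have /andP[? ?] := fab y Py; rewrite mulN1r addrC subr_ge0.
have b0 := affine_bb 1 (- a) bf; have b1 := affine_bb (-1) b bf.
have e0 : m (fun z => 1 * f z + - a) = m f - a * theta.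
  by rewrite (m_lin _ bf (cst_bb _)) functional_cst mul1r mulNr.
have e1 : m (fun z => -1 * f z + b) = b * theta - m f.
  by rewrite (m_lin _ bf (cst_bb _)) functional_cst mulN1r addrC.
have P2 c e z : PV z -> P (P (fun z => c * f z + e)) z = c * P (P f) z + e.
  move=> Pz; have E : forall y, PV y -> P (fun z => c * f z + e) y = c * P f y + e.
    by move=> y Py; rewrite (P_lin _ bf (cst_bb _) Py) operator_cst.
  have bPf := P_bb bf; have bPa := affine_bb c e bPf; have bPc := P_bb (affine_bb c e bf).
  have bD := bounded_borel_lin (-1) bPa bPc.
  have D0 (y : X) : PV y -> 0 <= -1 * (c * P f y + e) + P (fun z => c * f z + e) y <= 0.
    by move=> Py; rewrite E// mulN1r addNr lexx.
  have := operator_range bD D0 Pz.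
  rewrite (P_lin _ bPa bPc Pz) (P_lin _ bPf (cst_bb _) Pz) operator_cst// => /andP[? ?].
  lra.
split.
- by rewrite lerDl -e0; exact: m_ge0.
- by rewrite gerBl -e1; exact: m_ge0.
- ring.
- move=> z Pz; have h0 := m_minor b0 g0 Pz; have h1 := m_minor b1 g1 Pz.
  rewrite P2// e0 in h0; rewrite P2// e1 in h1.
  by apply/andP; split; lra.
Qed.

Definition operator_iter (n : nat) (f : X -> R) : X -> R := iter n (fun g => P (P g)) f.

Lemma operator_iter_bb n f : bb f -> bb (operator_iter n f).
Proof. by move=> bf; elim: n => [//|n IH]; rewrite /operator_iter iterS; do 2 apply: P_bb. Qed.

Lemma operator_iter_range k (a b : R) f : bb f -> (forall z, PV z -> a <= f z <= b) ->
  forall z, PV z -> a <= operator_iter k f z <= b.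
Proof.
move=> bf fab; elim: k => [//|k IH] z Pz; rewrite /operator_iter iterS.
have bk := operator_iter_bb k bf.
exact: (operator_range (P_bb bk) (operator_range bk IH)).
Qed.

Lemma operator_iter_osc n f M : bb f -> bnd V f M ->
  exists a b, b - a = (1 - theta) ^+ n * (2 * M) /\ forall z, PV z -> a <= operator_iter n f z <= b.
Proof.
move=> bf fM; elim: n => [|n [a [b [ab IH]]]].
  exists (- M), M; split; first by rewrite expr0; ring.
  by move=> z Pz; rewrite -ler_norml; exact: fM.
have [a' [b' [_ _ e h]]] := operator2_range (operator_iter_bb n bf) IH.
by exists a', b'; split; [rewrite e ab exprS mulrA|exact: h].
Qed.

(** The ranges of the iterates are nested and shrink to a point; the supremum of their lower bounds
    names that point. *)
Definition invariant_functional (f : X -> R) : R :=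
  sup [set a | exists n, forall z, PV z -> a <= operator_iter n f z].

Lemma invariant_functional_itv n (a b : R) f : bb f ->
  (forall z, PV z -> a <= operator_iter n f z <= b) -> a <= invariant_functional f <= b.
Proof.
move=> bf h.
have ub : ubound [set a | exists n, forall z, PV z -> a <= operator_iter n f z] b.
  move=> a' [k hk].
  have h1 : a' <= operator_iter (n + k) f z0.
    have bk := operator_iter_bb k bf; have [_ [M fM]] := bk.
    have hk' z : PV z -> a' <= operator_iter k f z <= M.
      by move=> Pz; rewrite hk//=; have := fM z Pz; rewrite ler_norml => /andP[].
    have := operator_iter_range n bk hk' Pz0.
    by rewrite /operator_iter -iterD => /andP[].
  apply: (le_trans h1).
  have := operator_iter_range k (operator_iter_bb n bf) h Pz0.
  by rewrite /operator_iter -iterD addnC => /andP[].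
have am : [set a | exists n, forall z, PV z -> a <= operator_iter n f z] a.
  by exists n => z Pz; have /andP[] := h z Pz.
apply/andP; split.
  by apply: sup_upper_bound => //; split; [exists a|exists b].
by apply: ge_sup; [exists a|].
Qed.

(** [operator_iter n (P f)] is [P] of [operator_iter n f], so its values lie in the same interval.
    Both sequences are trapped in it as it shrinks, which is the source of invariance. *)
Lemma invariant_functional_rate n f M : bb f -> bnd V f M ->
  `|invariant_functional f - operator_iter n f z0| <= (1 - theta) ^+ n * (2 * M) /\
  `|invariant_functional f - operator_iter n (P f) z0| <= (1 - theta) ^+ n * (2 * M).
Proof.
move=> bf fM; have [a [b [<- h]]] := operator_iter_osc n bf fM.
have /andP[L1 L2] := invariant_functional_itv bf h.
have /andP[h1 h2] := h z0 Pz0.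
have E : operator_iter n (P f) = P (operator_iter n f).
  by elim: n {h h1 h2} => [//|n IH]; rewrite /operator_iter !iterS -/(operator_iter _ _) IH.
have /andP[h3 h4] := operator_range (operator_iter_bb n bf) h Pz0.
by rewrite E; split; rewrite ler_norml; apply/andP; split; lra.
Qed.

Lemma theta_cvg (c : R) : (1 - theta) ^+ n * c @[n --> \oo] --> (0 : R).
Proof.
rewrite -[X in _ --> X](mul0r c); apply: cvgM; last exact: cvg_cst.
by apply: cvg_expr; rewrite ger0_norm ?subr_ge0 ?theta_le1// gtrBl.
Qed.

Lemma cvg_rate (x : R) (u : nat -> R) (c : R) : (forall n, `|x - u n| <= (1 - theta) ^+ n * c) ->
  u @ \oo --> x.
Proof.
move=> h; apply/cvgrPdist_le => e e0.
have /cvgrPdist_le/(_ e e0) := theta_cvg c.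
apply: filterS => n; rewrite sub0r normrN => /(le_trans (ler_norm _)).
exact: le_trans.
Qed.

Lemma invariant_functional_cvg f : bb f ->
  operator_iter n f z0 @[n --> \oo] --> invariant_functional f.
Proof.
move=> bf; have [_ [M fM]] := bf.
by apply: (cvg_rate (c := 2 * M)) => n; case: (invariant_functional_rate n bf fM).
Qed.

Lemma invariant_functionalP f : bb f -> invariant_functional (P f) = invariant_functional f.
Proof.
move=> bf; have [_ [M fM]] := bf.
have c1 := invariant_functional_cvg (P_bb bf).
have c2 : operator_iter n (P f) z0 @[n --> \oo] --> invariant_functional f.
  by apply: (cvg_rate (c := 2 * M)) => n; case: (invariant_functional_rate n bf fM).
by rewrite -(cvg_lim (@Rhausdorff R) c1) -(cvg_lim (@Rhausdorff R) c2).
Qed.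

Lemma operator_iter_lin n a f g z : bb f -> bb g -> PV z ->
  operator_iter n (fun z => a * f z + g z) z = a * operator_iter n f z + operator_iter n g z.
Proof.
move=> bf bg; elim: n z => [//|n IH] z Pz; rewrite /operator_iter !iterS -!/(operator_iter _ _).
have bfn := operator_iter_bb n bf; have bgn := operator_iter_bb n bg.
have bn := operator_iter_bb n (bounded_borel_lin a bf bg).
have eqP1 u v : bb u -> bb v -> (forall y, PV y -> u y = v y) -> forall y, PV y -> P u y = P v y.
  move=> bu bv uv y Py; have bD := bounded_borel_lin (-1) bu bv.
  have D0 (x : X) : PV x -> 0 <= -1 * u x + v x <= 0 by move=> Px; rewrite uv// mulN1r addNr lexx.
  have := operator_range bD D0 Py; rewrite (P_lin _ bu bv Py) => /andP[? ?]; lra.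
rewrite -(P_lin a (P_bb bfn) (P_bb bgn) Pz).
apply: (eqP1) => //; [exact: P_bb|by apply: bounded_borel_lin; exact: P_bb|].
move=> y Py; rewrite -(P_lin a bfn bgn Py); apply: (eqP1) => //.
exact: bounded_borel_lin.
Qed.

Lemma invariant_functional_lin a f g : bb f -> bb g ->
  invariant_functional (fun z => a * f z + g z) = a * invariant_functional f + invariant_functional g.
Proof.
move=> bf bg; have c := invariant_functional_cvg (bounded_borel_lin a bf bg).
have c' : operator_iter n (fun z => a * f z + g z) z0 @[n --> \oo] --> a * invariant_functional f + invariant_functional g.
  rewrite (_ : (fun n => operator_iter n _ z0) = (fun n => a * operator_iter n f z0 + operator_iter n g z0)).
    by apply: cvgD; [apply: cvgM; [exact: cvg_cst|]|]; exact: invariant_functional_cvg.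
  by apply/funext => n; rewrite operator_iter_lin.
by rewrite -(cvg_lim (@Rhausdorff R) c) -(cvg_lim (@Rhausdorff R) c').
Qed.

Lemma invariant_functional_ge0 f : bb f -> (forall z, PV z -> 0 <= f z) -> 0 <= invariant_functional f.
Proof.
move=> bf f0; have [_ [M fM]] := bf.
have h z : PV z -> 0 <= operator_iter 0 f z <= M.
  by move=> Pz; rewrite f0//=; have := fM z Pz; rewrite ler_norml => /andP[].
by have /andP[] := invariant_functional_itv bf h.
Qed.

(** The rate depends on the sup bound only, hence is uniform along the sequence; for a fixed number
    of iterations convergence passes through [P], and three errors of size e / 3 add up. *)
Lemma invariant_functional_bp (f_ : nat -> X -> R) f M : (forall n, bb (f_ n)) ->
  bb f -> (forall n, bnd V (f_ n) M) ->
  (forall z, PV z -> f_ n z @[n --> \oo] --> f z) ->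
  invariant_functional (f_ n) @[n --> \oo] --> invariant_functional f.
Proof.
move=> bf_ bf f_M ff.
have fM : bnd V f M.
  move=> z Pz; apply: (ler_cvg_to (cvg_norm (ff z Pz)) (@cvg_cst _ M _ \oo _)).
  by apply: nearW => n; exact: f_M.
have itc n z : PV z -> operator_iter n (f_ k) z @[k --> \oo] --> operator_iter n f z.
  elim: n z => [|n IH] z Pz; first exact: ff.
  rewrite /operator_iter iterS -/(operator_iter _ _).
  rewrite (_ : (fun k => iter n.+1 _ (f_ k) z) = (fun k => P (P (operator_iter n (f_ k))) z)); last first.
    by apply/funext => k; rewrite iterS.
  have bM k (y : X) : PV y -> - M <= operator_iter n (f_ k) y <= M.
    apply: operator_iter_range => // y' Py'; rewrite -ler_norml; exact: f_M.
  apply: (P_cvg (M := M)) => //.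
  - by move=> k; apply: P_bb; exact: operator_iter_bb.
  - by apply: P_bb; exact: operator_iter_bb.
  - by move=> k y Py; rewrite ler_norml; apply: (operator_range (operator_iter_bb n (bf_ k)) (bM k)).
  move=> y Py; apply: (P_cvg (M := M)) => //.
  - by move=> k; exact: operator_iter_bb.
  - exact: operator_iter_bb.
  - by move=> k x Px; rewrite ler_norml; exact: bM.
apply/cvgrPdist_le => e e0.
have e30 : 0 < e / 3 by rewrite divr_gt0.
have /cvgrPdist_le/(_ _ e30) [n _ /(_ n (leqnn n))] := theta_cvg (2 * M).
rewrite /= sub0r normrN => /(le_trans (ler_norm _)) hn.
have /cvgrPdist_le/(_ _ e30) := itc n z0 Pz0.
apply: filterS => k hk.
have [h1 _] := invariant_functional_rate n bf fM.
have [h2 _] := invariant_functional_rate n (bf_ k) (f_M k).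
have {}h1 := le_trans h1 hn; have {}h2 := le_trans h2 hn.
move: h1 h2 hk; set x := invariant_functional f; set y := invariant_functional (f_ k).
set u := operator_iter n f z0; set v := operator_iter n (f_ k) z0.
rewrite !ler_norml => /andP[? ?] /andP[? ?] /andP[? ?]; apply/andP; split; lra.
Qed.

Lemma invariant_functional1 : invariant_functional (fun=> 1) = 1.
Proof.
have h (z : X) : PV z -> 1 <= operator_iter 0 (fun=> 1) z <= 1 by rewrite /operator_iter/= lexx.
by have /andP[h1 h2] := invariant_functional_itv (cst_bb 1) h; apply/eqP; rewrite eq_le h1 h2.
Qed.

End InvariantFunctional.

(** * The event step and its occupation functional *)

Section StationaryFunctional.
Context {R : realType} {d : nat}.
Local Notation Rd := 'rV[R]_d.
Local Notation Td := (torus R d).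
Local Notation X := (Td * Rd)%type.
Local Notation RT := (measurableTypeR R).
Local Notation phase := (borel (Td * Rd)%type).
Local Notation brow := (borel 'rV[R]_d).
Local Notation leb := (@lebesgue_row R d).
Variable V : set Rd.
Hypothesis oV : open V.
Variable p : Rd -> Rd -> R.
Hypothesis pk : transition_kernel V p.
Variable sigma : Td -> R.
Hypothesis csigma : continuous sigma.
Variable Sg : R.
Hypothesis sigma_itv : forall x, 0 <= sigma x <= Sg.
Local Notation PV := (phase_set V : set X).
Local Notation K := (dual_kernel V p).
Local Notation gain := (gain V p sigma Sg).
Local Notation bb := (bounded_borel V).
Variable h : R.
Hypothesis h0 : 0 < h.

(** The absolute value keeps the weight in [0, 1] at every real time, over all of which the bounds
    in the Fubini lemmas are quantified. *)
Definition damping (s : R) : R := expR (- (Sg * `|s|)).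

Lemma damping_itv s : 0 <= damping s <= 1.
Proof.
rewrite /damping expR_ge0/= -[leRHS]expR0 ler_expR oppr_le0.
by rewrite mulr_ge0// (Sg_ge0 sigma_itv).
Qed.

Lemma damping_continuous : continuous damping.
Proof.
move=> s; apply: (@continuous_comp _ _ _ (fun s : R => - (Sg * `|s|)) (@expR R)); last exact: continuous_expR.
by apply: cvgN; apply: cvgM; [exact: cvg_cst|exact: norm_continuous].
Qed.

Lemma damping_le s t : 0 <= s -> s <= t -> damping t <= damping s.
Proof.
move=> s0 st; rewrite ler_expR lerN2; apply: ler_wpM2l; first exact: (Sg_ge0 sigma_itv).
by rewrite !ger0_norm// (le_trans s0).
Qed.

Lemma jmeasurable_damped f : pmeasurable V f -> jmeasurable V (fun s z => damping s * f (flow s z)).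
Proof.
move=> mf; have c1 : continuous (fun s : R => s) by move=> s; exact: cvg_id.
have j1 := jmeasurable_flow oV c1 (jmeasurable_space oV mf).
have md : measurable_fun (setT : set RT) damping by apply: measurable_contR; exact: damping_continuous.
have j0 := @jmeasurable_time R d V damping md.
exact: (measurable_funM j0 j1).
Qed.

Lemma damped_bnd f M s : bnd V f M -> bnd V (fun z => damping s * f (flow s z)) M.
Proof.
move=> fM z Pz; have /andP[e0 e1] := damping_itv s.
rewrite normrM (ger0_norm e0) -[leRHS]mul1r ler_pM//; exact: fM.
Qed.

(** The expected occupation of the orbit until the clock of rate [Sg] rings or time [h] is reached:
    a truncated resolvent of the free flow. *)
Definition resolvent (f : X -> R) (z : X) : R :=
  \int[lebesgue_measure]_(s in `[0, h]) (damping s * f (flow s z)).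

Let mI : measurable (`[0, h]%classic : set RT).
Proof. exact: measurable_itv. Qed.

Lemma damped_integrable f z a b : bb f -> PV z ->
  lebesgue_measure.-integrable (`[a, b]%classic : set RT) (EFin \o (fun s : RT => damping s * f (flow s z))).
Proof.
move=> [mf [M fM]] Pz; apply: (@integrable_bnd _ RT R lebesgue_measure `[a, b]%classic _ M (measurable_itv _) (itv_lty a b)).
  exact: (@jmeasurable_fixz R d V oV _ z `[a, b]%classic Pz (jmeasurable_damped mf)).
by move=> s _; exact: (damped_bnd s fM).
Qed.

Lemma resolvent_bnd f M : pmeasurable V f -> bnd V f M -> bnd V (resolvent f) (M * (h - 0)).
Proof.
move=> mf fM z Pz; apply: Rintegral_itv_bnd; first exact: ltW.
  exact: (@jmeasurable_fixz R d V oV _ z `[0, h]%classic Pz (jmeasurable_damped mf)).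
by move=> s _; exact: (damped_bnd s fM).
Qed.

Lemma resolvent_bb f : bb f -> bb (resolvent f).
Proof.
move=> [mf [M fM]]; split; first exact: (pmeasurable_int oV 0 h (jmeasurable_damped mf) (fun s => damped_bnd s fM)).
by exists (M * (h - 0)); exact: resolvent_bnd.
Qed.

Lemma resolvent_lin a f g z : bb f -> bb g -> PV z ->
  resolvent (fun z => a * f z + g z) z = a * resolvent f z + resolvent g z.
Proof.
move=> bf bg Pz; have i1 := damped_integrable 0 h bf Pz; have i2 := damped_integrable 0 h bg Pz.
have i3 := @integrableZl _ _ _ lebesgue_measure _ mI a _ i1.
rewrite /resolvent -(RintegralZl a mI i1) -(RintegralD mI i3 i2).
by apply: eq_Rintegral => s _; ring.
Qed.

Lemma resolvent_ge0 f z : (forall z, PV z -> 0 <= f z) -> PV z -> 0 <= resolvent f z.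
Proof.
move=> f0 Pz; apply: Rintegral_ge0 => s _; rewrite mulr_ge0//; first by have /andP[] := damping_itv s.
exact: f0.
Qed.

Lemma resolvent_cvg (f_ : nat -> X -> R) f M z : (forall n, bb (f_ n)) -> bb f ->
  (forall n, bnd V (f_ n) M) -> (forall z, PV z -> f_ n z @[n --> \oo] --> f z) -> PV z ->
  resolvent (f_ n) z @[n --> \oo] --> resolvent f z.
Proof.
move=> bf_ bf f_M ff Pz.
apply: (@Rintegral_bdct _ RT R lebesgue_measure `[0, h]%classic (fun n s => damping s * f_ n (flow s z))
  (fun s => damping s * f (flow s z)) M mI (itv_lty 0 h)).
- by move=> n; case: (bf_ n) => mf _; exact: (@jmeasurable_fixz R d V oV _ z `[0, h]%classic Pz (jmeasurable_damped mf)).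
- by case: bf => mf _; exact: (@jmeasurable_fixz R d V oV _ z `[0, h]%classic Pz (jmeasurable_damped mf)).
- by move=> n s _; exact: (damped_bnd s (f_M n)).
- by move=> s _; apply: cvgM; [exact: cvg_cst|exact: ff].
Qed.

(** The probability that the clock rings before [h]. With the constant [Sg] the integrand is an
    exact derivative, and no division by [Sg] occurs. *)
Lemma resolvent_cst z : resolvent (fun=> Sg) z = 1 - damping h.
Proof.
have dE (s : R) : is_derive s (1 : R) (fun s : R => - expR (- (Sg * s))) (expR (- (Sg * s)) * Sg).
  have d1 : is_derive s (1 : R) (fun s : R => - (Sg * s)) (- Sg).
    by apply: is_derive_eq; rewrite /GRing.scale/=; ring.
  have := is_deriveN (@is_derive1_comp _ (@expR R) (fun s : R => - (Sg * s)) s _ _ (is_derive_expR (- (Sg * s))) d1).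
  by rewrite mulrN opprK.
rewrite (_ : resolvent _ z = \int[lebesgue_measure]_(s in `[0, h]) (expR (- (Sg * s)) * Sg)).
  rewrite (FTC2_C1 (ltW h0) dE).
    by rewrite mulr0 oppr0 expR0 opprK addrC /damping ger0_norm ?ltW.
  move=> s; apply: cvgM; last exact: cvg_cst.
  apply: (@continuous_comp _ _ _ (fun s : R => - (Sg * s)) (@expR R)); last exact: continuous_expR.
  by apply: cvgN; apply: cvgM; [exact: cvg_cst|exact: cvg_id].
apply: eq_Rintegral => s; rewrite inE/= in_itv/= => /andP[s0 _].
by rewrite /damping ger0_norm.
Qed.

Lemma gain_bb f : bb f -> bb (gain f).
Proof.
move=> [mf [M fM]]; split.
  apply: measurable_funD; first by apply: measurable_funM; [exact: measurable_cst|exact: mf].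
  exact: (pmeasurable_dual_coll oV pk csigma mf fM).
by exists (Sg * M) => z Pz; exact: (gain_bnd oV pk sigma_itv Pz (pmeasurable_vmeasurable oV mf) fM).
Qed.

Lemma gain_lin a f g z : bb f -> bb g -> PV z ->
  gain (fun z => a * f z + g z) z = a * gain f z + gain g z.
Proof.
move=> [mf [M fM]] [mg [M' gM]] Pz; have vf := pmeasurable_vmeasurable oV mf; have vg := pmeasurable_vmeasurable oV mg.
have vaf : vmeasurable V (fun z => a * f z) by move=> x; apply: measurable_funM; [exact: measurable_cst|exact: vf].
have baf : bnd V (fun z => a * f z) (`|a| * M) by move=> y Py; rewrite normrM ler_wpM2l//; exact: fM.
rewrite (gainD oV pk sigma Sg Pz vaf vg baf gM) /gain (dual_collZ oV pk sigma a Pz vf fM).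
by ring.
Qed.

Lemma gain1 z : PV z -> gain (fun=> 1) z = Sg.
Proof. by move=> Pz; rewrite /gain /dual_coll (dual_kernel1 pk Pz) subrr mulr0 addr0 mulr1. Qed.

Lemma gain_cvg (f_ : nat -> X -> R) f M z : (forall n, bb (f_ n)) -> bb f ->
  (forall n, bnd V (f_ n) M) -> (forall z, PV z -> f_ n z @[n --> \oo] --> f z) -> PV z ->
  gain (f_ n) z @[n --> \oo] --> gain f z.
Proof.
move=> bf_ bf f_M ff Pz; apply: cvgD; first by apply: cvgM; [exact: cvg_cst|exact: ff].
apply: cvgM; first exact: cvg_cst; apply: cvgB; last exact: ff.
apply: (dual_kernel_cvg oV pk (M := M) Pz _ _ f_M ff).
- by move=> n; case: (bf_ n).
- by case: bf.
Qed.

(* The process observed at the first ring of a clock of rate [Sg], or time [h] if it comes first. *)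
Definition event_step (f : X -> R) (z : X) : R := damping h * f (flow h z) + resolvent (gain f) z.

Lemma event_step_bb f : bb f -> bb (event_step f).
Proof.
move=> bf; have [mf [M fM]] := bf.
have b1 : bb (fun z => f (flow h z)).
  by split; [exact: (pmeasurable_flow oV h mf)|exists M; exact: (bnd_flow h fM)].
exact: (bounded_borel_lin (damping h) b1 (resolvent_bb (gain_bb bf))).
Qed.

Lemma resolvent_eq f g z : (forall y, PV y -> f y = g y) -> PV z -> resolvent f z = resolvent g z.
Proof. by move=> fg Pz; apply: eq_Rintegral => s _; rewrite fg. Qed.

Lemma event_step_lin a f g z : bb f -> bb g -> PV z ->
  event_step (fun z => a * f z + g z) z = a * event_step f z + event_step g z.
Proof.
move=> bf bg Pz; rewrite /event_step.
have E y : PV y -> gain (fun z => a * f z + g z) y = a * gain f y + gain g y by move=> Py; exact: gain_lin.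
rewrite (resolvent_eq E Pz) (resolvent_lin a (gain_bb bf) (gain_bb bg) Pz).
by ring.
Qed.

Lemma event_step_ge0 f z : bb f -> (forall z, PV z -> 0 <= f z) -> PV z -> 0 <= event_step f z.
Proof.
move=> bf f0 Pz; rewrite addr_ge0//.
  by rewrite mulr_ge0//; [have /andP[] := damping_itv h|exact: f0].
by apply: resolvent_ge0 => // y Py; exact: (gain_ge0 pk sigma_itv).
Qed.

Lemma event_step_cvg (f_ : nat -> X -> R) f M z : (forall n, bb (f_ n)) -> bb f ->
  (forall n, bnd V (f_ n) M) -> (forall z, PV z -> f_ n z @[n --> \oo] --> f z) -> PV z ->
  event_step (f_ n) z @[n --> \oo] --> event_step f z.
Proof.
move=> bf_ bf f_M ff Pz; apply: cvgD; first by apply: cvgM; [exact: cvg_cst|exact: ff].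
apply: (resolvent_cvg (M := Sg * M)) => //.
- by move=> n; exact: gain_bb.
- exact: gain_bb.
- by move=> n y Py; case: (bf_ n) => mf _; exact: (gain_bnd oV pk sigma_itv Py (pmeasurable_vmeasurable oV mf) (f_M n)).
- by move=> y Py; exact: (gain_cvg bf_ bf f_M ff Py).
Qed.

Lemma event_step1 z : PV z -> event_step (fun=> 1) z = 1.
Proof.
by move=> Pz; rewrite /event_step (resolvent_eq gain1 Pz) resolvent_cst mulr1 addrC subrK.
Qed.

Lemma le_middle (w x y z : R) : 0 <= w -> 0 <= x -> 0 <= z -> y <= w + (x + (y + z)).
Proof. by move=> ? ? ?; lra. Qed.

(** Only rings in [a, b] that are genuine collisions are kept, and their damping is replaced by its
    least value, the one at [h]. *)
Lemma event_step_ge f y a b : bb f -> (forall z, PV z -> 0 <= f z) -> PV y -> 0 <= a -> a <= b -> b <= h ->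
  \int[lebesgue_measure]_(u in `[a, b]) (damping h * (sigma (flow u y).1 * K f (flow u y))) <= event_step f y.
Proof.
move=> bf f0 Py a0 ab bh.
have bQ := gain_bb bf; have Q0 z : PV z -> 0 <= gain f z by move=> Pz; exact: (gain_ge0 pk sigma_itv).
have ah := le_trans ab bh.
have iQ c e : 0 <= \int[lebesgue_measure]_(s in `[c, e]) (damping s * gain f (flow s y)).
  apply: Rintegral_ge0 => s _; rewrite mulr_ge0//; first by have /andP[] := damping_itv s.
  exact: Q0.
have d0 : 0 <= damping h * f (flow h y).
  by rewrite mulr_ge0//; [have /andP[] := damping_itv h|exact: f0].
have E : resolvent (gain f) y = \int[lebesgue_measure]_(s in `[0, a]) (damping s * gain f (flow s y)) +
    (\int[lebesgue_measure]_(s in `[a, b]) (damping s * gain f (flow s y)) +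
     \int[lebesgue_measure]_(s in `[b, h]) (damping s * gain f (flow s y))).
  rewrite /resolvent (Rintegral_itv_split a0 ah (damped_integrable 0 h bQ Py)).
  by rewrite (Rintegral_itv_split ab bh (damped_integrable a h bQ Py)).
apply: (@le_trans _ _ (\int[lebesgue_measure]_(s in `[a, b]) (damping s * gain f (flow s y)))); last first.
  rewrite /event_step E; apply: le_middle; [exact: d0|exact: (iQ 0 a)|exact: (iQ b h)].
have [mf [M fM]] := bf.
have bs : bb (fun z => sigma z.1 * K f z).
  split; first by apply: measurable_funM; [exact: (pmeasurable_sigma oV csigma)|exact: (pmeasurable_dual_kernel oV pk mf fM)].
  exists (Sg * M) => z Pz; have /andP[g0 g1] := sigma_itv z.1.
  by rewrite normrM (ger0_norm g0) ler_pM//; exact: (dual_kernel_bnd oV pk Pz (pmeasurable_vmeasurable oV mf) fM).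
have [ms [Ms sM]] := bs.
apply: le_Rintegral; first exact: measurable_itv.
- apply: (@integrable_bnd _ RT R lebesgue_measure `[a, b]%classic _ (1 * Ms) (measurable_itv _) (itv_lty a b)).
    apply: measurable_funM; first exact: measurable_cst.
    have c1 : continuous (fun s : R => s) by move=> s; exact: cvg_id.
    exact: (@jmeasurable_fixz R d V oV _ y `[a, b]%classic Py (jmeasurable_flow oV c1 (jmeasurable_space oV ms))).
  move=> u _; have /andP[e0 e1] := damping_itv h.
  by rewrite normrM (ger0_norm e0) ler_pM//; exact: (sM (flow u y)).
- exact: (damped_integrable a b bQ Py).
move=> u; rewrite /= in_itv/= => /andP[au ub].
have u0 := le_trans a0 au; have uh := le_trans ub bh.
apply: (@le_trans _ _ (damping u * (sigma (flow u y).1 * K f (flow u y)))).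
  apply: ler_wpM2r; last exact: damping_le.
  rewrite mulr_ge0//; first by have /andP[] := sigma_itv (flow u y).1.
  exact: (dual_kernel_ge0 pk (z := flow u y) Py f0).
apply: ler_wpM2l; first by have /andP[] := damping_itv u.
exact: (gain_ge p sigma_itv (z := flow u y) Py f0).
Qed.

(* Integrating [d/ds (e^(-Sg s) psi (flow s z))] over [0, h] turns the transport term into [event_step psi - psi]. *)
Lemma resolvent_generator psi Dpsi z : bb psi -> bb Dpsi -> PV z ->
  (forall s : R, is_derive s (1 : R) (fun s : R => psi (flow s z)) (Dpsi (flow s z))) ->
  continuous (fun s : R => Dpsi (flow s z)) ->
  resolvent (fun z => Dpsi z + dual_coll V p sigma psi z) z = event_step psi z - psi z.
Proof.
move=> bp bD Pz dp cD.
(* [dual_coll] is [gain] minus [Sg] times the identity; the subtracted term joins [Dpsi] to form the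
   derivative of the damped orbit. *)
have E y : PV y -> Dpsi y + dual_coll V p sigma psi y = 1 * (- Sg * psi y + Dpsi y) + gain psi y.
  by move=> Py; rewrite /gain; ring.
have b1 := bounded_borel_lin (- Sg) bp bD.
rewrite (resolvent_eq E Pz) (resolvent_lin 1 b1 (gain_bb bp) Pz) mul1r /event_step.
suff -> : resolvent (fun y => - Sg * psi y + Dpsi y) z = damping h * psi (flow h z) - psi z by ring.
have dE (s : R) : is_derive s (1 : R) (fun s : R => expR (- (Sg * s)) * psi (flow s z))
    (expR (- (Sg * s)) * (- Sg * psi (flow s z) + Dpsi (flow s z))).
  have d1 : is_derive s (1 : R) (fun s : R => - (Sg * s)) (- Sg).
    by apply: is_derive_eq; rewrite /GRing.scale/=; ring.
  have d2 := @is_derive1_comp _ (@expR R) (fun s : R => - (Sg * s)) s _ _ (is_derive_expR (- (Sg * s))) d1.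
  have := is_deriveM d2 (dp s).
  by congr is_derive; rewrite /GRing.scale/=; ring.
rewrite (_ : resolvent _ z = \int[lebesgue_measure]_(s in `[0, h]) (expR (- (Sg * s)) * (- Sg * psi (flow s z) + Dpsi (flow s z)))).
  rewrite (FTC2_C1 (ltW h0) dE).
    by rewrite mulr0 oppr0 expR0 mul1r flow0 /damping (ger0_norm (ltW h0)).
  move=> s; apply: cvgM.
    apply: (@continuous_comp _ _ _ (fun s : R => - (Sg * s)) (@expR R)); last exact: continuous_expR.
    by apply: cvgN; apply: cvgM; [exact: cvg_cst|exact: cvg_id].
  apply: cvgD; last exact: cD.
  apply: cvgM; first exact: cvg_cst.
  by apply: differentiable_continuous; apply/derivable1_diffP; case: (dp s).
apply: eq_Rintegral => s; rewrite inE/= in_itv/= => /andP[s0 _].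
by rewrite /damping ger0_norm.
Qed.

End StationaryFunctional.

(** * Existence of a stationary measure *)

Section StationaryMeasure.
Context {R : realType} {d : nat}.
Local Notation Rd := 'rV[R]_d.
Local Notation Td := (torus R d).
Local Notation X := (Td * Rd)%type.
Local Notation RT := (measurableTypeR R).
Local Notation phase := (borel (Td * Rd)%type).
Local Notation brow := (borel 'rV[R]_d).
Local Notation leb := (@lebesgue_row R d).
Variable V : set Rd.
Hypothesis oV : open V.
Variable p : Rd -> Rd -> R.
Hypothesis pk : transition_kernel V p.
Variable sigma : Td -> R.
Hypothesis csigma : continuous sigma.
Variable Sg : R.
Hypothesis sigma_itv : forall x, 0 <= sigma x <= Sg.
Local Notation PV := (phase_set V : set X).
Local Notation K := (dual_kernel V p).
Local Notation bb := (bounded_borel V).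
Variables (v_star : Rd) (r0 gamma : R).
Local Notation B := (eball v_star r0).
Hypothesis gamma0 : 0 < gamma.
Hypothesis BV : B `<=` V.
Hypothesis pB : forall v v', V v -> V v' -> gamma * \1_B v <= p v v'.
Variables (T kappa : R).
Hypotheses (T0 : 0 < T) (kappa0 : 0 < kappa).
Hypothesis gcc0 : forall z, PV z ->
  kappa <= \int[lebesgue_measure]_(s in `[0, T]) sigma (flow (- s) z).1.
Hypotheses (r00 : 0 < r0) (d0 : (0 < d)%N).
Local Notation bv := (ball_volume v_star r0).
Local Notation S1 := (sigma_avg sigma v_star r0).

Lemma sigma_avg_lin (a : R) f g : bb f -> bb g ->
  S1 (fun z => a * f z + g z) = a * S1 f + S1 g.
Proof.
move=> [mf [M fM]] [mg [M' gM]]; have mB := @measurable_B R d v_star r0.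
have E x : fiber_avg v_star r0 (fun z => a * f z + g z) x =
    a * fiber_avg v_star r0 f x + fiber_avg v_star r0 g x.
  have i1 := fiber_integrable oV BV x mf fM; have i2 := fiber_integrable oV BV x mg gM.
  have i3 := @integrableZl _ _ _ leb _ mB a _ i1.
  by rewrite /fiber_avg -(RintegralZl a mB i1) -(RintegralD mB i3 i2).
have J f' N : pmeasurable V f' -> bnd V f' N -> leb.-integrable (cube : set brow)
    (EFin \o (fun y : brow => sigma (torus_pi (y : Rd)) * fiber_avg v_star r0 f' (torus_pi (y : Rd)))).
  move=> mf' fN; apply: (@integrable_bnd _ brow R leb cube _ (Sg * (N * bv)) measurable_cube cube_lty).
    apply: measurable_funTS; apply: measurable_funM; first exact: (measurable_sigma_pi csigma).
    exact: (measurable_fiber oV BV mf' fN).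
  move=> y _; have /andP[g0 g1] := sigma_itv (torus_pi y).
  by rewrite normrM (ger0_norm g0) ler_pM//; exact: (fiber_bnd oV BV).
have i1 := J _ _ mf fM; have i2 := J _ _ mg gM.
have i3 := @integrableZl _ _ _ leb _ measurable_cube a _ i1.
rewrite /sigma_avg -(RintegralZl a measurable_cube i1) -(RintegralD measurable_cube i3 i2).
by apply: eq_Rintegral => y _; rewrite E; ring.
Qed.

Lemma sigma_avg_ge0 f : (forall z, PV z -> 0 <= f z) -> 0 <= S1 f.
Proof.
move=> f0; apply: Rintegral_ge0 => y _; rewrite mulr_ge0//.
  by have /andP[] := sigma_itv (torus_pi y).
exact: (fiber_ge0 BV).
Qed.

Lemma ball_volume_gt0 : 0 < bv.
Proof. by apply: fine_gt0; rewrite (eball_gt0 v_star r00) eball_lty. Qed.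

(** Averaging the control condition over T^d x B bounds [kappa * bv] by the integral, over a window
    of length [T], of the constant [S1 (fun=> 1)], which therefore cannot vanish. *)
Lemma sigma_avg1_gt0 : 0 < S1 (fun=> 1).
Proof.
have [m1 _] := bounded_borel_cst V (1 : R).
have f1 (z : X) : PV z -> (0 : R) <= (1 : R) <= (1 : R) by rewrite ler01 lexx.
have gT := @gccR R d V sigma csigma T kappa T0 gcc0 T.
have ab : T - T <= T by rewrite gerBl ltW.
have h : kappa * ball_avg v_star r0 (fun=> 1) <= \int[lebesgue_measure]_(s in `[T - T, T]) S1 (fun=> 1).
  exact: (gcc_average oV csigma sigma_itv BV T0 gT m1 f1).
move: h; rewrite ball_avg_cst mul1r (Rintegral_itv_cst _ ab) subrr subr0 => h.
have := lt_le_trans (mulr_gt0 kappa0 ball_volume_gt0) h.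
by rewrite pmulr_lgt0.
Qed.

Local Notation T_star := (@T_star R d r0).
(** Long enough for a collision during [0, T] in one step, and in the next for a collision after a
    flight between [T_star] and [h], a window of length [T]. *)
Let h := T_star + T.
Local Notation P := (event_step V p sigma Sg h).

Let h0 : 0 < h.
Proof. by rewrite addr_gt0// T_star_gt0. Qed.

Local Notation dh := (damping Sg h).
Let C0 := dh * kappa * (gamma ^+ 2 * (2 ^- d * bv) * (dh * T)).

Let C0_gt0 : 0 < C0.
Proof.
have e0 : 0 < dh by exact: expR_gt0.
rewrite /C0; apply: mulr_gt0; first exact: mulr_gt0.
apply: mulr_gt0; last exact: mulr_gt0.
apply: mulr_gt0; first exact: exprn_gt0.
apply: mulr_gt0; last exact: ball_volume_gt0.
by rewrite invr_gt0 exprn_gt0.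
Qed.

(** This is the second step, started at the first collision: its own collision happens after a
    flight of at least [T_star], and the rate there is kept inside [S1]. *)
Lemma dual_kernel_minor f y : bb f -> (forall z, PV z -> 0 <= f z) -> PV y ->
  gamma ^+ 2 * (2 ^- d * bv) * (dh * T) * S1 f <= K (P f) y.
Proof.
move=> bf f0 Py; have [mf [M fM]] := bf; have e0 : 0 <= dh by exact: expR_ge0.
have [mPf [MP PfM]] := event_step_bb oV pk csigma sigma_itv h0 bf.
have bef : bb (fun z => dh * f z + 0) by exact: (bounded_borel_lin dh bf (bounded_borel_cst V 0)).
have [mef _] := bef.
have ab : T_star <= h by rewrite lerDl ltW.
have efM (u : R) z : PV z -> 0 <= dh * f z + 0 <= dh * M.
  move=> Pz; rewrite addr0 mulr_ge0//= ?f0// ler_wpM2l//.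
  by apply: le_trans (fM z Pz); exact: ler_norm.
have PP z : PV z -> 0 <= P f z by move=> Pz; exact: (event_step_ge0 pk sigma_itv).
have cov u : T_star <= u -> 0 < u - 0 /\ 2 * Num.sqrt d%:R <= (u - 0) * r0.
  by rewrite subr0; exact: T_star_covers.
(* Time is counted from the first collision, hence [q := 0]. The damping is bounded below by [dh] on
   the whole window, so [F] does not depend on time. *)
have := double_collision oV pk csigma sigma_itv gamma0 BV pB (F := fun _ z => dh * f z + 0)
  (g := P f) (M := dh * M) (Mg := MP) (a := T_star) (b := h) (q := 0) (z := y).
move=> /(_ (jmeasurable_space oV mef) efM mPf PfM PP ab cov).
rewrite (Rintegral_itv_cst _ ab) (sigma_avg_lin dh bf (bounded_borel_cst V 0)).
rewrite (_ : h - T_star = T); last by rewrite /h addrC addKr.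
rewrite (_ : S1 (fun=> 0) = 0); last first.
  have := sigma_avg_lin (-1) (bounded_borel_cst V 0) (bounded_borel_cst V 0).
  rewrite (_ : (fun=> -1 * 0 + 0) = (fun=> 0)); last by apply/funext => z; rewrite mulr0 addr0.
  by rewrite [in RHS]mulN1r addNr.
rewrite addr0 (_ : _ * (dh * S1 f * T) = gamma ^+ 2 * (2 ^- d * bv) * (dh * T) * S1 f); last first.
  by move: dh (S1 f) (_ * (2 ^- d * bv)) => x1 x2 x3; ring.
apply; last exact: Py.
move=> z Pz; apply: le_trans (event_step_ge oV pk csigma sigma_itv bf f0 Pz (ltW (T_star_gt0 r00 d0)) ab (lexx h)).
rewrite le_eqVlt; apply/orP; left; apply/eqP; apply: eq_Rintegral => u _.
rewrite subr0 mulrCA; congr (_ * _).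
rewrite -(dual_kernelZ oV pk dh (z := flow u z) Pz (pmeasurable_vmeasurable oV mf) fM).
by congr (dual_kernel _ _ _ _); apply/funext => x; rewrite addr0.
Qed.

(** The first step collides during [0, T], where the control condition gives the rates a total of at
    least [kappa]; what follows is bounded by [dual_kernel_minor] whatever the place of the
    collision. *)
Lemma event_step2_minor f z : bb f -> (forall z, PV z -> 0 <= f z) -> PV z -> C0 * S1 f <= P (P f) z.
Proof.
move=> bf f0 Pz; have bP := event_step_bb oV pk csigma sigma_itv h0 bf.
have P0 y : PV y -> 0 <= P f y by move=> Py; exact: (event_step_ge0 pk sigma_itv).
have Th : T <= h by rewrite lerDr ltW// T_star_gt0.
apply: le_trans (event_step_ge oV pk csigma sigma_itv bP P0 Pz (lexx 0) (ltW T0) Th).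
have e0 : 0 <= dh by exact: expR_ge0.
set c := gamma ^+ 2 * (2 ^- d * bv) * (dh * T) * S1 f.
have c0 : 0 <= dh * c.
  rewrite /c !mulr_ge0 ?ler0n ?invr_ge0 ?exprn_ge0 ?(ltW gamma0) ?(ltW T0) ?(ltW ball_volume_gt0)//.
  exact: sigma_avg_ge0.
have cid : continuous (fun s : R => s) by move=> s; exact: cvg_id.
have cs := sigma_flow_continuous csigma (z := z) cid.
have is1 := cont_itv_integrable 0 T cs.
have mI : measurable (`[0, T]%classic : set RT) by exact: measurable_itv.
apply: (@le_trans _ _ (\int[lebesgue_measure]_(u in `[0, T]) (dh * c * sigma (flow u z).1))).
  rewrite (RintegralZl (dh * c) mI is1).
  apply: (@le_trans _ _ (dh * c * kappa)).
    by rewrite /C0 /c le_eqVlt; apply/orP; left; apply/eqP;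
      move: dh (S1 f) (_ * (2 ^- d * bv)) => x1 x2 x3; ring.
  by apply: ler_wpM2l => //; have := gcc_forward csigma T0 gcc0 0 Pz; rewrite add0r.
apply: le_Rintegral; first exact: mI.
- exact: (@integrableZl _ _ _ _ _ mI (dh * c) _ is1).
- have [mP [MP PfM]] := bP.
  have ms : pmeasurable V (fun y : X => sigma y.1 * K (P f) y).
    by apply: measurable_funM; [exact: (pmeasurable_sigma oV csigma)|exact: (pmeasurable_dual_kernel oV pk mP PfM)].
  apply: (@integrable_bnd _ RT R lebesgue_measure `[0, T]%classic _ (1 * (Sg * MP)) mI (itv_lty 0 T)).
    apply: measurable_funM; first exact: measurable_cst.
    apply: (@jmeasurable_fixz R d V oV (fun s y => sigma (flow s y).1 * K (P f) (flow s y)) z `[0, T]%classic Pz).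
    exact: (jmeasurable_flow oV cid (jmeasurable_space oV ms)).
  move=> u _; have /andP[e1 e2] := damping_itv sigma_itv h.
  have /andP[g0 g1] := sigma_itv (flow u z).1.
  rewrite normrM (ger0_norm e1) ler_pM// normrM (ger0_norm g0) ler_pM//.
  exact: (dual_kernel_bnd oV pk (z := flow u z) Pz (pmeasurable_vmeasurable oV mP) PfM).
move=> u _; rewrite -mulrA; apply: ler_wpM2l => //; rewrite mulrC; apply: ler_wpM2l.
  by have /andP[] := sigma_itv (flow u z).1.
exact: (dual_kernel_minor (y := flow u z) bf f0 Pz).
Qed.

Hypothesis PV0 : PV !=set0.

Lemma Sg_gt0 : 0 < Sg.
Proof.
have [z Pz] := PV0; have h1 := gcc0 Pz.
have S0 := Sg_ge0 sigma_itv; rewrite lt_neqAle S0 andbT; apply/eqP => S00.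
have := lt_le_trans kappa0 h1; rewrite (_ : Rintegral _ _ _ = 0) ?ltxx//.
rewrite -[RHS](mul0r (T - 0)) -(Rintegral_itv_cst _ (ltW T0)).
by apply: eq_Rintegral => s _; apply/eqP; rewrite eq_le; have := sigma_itv (flow (- s) z).1; rewrite -S00 andbC.
Qed.

(* The candidate [c L W], with [L] invariant under [P], annihilates the generator because [W] sends it to [P - 1]. *)
Lemma stationary_measure_exists : exists nu : probability phase R, prob_on V nu /\
  forall psi Dpsi, bb psi -> bb Dpsi ->
  (forall z (s : R), PV z -> is_derive s (1 : R) (fun s : R => psi (flow s z)) (Dpsi (flow s z))) ->
  (forall z, PV z -> continuous (fun s : R => Dpsi (flow s z))) ->
  \int[nu]_(z in PV) (Dpsi z + dual_coll V p sigma psi z) = 0.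
Proof.
have [z0 Pz0] := PV0.
have P_bb f : bb f -> bb (P f) by exact: (event_step_bb oV pk csigma sigma_itv h0).
have P_lin a f g z : bb f -> bb g -> PV z -> P (fun z => a * f z + g z) z = a * P f z + P g z.
  by move=> bf bg Pz; exact: (event_step_lin oV pk csigma sigma_itv).
have P_ge0 f z : bb f -> (forall z, PV z -> 0 <= f z) -> PV z -> 0 <= P f z.
  by move=> bf f0 Pz; exact: (event_step_ge0 pk sigma_itv).
have P_cvg (f_ : nat -> X -> R) f M z : (forall n, bb (f_ n)) -> bb f -> (forall n, bnd V (f_ n) M) ->
    (forall z, PV z -> f_ n z @[n --> \oo] --> f z) -> PV z -> P (f_ n) z @[n --> \oo] --> P f z.
  by move=> bf_ bf f_M ff Pz; exact: (event_step_cvg oV pk csigma sigma_itv bf_ bf f_M ff Pz).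
have P1 z : PV z -> P (fun=> 1) z = 1 by exact: (event_step1 pk sigma Sg h0).
pose m (f : X -> R) := C0 * S1 f.
have m_lin a f g : bb f -> bb g -> m (fun z => a * f z + g z) = a * m f + m g.
  by move=> bf bg; rewrite /m (sigma_avg_lin a bf bg) mulrDr mulrCA.
have m_ge0 f : bb f -> (forall z, PV z -> 0 <= f z) -> 0 <= m f.
  by move=> _ f0; exact: (mulr_ge0 (ltW C0_gt0) (sigma_avg_ge0 f0)).
have m_minor f z : bb f -> (forall z, PV z -> 0 <= f z) -> PV z -> m f <= P (P f) z.
  exact: event_step2_minor.
have m1 : 0 < m (fun=> 1) by exact: (mulr_gt0 C0_gt0 sigma_avg1_gt0).
pose L := invariant_functional V P; pose W := @resolvent R d Sg h.
have L_lin a f g : bb f -> bb g -> L (fun z => a * f z + g z) = a * L f + L g.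
  exact: (invariant_functional_lin P_bb P_lin P_ge0 P1 m_lin m_ge0 m_minor m1 Pz0).
have L_ge0 f : bb f -> (forall z, PV z -> 0 <= f z) -> 0 <= L f.
  exact: (invariant_functional_ge0 P_bb P_lin P_ge0 P1 Pz0).
have L_eq f g : bb f -> bb g -> (forall z, PV z -> f z = g z) -> L f = L g.
  exact: (functional_eq L_lin L_ge0).
have W_bb f : bb f -> bb (W f) by exact: (resolvent_bb oV sigma_itv h0).
have dh1 : dh < 1.
  by rewrite -expR0 ltr_expR oppr_lt0 mulr_gt0// ?Sg_gt0// normr_gt0 gt_eqF.
(* The composite of [L] and [W] has mass [(1 - dh) / Sg], which is positive since [Sg] is; [c]
   normalizes it. *)
pose c := Sg / (1 - dh).
have c0 : 0 < c by rewrite divr_gt0 ?Sg_gt0// subr_gt0.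
pose N f := c * L (W f).
have N_lin a f g : bb f -> bb g -> N (fun z => a * f z + g z) = a * N f + N g.
  move=> bf bg; have bfg := bounded_borel_lin a bf bg.
  rewrite /N (L_eq _ (fun z => a * W f z + W g z) (W_bb _ bfg) (bounded_borel_lin a (W_bb _ bf) (W_bb _ bg))).
    by rewrite (L_lin a _ _ (W_bb _ bf) (W_bb _ bg)) mulrDr mulrCA.
  by move=> z Pz; exact: (resolvent_lin oV sigma_itv h a bf bg Pz).
have N_ge0 f : bb f -> (forall z, PV z -> 0 <= f z) -> 0 <= N f.
  move=> bf f0; apply: (mulr_ge0 (ltW c0)); apply: (L_ge0 _ (W_bb _ bf)) => z Pz.
  exact: (resolvent_ge0 sigma_itv h f0 Pz).
have N_cvg (f_ : nat -> X -> R) f M : (forall n, bb (f_ n)) -> bb f -> (forall n, bnd V (f_ n) M) ->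
    (forall z, PV z -> f_ n z @[n --> \oo] --> f z) -> N (f_ n) @[n --> \oo] --> N f.
  move=> bf_ bf f_M ff; apply: cvgM; first exact: cvg_cst.
  apply: (invariant_functional_bp P_bb P_lin P_ge0 P_cvg P1 m_lin m_ge0 m_minor m1 Pz0 (M := M * (h - 0))).
  - by move=> n; exact: W_bb.
  - exact: W_bb.
  - by move=> n; have [mf _] := bf_ n; exact: (resolvent_bnd oV sigma_itv h0 mf (f_M n)).
  - by move=> z Pz; exact: (resolvent_cvg oV sigma_itv bf_ bf f_M ff Pz).
have N1 : N (fun=> 1) = 1.
  have b1 := bounded_borel_cst V (1 : R); have bS := bounded_borel_cst V Sg.
  have S0 := Sg_gt0; have dh0 : 1 - dh != 0 by rewrite subr_eq0 gt_eqF.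
  have E z : PV z -> W (fun=> 1) z = (1 - dh) / Sg.
    (* [resolvent_cst] speaks of the constant [Sg], which is written as [(Sg - 1) * 1 + 1] to fit
       the linearity lemma. *)
    move=> Pz; have := resolvent_lin oV sigma_itv h (Sg - 1) b1 b1 Pz.
    rewrite (_ : (fun=> _) = (fun=> Sg)); last by apply/funext => y; rewrite mulr1 subrK.
    rewrite (resolvent_cst Sg h0) => H; have {}H : 1 - dh = Sg * W (fun=> 1) z.
      by rewrite H /W; move: (resolvent _ _ _ _) => w; ring.
    by rewrite H mulrAC divff ?mul1r// gt_eqF.
  have L1 : L (fun=> 1) = 1 := invariant_functional1 P_bb P_lin P_ge0 P1 Pz0.
  have L0 : L (fun=> 0) = 0.
    have := L_lin (-1) _ _ b1 b1.
    by rewrite L1 (_ : (fun=> -1 * 1 + 1) = (fun=> 0)) ?mulr1 ?addNr//; apply/funext => z; rewrite mulr1 addNr.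
  rewrite /N (L_eq _ (fun=> (1 - dh) / Sg * 1 + 0) (W_bb _ b1)).
  - rewrite (L_lin _ _ _ b1 (bounded_borel_cst V 0)) L1 L0 addr0 mulr1 /c.
    by rewrite mulrA divfK// divff// gt_eqF.
  - exact: (bounded_borel_lin _ b1 (bounded_borel_cst V 0)).
  - by move=> z Pz; rewrite E// mulr1 addr0.
have [nu [nuV nuN]] := functional_measure_exists oV N_lin N_ge0 N_cvg N1.
exists nu; split => // psi Dpsi bp bD dp cD.
have bG : bb (fun z => Dpsi z + dual_coll V p sigma psi z).
  have [mp [M pM]] := bp.
  have bB : bb (dual_coll V p sigma psi).
    split; first exact: (pmeasurable_dual_coll oV pk csigma mp pM).
    exists (2 * Sg * M) => z Pz; exact: (dual_coll_bnd oV pk sigma_itv Pz (pmeasurable_vmeasurable oV mp) pM).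
  have := bounded_borel_lin 1 bD bB; congr bounded_borel.
  by apply/funext => z; rewrite mul1r.
rewrite (nuN _ bG) /N (L_eq _ (fun z => -1 * psi z + P psi z) (W_bb _ bG)).
- rewrite (L_lin _ _ _ bp (P_bb _ bp)) mulN1r (_ : L (P psi) = L psi) ?addNr ?mulr0//.
  exact: (invariant_functionalP P_bb P_lin P_ge0 P1 m_lin m_ge0 m_minor m1 Pz0).
- exact: (bounded_borel_lin _ bp (P_bb _ bp)).
- move=> z Pz; rewrite mulN1r addrC.
  exact: (resolvent_generator oV pk csigma sigma_itv h0 bp bD Pz (fun s => dp z s Pz) (cD z Pz)).
Qed.

End StationaryMeasure.

Lemma is_derive_line {R : realType} {E : normedModType R} (f : E -> R) (e w : E) (s : R) :
  C1_on setT f -> is_derive s (1 : R) (fun s : R => f (e + s *: w)) ('d f (e + s *: w) w).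
Proof.
move=> [df _]; have fd : differentiable f (e + s *: w) by apply: df; rewrite inE.
have dv := diff_derivable (v := w) fd.
have E1 : (fun h : R => h^-1 *: ((fun s : R => f (e + s *: w)) (h *: (1 : R) + s) - f (e + s *: w))) =
    (fun h : R => h^-1 *: (f (h *: w + (e + s *: w)) - f (e + s *: w))).
  by apply/funext => h /=; rewrite /GRing.scale/= mulr1 [h *: w + _]addrCA -scalerDl.
apply: DeriveDef; first by rewrite /derivable/= E1; exact: dv.
by rewrite -(deriveE w fd) /derive/= E1.
Qed.

Lemma cvg_bigsum {R : realType} {T : topologicalType} (I : Type) (r : seq I) (F : I -> T -> R) (x : T) :
  (forall i, F i y @[y --> x] --> F i x) ->
  \sum_(i <- r) F i y @[y --> x] --> \sum_(i <- r) F i x.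
Proof.
move=> cF; elim: r => [|i r IH].
  by rewrite big_nil; under eq_fun do rewrite big_nil; exact: cvg_cst.
by rewrite big_cons; under eq_fun do rewrite big_cons; exact: (cvgD (cF i) IH).
Qed.

(** * Stationary solutions in weak form *)

Section TestFunction.
Context {R : realType} {d : nat}.
Local Notation Rd := 'rV[R]_d.
Local Notation Td := (torus R d).
Local Notation X := (Td * Rd)%type.
Local Notation phase := (borel (Td * Rd)%type).
Variable phi : R -> Td -> Rd -> R.
Local Notation Phi := (fun z : R * Rd * Rd => phi z.1.1 (torus_pi z.1.2) z.2).
Hypothesis cPhi : C1_on setT Phi.

Lemma phi_time (x v : Rd) (t : R) :
  is_derive t (1 : R) (fun t : R => phi t (torus_pi x) v) ('d Phi (t, x, v) (1, 0, 0)).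
Proof.
have := is_derive_line ((0, x, v) : R * Rd * Rd) ((1, 0, 0) : R * Rd * Rd) t cPhi.
have E (s : R) : (0, x, v) + s *: (1, 0, 0) = (s, x, v) :> R * Rd * Rd.
  by transitivity ((0 + s * 1, x + s *: (0 : Rd), v + s *: (0 : Rd)) : R * Rd * Rd) => //; rewrite !scaler0 !addr0 mulr1 add0r.
rewrite E; congr is_derive; apply/funext => s.
by have := congr1 Phi (E s).
Qed.

Lemma phi_space (x v : Rd) (t s : R) :
  is_derive s (1 : R) (fun s : R => phi t (torus_pi (x + s *: v)) v) ('d Phi (t, x + s *: v, v) (0, v, 0)).
Proof.
have := is_derive_line ((t, x, v) : R * Rd * Rd) ((0, v, 0) : R * Rd * Rd) s cPhi.
have E (r : R) : (t, x, v) + r *: (0, v, 0) = (t, x + r *: v, v) :> R * Rd * Rd.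
  by transitivity ((t + r * 0, x + r *: v, v + r *: (0 : Rd)) : R * Rd * Rd) => //; rewrite scaler0 mulr0 !addr0.
rewrite E; congr is_derive; apply/funext => r.
by have := congr1 Phi (E r).
Qed.

Lemma time_derivative_lift (x v : Rd) t :
  time_derivative phi t (torus_pi x) v = 'd Phi (t, x, v) (1, 0, 0).
Proof. by rewrite /time_derivative derive1E; have [_] := phi_time x v t. Qed.

Lemma transport_lift (x v : Rd) t :
  transport phi t (torus_pi x) v = 'd Phi (t, x, v) (0, v, 0).
Proof.
have E : (fun s : R => phi t (torus_translate (torus_pi x) (s *: v)) v) =
    (fun s : R => phi t (torus_pi (x + s *: v)) v).
  by apply/funext => s; rewrite torus_translate_pi.
by rewrite /transport derive1E E; have [_ ->] := phi_space x v t 0; rewrite scale0r addr0.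
Qed.

Lemma transport_flow t z s :
  is_derive s (1 : R) (fun s : R => phi t (flow s z).1 (flow s z).2)
    (transport phi t (flow s z).1 (flow s z).2).
Proof.
case: z => x v; rewrite -(torus_reprK x).
have -> : transport phi t (flow s (torus_pi (repr x), v)).1 (flow s (torus_pi (repr x), v)).2 =
    'd Phi (t, repr x + s *: v, v) (0, v, 0).
  by rewrite /flow/= torus_translate_pi transport_lift.
have := phi_space (repr x) v t s; congr is_derive; apply/funext => r.
by rewrite /flow/= torus_translate_pi.
Qed.

Lemma reassoc_continuous : continuous (fun e : R * (Rd * Rd) => (e.1, e.2.1, e.2.2)).
Proof.
move=> e; have c1 : (fun e : R * (Rd * Rd) => e.1) @ e --> e.1 by exact: cvg_fst.
have c2 : (fun e : R * (Rd * Rd) => e.2.1) @ e --> e.2.1.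
  by apply: (@continuous_comp _ _ _ snd fst); [exact: cvg_snd|exact: cvg_fst].
have c3 : (fun e : R * (Rd * Rd) => e.2.2) @ e --> e.2.2.
  by apply: (@continuous_comp _ _ _ snd snd); exact: cvg_snd.
exact: (cvg_pair (cvg_pair c1 c2) c3).
Qed.

Lemma diff_lift_continuous (w : R * Rd * Rd) :
  continuous (fun e : R * (Rd * Rd) => 'd Phi (e.1, e.2.1, e.2.2) w).
Proof.
move=> e; apply: (@continuous_comp _ _ _ (fun e : R * (Rd * Rd) => (e.1, e.2.1, e.2.2))
  (fun z : R * Rd * Rd => 'd Phi z w)); first exact: reassoc_continuous.
by have [_ c] := cPhi; apply: c; rewrite inE.
Qed.

Lemma jcontinuous_phi : jcontinuous setT (fun t z => phi t z.1 z.2).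
Proof.
apply: jcontinuous_lift => e _; apply: (@continuous_comp _ _ _ (fun e : R * (Rd * Rd) => (e.1, e.2.1, e.2.2)) Phi).
  exact: reassoc_continuous.
exact: (C1_cont cPhi).
Qed.

Lemma jcontinuous_time_derivative : jcontinuous setT (fun t z => time_derivative phi t z.1 z.2).
Proof.
apply: jcontinuous_lift => e _.
rewrite (_ : lift _ = fun e => 'd Phi (e.1, e.2.1, e.2.2) (1, 0, 0)); first exact: diff_lift_continuous.
by apply/funext => e'; exact: time_derivative_lift.
Qed.

(** [C1_on] gives continuity of the differential in a fixed direction, while here the direction is
    the velocity itself; expanding it along coordinate directions bridges the gap. *)
Lemma jcontinuous_transport : jcontinuous setT (fun t z => transport phi t z.1 z.2).
Proof.
apply: jcontinuous_lift => e _.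
rewrite (_ : lift _ = fun e : R * (Rd * Rd) =>
  \sum_i e.2.2 0 i * 'd Phi (e.1, e.2.1, e.2.2) (0, delta_mx 0 i, 0)).
  apply: cvg_bigsum => i; apply: cvgM; last exact: diff_lift_continuous.
  apply: (@continuous_comp _ _ _ (fun e : R * (Rd * Rd) => e.2.2) (fun w : Rd => w 0 i)).
    by apply: (@continuous_comp _ _ _ snd snd); exact: cvg_snd.
  exact: coord_continuous.
apply/funext => -[t [x v]]; rewrite /lift/= transport_lift.
have E : (0, v, 0) = \sum_i v 0 i *: (0, delta_mx 0 i, 0) :> R * Rd * Rd.
  rewrite {1}(row_sum_delta v) (@big_morph _ _ (fun w : Rd => (0, w, 0) : R * Rd * Rd) 0 +%R 0 +%R).
  - apply: eq_bigr => i _.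
    by transitivity ((v 0 i * 0, v 0 i *: delta_mx 0 i, v 0 i *: (0 : Rd)) : R * Rd * Rd) => //; rewrite scaler0 mulr0.
  - by move=> a b; transitivity ((0 + 0, a + b, 0 + 0) : R * Rd * Rd) => //; rewrite !addr0.
  - by [].
rewrite E raddf_sum; apply: eq_bigr => i _; exact: linearZ.
Qed.

Lemma jcontinuous_sub (V : set Rd) g : jcontinuous setT g -> jcontinuous V g.
Proof. by move=> cg q z _; exact: cg. Qed.

Lemma jcontinuous_compact_bnd (g : R -> X -> R) (S : R) (KV : set Rd) : compact KV -> jcontinuous setT g ->
  (forall t z, 0 <= t <= S -> ~ KV z.2 -> g t z = 0) ->
  exists M, forall t z, 0 <= t <= S -> `|g t z| <= M.
Proof.
move=> cK cg g0.
have cC : compact (`[0, S]%classic `*` (setT `*` KV) : set (R * X)).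
  apply: compact_setX; first exact: segment_compact.
  by apply: compact_setX => //; exact: torus_compact.
have ci : compact ((fun y : R * X => g y.1 y.2) @` (`[0, S]%classic `*` (setT `*` KV))).
  apply: continuous_compact => //; apply: continuous_subspaceT => -[q z].
  by apply: cg; split.
have [M [_ hM]] := compact_bounded ci.
exists (Num.max (M + 1) 0) => t z t0S.
have [Kz|nKz] := pselect (KV z.2); last by rewrite g0// normr0 le_max lexx orbT.
rewrite le_max; apply/orP; left; apply: (hM (M + 1)); first by rewrite ltrDl.
by exists (t, z) => //; split=> /=; rewrite ?in_itv.
Qed.

Variables (V : set Rd) (S : R).
Variable K : set (R * Td * Rd).
Hypotheses (cK : compact K) (KS : K `<=` (`[0, S[ `*` setT) `*` V)
  (supp : forall t x v, 0 <= t -> phi t x v != 0 -> K (t, x, v)).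

Let KV := (@snd (R * Td) Rd) @` K.

Let compact_KV : compact KV.
Proof. by apply: continuous_compact => //; apply: continuous_subspaceT => z; exact: cvg_snd. Qed.

Lemma phi_supp t z : 0 <= t -> ~ KV z.2 -> phi t z.1 z.2 = 0.
Proof.
move=> t0 nK; apply: contrapT => /eqP h; apply: nK.
by exists (t, z.1, z.2) => //; exact: supp.
Qed.

Lemma transport_supp t z : 0 <= t -> ~ KV z.2 -> transport phi t z.1 z.2 = 0.
Proof.
move=> t0 nK; rewrite /transport (_ : (fun s => _) = cst 0) ?derive1_cst//.
by apply/funext => s; exact: (phi_supp (z := flow s z) t0 nK).
Qed.

Lemma time_derivative_supp_pos t z : 0 < t -> ~ KV z.2 -> time_derivative phi t z.1 z.2 = 0.
Proof.
move=> t0 nK; rewrite /time_derivative derive1E -(derive_cst (0 : R) t (1 : R)).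
apply: near_eq_derive; have : \forall s \near t, 0 < s by exact: lt_nbhsr.
by apply: filterS => s s0; exact: (phi_supp (z := z) (ltW s0) nK).
Qed.

(** At t = 0 the derivative also sees negative times, where the support is unconstrained; the value
    is recovered by continuity from positive times. *)
Lemma time_derivative_supp t z : 0 <= t -> ~ KV z.2 -> time_derivative phi t z.1 z.2 = 0.
Proof.
rewrite le_eqVlt => /predU1P[<-|]; last exact: time_derivative_supp_pos.
move=> nK; have c := jcontinuous_fixz jcontinuous_time_derivative (z := z) (conj I I : phase_set setT z).
have c0 : time_derivative phi n.+1%:R^-1 z.1 z.2 @[n --> \oo] --> time_derivative phi 0 z.1 z.2.
  have h0 : (n.+1%:R^-1 : R) @[n --> \oo] --> (0 : R) by exact: cvg_harmonic.
  exact: (cvg_comp _ _ h0 (c 0)).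
have E : (fun n => time_derivative phi n.+1%:R^-1 z.1 z.2) = (fun=> 0).
  by apply/funext => n; apply: time_derivative_supp_pos => //; rewrite invr_gt0.
rewrite E in c0; exact: (cvg_unique (@Rhausdorff R) c0 (cvg_cst _)).
Qed.

Lemma phi_final z : 0 < S -> phi S z.1 z.2 = 0.
Proof.
move=> S0; apply: contrapT => /eqP/(supp (ltW S0))/KS[[/= + _] _].
by rewrite in_itv/= ltxx andbF.
Qed.

Lemma phi_bnd : exists M, forall t z, 0 <= t <= S -> `|phi t z.1 z.2| <= M.
Proof.
apply: (@jcontinuous_compact_bnd (fun t z => phi t z.1 z.2) S _ compact_KV jcontinuous_phi).
by move=> t z /andP[t0 _]; exact: phi_supp.
Qed.

Lemma transport_bnd : exists M, forall t z, 0 <= t <= S -> `|transport phi t z.1 z.2| <= M.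
Proof.
apply: (@jcontinuous_compact_bnd (fun t z => transport phi t z.1 z.2) S _ compact_KV jcontinuous_transport).
by move=> t z /andP[t0 _]; exact: transport_supp.
Qed.

Lemma time_derivative_bnd : exists M, forall t z, 0 <= t <= S -> `|time_derivative phi t z.1 z.2| <= M.
Proof.
apply: (@jcontinuous_compact_bnd (fun t z => time_derivative phi t z.1 z.2) S _ compact_KV jcontinuous_time_derivative).
by move=> t z /andP[t0 _]; exact: time_derivative_supp.
Qed.

End TestFunction.

Section StationarySolution.
Context {R : realType} {d : nat}.
Local Notation Rd := 'rV[R]_d.
Local Notation Td := (torus R d).
Local Notation X := (Td * Rd)%type.
Local Notation RT := (measurableTypeR R).
Local Notation phase := (borel (Td * Rd)%type).
Variable V : set Rd.
Hypothesis oV : open V.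
Variable p : Rd -> Rd -> R.
Hypothesis pk : transition_kernel V p.
Variable sigma : Td -> R.
Hypothesis csigma : continuous sigma.
Variable Sg : R.
Hypothesis sigma_itv : forall x, 0 <= sigma x <= Sg.
Local Notation PV := (phase_set V : set X).
Local Notation bb := (bounded_borel V).
Variable nu : probability phase R.
Hypothesis nuV : prob_on V nu.
Hypothesis nu_generator : forall psi Dpsi, bb psi -> bb Dpsi ->
  (forall z (s : R), PV z -> is_derive s (1 : R) (fun s : R => psi (flow s z)) (Dpsi (flow s z))) ->
  (forall z, PV z -> continuous (fun s : R => Dpsi (flow s z))) ->
  \int[nu]_(z in PV) (Dpsi z + dual_coll V p sigma psi z) = 0.

Lemma bb_integrable (m : probability phase R) f : bb f -> m.-integrable (PV : set phase) (EFin \o (f : phase -> R)).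
Proof.
have mPV := @measurable_PV R d V oV.
have mlty : (m PV < +oo)%E by rewrite (le_lt_trans (probability_le1 _ mPV))// ltry.
by move=> [mf [M fM]]; exact: (@integrable_bnd _ phase R m PV f M mPV mlty mf fM).
Qed.

(** At each time transport and collision integrate to 0 against [nu]. As [nu] does not depend on
    time, the remaining time derivative may be integrated in time first, giving [- phi 0] because
    [phi] vanishes at [S]. *)
Lemma stationary_weak (S : R) phi : 0 < S -> test_function V S phi ->
  \int[lebesgue_measure]_(t in `[0, S])
    (\int[nu]_(z in PV) (time_derivative phi t z.1 z.2 + transport phi t z.1 z.2
       + sigma z.1 * dual_collision V p phi t z.1 z.2))
  = - \int[nu]_(z in PV) phi 0 z.1 z.2.
Proof.
move=> S0 [cPhi [K [cK KS supp]]]; have mPV := @measurable_PV R d V oV.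
have [M1 phiM] := phi_bnd cPhi S cK supp.
have [M2 DM] := transport_bnd cPhi S cK supp.
have [M3 gM] := time_derivative_bnd cPhi S cK supp.
have bbt (g : R -> X -> R) (M t : R) : jcontinuous setT g -> (forall t z, 0 <= t <= S -> `|g t z| <= M) ->
    0 <= t <= S -> bb (g t).
  move=> cg hM t0S; split; last by exists M => z _; exact: hM.
  exact: (measurable_PVcont oV (jcontinuous_fix (jcontinuous_sub (V := V) cg))).
pose cl : R -> R := clamp S; have S00 := ltW S0.
have cl_itv t : 0 <= cl t <= S by rewrite clamp_ge0 (clamp_le S00).
have clE t : 0 <= t <= S -> cl t = t by move=> /andP[t0 tS]; exact: clamp_id.
have ccl : continuous cl by exact: clamp_continuous.
(* Clamping keeps [g] bounded at every real time, since [phi] is uncontrolled at negative ones. *)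
pose g (t : R) (z : X) := time_derivative phi (cl t) z.1 z.2.
have mg : jmeasurable V g.
  apply: (measurable_jcontinuous oV); apply: (jcontinuous_comp (jcontinuous_sub (V := V) (jcontinuous_time_derivative cPhi)) ccl) => //.
  by move=> y; exact: cvg_snd.
have gbnd t : bnd V (g t) M3 by move=> z _; exact: (gM _ _ (cl_itv t)).
transitivity (\int[lebesgue_measure]_(t in `[0, S]) \int[nu]_(z in PV) g t z).
  apply: eq_Rintegral => t; rewrite inE/= in_itv/= => t0S.
  pose psi (z : X) := phi t z.1 z.2.
  have bpsi : bb psi := bbt (fun t z => phi t z.1 z.2) _ _ (jcontinuous_phi cPhi) phiM t0S.
  have bD : bb (fun z : X => transport phi t z.1 z.2) :=
    bbt (fun t z => transport phi t z.1 z.2) _ _ (jcontinuous_transport cPhi) DM t0S.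
  have bg : bb (fun z : X => time_derivative phi t z.1 z.2) :=
    bbt (fun t z => time_derivative phi t z.1 z.2) _ _ (jcontinuous_time_derivative cPhi) gM t0S.
  have bG : bb (fun z : X => transport phi t z.1 z.2 + dual_coll V p sigma psi z).
    have [mp [M pM]] := bpsi.
    have bB : bb (dual_coll V p sigma psi).
      split; first exact: (pmeasurable_dual_coll oV pk csigma mp pM).
      exists (2 * Sg * M) => z Pz; exact: (dual_coll_bnd oV pk sigma_itv Pz (pmeasurable_vmeasurable oV mp) pM).
    have := bounded_borel_lin 1 bD bB; congr bounded_borel.
    by apply/funext => z; rewrite mul1r.
  have H := RintegralD mPV (bb_integrable nu bg) (bb_integrable nu bG).
  have H0 := nu_generator bpsi bD (fun z s _ => transport_flow cPhi t z s).
  rewrite H0 ?addr0 in H; last first.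
    move=> z Pz s; apply: (@continuous_comp _ _ _ (fun s : R => flow s z) (fun z : X => transport phi t z.1 z.2)).
      apply: (@continuous_comp _ _ _ (fun s : R => (s, z)) (fun y : R * X => flow y.1 y.2)); last exact: flow_continuous.
      exact: (cvg_pair (@cvg_id _ (nbhs s)) (cvg_cst z)).
    by apply: (jcontinuous_fix (jcontinuous_transport cPhi)); rewrite inE.
  rewrite /g clE// -H; apply: eq_Rintegral => z _.
  by rewrite addrA.
rewrite -(Rintegral_swap_time oV 0 S mg gbnd nu).
have E z : \int[lebesgue_measure]_(t in `[0, S]) g t z = - phi 0 z.1 z.2.
  have -> : \int[lebesgue_measure]_(t in `[0, S]) g t z =
      \int[lebesgue_measure]_(t in `[0, S]) time_derivative phi t z.1 z.2.
    by apply: eq_Rintegral => t; rewrite inE/= in_itv/= => t0S; rewrite /g clE.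
  have dF (t : R) : is_derive t (1 : R) (fun t : R => phi t z.1 z.2) (time_derivative phi t z.1 z.2).
    case: z => x v; rewrite -(torus_reprK x) /= (time_derivative_lift cPhi).
    exact: phi_time.
  have cF : continuous (fun t : R => time_derivative phi t z.1 z.2).
    exact: (jcontinuous_fixz (jcontinuous_time_derivative cPhi) (z := z) (conj I I : phase_set setT z)).
  by rewrite (FTC2_C1 S00 dF cF) (phi_final KS supp z S0) sub0r.
have b0 : bb (fun z : X => phi 0 z.1 z.2).
  by apply: (bbt (fun t z => phi t z.1 z.2) _ _ (jcontinuous_phi cPhi) phiM); rewrite lexx ltW.
transitivity (\int[nu]_(z in PV) (-1 * phi 0 z.1 z.2)).
  by apply: eq_Rintegral => z _; rewrite E mulN1r.
by rewrite (RintegralZl (-1) mPV (bb_integrable nu b0)) mulN1r.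
Qed.

Lemma stationary_equilibrium : equilibrium V p sigma nu.
Proof.
split=> //; split=> //.
- by move=> phi _; apply: continuous_subspaceT => t; exact: cvg_cst.
- exact: stationary_weak.
Qed.

End StationarySolution.

(** * Uniqueness and conclusion *)

Section Uniqueness.
Context {R : realType} {d : nat}.
Local Notation Rd := 'rV[R]_d.
Local Notation Td := (torus R d).
Local Notation X := (Td * Rd)%type.
Local Notation phase := (borel (Td * Rd)%type).
Variable V : set Rd.
Hypothesis oV : open V.
Local Notation PV := (phase_set V : set X).

(** Compactness of the torus bounds the set of values, so the supremum is a true one and not a
    default value. *)
Lemma sup_norm_ge (sigma : Td -> R) x : continuous sigma -> `|sigma x| <= sup_norm sigma.
Proof.
move=> cs; have ci : compact (sigma @` [set: Td]).
  by apply: continuous_compact; [exact: continuous_subspaceT|exact: torus_compact].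
have [M [_ hM]] := compact_bounded ci.
apply: sup_upper_bound; last by exists x.
split; first by exists `|sigma x|; exists x.
by exists (M + 1) => _ [y _ <-]; apply: (hM (M + 1)); [rewrite ltrDl|exists y].
Qed.

Section TwoMeasures.
Variables mu nu : probability phase R.
Hypotheses (mu1 : prob_on V mu) (nu1 : prob_on V nu).

Lemma tv_eq0_pairing f : tv_dist V mu nu <= 0 -> Cb V f -> bnd V f 1 ->
  \int[mu]_(z in PV) f z = \int[nu]_(z in PV) f z.
Proof.
move=> tv0 Cf f1; have h1 := le_trans (pairing_le_tv oV mu1 nu1 Cf f1) tv0.
have CNf : Cb V (fun z => -1 * f z).
  case: Cf => cf [M fM]; split; first by move=> z Pz; apply: cvgM; [exact: cvg_cst|exact: cf].
  by exists M => z Pz; rewrite mulN1r normrN; exact: fM.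
have Nf1 : bnd V (fun z => -1 * f z) 1 by move=> z Pz; rewrite mulN1r normrN; exact: f1.
have := le_trans (pairing_le_tv oV mu1 nu1 CNf Nf1) tv0.
rewrite (pairingZ oV mu nu (-1) Cf) mulN1r oppr_le0 => h2.
have h : pairing V mu nu f = 0 by apply/eqP; rewrite eq_le h1 h2.
by apply/eqP; rewrite -subr_eq0; apply/eqP.
Qed.

Lemma prob_on_setI (m : probability phase R) (A : set phase) : prob_on V m -> measurable A ->
  m A = m (PV `&` A).
Proof.
move=> m1 mA; have mPV := @measurable_PV R d V oV.
have mC : measurable (~` PV : set phase) by exact: measurableC.
have C0 : m (~` PV) = 0%E by rewrite probability_setC// m1 subee.
rewrite -[in LHS](setIT A) -(setUv (PV : set phase)) setIUr measureU.
- rewrite [X in (_ + X)%E](_ : _ = 0%E) ?adde0 1?setIC//; apply/eqP.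
  by rewrite -measure_le0 -C0; apply: le_measure; rewrite ?inE//; exact: measurableI.
- exact: measurableI.
- exact: measurableI.
- by rewrite setIACA setICr setI0.
Qed.

Lemma Rintegral_mem (m : probability phase R) (A : set phase) : measurable A ->
  \int[m]_(z in PV) ((z \in A)%:R : R) = fine (m (PV `&` A)).
Proof.
move=> mA; have mPV := @measurable_PV R d V oV.
rewrite /Rintegral (_ : \int[m]_(z in PV) _ = \int[m]_(z in PV) (\1_A z)%:E)%E.
  by rewrite integral_indic// setIC.
by apply: eq_integral => z _; rewrite indicE.
Qed.

(** Total variation is tested on continuous functions only; [open_approx] reaches indicators of open
    sets as bounded limits of such functions. *)
Lemma tv_eq0_open (U : set X) : tv_dist V mu nu <= 0 -> open U -> mu U = nu U.
Proof.
move=> tv0 oU; have mU : measurable (U : set phase) by exact: open_borel.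
have mPV := @measurable_PV R d V oV.
rewrite (prob_on_setI mu1 mU) (prob_on_setI nu1 mU).
have [S_ [smooth_compactS S01 cS]] := open_approx oV oU.
have S1 n : bnd V (S_ n) 1 by move=> z _; have /andP[s0 s1] := S01 n z; rewrite ger0_norm.
have mS n : measurable_fun (PV : set phase) (S_ n : phase -> R) by exact: (Cb_measurable oV (smooth_compact_Cb (smooth_compactS n))).
have mlty (m : probability phase R) : (m PV < +oo)%E.
  by rewrite (le_lt_trans (probability_le1 _ mPV))// ltry.
have mI : measurable_fun (PV : set phase) (fun z : phase => ((z \in U)%:R : R)).
  rewrite (_ : (fun z => _) = \1_(U : set phase)); last by apply/funext => z; rewrite indicE.
  by apply: measurable_funTS; exact: measurable_indic.
have lim_ (m : probability phase R) :
    \int[m]_(z in PV) S_ n z @[n --> \oo] --> fine (m (PV `&` U)).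
  rewrite -(Rintegral_mem m mU).
  exact: (@Rintegral_bdct _ phase R m PV S_ _ 1 mPV (mlty m) mS mI S1 cS).
have E : (fun n => \int[mu]_(z in PV) S_ n z) = (fun n => \int[nu]_(z in PV) S_ n z).
  by apply/funext => n; exact: (tv_eq0_pairing tv0 (smooth_compact_Cb (smooth_compactS n)) (S1 n)).
have h := cvg_unique (@Rhausdorff R) (lim_ mu) (_ : _ --> fine (nu (PV `&` U))).
have mUV : measurable (PV `&` U : set phase) by exact: measurableI.
rewrite -(fineK (fin_num_measure mu _ mUV)) -(fineK (fin_num_measure nu _ mUV)) h//.
by rewrite E; exact: lim_.
Qed.

(** Open sets form a pi-system generating the Borel sets of phase space. *)
Lemma tv_eq0_measure : tv_dist V mu nu <= 0 -> forall A : set phase, measurable A -> mu A = nu A.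
Proof.
move=> tv0 A mA; apply: (@measure_unique _ R phase (@open X) (fun=> setT)) => //.
- by move=> A' B' oA oB; exact: openI.
- by move=> _; exact: openT.
- by rewrite bigcup_const.
- by move=> U oU; exact: tv_eq0_open.
- by move=> _; apply: le_lt_trans (ltry 1); exact: probability_le1.
Qed.

End TwoMeasures.

End Uniqueness.

Lemma geometric_control_flow {R : realType} {d : nat} (V : set 'rV[R]_d) (sigma : torus R d -> R) (T kappa : R) :
  continuous sigma -> geometric_control V sigma T kappa ->
  forall z, phase_set V z -> kappa <= \int[lebesgue_measure]_(s in `[0, T]) sigma (flow (- s) z).1.
Proof.
move=> cs gcc z Pz; have cN : continuous (fun s : R => - s) by move=> s; apply: cvgN; exact: cvg_id.
have ints := cont_itv_integrable 0 T (sigma_flow_continuous cs (z := z) cN).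
have mI : measurable (`[0, T]%classic : set (measurableTypeR R)) by exact: measurable_itv.
have fin := integrable_fin_num mI ints.
rewrite -lee_fin /Rintegral (fineK fin); apply: le_trans gcc _.
apply: ereal_inf_lbound; exists z => //; apply: eq_integral => s _.
by rewrite /flow/= scaleNr.
Qed.

(** In dimension 0 the only vector is the origin, from which [V] stays away. Positive dimension
    makes [T_star] positive. *)
Lemma dim_gt0 {R : realType} {d : nat} (V : set 'rV[R]_d) (v : 'rV[R]_d) :
  bounded_away_from_origin V -> V v -> (0 < d)%N.
Proof.
case: d V v => // V v [delta delta0 h] /h; rewrite /enorm big_ord0 sqrtr0.
by move=> /(lt_le_trans delta0); rewrite ltxx.
Qed.

Theorem corollary1 (R : realType) (d : nat) (V : set 'rV[R]_d)
  (p : 'rV[R]_d -> 'rV[R]_d -> R) (v_star : 'rV[R]_d) (r0 gamma : R)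
  (sigma : torus R d -> R) (T kappa : R) :
  open V -> bounded_away_from_origin V ->
  transition_kernel V p ->
  0 < r0 -> 0 < gamma -> eball v_star r0 `<=` V ->
  (forall v v', V v -> V v' -> gamma * \1_(eball v_star r0) v <= p v v') ->
  continuous sigma -> (forall x, 0 <= sigma x) ->
  0 < T -> 0 < kappa -> geometric_control V sigma T kappa ->
  let T_star := 2 * Num.sqrt d%:R / r0 in
  let ball_volume := fine (lebesgue_row (eball v_star r0)) in
  let lambda :=
    - (1 / (2 * T + 2 * Num.sqrt d%:R / r0)) *
      ln (1 - gamma ^+ 2 * ball_volume ^+ 2 / 2 ^+ d * kappa ^+ 2 *
              expR (- (2 * T + 2 * Num.sqrt d%:R / r0) * sup_norm sigma)) in
  exists nu : probability (borel (torus R d * 'rV[R]_d)%type) R,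
    [/\ equilibrium V p sigma nu,
        (forall nu' : probability (borel (torus R d * 'rV[R]_d)%type) R,
           equilibrium V p sigma nu' ->
           forall A, measurable A -> nu' A = nu A) &
        forall mu : R -> probability (borel (torus R d * 'rV[R]_d)%type) R,
          mv_solution V p sigma mu ->
          forall t, T_star <= t ->
            tv_dist V (mu t) nu <=
            expR (- lambda * (t - 2 * T - T_star)) * tv_dist V (mu 0) nu].

Proof.
move=> oV away pk r00 gamma0 BV pB csigma sigma0 T0 kappa0 gcc Tst bvol lambda.
have Bv : eball v_star r0 v_star by rewrite /eball/= subrr /enorm big1 ?sqrtr0// => i _; rewrite mxE expr0n.
have d0 := dim_gt0 away (BV _ Bv).
have PV0 : (phase_set V : set (torus R d * 'rV[R]_d)) !=set0 by exists (torus_pi 0, v_star); split=> //; exact: BV.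
pose Sg := sup_norm sigma.
have sigma_itv x : 0 <= sigma x <= Sg.
  by rewrite sigma0/=; apply: le_trans (sup_norm_ge x csigma); exact: ler_norm.
have gcc0 := geometric_control_flow csigma gcc.
have [nu [nuV nuG]] := stationary_measure_exists oV pk csigma sigma_itv gamma0 BV pB T0 kappa0 gcc0 r00 d0 PV0.
have eqnu := stationary_equilibrium oV pk csigma sigma_itv nuV nuG.
have [_ nu_sol] := eqnu.
exists nu; split => //.
- move=> nu' [nu'V nu'_sol].
  (* The two constant families are solutions, so over one period their distance is at most
     [1 - alpha] times itself; as [alpha] is positive it must vanish. *)
  have := tv_contract oV pk csigma sigma_itv gamma0 BV pB T0 kappa0 gcc0 r00 d0 nu'_sol nu_sol PV0 (lexx 0).
  rewrite mulrBl mul1r lerBrDr gerDl.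
  have a0 : 0 < alpha Sg v_star r0 gamma T kappa.
    have bv0 := ball_volume_gt0 v_star r00.
    by rewrite /alpha !mulr_gt0 ?exprn_gt0 ?expR_gt0 ?invr_gt0 ?exprn_gt0.
  rewrite (pmulr_rle0 _ a0) => h; exact: (tv_eq0_measure oV nu'V nuV h).
- move=> mu mu_sol t Tt.
  have := tv_decay oV pk csigma sigma_itv gamma0 BV pB T0 kappa0 gcc0 r00 d0 mu_sol nu_sol PV0 Tt.
  rewrite (_ : alpha _ _ _ _ _ _ = gamma ^+ 2 * bvol ^+ 2 / 2 ^+ d * kappa ^+ 2 *
      expR (- (2 * T + 2 * Num.sqrt d%:R / r0) * sup_norm sigma)); first exact.
  rewrite /alpha /Sg /tau /T_star -/bvol mulNr (mulrC (sup_norm sigma)).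
  rewrite -/(ball_volume _ _) /bvol -/(ball_volume _ _).
  by move: (ball_volume _ _) (expR _) (2 ^- d) => b e c; ring.
Qed.
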